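(* Let $k\ge1$ and suppose that $\beta\in\,]0,k\wedge2[$ or $k=1=\beta$. Let $\hat v=(\hat v(t,x),\,t\in\mathbb{R}_+,\,x\in\mathbb{R}^k)$ be the ($\mathbb{R}^d$-valued, continuous) mild solution of the system of $d$ uncoupled linear stochastic heat equations $$\frac{\partial}{\partial t}\hat v_j(t,x)=\Delta\hat v_j(t,x)+\dot{\hat W}_j(t,x),\quad j=1,\dots,d,\qquad \hat v(0,x)=0,\ x\in\mathbb{R}^k,$$ where $\Delta$ is the Laplacian in $x$ and $\hat W$ is the $\mathbb{R}^d$-valued Gaussian noise described in the context. Suppose $(4+2k)/(2-\beta)=d$. Then points are polar for $\hat v$, that is, for all $z\in\mathbb{R}^{(4+2k)/(2-\beta)}$, $$P\{\exists(t,x)\in\,]0,+\infty[\,\times\mathbb{R}^k:\ \hat v(t,x)=z\}=0.$$ In particular, in the case where $k=1=\beta$, $\hat W$ is space-time white noise and $d=6$, points are polar for $\hat v$.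
   Context: Noise: $\hat W=(\hat W_1,\dots,\hat W_d)$ is a centered Gaussian family indexed by $C^\infty$ test functions $\varphi$ with compact support on $\mathbb{R}\times\mathbb{R}^k$, with independent components, white in time. If $\beta\in\,]0,k\wedge2[$, it is spatially homogeneous with spatial covariance given by the Riesz kernel: $$E(\hat W_\ell(\varphi)\hat W_j(\psi))=\delta_{\ell,j}\int_{\mathbb{R}_+}dr\int_{\mathbb{R}^k}dy\int_{\mathbb{R}^k}dz\,\varphi(r,y)\,|y-z|^{-\beta}\,\psi(r,z).$$ If $k=1=\beta$, it is space-time white noise: $E(\hat W_\ell(\varphi)\hat W_j(\psi))=\delta_{\ell,j}\int_{\mathbb{R}_+}dr\int_{\mathbb{R}}dy\,\varphi(r,y)\psi(r,y)$. Mild solution: $\hat v_j(t,x)=\int_0^t\int_{\mathbb{R}^k}G(t-s,x-y)\,\hat W_j(ds,dy)$ (Wiener integral), where $G(t,x)=(4\pi t)^{-k/2}e^{-|x|^2/(4t)}$. Thus $\hat v$ is a centered Gaussian random field with i.i.d. components and covariance $$E[\hat v_j(t,x)\hat v_j(s,y)]=\int_0^{t\wedge s}dr\int_{\mathbb{R}^k}d\bar y\int_{\mathbb{R}^k}d\bar z\,G(t-r,x-\bar y)\,|\bar y-\bar z|^{-\beta}\,G(s-r,y-\bar z)$$ (if $k=1=\beta$: $\int_0^{t\wedge s}dr\int_{\mathbb{R}}d\bar y\,G(t-r,x-\bar y)G(s-r,y-\bar y)$). $\hat v$ denotes the version with continuous sample paths. *)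

(* Defs.v *)
From HB Require Import structures.
From mathcomp Require Import all_boot all_order all_algebra.
From mathcomp Require Import all_classical all_reals all_analysis.
Set Implicit Arguments.
Unset Strict Implicit.
Unset Printing Implicit Defensive.
Import Order.TTheory GRing.Theory Num.Theory.
Import numFieldNormedType.Exports.
Local Open Scope classical_set_scope.
Local Open Scope ring_scope.

(* Lebesgue measure on R^k, carried by the measurable type k.-tuple R (product
   sigma-algebra): the product measure lambda \x lambda_k on R * k.-tuple R is
   transported to k.+1.-tuple R along (a, x) |-> a :: x. *)
Section lebesgue_tuple_step.
Context {R : realType} (k : nat).
Variable m : {sigma_finite_measure set (k.-tuple (measurableTypeR R)) -> \bar R}.

Definition tuple_cons (p : measurableTypeR R * k.-tuple (measurableTypeR R)) :
  k.+1.-tuple (measurableTypeR R) := [tuple of p.1 :: p.2].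

Definition tuple_uncons (x : k.+1.-tuple (measurableTypeR R)) :
  measurableTypeR R * k.-tuple (measurableTypeR R) :=
  (thead x, [tuple of behead x]).

Lemma tuple_consK : cancel tuple_cons tuple_uncons.
Proof.
by case=> a x; rewrite /tuple_uncons /=; congr pair; apply: val_inj.
Qed.

Lemma measurable_tuple_cons : measurable_fun setT tuple_cons.
Proof. exact: (measurable_cons measurable_fst measurable_snd). Qed.

Lemma measurable_tuple_uncons : measurable_fun setT tuple_uncons.
Proof.
apply: measurable_fun_pair.
  exact: measurable_tnth.
exact: measurable_behead.
Qed.

Definition lebesgue_tuple_step : set (k.+1.-tuple (measurableTypeR R)) -> \bar R :=
  pushforward (lebesgue_measure \x m)%E tuple_cons.

Let step0 : lebesgue_tuple_step set0 = 0%E.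
Proof. by rewrite /lebesgue_tuple_step /pushforward preimage_set0 measure0. Qed.

Let step_ge0 A : (0 <= lebesgue_tuple_step A)%E.
Proof. by have mf := measurable_tuple_cons; exact: measure_ge0. Qed.

Let step_sigma_additive : semi_sigma_additive lebesgue_tuple_step.
Proof.
have mf := measurable_tuple_cons; exact: measure_semi_sigma_additive.
Qed.

HB.instance Definition _ := isMeasure.Build _ _ _ lebesgue_tuple_step
  step0 step_ge0 step_sigma_additive.

Let step_sigma_finite : sigma_finite setT lebesgue_tuple_step.
Proof.
have /sigma_finiteP[F [TF ndF Foo]] := sigma_finiteT (@lebesgue_measure R).
have /sigma_finiteP[G [TG ndG Goo]] := sigma_finiteT m.
exists (fun i => tuple_uncons @^-1` (F i `*` G i)).
  rewrite -preimage_bigcup -[LHS](preimage_setT tuple_uncons); congr preimage.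
  rewrite -setXTT TF TG predeqE => -[x y]; split.
    move=> [/= [i _ Fx] [j _ Gy]]; exists (maxn i j) => //; split.
    - by move: x Fx; exact/subsetPset/ndF/leq_maxl.
    - by move: y Gy; exact/subsetPset/ndG/leq_maxr.
  by move=> [i _ []/= ? ?]; split; exists i.
move=> i; have [mF Fi] := Foo i; have [mG Gi] := Goo i; split.
  rewrite -[X in measurable X]setTI; apply: measurable_tuple_uncons => //.
  exact: measurableX.
rewrite /lebesgue_tuple_step /pushforward -comp_preimage.
rewrite (_ : _ \o _ = id); last by apply/funext => p; exact: tuple_consK.
by rewrite preimage_id product_measure1E// lte_mul_pinfty// ge0_fin_numE.
Qed.

HB.instance Definition _ := Measure_isSigmaFinite.Build _ _ _
  lebesgue_tuple_step step_sigma_finite.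
End lebesgue_tuple_step.

Fixpoint lebesgue_tuple (R : realType) (k : nat) :
    {sigma_finite_measure set (k.-tuple (measurableTypeR R)) -> \bar R} :=
  if k is k'.+1 then lebesgue_tuple_step (lebesgue_tuple R k')
  else \d_([tuple] : 0.-tuple (measurableTypeR R)).

(* R^k is 'rV[R]_k; the measure above lives on the same space of coordinates. *)
Definition integral_rV (R : realType) (k : nat) (f : 'rV[R]_k -> \bar R) : \bar R :=
  (\int[lebesgue_tuple R k]_x f (\row_i tnth x i))%E.

Definition euclidean_norm (R : realType) (k : nat) (x : 'rV[R]_k) : R :=
  Num.sqrt (\sum_(i < k) x 0 i ^+ 2).

Section test_functions.
Context (R : realType) (k : nat).
Notation V := (R * 'rV[R]_k)%type.

Definition iter_derive (vs : seq V) (f : V -> R) : V -> R :=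
  foldr (fun v g => 'D_v g) f vs.

Definition smooth (f : V -> R) : Prop := forall vs : seq V,
  continuous (iter_derive vs f) /\
  forall p v, derivable (iter_derive vs f) p v.

Record test_function := TestFunction {
  test_fun :> V -> R ;
  test_fun_smooth : smooth test_fun ;
  test_fun_support : compact (closure [set p | test_fun p != 0]) }.
End test_functions.

Section noise_covariance.
Context (R : realType) (k : nat).
Implicit Types (beta : R) (f g : R * 'rV[R]_k -> R).

(* On the diagonal 0 `^ (- beta) = 0 instead of +oo; the diagonal is a null set. *)
Definition riesz_inner beta f g : \bar R :=
  (\int[lebesgue_measure]_(r in `[0%R, +oo[)
     integral_rV (fun y : 'rV[R]_k => integral_rV (fun z : 'rV[R]_k =>
       (f (r, y) * euclidean_norm (y - z) `^ (- beta) * g (r, z))%:E)))%E.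

Definition white_inner f g : \bar R :=
  (\int[lebesgue_measure]_(r in `[0%R, +oo[)
     integral_rV (fun y : 'rV[R]_k => (f (r, y) * g (r, y))%:E))%E.

Definition noise_inner beta f g : \bar R :=
  if (k == 1%N) && (beta == 1) then white_inner f g else riesz_inner beta f g.
End noise_covariance.

Section gaussian.
Context d (T : measurableType d) (R : realType) (P : probability T R).

(* [normal_prob m 0] is not the Dirac mass at [m] in the library, so the
   degenerate case is treated separately. *)
Definition centered_gaussian (X : T -> R) : Prop :=
  measurable_fun setT X /\
  exists s : R, forall A : set (measurableTypeR R), measurable A ->
    P (X @^-1` A) = (if s == 0 then \d_(0 : measurableTypeR R) A
                     else normal_prob 0 s A).

Definition centered_gaussian_family (I : Type) (X : I -> T -> R) : Prop :=
  forall (n : nat) (i : 'I_n -> I) (a : 'I_n -> R),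
    centered_gaussian (fun w => \sum_(m < n) a m * X (i m) w).

(* Independence of the sigma-algebras generated by the processes X l, l : 'I_n,
   tested on the pi-systems of finite-dimensional rectangles. *)
Definition independent_processes (n : nat) (I : Type) (X : 'I_n -> I -> T -> R) :
    Prop :=
  forall (m : nat) (i : 'I_m -> I) (A : 'I_n -> 'I_m -> set (measurableTypeR R)),
    (forall l q, measurable (A l q)) ->
    (P [set w | forall l q, A l q (X l (i q) w)] =
     \prod_(l < n) P [set w | forall q, A l q (X l (i q) w)])%E.
End gaussian.

Section heat_equation.
Context d (T : measurableType d) (R : realType) (P : probability T R).
Context (k n : nat) (beta : R).

Definition is_noise (W : 'I_n -> test_function R k -> T -> R) : Prop :=
  [/\ centered_gaussian_family P
        (fun p : 'I_n * test_function R k => W p.1 p.2),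
      independent_processes P W &
      forall (l j : 'I_n) (phi psi : test_function R k),
        ('E_P[fun w => (W l phi w * W j psi w)%R])%E =
        (if l == j then noise_inner beta phi psi else 0%E)].

(* X is the Wiener integral of f with respect to the scalar noise W: the
   L2(P)-limit of W phi_n along test functions phi_n converging to f for the
   (semi)norm of the covariance of W.  The finiteness condition on |f| makes the
   signed integrals defining this seminorm at phi_n - f absolutely convergent. *)
Definition is_wiener_integral (W : test_function R k -> T -> R)
    (f : R * 'rV[R]_k -> R) (X : T -> R) : Prop :=
  [/\ measurable_fun setT X,
      (noise_inner beta (fun p => `|f p|)%R (fun p => `|f p|)%R < +oo)%E &
      exists phi : nat -> test_function R k,
        noise_inner beta (fun p => phi q p - f p) (fun p => phi q p - f p)
          @[q --> \oo] --> 0%E /\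
        ('E_P[fun w => ((W (phi q) w - X w) ^+ 2)%R])%E @[q --> \oo] --> 0%E].

Definition heat_kernel (t : R) (x : 'rV[R]_k) : R :=
  (4 * pi * t) `^ (- (k%:R / 2)) * expR (- (euclidean_norm x ^+ 2 / (4 * t))).

Definition is_mild_solution (W : 'I_n -> test_function R k -> T -> R)
    (v : R -> 'rV[R]_k -> T -> 'rV[R]_n) : Prop :=
  forall (j : 'I_n) (t : R) (x : 'rV[R]_k), 0 <= t ->
    is_wiener_integral (W j)
      (fun p => if 0 <= p.1 < t then heat_kernel (t - p.1) (x - p.2) else 0)
      (fun w => v t x w 0 j).

Definition continuous_paths (v : R -> 'rV[R]_k -> T -> 'rV[R]_n) : Prop :=
  forall w : T, {within [set p : R * 'rV[R]_k | 0 <= p.1],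
    continuous (fun p => v p.1 p.2 w)}.

Definition points_polar (v : R -> 'rV[R]_k -> T -> 'rV[R]_n) : Prop :=
  forall z : 'rV[R]_n,
    P [set w | exists (t : R) (x : 'rV[R]_k), 0 < t /\ v t x w = z] = 0%E.
End heat_equation.

(* Main.v *)
(* For finitely many points p of a parabolic cell of side r, consider the mean
Lebesgue volume of the eps-neighbourhood of the values at p of (v - z) / h, with
h a caloric weight.  Chaining bounds it by theta * r^(k+2) for small eps, since
the dimension is critical.  The infimum of the admissible theta is 0: otherwise
the sub-cells of a near-extremal cell are near-extremal with almost disjoint
images, while resampling v by Gaussian multiples of a caloric function over a
time window makes the images of sub-cells in many separated time slots overlap,
against a second-moment bound.  One more, global, resampling turns vanishing mean
volume into vanishing probability of hitting z.  Covariances are inner products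
of features, |y - z|^-beta being a mixture of heat kernels. *)
From HB Require Import structures.
Require Import Defs.
From mathcomp Require Import all_boot all_order all_algebra.
From mathcomp Require Import all_classical all_reals all_analysis.
From mathcomp Require Import measurable_realfun ring lra zify.
Set Implicit Arguments.
Unset Strict Implicit.
Unset Printing Implicit Defensive.
Import Order.TTheory GRing.Theory Num.Theory.
Import numFieldNormedType.Exports.
Local Open Scope classical_set_scope.
Local Open Scope ring_scope.

Notation mfun := (measurable_fun setT).
Notation mfunM := measurable_funM.
Notation mfunD := measurable_funD.
Notation mfunB := measurable_funB.
Notation mfunX := measurable_funX.
Notation mcomp := measurableT_comp.
Notation mfst := measurable_fst.
Notation msnd := measurable_snd.
Notation mfun_pair := measurable_fun_pair.
Notation mfun_if := measurable_fun_ifT.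
Notation emfunM := emeasurable_funM.
Notation mfunZe := measurable_funeM.
Notation nonneg f := (forall x, 0 <= f x).

(** The obstacle is criticality itself: D (1 - beta/2) = k + 2 gives the image of a cell of side r
    the same volume scaling as the cell, [sc r ^+ D = r ^+ Q], so moment bounds are scale free and
    never small. Smallness has to come from the optimal constant of a scale-free inequality.
    Dividing by h makes one Cameron-Martin direction constant: h, switched on before time t1, lies
    in the Hilbert space of the covariance, so (v - z)/h is a field plus an independent Gaussian
    constant, and a volume averaged over targets controls the single target 0. Time windows are
    differences of two ramps. A source active during [a, a + l] yields 0 before a and a multiple of
    a caloric function after a + l, so one slot moves while the others stay fixed, provided that no
    point lies in a switching interval. The counting is as follows. Each of n0 slots yields a
    function of mass of order muc, the volume of a sub-cell, spread almost flatly over a common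
    volume r^Q. Cauchy-Schwarz compares the squared mass n0^2 muc^2 with diagonal terms of order n0
    muc^2 and off-diagonal terms that near-disjointness makes negligible, which bounds n0. Path
    continuity enters only at the very end. *)

Lemma mEFin d (T : measurableType d) (R : realType) (D : set T) (f : T -> R) :
 measurable_fun D f -> measurable_fun D (fun x => (f x)%:E).
by move=> mf; apply/measurable_EFinP. Qed.

(** * Affine substitutions for Lebesgue measure on the line *)

Section lebesgue_affine.
Context {R : realType}.
Notation mR := (measurableTypeR R).
Notation leb := (@lebesgue_measure R).

Definition affine (c b : R) : mR -> mR := fun x => c * x + b.

Lemma mfun_affine (c b : R) : mfun (affine c b).
by apply: mfunD => //; apply: mfunM. Qed.

Lemma affine_measure (c b : R) : exists m : {measure set mR -> \bar R},
 forall A, m A = (`|c|%:E * leb (affine c b @^-1` A))%E.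
have mf := mfun_affine c b.
unshelve eexists (mscale `|c|%:nng (pushforward leb (affine c b))) => //.
Qed.

Lemma lebesgue_affine (c b : R) (A : set mR) : c != 0 -> measurable A ->
 leb A = (`|c|%:E * leb (affine c b @^-1` A))%E.
move=> c0 mA.
have mf := mfun_affine c b.
pose f := affine c b.
have [m mE] := affine_measure c b.
rewrite -mE; apply: lebesgue_measure_unique => // _ [[u v] _ <-] /=.
rewrite mE.
have [c_gt0|c_lt0|/eqP] := ltgtP 0 c; last by rewrite eq_sym (negPf c0).
- have -> : f @^-1` `]u, v]%classic = `](u - b) / c, (v - b) / c]%classic.
  apply/seteqP; split => x /=; rewrite /f /affine !in_itv /= ltr_pdivrMr // ler_pdivlMr //
   ltrBlDr lerBrDr (mulrC x) //.
 rewrite !lebesgue_measure_itv /= !lte_fin ltr_pM2r ?invr_gt0 // ltrD2r.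
 case: ifP => uv; rewrite ?mule0 // -!EFinB -EFinM; congr EFin.
 rewrite gtr0_norm //; field => //.
- have -> : f @^-1` `]u, v]%classic = `[(v - b) / c, (u - b) / c[%classic.
  apply/seteqP; split => x /=; rewrite /f /affine !in_itv /= ler_ndivrMr // ltr_ndivlMr //
   ltrBlDr lerBrDr (mulrC x) andbC //.
 rewrite !lebesgue_measure_itv /= !lte_fin ltr_nM2r ?invr_lt0 // ltrD2r.
 case: ifP => uv; rewrite ?mule0 // -!EFinB -EFinM; congr EFin.
 rewrite ltr0_norm //; field => //.
Qed.

Lemma int_affine (c b : R) (f : mR -> \bar R) : c != 0 ->
 mfun f -> (forall x, 0 <= f x)%E ->
 (\int[leb]_x f (c * x + b)%R = (`|c|^-1)%:E * \int[leb]_x f x)%E.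
move=> c0 mf f0.
have mg := mfun_affine c b.
rewrite [in RHS](@eq_measure_integral _ mR R setT
 (mscale `|c|%:nng (pushforward leb (affine c b)))); last first.
 by move=> A mA _ /=; rewrite (lebesgue_affine b c0 mA).
rewrite ge0_integral_mscale //= ge0_integral_pushforward //= preimage_setT.
rewrite muleA -EFinM mulVf ?mul1e// normr_eq0 //.
Qed.
End lebesgue_affine.

(** * Lebesgue measure on tuples: Tonelli, products, translations, boxes *)

Section tuple_lebesgue.
Context {R : realType}.
Notation mR := (measurableTypeR R).
Notation leb := (@lebesgue_measure R).

Lemma int_tupleS k (f : k.+1.-tuple mR -> \bar R) :
 mfun f -> (forall x, 0 <= f x)%E ->
 (\int[lebesgue_tuple R k.+1]_x f x =
  \int[leb]_a \int[lebesgue_tuple R k]_x f [tuple of a :: x])%E.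
move=> mf f0.
have mc := @measurable_tuple_cons R k.
have -> : (\int[lebesgue_tuple R k.+1]_x f x =
 \int[pushforward (leb \x lebesgue_tuple R k)%E (@tuple_cons R k)]_x f x)%E by [].
rewrite ge0_integral_pushforward //= preimage_setT.
rewrite fubini_tonelli1 //; exact: mcomp.
Qed.

Lemma int_tuple0 (f : 0.-tuple mR -> \bar R) :
 mfun f ->
 (\int[lebesgue_tuple R 0]_x f x = f [tuple])%E.
by move=> mf; rewrite /= integral_dirac //= diracT mul1e. Qed.

Lemma int_tuple_prod k (g : 'I_k -> mR -> R) :
 (forall i, mfun (g i)) -> (forall i x, 0 <= g i x) ->
 (\int[lebesgue_tuple R k]_x (\prod_(i < k) g i (tnth x i))%:E =
  \prod_(i < k) \int[leb]_x (g i x)%:E)%E.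
have mprod n (h : 'I_n -> mR -> R) : (forall i, mfun (h i)) ->
  mfun (fun x : n.-tuple mR => (\prod_(i < n) h i (tnth x i))).
 move=> mh; apply: measurable_prod => i _.
 by apply: mcomp => //; exact: measurable_tnth.
elim: k g => [|k IH] g mg g0.
 rewrite int_tuple0 ?big_ord0 //.
 by apply: mEFin; apply: mprod.
rewrite int_tupleS; last 2 first.
- by apply: mEFin; apply: mprod.
- by move=> x; rewrite lee_fin prodr_ge0.
rewrite big_ord_recl.
have h a : (\int[lebesgue_tuple R k]_x
  (\prod_(i < k.+1) g i (tnth [tuple of a :: x] i))%:E =
  (g ord0 a)%:E * \prod_(i < k) \int[leb]_x (g (lift ord0 i) x)%:E)%E.
 rewrite -IH //.
 rewrite -ge0_integralZl //=.
 - apply: eq_integral => x _; rewrite big_ord_recl /= -EFinM tnth0.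
  congr (_ * _)%:E; apply: eq_bigr => i _; by rewrite tnthS.
 - by apply: mEFin; apply: (mprod _ (fun i => g (lift ord0 i))) => i; exact: mg.
 - by move=> x _; rewrite lee_fin prodr_ge0.
 - by rewrite lee_fin.
under eq_integral do rewrite h.
rewrite ge0_integralZr //; first by apply: mEFin; exact: mg.
 by move=> x _; rewrite lee_fin.
by apply: prode_ge0 => i _; apply: integral_ge0 => x _; rewrite lee_fin.
Qed.

Definition addt k (x b : k.-tuple mR) : k.-tuple mR :=
 [tuple (tnth x i : R) + (tnth b i : R) | i < k].

Lemma mfun_addt d (T : measurableType d) k (f g : T -> k.-tuple mR) :
 mfun f -> mfun g ->
 mfun (fun x => addt (f x) (g x)).
move=> mf mg; apply/measurable_fun_tnthP => i; rewrite /comp /=.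
under eq_fun do rewrite tnth_mktuple.
have h (u : T -> k.-tuple mR) : mfun u ->
  mfun (fun x => tnth (u x) i : R).
 by move=> /measurable_fun_tnthP /(_ i).
exact: (mfunD (h _ mf) (h _ mg)).
Qed.

Lemma int_tuple_translate k (b : k.-tuple mR) (f : k.-tuple mR -> \bar R) :
 mfun f -> (forall x, 0 <= f x)%E ->
 (\int[lebesgue_tuple R k]_x f (addt x b) =
  \int[lebesgue_tuple R k]_x f x)%E.
elim: k b f => [|k IH] b f mf f0.
 rewrite !int_tuple0 //.
  by congr f; apply: val_inj; apply: size0nil; exact: size_tuple.
 by apply: mcomp => //; exact: mfun_addt.
rewrite !int_tupleS //; last first.
 by apply: mcomp => //; exact: mfun_addt.
have mfa a : mfun (fun x : k.-tuple mR => f [tuple of a :: x]).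
 apply: mcomp => //; exact: measurable_cons.
transitivity (\int[leb]_a \int[lebesgue_tuple R k]_x f [tuple of (1 * a + (tnth b ord0 : R))%R :: x])%E.
 apply: eq_integral => a _.
 rewrite -[RHS](IH [tuple of behead b]) //; apply: eq_integral => x _; congr f.
 apply: eq_from_tnth => i; rewrite tnth_mktuple.
 case: (unliftP ord0 i) => [j ->|->].
  by rewrite !tnthS tnth_mktuple [in LHS](tuple_eta b) tnthS.
 by rewrite !tnth0 mul1r.
rewrite (@int_affine _ 1 (tnth b ord0)
 (fun a => \int[lebesgue_tuple R k]_x f [tuple of a :: x])%E) ?oner_eq0 //.
- by rewrite normr1 invr1 mul1e.
- apply: (@measurable_fun_fubini_tonelli_F _ _ _ _ _ (lebesgue_tuple R k)
  (fun p : mR * k.-tuple mR => f [tuple of p.1 :: p.2])) => //.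
 apply: mcomp => //; exact: (@measurable_tuple_cons R k).
- by move=> a; apply: integral_ge0.
Qed.

Definition boxset k (c : 'I_k -> R) (r : R) : set (k.-tuple mR) :=
 [set x | forall i, `|tnth x i - c i| < r].

Lemma mfun_boxset k c r : measurable (@boxset k c r).
have -> : boxset c r = \bigcap_(i in setT)
  ((fun x : k.-tuple mR => tnth x i) @^-1` [set y | `|y - c i| < r]).
 by apply/seteqP; split => [x h i _|x h i]; [exact: h|exact: (h i Logic.I)].
apply: fin_bigcap_measurable => // i _.
rewrite -[X in measurable X]setTI; apply: (measurable_tnth) => //.
have -> : [set y | `|y - c i| < r] = `]c i - r, c i + r[%classic.
 by apply/seteqP; split => y /=; rewrite in_itv /= ltr_distl.
exact: measurable_itv.
Qed.

Lemma lebesgue_tuple_boxset k (c : 'I_k -> R) (r : R) : 0 <= r ->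
 lebesgue_tuple R k (boxset c r) = ((r *+ 2) ^+ k)%:E.
move=> r0.
have mI i : measurable (`]c i - r, c i + r[%classic : set mR) by exact: measurable_itv.
transitivity (\int[lebesgue_tuple R k]_x
  (\prod_(i < k) \1_(`]c i - r, c i + r[%classic : set mR) (tnth x i))%:E)%E.
 rewrite -[boxset c r]setIT -integral_indic //; last exact: mfun_boxset.
 apply: eq_integral => x _; congr EFin.
 rewrite indicE; have [xb|xb] := boolP (x \in boxset c r).
  rewrite big1 // => i _; rewrite indicE mem_set //=.
  by move: xb; rewrite inE /boxset /= => /(_ i); rewrite in_itv /= ltr_distl.
 suff [i ci] : exists i, ~~ (`|tnth x i - c i| < r).
  rewrite (bigD1 i) //= indicE memNset ?mul0r //=.
  by rewrite in_itv /= -ltr_distl; exact/negP.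
 apply: contrapT => /forallNP h; move/negP: xb; apply; rewrite inE => i.
 by move/negP: (h i); rewrite negbK.
rewrite (int_tuple_prod (g := fun i => \1_(`]c i - r, c i + r[%classic : set mR))) //.
transitivity (\prod_(i < k) (r *+ 2)%:E)%E; last by rewrite prodEFin prodr_const card_ord.
apply: eq_bigr => i _; rewrite integral_indic // setIT.
apply: (etrans (lebesgue_measure_itv `]c i - r, c i + r[)); rewrite /= lte_fin.
case: ltP => h; first by rewrite -EFinB; congr EFin; ring.
by congr EFin; lra.
Qed.

End tuple_lebesgue.

(** * Measurability of elementary real functions *)

Section measurable_extra.
Context {R : realType} d {T : measurableType d}.
Implicit Types f g : T -> R.

Lemma mfun_funVr f : mfun f -> mfun (fun x => (f x)^-1).
move=> mf.
(* The inverse of 0 is 0, so a split by sign reduces the inverse to the measurable power -1. *)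
have -> : (fun x => (f x)^-1) =
  (fun x => if 0 < f x then f x `^ (-1) else if f x < 0 then - ((- f x) `^ (-1)) else 0).
 apply/funext => x; case: ltgtP => [h|h|<-].
 - by rewrite powR_inv1 ?ltW.
 - by rewrite powR_inv1 ?oppr_ge0 ?ltW // invrN opprK.
 - by rewrite invr0.
apply: mfun_if.
- exact: measurable_fun_ltr.
- by apply: (mcomp (measurable_powR (-1))).
apply: mfun_if => //.
- exact: measurable_fun_ltr.
apply: mcomp => //.
apply: (mcomp (measurable_powR (-1))).
exact: mcomp.
Qed.

Lemma mfun_powRr f p : mfun f -> mfun (fun x => f x `^ p).
by move=> mf; exact: (mcomp (measurable_powR p)). Qed.

Lemma mfun_expRr f : mfun f -> mfun (fun x => expR (f x)).
by move=> mf; exact: (mcomp (@measurable_expR R)). Qed.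

Lemma mfun_sqrtr f : mfun f -> mfun (fun x => Num.sqrt (f x)).
move=> mf; have -> : (fun x => Num.sqrt (f x)) = (fun x => if 0 <= f x then f x `^ 2^-1 else 0).
 apply/funext => x; case: leP => h; first by rewrite powR12_sqrt.
 by rewrite ler0_sqrtr // ltW.
apply: mfun_if => //; first exact: measurable_fun_ler.
exact: mfun_powRr.
Qed.

Lemma mfun_cosr f : mfun f -> mfun (fun x => cos (f x)).
move=> mf; apply: (mcomp (f := cos)) => //.
apply: continuous_measurable_fun; exact: continuous_cos.
Qed.
End measurable_extra.

(** * The heat kernel: one-dimensional factors and semigroup law *)

Section gauss_kernel.
Context {R : realType}.
Notation mR := (measurableTypeR R).
Implicit Types (k : nat).

Definition rowt k (y : k.-tuple mR) : 'rV[R]_k := \row_i tnth y i.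

Definition G1 (t x : R) : R := (Num.sqrt (4 * pi * t))^-1 * expR (- (x ^+ 2 / (4 * t))).

Lemma G1_ge0 t x : 0 <= G1 t x.
by rewrite mulr_ge0 ?expR_ge0 // invr_ge0 sqrtr_ge0. Qed.

Lemma sqr_norm k (x : 'rV[R]_k) : euclidean_norm x ^+ 2 = \sum_(i < k) x 0 i ^+ 2.
by rewrite sqr_sqrtr // sumr_ge0 // => i _; rewrite sqr_ge0. Qed.

Lemma heat_kernelE k t (x : 'rV[R]_k) : 0 < t ->
 heat_kernel t x = \prod_(i < k) G1 t (x 0 i).
move=> t0; rewrite /heat_kernel big_split /= prodr_const card_ord.
have p0 : 0 <= 4 * pi * t by rewrite !mulr_ge0 ?pi_ge0 ?ltW.
congr (_ * _).
 by rewrite powRN [k%:R / 2]mulrC powRrM powR12_sqrt // powR_mulrn ?sqrtr_ge0 // exprVn.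
rewrite sqr_norm -expR_sum sumrN mulr_suml //.
Qed.

Lemma hker_ge0 k t (x : 'rV[R]_k) : 0 <= heat_kernel t x.
by rewrite mulr_ge0 ?expR_ge0 // powR_ge0. Qed.

Lemma heat_kernel_gt0 k t (x : 'rV[R]_k) : 0 < t -> 0 < heat_kernel t x.
by move=> t0; rewrite mulr_gt0 ?expR_gt0 // powR_gt0 // !mulr_gt0 ?pi_gt0.
Qed.

Lemma heat_kernelN k t (x : 'rV[R]_k) : heat_kernel t (- x) = heat_kernel t x.
rewrite /heat_kernel; suff -> : euclidean_norm (- x) = euclidean_norm x by [].
by congr Num.sqrt; apply: eq_bigr => i _; rewrite mxE sqrrN.
Qed.

Lemma heat_kernelC k t (x y : 'rV[R]_k) : heat_kernel t (x - y) = heat_kernel t (y - x).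
by rewrite -heat_kernelN opprB. Qed.

Lemma mfun_euclidean_norm d (T : measurableType d) k (X : T -> 'rV[R]_k) :
 (forall i, mfun (fun x => X x 0 i)) ->
 mfun (fun x => euclidean_norm (X x)).
move=> mX; apply: mfun_sqrtr; apply: measurable_sum => i.
exact: mfunX.
Qed.

Lemma mfun_hk d (T : measurableType d) k (tau : T -> R) (X : T -> 'rV[R]_k) :
 mfun tau -> (forall i, mfun (fun x => X x 0 i)) ->
 mfun (fun x => heat_kernel (tau x) (X x)).
move=> mt mX; apply: mfunM.
 by apply: mfun_powRr; exact: mfunM.
apply: mfun_expRr; apply: mcomp => //; apply: mfunM.
 by apply: mfunX; exact: mfun_euclidean_norm.
by apply: mfun_funVr; exact: mfunM.
Qed.

(** Completing the square in w leaves a normal density in w, so the semigroup law reduces to the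
    total mass of [normal_pdf]. The mean and variance are those of the bridge from x to y. *)
Lemma G1_semigroup (a b x y w : R) : 0 < a -> 0 < b ->
 G1 a (x - w) * G1 b (w - y) =
 G1 (a + b) (x - y) *
  normal_pdf ((b * x + a * y) / (a + b)) (Num.sqrt (2 * a * b / (a + b))) w.
move=> a0 b0; have ab0 : 0 < a + b by rewrite addr_gt0.
have s0 : 0 < 2 * a * b / (a + b) by rewrite divr_gt0 // !mulr_gt0.
rewrite normal_pdfE ?gt_eqF ?sqrtr_gt0 // /normal_peak /normal_fun /G1.
rewrite !sqr_sqrtr ?ltW // [LHS]mulrACA [RHS]mulrACA -!expRD -!invfM -!sqrtrM; last 2 first.
- by rewrite !mulr_ge0 ?pi_ge0 ?ltW.
- by rewrite !mulr_ge0 ?pi_ge0 ?ltW.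
have a' := gt_eqF a0; have b' := gt_eqF b0; have ab' := gt_eqF ab0.
congr (_^-1 * expR _).
 by congr Num.sqrt; rewrite -mulr_natr; field; rewrite ab'.
by rewrite -mulr_natr; field; rewrite a' b' ab'.
Qed.

Lemma mfun_rowt k i : mfun (fun y : k.-tuple mR => rowt y 0 i).
by under eq_fun do rewrite mxE; exact: measurable_tnth. Qed.

Lemma mfun_normal_pdfT (m s : R) : mfun (normal_pdf m s : mR -> R).
exact: measurable_normal_pdf. Qed.

Lemma heat_semigroup k (a b : R) (x y : 'rV[R]_k) : 0 < a -> 0 < b ->
 (\int[lebesgue_tuple R k]_w (heat_kernel a (x - rowt w) * heat_kernel b (rowt w - y))%:E =
  (heat_kernel (a + b) (x - y))%:E)%E.
move=> a0 b0; rewrite heat_kernelE ?addr_gt0 //.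
pose h i w := normal_pdf ((b * x 0 i + a * y 0 i) / (a + b)) (Num.sqrt (2 * a * b / (a + b))) w.
pose g i (w : mR) := G1 (a + b) ((x - y) 0 i) * h i w.
have mh i : mfun (h i : mR -> R) by exact: mfun_normal_pdfT.
transitivity (\int[lebesgue_tuple R k]_w (\prod_(i < k) g i (tnth w i))%:E)%E.
 apply: eq_integral => w _; congr EFin; rewrite !heat_kernelE // -big_split /=.
 by apply: eq_bigr => i _; rewrite /g !mxE G1_semigroup.
rewrite int_tuple_prod; last 2 first.
- by move=> i; apply: mfunM.
- by move=> i z; rewrite mulr_ge0 ?G1_ge0 // normal_pdf_ge0.
rewrite -prodEFin; apply: eq_bigr => i _.
under eq_integral do rewrite EFinM.
rewrite ge0_integralZl //; last 3 first.
- by apply: mEFin.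
- by move=> z _; rewrite lee_fin normal_pdf_ge0.
- by rewrite lee_fin G1_ge0.
by rewrite integral_normal_pdf mule1.
Qed.
End gauss_kernel.

(** Cauchy-Schwarz when only positivity along a line is known. The case c = 0 is allowed because
    degenerate directions occur: there a nonzero b would make the polynomial equal to -1 at some
    t. *)
Lemma quadratic_discriminant (R : realFieldType) (a b c : R) : 0 <= c ->
 (forall t, 0 <= a + 2 * t * b + t ^+ 2 * c) -> b ^+ 2 <= a * c.
move=> c0 h; have [c_eq0|cn0] := eqVneq c 0.
 have [->|b0] := eqVneq b 0; first by rewrite c_eq0 mulr0 expr0n.
 have := h (- (a + 1) / (2 * b)); rewrite c_eq0 !mulr0 addr0.
 have -> : a + 2 * (- (a + 1) / (2 * b)) * b = -1 by field.
 by rewrite ler0N1.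
have cp : 0 < c by rewrite lt_def cn0.
have := h (- b / c).
have -> : a + 2 * (- b / c) * b + (- b / c) ^+ 2 * c = (a * c - b ^+ 2) / c by field.
by rewrite ler_pdivlMr // mul0r subr_ge0.
Qed.

(** * Integrability of real-valued functions *)

Section real_integrable.
Context d (T : measurableType d) (R : realType) (mu : {measure set T -> \bar R}).
Implicit Types f g : T -> R.

Definition intg f := mu.-integrable setT (EFin \o f).

Lemma intgD f g : intg f -> intg g -> intg (fun x => f x + g x).
by move=> hf hg; exact: (integrableD _ hf hg). Qed.

Lemma intgZ r f : intg f -> intg (fun x => r * f x).
by move=> hf; exact: (integrableZl _ r hf). Qed.

Lemma intg0 : intg (fun=> 0).
exact: integrable0. Qed.

Lemma intg_sum (I : Type) (s : seq I) (f : I -> T -> R) :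
 (forall i, intg (f i)) -> intg (fun x => \sum_(i <- s) f i x).
move=> hf; elim: s => [|i s IH].
 by under eq_fun do rewrite big_nil; exact: intg0.
by under eq_fun do rewrite big_cons; exact: intgD.
Qed.

Lemma intg_le f g : mfun f -> (forall x, `|f x| <= `|g x|) -> intg g -> intg f.
move=> mf fg hg; apply: (le_integrable _ _ _ hg) => //; first exact/measurable_EFinP.
by move=> x _ /=; rewrite lee_fin.
Qed.

Lemma Rintegral_sum (I : Type) (s : seq I) (f : I -> T -> R) :
 (forall i, intg (f i)) ->
 (\int[mu]_x (\sum_(i <- s) f i x) = \sum_(i <- s) \int[mu]_x f i x)%R.
move=> hf; elim: s => [|i s IH].
 rewrite big_nil; under eq_Rintegral do rewrite big_nil.
 by rewrite /Rintegral integral0.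
rewrite big_cons -IH -RintegralD //; [|exact: hf|exact: intg_sum].
by apply: eq_Rintegral => x _; rewrite big_cons.
Qed.

Lemma intg_ge0P f : mfun f -> nonneg f ->
 (\int[mu]_x (f x)%:E < +oo)%E -> intg f.
move=> mf f0 h; apply/integrableP; split; first exact/measurable_EFinP.
by under eq_integral do rewrite /= ger0_norm //.
Qed.

Lemma intg_lty f : intg f -> nonneg f -> (\int[mu]_x (f x)%:E < +oo)%E.
move=> /integrableP[_ h] f0; move: h.
by under eq_integral do rewrite /= ger0_norm //.
Qed.

Lemma EFin_Rint f : intg f -> ((\int[mu]_x f x)%R%:E = \int[mu]_x (f x)%:E)%E.
by move=> hf; rewrite fineK //; exact: integrable_fin_num. Qed.

End real_integrable.

(** * Bilinear forms given by a nonnegative kernel *)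

Section bilinear_form.
Context d (X : measurableType d) (R : realType) (mu : {measure set X -> \bar R}) (V : Type).
Variables (kappa : X -> R) (p1 p2 : X -> V).
Hypothesis mkappa : mfun kappa.
Implicit Types f g h : V -> R.

Definition form_meas f := mfun (f \o p1) /\ mfun (f \o p2).
(** Both noise covariances have this shape: [p1] and [p2] coincide for white noise and are two
    spatial points at a common time for the Riesz kernel. *)
Definition integrand f g x := kappa x * (f (p1 x) * g (p2 x)).
Notation I := integrand.
Definition form f g : R := (\int[mu]_x I f g x)%R.
Definition form_dom f := form_meas f /\ intg mu (I f f).

Hypothesis kappa0 : nonneg kappa.
Hypothesis form_sym0 : forall f g, nonneg f -> nonneg g ->
 form_meas f -> form_meas g -> (\int[mu]_x (I f g x)%:E = \int[mu]_x (I g f x)%:E)%E.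
Hypothesis form_cs0 : forall f g, nonneg f -> nonneg g ->
 form_meas f -> form_meas g ->
 (2%:E * \int[mu]_x (I f g x)%:E <= \int[mu]_x (I f f x)%:E + \int[mu]_x (I g g x)%:E)%E.

Lemma form_measurable f g : form_meas f -> form_meas g -> mfun (I f g).
move=> [mf1 mf2] [mg1 mg2]; apply: mfunM => //.
exact: (mfunM mf1 mg2).
Qed.

Lemma form_meas_abs f : form_meas f -> form_meas (fun v => `|f v|).
by move=> [h1 h2]; split; [exact: (mcomp (@normr_measurable R setT) h1)|exact: (mcomp (@normr_measurable R setT) h2)]. Qed.

Lemma form_meas_lin a b f g : form_meas f -> form_meas g ->
 form_meas (fun v => a * f v + b * g v).
by move=> [f1 f2] [g1 g2]; split; apply: mfunD; apply: mfunM.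
Qed.

Lemma form_norm f g x : `|I f g x| = I (fun v => `|f v|) (fun v => `|g v|) x.
by rewrite /I !normrM (ger0_norm (kappa0 _)). Qed.

(** The mixed term is controlled by [form_cs0] for |f| and |g|. That inequality lives in the
    extended reals, so it can be used before any integrability is known. *)
Lemma form_intg f g : form_dom f -> form_dom g -> intg mu (I f g).
move=> [mf If] [mg Ig].
have mI := form_measurable mf mg.
apply: (@intg_le _ _ _ _ _ (I (fun v => `|f v|) (fun v => `|g v|))) => //.
 by move=> x; rewrite form_norm ler_norm.
apply: intg_ge0P.
- by apply: form_measurable; exact: form_meas_abs.
- by move=> x; rewrite -form_norm.
have := form_cs0 (fun v => normr_ge0 (f v)) (fun v => normr_ge0 (g v))
 (form_meas_abs mf) (form_meas_abs mg).
have fin h : form_meas h -> intg mu (I h h) ->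
  (\int[mu]_x (I (fun v => `|h v|) (fun v => `|h v|) x)%:E < +oo)%E.
 move=> mh Ih; apply: intg_lty; last by move=> x; rewrite -form_norm.
 apply: (intg_le _ _ Ih) => [|x].
  by apply: form_measurable; exact: form_meas_abs.
 by rewrite -form_norm normr_id.
move=> /le_lt_trans/(_ (lte_add_pinfty (fin _ mf If) (fin _ mg Ig))).
set J := (\int[mu]_x _)%E; have J0 : (0 <= J)%E.
 by apply: integral_ge0 => x _; rewrite lee_fin -form_norm.
by apply: le_lt_trans; apply: lee_pemull => //; rewrite lee_fin ler1n.
Qed.

Lemma form_dom_lin a b f g : form_dom f -> form_dom g ->
 form_dom (fun v => a * f v + b * g v).
move=> hf hg; have [[mf _] [mg _]] := (hf, hg).
split; first exact: form_meas_lin.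
have -> : I (fun v => a * f v + b * g v) (fun v => a * f v + b * g v) =
  (fun x => (a * a * I f f x + a * b * I f g x) + (b * a * I g f x + b * b * I g g x)).
 by apply/funext => x; rewrite /I; ring.
by apply: intgD; apply: intgD; apply: intgZ; exact: form_intg.
Qed.

Lemma form_linl a b f g h : form_dom f -> form_dom g -> form_dom h ->
 form (fun v => a * f v + b * g v) h = a * form f h + b * form g h.
move=> hf hg hh; rewrite /form.
transitivity (\int[mu]_x (a * I f h x + b * I g h x))%R.
 by apply: eq_Rintegral => x _; rewrite /I; ring.
rewrite RintegralD //; last 2 first.
- by apply: intgZ; exact: form_intg.
- by apply: intgZ; exact: form_intg.
by rewrite !RintegralZl //; exact: form_intg.
Qed.

Lemma form_linr a b f g h : form_dom f -> form_dom g -> form_dom h ->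
 form h (fun v => a * f v + b * g v) = a * form h f + b * form h g.
move=> hf hg hh; rewrite /form.
transitivity (\int[mu]_x (a * I h f x + b * I h g x))%R.
 by apply: eq_Rintegral => x _; rewrite /I; ring.
rewrite RintegralD //; last 2 first.
- by apply: intgZ; exact: form_intg.
- by apply: intgZ; exact: form_intg.
by rewrite !RintegralZl //; exact: form_intg.
Qed.

Let pos f := (fun v => Num.max (f v) 0).
Let neg f := (fun v => Num.max (- f v) 0).

Let pos_dom f : form_dom f -> form_dom (pos f).
move=> [[m1 m2] If].
have mp : form_meas (pos f).
 by split; apply: (measurable_maxr (f := _ \o _) (g := cst 0)).
split=> //; apply: (intg_le _ _ If); first exact: form_measurable.
move=> x; rewrite /I !normrM; apply: ler_wpM2l => //.
have pn v : `|pos f v| <= `|f v|.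
 by rewrite ger0_norm /pos ?ge_max ?ler_norm ?normr_ge0 // le_max lexx orbT.
by apply: ler_pM.
Qed.

Let neg_dom f : form_dom f -> form_dom (neg f).
move=> hf; have := pos_dom (form_dom_lin (-1) 0 hf hf).
suff -> : pos (fun v => -1 * f v + 0 * f v) = neg f by [].
by apply/funext => v; rewrite /pos /neg mul0r addr0 mulN1r.
Qed.

Let posnegE f : f = (fun v => 1 * pos f v + (-1) * neg f v).
apply/funext => v; rewrite /pos /neg mul1r mulN1r.
have [h|h] := lerP 0 (f v).
 by rewrite max_r ?oppr_le0 // subr0.
by rewrite max_l ?oppr_ge0 ?ltW // sub0r opprK.
Qed.

Let pos0 f v : 0 <= pos f v. by rewrite /pos le_max lexx orbT. Qed.
Let neg0 f v : 0 <= neg f v. by rewrite /neg le_max lexx orbT. Qed.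

Lemma form_sym f g : form_dom f -> form_dom g -> form f g = form g f.
move=> hf hg.
have S u w : nonneg u -> nonneg w -> form_dom u -> form_dom w ->
  form u w = form w u.
 by move=> u0 w0 [mu_ _] [mw _]; rewrite /form /Rintegral form_sym0.
have [[[pf nf] pg] ng] := (pos_dom hf, neg_dom hf, pos_dom hg, neg_dom hg).
rewrite (posnegE f) (posnegE g) !form_linl ?form_linr //; last 2 first.
- exact: form_dom_lin.
- exact: form_dom_lin.
by rewrite (S (pos f) (pos g)) // (S (pos f) (neg g)) // (S (neg f) (pos g)) //
 (S (neg f) (neg g)) //; ring.
Qed.

(** For f written as positive part minus negative part, the cross terms are twice the form of the
    two parts, which [form_cs0] bounds by the two squares. Positivity on signed functions thus
    follows from an AM-GM inequality between nonnegative ones. *)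
Lemma form_ge0 f : form_dom f -> 0 <= form f f.
move=> hf; have [pf nf] := (pos_dom hf, neg_dom hf).
rewrite (posnegE f) form_linl ?form_linr //; last exact: form_dom_lin.
rewrite (form_sym nf pf).
have : 2 * form (pos f) (neg f) <= form (pos f) (pos f) + form (neg f) (neg f).
 have := form_cs0 (pos0 f) (neg0 f) pf.1 nf.1.
 by rewrite -!EFin_Rint; try exact: form_intg.
by lra.
Qed.

Lemma form_cauchy f g : form_dom f -> form_dom g ->
 form f g ^+ 2 <= form f f * form g g.
move=> hf hg; apply: quadratic_discriminant; first exact: form_ge0.
move=> t; have hd := form_dom_lin 1 t hf hg.
have := form_ge0 hd; rewrite form_linl ?form_linr // (form_sym hg hf).
by move=> h; apply: (le_trans h); rewrite le_eqVlt; apply/orP; left; apply/eqP; ring.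
Qed.

(** Expanding around the limits leaves three remainders, each tending to 0 by Cauchy-Schwarz. This
    turns the approximations in the definition of a Wiener integral into the covariance of the
    limits. *)
Lemma form_cvg (f_ g_ : nat -> V -> R) f g :
 (forall n, form_dom (f_ n)) -> (forall n, form_dom (g_ n)) -> form_dom f -> form_dom g ->
 form (fun v => f_ n v - f v) (fun v => f_ n v - f v) @[n --> \oo] --> (0 : R) ->
 form (fun v => g_ n v - g v) (fun v => g_ n v - g v) @[n --> \oo] --> (0 : R) ->
 form (f_ n) (g_ n) @[n --> \oo] --> form f g.
move=> hf_ hg_ hf hg cf cg.
have subE (u w : V -> R) : (fun v => u v - w v) = (fun v => 1 * u v + (-1) * w v).
 by apply/funext => v; rewrite mul1r mulN1r.
pose df n v := f_ n v - f v; pose dg n v := g_ n v - g v.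
have hdf n : form_dom (df n) by rewrite /df subE; exact: form_dom_lin.
have hdg n : form_dom (dg n) by rewrite /dg subE; exact: form_dom_lin.
have E n : form (f_ n) (g_ n) =
  form f g + (form (df n) (dg n) + form (df n) g + form f (dg n)).
 rewrite /df /dg !subE !form_linl ?form_linr //; try exact: form_dom_lin.
 by ring.
rewrite (funext E).
suff : form f g + (form (df n) (dg n) + form (df n) g + form f (dg n)) @[n --> \oo] -->
  form f g + (0 + 0 + 0) by rewrite !addr0.
apply: cvgD; first exact: cvg_cst.
have c0 (u w : nat -> V -> R) : (forall n, form_dom (u n)) -> (forall n, form_dom (w n)) ->
  form (u n) (u n) * form (w n) (w n) @[n --> \oo] --> (0 : R) ->
  form (u n) (w n) @[n --> \oo] --> (0 : R).
 move=> hu hw cuw; apply/norm_cvg0P.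
 apply: (@squeeze_cvgr _ _ _ _ (cst 0) (fun n => Num.sqrt (form (u n) (u n) * form (w n) (w n)))).
 - near=> n; rewrite normr_ge0 /= -sqrtr_sqr; apply: ler_wsqrtr; exact: form_cauchy.
 - exact: cvg_cst.
 - rewrite -sqrtr0; apply: (cvg_comp _ _ cuw); exact: sqrt_continuous.
have cM (u w : nat -> R) (l : R) : u n @[n --> \oo] --> (0 : R) -> w n @[n --> \oo] --> l ->
  u n * w n @[n --> \oo] --> (0 : R) by move=> cu cw; rewrite -(mul0r l); exact: cvgM.
apply: cvgD; first apply: cvgD.
- by apply: c0 => //; apply: cM cg.
- by apply: (c0 df (fun=> g)) => //; apply: cM (cvg_cst _).
- apply: (c0 (fun=> f) dg) => //.
 by under eq_fun do rewrite mulrC; apply: cM (cvg_cst _).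
Unshelve. all: by end_near. Qed.

End bilinear_form.

(** * The Riesz kernel as a mixture of heat kernels *)

Section riesz_scaling.
Context {R : realType}.
Notation mR := (measurableTypeR R).
Notation leb := (@lebesgue_measure R).

Lemma cvg_ln_pinfty : ln x @[x --> +oo] --> (+oo : set_system R).
apply/cvgryPge => M; near=> x.
have x1 : expR M <= x by near: x; exact: nbhs_pinfty_ge.
by rewrite -(expRK M) ler_ln ?posrE ?expR_gt0 // (lt_le_trans _ x1) ?expR_gt0.
Unshelve. all: end_near. Qed.

Lemma powR1r (c : R) : (1 : R) `^ c = 1.
by rewrite powR1. Qed.

Lemma cvg_powRN_pinfty (c : R) : 0 < c -> x `^ (- c) @[x --> +oo] --> (0 : R).
move=> c0.
apply: (@cvg_trans _ (expR (- (ln x * c)) @[x --> +oo])).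
 apply: near_eq_cvg; near=> x.
 by rewrite /powR gt_eqF ?mulNr 1?mulrC //; near: x; exact: nbhs_pinfty_gt.
apply: (@cvg_comp _ _ _ (fun x => ln x * c) (fun y => expR (- y)) _ +oo); last exact: cvgr_expR.
by apply: gt0_cvgMly => //; exact: cvg_ln_pinfty.
Unshelve. all: end_near. Qed.

Lemma integral_powR_tail (p : R) : 1 < p ->
 (\int[leb]_(s in `[1%R, +oo[) (s `^ (- p))%:E = ((p - 1)^-1)%:E)%E.
move=> p1; have p1' : p - 1 != 0 by rewrite subr_eq0 gt_eqF.
pose F (s : R) := - (p - 1)^-1 * s `^ (1 - p).
have dF (x : R) : 0 < x -> is_derive x 1 F (x `^ (- p)).
 move=> x0.
 have h : is_derive x 1 (fun y : R => y `^ (1 - p)) ((1 - p) * x `^ (1 - p - 1)) by exact: is_derive1_powR.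
 rewrite (_ : F = (- (p - 1)^-1) \*: (fun y : R => y `^ (1 - p))) //; apply: is_derive_eq.
 rewrite /GRing.scale /=.
 by rewrite mulrA (_ : 1 - p - 1 = - p) //; [field|ring].
rewrite (@ge0_continuous_FTC2y _ (fun s => s `^ (- p)) F 1 0).
- by rewrite /F powR1 mulr1 sub0e -EFinN opprK.
- by move=> x _; exact: powR_ge0.
- apply: continuous_in_subspaceT => x; rewrite inE /= in_itv /= andbT => x1.
 have x0 : 0 < x by rewrite (lt_le_trans _ x1).
 apply: differentiable_continuous; apply/derivable1_diffP.
 by apply: ex_derive; exact: is_derive1_powR.
- rewrite -(mulr0 (- (p - 1)^-1)); apply: cvgM; first exact: cvg_cst.
 by rewrite -[1 - p]opprB; apply: cvg_powRN_pinfty; rewrite subr_gt0.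
- by move=> x x1; have [] := dF x (lt_trans ltr01 x1).
- apply: cvg_at_right_filter; apply: differentiable_continuous; apply/derivable1_diffP.
 by have [] := dF 1 ltr01.
- move=> x; rewrite in_itv /= andbT => x1.
 by rewrite derive1E; have [] := dF x (lt_trans ltr01 x1).
Qed.

(** The power is at most [1 + x ^+ k], and the exponential series dominates [x ^+ k] divided by k
    factorial. It bounds the mixture at small times. *)
Lemma powR_half_le (k : nat) (x : R) : (0 < k)%N -> 0 <= x ->
 x `^ (k%:R / 2) * expR (- x) <= 1 + k`!%:R.
case: k => // k _ x0.
have h1 : x `^ (k.+1%:R / 2) <= 1 + x ^+ k.+1.
 have [x1|x1] := leP x 1.
  apply: (@le_trans _ _ 1); last by rewrite lerDl exprn_ge0.
  rewrite -[leRHS](powR1r (k.+1%:R / 2)).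
  by apply: ge0_ler_powR; rewrite ?nnegrE // divr_ge0.
 apply: (@le_trans _ _ (x ^+ k.+1)); last by rewrite lerDr.
 rewrite -powR_mulrn //; apply: ler_powR; first exact: ltW.
 by rewrite ler_pdivrMr // ler_peMr ?ler1n // ler0n.
have h2 := expR_ge1Dxn k x0.
have f0 : (0 : R) < k.+1`!%:R by rewrite ltr0n fact_gt0.
have h3 : x ^+ k.+1 <= k.+1`!%:R * expR x.
 rewrite mulrC -ler_pdivrMr //; apply: le_trans h2; by rewrite lerDr.
have e0 := expR_gt0 x.
rewrite expRN ler_pdivrMr //; apply: (le_trans h1).
rewrite mulrDl mul1r; apply: lerD => //.
by rewrite -expR0 ler_expR.
Qed.

Variables (k : nat) (beta : R).
Hypotheses (k0 : (0 < k)%N) (beta0 : 0 < beta) (betak : beta < k%:R).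
Let theta := (k%:R - beta) / 2.
Let theta0 : 0 < theta. by rewrite divr_gt0 // subr_gt0. Qed.

(** Lebesgue measure pushed forward by [riesz_time] has a density proportional to a^((k - beta)/2 -
    1) on positive times, the mixing density of the Riesz kernel. The value 1 at s = 0 only keeps
    all times positive. *)
Definition riesz_time (s : mR) : R := if s == 0 then 1 else `|s| `^ ((k%:R - beta) / 2)^-1.
Notation A := riesz_time.

Lemma riesz_time_gt0 s : 0 < A s.
by rewrite /A; case: ifP => [_|/negbT s0]; rewrite ?ltr01 // powR_gt0 // normr_gt0. Qed.

Lemma mfun_riesz_time : mfun A.
rewrite /A; apply: mfun_if => //.
 exact: measurable_fun_eqr.
by apply: mfun_powRr.
Qed.

Lemma riesz_time_scale (lam : R) (f : R -> \bar R) : 0 < lam ->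
 mfun f -> (forall x, 0 <= f x)%E ->
 (\int[leb]_s f (lam * A s)%R = (lam `^ (- theta))%:E * \int[leb]_s f (A s))%E.
move=> lam0 mf f0.
have c0 : lam `^ theta != 0 by rewrite gt_eqF // powR_gt0.
have mA := mfun_riesz_time.
have mfA : mfun (f \o A) by exact: mcomp.
have := @int_affine R (lam `^ theta) 0 (f \o A) c0 mfA (fun x => f0 _).
rewrite ger0_norm ?powR_ge0 // -powRN => <-.
apply: ae_eq_integral => //.
- by apply: mcomp => //; exact: mfunM.
- by apply: mcomp => //; exact: mfun_affine.
exists [set 0]; split => //.
 exact: lebesgue_measure_set1.
move=> s /= h; apply: contrapT => s0; apply: h => _.
have s0' : s != 0 by apply/eqP.
rewrite /= /A addr0 mulf_eq0 (negPf c0) (negPf s0') /= normrM powRM //.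
congr (f (_ * _)); rewrite ger0_norm ?powR_ge0 // -powRrM mulfV ?powRr1 ?ltW //.
by rewrite gt_eqF.
Qed.

(** The heat kernel of age 2a at a vector of norm 1. *)
Let Phi (a : R) : R := (8 * pi * a) `^ (- (k%:R / 2)) * expR (- (8 * a)^-1).

Let Phi_ge0 a : 0 <= Phi a.
by rewrite mulr_ge0 ?powR_ge0 ?expR_ge0. Qed.

Let mfun_Phi : mfun Phi.
apply: mfunM; first by apply: mfun_powRr; exact: mfunM.
apply: mfun_expRr; apply: mcomp => //.
by apply: mfun_funVr; exact: mfunM.
Qed.

Let Phi_bound a : 0 < a -> Phi a <= 1 + k`!%:R.
move=> a0; have x0 : 0 <= (8 * a)^-1 by rewrite invr_ge0 mulr_ge0 // ltW.
apply: le_trans (powR_half_le k0 x0); rewrite /Phi; apply: ler_wpM2r; first exact: expR_ge0.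
have -> : (8 * pi * a) `^ (- (k%:R / 2)) = (8 * pi * a)^-1 `^ (k%:R / 2).
 by rewrite -[(8 * pi * a)^-1]powR_inv1 ?mulr_ge0 ?pi_ge0 ?(ltW a0) // -powRrM mulN1r.
apply: ge0_ler_powR; rewrite ?nnegrE ?invr_ge0 ?divr_ge0 ?mulr_ge0 ?pi_ge0 ?(ltW a0) //.
by rewrite lef_pV2 ?posrE ?mulr_gt0 ?pi_gt0 // -mulrA ler_wpM2l //; have := @pi_ge2 R; nra.
Qed.

Let Phi_decay a : 1 <= a -> Phi a <= a `^ (- (k%:R / 2)).
move=> a1; have a0 : 0 < a by rewrite (lt_le_trans _ a1).
rewrite /Phi powRM ?(ltW a0) ?mulr_ge0 ?pi_ge0 // mulrAC -[leRHS]mul1r.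
apply: ler_wpM2r; first exact: powR_ge0.
rewrite -[leRHS]mulr1; apply: ler_pM => //; rewrite ?powR_ge0 ?expR_ge0 //.
 rewrite powRN invf_le1 ?powR_gt0 ?mulr_gt0 ?pi_gt0 //.
 rewrite -[leLHS](powR1r (k%:R / 2)); apply: ge0_ler_powR; rewrite ?nnegrE ?divr_ge0 ?mulr_ge0 ?pi_ge0 //.
 have := @pi_ge2 R; lra.
by rewrite -[leRHS]expR0 ler_expR oppr_le0 invr_ge0 mulr_ge0 // ltW.
Qed.

Lemma int_even_tail (f : R -> R) : mfun f -> nonneg f ->
 (\int[leb]_(s in [set s | (1 <= `|s|)%R]) (f `|s|%R)%:E =
  2%:E * \int[leb]_(s in `[1%R, +oo[) (f s)%:E)%E.
move=> mf f0.
have mN : mfun (fun s : mR => f `|s|) by apply: (mcomp mf).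
have -> : [set s : R | 1 <= `|s|] = `]-oo, (-1)%R] `|` `[1%R, +oo[.
 apply/seteqP; split => s /=; rewrite !in_itv /= andbT.
  by rewrite lerNr; case: (ler0P s) => h1 h2; [left|right]; lra.
 case=> h; last by rewrite (le_trans h) // ler_norm.
 by rewrite -normrN (le_trans _ (ler_norm _)) // lerNr.
rewrite ge0_integral_setU //; last 3 first.
- by apply: measurable_funTS; exact: mEFin.
- by move=> s _; rewrite lee_fin.
- rewrite disj_set2E; apply/eqP; rewrite -subset0 => s /=; rewrite !in_itv /= andbT; lra.
have -> : (2%:E : \bar R) = (1 + 1)%E by rewrite -EFinD.
rewrite ge0_muleDl ?lee_fin // mul1e; congr (_ + _)%E; last first.
 by apply: eq_integral => s; rewrite inE /= in_itv /= andbT => s1; rewrite ger0_norm // (le_trans _ s1).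
pose g (s : R) := ((f `|s|%R)%:E * (\1_(`[1%R, +oo[%classic : set mR) s)%:E)%E.
have mg : mfun (g : mR -> \bar R).
 by apply: emfunM => //; apply: mEFin.
have g0 x : (0 <= g x)%E by rewrite mule_ge0 // lee_fin.
transitivity (\int[leb]_s g (-1 * s + 0)%R)%E.
 rewrite [LHS]integral_mkcond; apply: eq_integral => s _; rewrite /g patchE indicE addr0 mulN1r normrN.
 have -> : (- s \in (`[1%R, +oo[%classic : set mR)) = (s \in (`]-oo, (-1)%R]%classic : set mR)).
  by apply/idP/idP; rewrite !inE /= !in_itv /= andbT lerNr.
 by case: ifP => _; rewrite ?mule1 ?mule0.
rewrite int_affine ?oppr_eq0 ?oner_eq0 // normrN1 invr1 mul1e.
rewrite [RHS]integral_mkcond; apply: eq_integral => s _; rewrite /g patchE indicE.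
case: ifPn => h; rewrite ?mule1 ?mule0 //; congr (f _)%:E.
by move: h; rewrite inE /= in_itv /= andbT => s1; rewrite ger0_norm // (le_trans _ s1).
Qed.

Let L := (\int[leb]_s (Phi (A s))%:E)%E.

Let mPhiA : mfun (fun s => (Phi (A s))%:E).
by apply: mEFin; apply: (mcomp mfun_Phi); exact: mfun_riesz_time. Qed.

Let L_lty : (L < +oo)%E.
(* In the variable s the decay a^(-k/2) becomes |s|^(-p) with p = k / (k - beta), and beta > 0 makes
   p > 1. *)
pose p := theta^-1 * (k%:R / 2).
have p1 : 1 < p.
 have pt : p * theta = k%:R / 2 by rewrite /p mulrAC mulVf ?mul1r // gt_eqF.
 by rewrite -(ltr_pM2r theta0) pt mul1r /theta ltr_pM2r ?invr_gt0 // ltrBlDr ltrDl.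
pose C : R := 1 + k`!%:R; have C0 : 0 <= C by rewrite addr_ge0.
pose S1 := [set s : mR | 1 <= `|s|].
have mS1 : measurable S1.
 have -> : S1 = (Num.norm : mR -> mR) @^-1` (`[1, +oo[%classic).
  by apply/seteqP; split => s; rewrite /S1 /= in_itv /= andbT.
 rewrite -[X in measurable X]setTI; apply: (@normr_measurable R setT) => //.
have mtail : mfun (fun s : R => s `^ (- p)) by exact: measurable_powR.
have h0 : (\int[leb]_(s in S1) (`|s|%R `^ (- p))%:E < +oo)%E.
 rewrite (int_even_tail mtail) //; last by move=> x; exact: powR_ge0.
 by rewrite integral_powR_tail // -EFinM ltry.
rewrite /L -(setUv S1) ge0_integral_setU //; last 4 first.
- exact: measurableC.
- by apply: measurable_funTS.
- by move=> s _; rewrite lee_fin.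
- by rewrite disj_set2E; apply/eqP; rewrite setICr.
apply: lte_add_pinfty.
 apply: le_lt_trans h0; apply: ge0_le_integral => //.
 - by move=> s _; rewrite lee_fin.
 - exact: measurable_funTS.
 - by apply: measurable_funTS; apply: mEFin; apply: mfun_powRr.
 move=> s s1; rewrite lee_fin.
 have s0 : s != 0 by apply: contraTneq s1 => ->; rewrite /S1 /= normr0 ler10.
 have -> : `|s| `^ (- p) = A s `^ (- (k%:R / 2)).
  by rewrite /A (negPf s0) -powRrM /p mulrN.
 apply: Phi_decay; rewrite /A (negPf s0) -[leLHS](powR1r theta^-1).
 by apply: ge0_ler_powR; rewrite ?nnegrE ?invr_ge0 ?(ltW theta0).
apply: (@le_lt_trans _ _ (\int[leb]_(s in ~` S1) (cst C%:E s))%E).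
 apply: ge0_le_integral => //.
 - exact: measurableC.
 - by move=> s _; rewrite lee_fin.
 - exact: measurable_funTS.
 - by move=> s _; rewrite lee_fin; apply: Phi_bound; exact: riesz_time_gt0.
rewrite integral_cst; last exact: measurableC.
have -> : ~` S1 = `](-1)%R, 1%R[%classic.
 by apply/seteqP; split => s; rewrite /S1 /= in_itv /= -ltr_norml ltNge; [move/negP|move=> h; apply/negP].
apply: lte_mul_pinfty => //.
have := lebesgue_measure_itv `](-1)%R, 1%R[ => h; rewrite [X in (X < _)%E]h /=.
by case: ifP => _; rewrite -?EFinB ltry.
Qed.

Let L_gt0 : (0 < L)%E.
pose I := (`[1%R, 2%R]%classic : set mR).
have mI : measurable I by exact: measurable_itv.
pose c : R := (8 * pi * 2 `^ theta^-1) `^ (- (k%:R / 2)) * expR (- 8^-1).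
have two0 : 0 < 2 `^ theta^-1 :> R by rewrite powR_gt0.
have c0 : 0 < c by rewrite mulr_gt0 ?expR_gt0 // powR_gt0 // !mulr_gt0 ?pi_gt0.
apply: (@lt_le_trans _ _ (\int[leb]_(s in I) (cst c%:E s))%E).
 have lI : leb I = 1%:E.
  apply: (etrans (lebesgue_measure_itv `[1%R, 2%R])).
  by rewrite /= lte_fin ltrDl ltr01 -EFinB; congr EFin; ring.
 have EI : (\int[leb]_(s in I) (cst c%:E s) = c%:E * leb I)%E by rewrite integral_cst //; exact: measurable_itv.
 by rewrite EI lI mule1 lte_fin.
apply: (@le_trans _ _ (\int[leb]_(s in I) (Phi (A s))%:E)%E); last first.
 by apply: ge0_subset_integral => // s _; rewrite lee_fin.
apply: ge0_le_integral => //.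
- by move=> s _; rewrite lee_fin ltW.
- exact: measurable_funTS.
move=> s; rewrite /I /= in_itv /= => /andP[s1 s2]; rewrite lee_fin.
have s0 : 0 < s by rewrite (lt_le_trans _ s1).
have t1 : 1 <= A s.
 rewrite /A gt_eqF // gtr0_norm // -[leLHS](powR1r theta^-1).
 by apply: ge0_ler_powR; rewrite ?nnegrE ?invr_ge0 ?(ltW theta0) // ltW.
have t2 : A s <= 2 `^ theta^-1.
 rewrite /A gt_eqF // gtr0_norm //.
 by apply: ge0_ler_powR; rewrite ?nnegrE ?invr_ge0 ?(ltW theta0) // ltW.
have t0 : 0 < A s by exact: riesz_time_gt0.
apply: ler_pM; rewrite ?powR_ge0 ?expR_ge0 //.
 rewrite !powRN lef_pV2 ?posrE ?powR_gt0 ?mulr_gt0 ?pi_gt0 //.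
 apply: ge0_ler_powR; rewrite ?nnegrE ?divr_ge0 ?mulr_ge0 ?pi_ge0 ?(ltW t0) ?(ltW two0) //.
 by apply: ler_wpM2l => //; rewrite mulr_ge0 ?pi_ge0.
by rewrite ler_expR lerN2 lef_pV2 ?posrE ?mulr_gt0 // ler_peMr.
Qed.

(** Rescaling time by |u|^2 reduces the integral to a unit vector, where it is the constant L. The
    powers of |u| combine as (k - beta) - k. *)
Lemma riesz_subordination : exists2 c0 : R, 0 < c0 & forall u : 'rV[R]_k, u != 0 ->
 (\int[leb]_s (heat_kernel (2 * A s) u)%:E = (c0 * euclidean_norm u `^ (- beta))%:E)%E.
exists (fine L); first by rewrite fine_gt0 // L_gt0 L_lty.
move=> u u0; set N := euclidean_norm u.
have N0 : 0 < N.
 rewrite /N /euclidean_norm sqrtr_gt0 lt_def sumr_ge0 ?andbT; last by move=> i _; rewrite sqr_ge0.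
 apply: contraNneq u0 => /eqP; rewrite psumr_eq0; last by move=> i _; rewrite sqr_ge0.
 move=> /allP h; apply/eqP/rowP => i; rewrite mxE; apply/eqP.
 by rewrite -sqrf_eq0; apply: h; rewrite mem_index_enum.
pose f (a : R) := (heat_kernel (2 * a) u)%:E.
have mf : mfun f.
 by apply: mEFin; apply: mfun_hk => //; apply: mfunM.
have f0 a : (0 <= f a)%E by rewrite lee_fin hker_ge0.
have N2 : 0 < N ^+ 2 by rewrite exprn_gt0.
have := riesz_time_scale N2 mf f0.
set J := (\int[leb]_s f (A s))%E => E.
have E2 : (\int[leb]_s f (N ^+ 2 * A s)%R = (N `^ (- k%:R))%:E * L)%E.
 rewrite /L -ge0_integralZl //; last 2 first.
 - by move=> s _; rewrite lee_fin.
 - by rewrite lee_fin powR_ge0.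
 apply: eq_integral => s _; rewrite /f -EFinM; congr EFin.
 have t0 := riesz_time_gt0 s.
 rewrite /heat_kernel -/N /Phi [RHS]mulrA.
 have -> : N ^+ 2 / (4 * (2 * (N ^+ 2 * A s))) = (8 * A s)^-1.
  by field; rewrite !gt_eqF.
 congr (_ * _).
 rewrite (_ : 4 * pi * (2 * (N ^+ 2 * A s)) = N ^+ 2 * (8 * pi * A s)); last by ring.
 rewrite powRM ?sqr_ge0 //; last by rewrite !mulr_ge0 ?pi_ge0 // ltW.
 congr (_ * _); rewrite -powR_mulrn ?(ltW N0) // -powRrM.
 by have -> : 2%:R * - (k%:R / 2) = - k%:R :> R by field.
have NT : (0 < (N ^+ 2) `^ (- theta))%R by rewrite powR_gt0.
have -> : J = (((N ^+ 2) `^ theta)%:E * ((N `^ (- k%:R))%:E * L))%E.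
 rewrite -E2 E muleA -EFinM -powRD ?subrr ?powRr0 ?mul1e //.
 by rewrite (gt_eqF N2) implybT.
rewrite -{1}(@fineK _ L) ?ge0_fin_numE ?L_lty ?(ltW L_gt0) // -!EFinM; congr EFin.
rewrite mulrA mulrC; congr (_ * _).
rewrite -powR_mulrn ?(ltW N0) // -powRrM -powRD ?(gt_eqF N0) ?implybT //.
by congr (_ `^ _); rewrite /theta; field.
Qed.

End riesz_scaling.

(** * Measurability along coordinates, product measures, null points *)

Section measurable_continuous.
Context {R : realType}.

Lemma mfun_countable_comp d (T : measurableType d) (C : countType) (c : T -> C) (h : C -> R) :
 (forall a, measurable (c @^-1` [set a])) -> mfun (h \o c).
move=> mc _ B mB; rewrite setTI.
have -> : (h \o c) @^-1` B = \bigcup_(a in setT) (if h a \in B then c @^-1` [set a] else set0).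
 apply/seteqP; split => [w /= hw|w [a _]].
  by exists (c w) => //; rewrite mem_set.
 by case: ifPn => // /set_mem haB /= ca; rewrite ca.
apply: countable_bigcupT_measurable; first exact: countableP.
by move=> a; case: ifP => _.
Qed.

Lemma mfun_floor_fiber d (T : measurableType d) (f : T -> R) (z : int) :
 mfun f -> measurable ((fun w => Num.floor (f w)) @^-1` [set z]).
move=> mf.
have -> : (fun w => Num.floor (f w)) @^-1` [set z] = f @^-1` `[z%:~R, (z + 1)%:~R[%classic.
 apply/seteqP; split => w /=; rewrite in_itv /=.
  by move=> <-; exact: floor_itv.
 by move=> h; exact: floor_def.
rewrite -[X in measurable X]setTI; exact: mf.
Qed.

(** The composite is the pointwise limit of phi at the coordinates rounded down to multiples of 1/(n
    + 1). Each rounded map takes countably many values, so only level sets of floors need to be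
    measurable. *)
Lemma mfun_continuous_prod d (T : measurableType d) k (phi : R * 'rV[R]_k -> R)
  (tau : T -> R) (X : T -> 'rV[R]_k) :
 continuous phi -> mfun tau ->
 (forall i, mfun (fun w => X w 0 i)) ->
 mfun (fun w => phi (tau w, X w)).
move=> cphi mtau mX.
pose c (n : nat) (w : T) : int * {ffun 'I_k -> int} :=
 (Num.floor (n.+1%:R * tau w), [ffun i => Num.floor (n.+1%:R * X w 0 i)]).
pose D (n : nat) (z : int * {ffun 'I_k -> int}) : R * 'rV[R]_k :=
 (z.1%:~R / n.+1%:R, \row_i ((z.2 i)%:~R / n.+1%:R)).
apply: (@measurable_fun_cvg _ _ _ setT (fun n => (phi \o D n) \o c n)) => // [n|w _].
 apply: mfun_countable_comp => -[a b].
 have -> : c n @^-1` [set (a, b)] = ((fun w => Num.floor (n.+1%:R * tau w)) @^-1` [set a]) `&`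
   \bigcap_(i in setT) ((fun w => Num.floor (n.+1%:R * X w 0 i)) @^-1` [set b i]).
  apply/seteqP; split => w /=.
   by case=> <- <-; split=> // i _; rewrite /= ffunE.
  case=> h0 h; rewrite /c h0; congr pair; apply/ffunP => i; rewrite ffunE; exact: (h i Logic.I).
 apply: measurableI; first by apply: mfun_floor_fiber; exact: mfunM.
 apply: fin_bigcap_measurable => // i _.
 by apply: mfun_floor_fiber; exact: mfunM.
apply: (@cvg_comp _ _ _ (fun n => D n (c n w)) phi _ (nbhs (tau w, X w))); last exact: cphi.
have est (x : R) n : `|x - (Num.floor (n.+1%:R * x))%:~R / n.+1%:R| <= n.+1%:R^-1.
 have /andP[h1 h2] := floor_itv (n.+1%:R * x).
 have n0 : (0 : R) < n.+1%:R by rewrite ltr0n.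
 set z := (Num.floor _)%:~R in h1 *.
 have -> : x - z / n.+1%:R = (n.+1%:R * x - z) / n.+1%:R by field; rewrite gt_eqF.
 rewrite normrM (ger0_norm (_ : 0 <= n.+1%:R^-1)) ?invr_ge0 // -[leRHS]mul1r.
 apply: ler_wpM2r; first by rewrite invr_ge0.
 by rewrite ger0_norm ?subr_ge0 // lerBlDl; move: h2; rewrite intrD => /ltW.
apply/cvg_ballP => e e0; near=> n.
have ne : n.+1%:R^-1 < e by near: n; exact: (near_infty_natSinv_lt (PosNum e0)).
split => /=.
 by rewrite /ball /= (le_lt_trans (est _ _)).
split=> // i j; rewrite /ball /= mxE ffunE ord1 (le_lt_trans (est _ _)) //.
Unshelve. all: end_near. Qed.

Section sprod_measure.
Context d1 d2 (T1 : measurableType d1) (T2 : measurableType d2).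
Variables (m1 : {sigma_finite_measure set T1 -> \bar R}) (m2 : {sigma_finite_measure set T2 -> \bar R}).

(** The product measure under a name that carries a sigma-finite structure, so that products can be
    nested. *)
Definition sprod : set (T1 * T2)%type -> \bar R := (m1 \x m2)%E.

Let sprod0 : sprod set0 = 0%E. exact: measure0. Qed.
Let sprod_ge0 A : (0 <= sprod A)%E. exact: measure_ge0. Qed.
Let sprod_sigma_additive : semi_sigma_additive sprod.
exact: measure_semi_sigma_additive. Qed.

HB.instance Definition _ := isMeasure.Build _ _ _ sprod
 sprod0 sprod_ge0 sprod_sigma_additive.

Let sprod_sigma_finite : sigma_finite setT sprod.
have /sigma_finiteP[F [TF ndF Foo]] := sigma_finiteT m1.
have /sigma_finiteP[G [TG ndG Goo]] := sigma_finiteT m2.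
exists (fun n => F n `*` G n).
 rewrite -setXTT TF TG predeqE => -[x y]; split.
  move=> [/= [n _ Fnx] [k _ Gky]]; exists (maxn n k) => //; split.
  - by move: x Fnx; exact/subsetPset/ndF/leq_maxl.
  - by move: y Gky; exact/subsetPset/ndG/leq_maxr.
 by move=> [n _ []/= ? ?]; split; exists n.
move=> n; have [mF oF] := Foo n; have [mG oG] := Goo n; split; first exact: measurableX.
by rewrite /sprod product_measure1E// lte_mul_pinfty// ge0_fin_numE.
Qed.

HB.instance Definition _ := Measure_isSigmaFinite.Build _ _ _ sprod sprod_sigma_finite.

End sprod_measure.

Section sprod_theory.
Context d1 d2 (T1 : measurableType d1) (T2 : measurableType d2).
Variables (m1 : {sigma_finite_measure set T1 -> \bar R}) (m2 : {sigma_finite_measure set T2 -> \bar R}).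

Lemma int_sprod (f : T1 * T2 -> \bar R) : mfun f ->
 (forall x, 0 <= f x)%E -> (\int[sprod m1 m2]_x f x = \int[m1]_x \int[m2]_y f (x, y))%E.
by move=> mf f0; rewrite /sprod fubini_tonelli1. Qed.

Lemma int_sprod_swap (f : T1 * T2 -> \bar R) : mfun f ->
 (forall x, 0 <= f x)%E -> (\int[sprod m1 m2]_x f x = \int[m2]_y \int[m1]_x f (x, y))%E.
by move=> mf f0; rewrite /sprod fubini_tonelli2. Qed.

Lemma integral_sprod (f : T1 * T2 -> \bar R) : (sprod m1 m2).-integrable setT f ->
 (\int[sprod m1 m2]_x f x = \int[m1]_x \int[m2]_y f (x, y))%E.
by move=> hf; exact: (esym (integral12_prod_meas1 hf)). Qed.

Lemma ae_integrable_sprod (f : T1 * T2 -> \bar R) : (sprod m1 m2).-integrable setT f ->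
 \forall x \ae m1, m2.-integrable [set: T2] (fun y : T2 => f (x, y)).
by move=> hf; exact: (ae_integrable1 hf). Qed.

Lemma mfun_sprod_F (f : T1 * T2 -> \bar R) : mfun f ->
 (forall x, 0 <= f x)%E -> mfun (fun x => \int[m2]_y f (x, y))%E.
by move=> mf f0; exact: measurable_fun_fubini_tonelli_F. Qed.
End sprod_theory.

(** No sign is assumed: the positive and negative parts are treated separately by Tonelli. *)
Lemma mfun_integral_F d1 d2 (T1 : measurableType d1) (T2 : measurableType d2)
  (m2 : {sigma_finite_measure set T2 -> \bar R}) (F : T1 * T2 -> \bar R) :
 mfun F -> mfun (fun x => \int[m2]_y F (x, y))%E.
move=> mF; under eq_fun do rewrite integralE.
apply: emeasurable_funB.
 have mp : mfun (F^\+)%E by exact: measurable_funepos.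
 rewrite [X in measurable_fun _ X](_ : _ = fubini_F m2 (F^\+)%E); last first.
  by apply/funext => x; apply: eq_integral => y _; rewrite ?funepos.unlock ?funeneg.unlock.
 by apply: measurable_fun_fubini_tonelli_F.
have mn : mfun (F^\-)%E by exact: measurable_funeneg.
rewrite [X in measurable_fun _ X](_ : _ = fubini_F m2 (F^\-)%E); last first.
  by apply/funext => x; apply: eq_integral => y _; rewrite ?funepos.unlock ?funeneg.unlock.
 by apply: measurable_fun_fubini_tonelli_F.
Qed.

(** Small boxes around y, of side [Num.min e 1] so that the k-th power stays below the side. It
    makes the diagonal, where the Riesz kernel takes a default value, invisible to integrals. *)
Lemma lebesgue_tuple_set1 k (y : k.-tuple (measurableTypeR R)) : (0 < k)%N ->
 measurable [set y] /\ lebesgue_tuple R k [set y] = 0%E.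
move=> k0; have m1 : measurable [set y].
 have -> : [set y] = \bigcap_(i in setT) ((fun x => tnth x i) @^-1` [set tnth y i]).
  apply/seteqP; split => [x ->//|x h]; apply: eq_from_tnth => i; exact: (h i Logic.I).
 apply: fin_bigcap_measurable => // i _; rewrite -[X in measurable X]setTI.
 by apply: measurable_tnth => //; exact: measurable_set1.
split=> //; apply/eqP; rewrite eq_le measure_ge0 andbT.
apply/lee_addgt0Pr => e e0; rewrite add0e.
pose r := Num.min e 1 / 2.
have r0 : 0 < r by rewrite divr_gt0 // lt_min e0 ltr01.
apply: (@le_trans _ _ (lebesgue_tuple R k (boxset (tnth y) r))).
 apply: le_measure; rewrite ?inE //; first exact: mfun_boxset.
 by move=> x -> i; rewrite subrr normr0.
have -> : lebesgue_tuple R k (boxset (tnth y) r) = ((r *+ 2) ^+ k)%:E.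
 by apply: lebesgue_tuple_boxset; exact: ltW.
rewrite lee_fin.
have -> : r *+ 2 = Num.min e 1 by rewrite -mulr_natr /r divfK.
have m0 : 0 <= Num.min e 1 by rewrite le_min ltW //= ler01.
apply: (@le_trans _ _ (Num.min e 1)); last by rewrite ge_min lexx.
by case: (k) k0 => // k' _; rewrite exprS ler_piMr // exprn_ile1 // ge_min lexx orbT.
Qed.

Lemma ereal_amgm (x y : \bar R) : (0 <= x)%E -> (0 <= y)%E ->
 (2%:E * (x * y) <= x * x + y * y)%E.
case: x => [x| |] //; case: y => [y| |] //.
- by rewrite !lee_fin => x0 y0; have := sqr_ge0 (x - y); nra.
- by move=> _ _; rewrite mulyy addey // leey.
- by move=> _ _; rewrite mulyy addye // leey.
- by move=> _ _; rewrite mulyy addye // leey.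
Qed.

End measurable_continuous.

(** * The noise covariances as bilinear forms *)

Section noise_forms.
Context {R : realType} (k : nat).
Notation mR := (measurableTypeR R).
Notation leb := (@lebesgue_measure R).
Notation Y := (k.-tuple mR).
Notation V := (R * 'rV[R]_k)%type.
Notation lk := (lebesgue_tuple R k).
Implicit Types f g : V -> R.

Definition fmeas f := measurable_fun [set: mR * Y] (fun e => f (e.1, rowt e.2)).

Definition white_kappa (x : mR * Y) : R := (0 <= x.1)%R%:R.
Definition white_p (x : mR * Y) : V := (x.1, rowt x.2).

Lemma mfun_nneg_nat d (T : measurableType d) (f : T -> R) : mfun f ->
 mfun (fun x => (0 <= f x)%R%:R : R).
move=> mf; have -> : (fun x => (0 <= f x)%R%:R : R) = (fun x => if 0 <= f x then 1 else 0).
 by apply/funext => x; case: ifP.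
by apply: mfun_if => //; exact: measurable_fun_ler.
Qed.

(** The covariance is an iterated integral whereas [form] integrates over a product. Tonelli
    identifies the two for nonnegative functions and Fubini for integrable ones; heat kernels use
    the first case, their differences with test functions the second. *)
Lemma white_innerE f g : fmeas f -> fmeas g ->
 nonneg f /\ nonneg g \/
  intg (sprod leb lk) (integrand white_kappa white_p white_p f g) ->
 white_inner f g =
 (\int[(sprod leb lk)]_x (integrand white_kappa white_p white_p f g x)%:E)%E.
move=> mf mg h.
have mI : mfun (fun x => (integrand white_kappa white_p white_p f g x)%:E).
 apply: mEFin; apply: form_measurable => //.
 exact: mfun_nneg_nat.
have -> : white_inner f g =
  (\int[leb]_r \int[lk]_y (integrand white_kappa white_p white_p f g (r, y))%:E)%E.
 rewrite /white_inner integral_mkcond; apply: eq_integral => r _; rewrite patchE /integral_rV.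
 case: ifPn => hr.
  apply: eq_integral => y _; rewrite /integrand /white_kappa /=.
  by move: hr; rewrite inE /= in_itv /= andbT => ->; rewrite mul1r.
 rewrite integral0_eq // => y _; rewrite /integrand /white_kappa /=.
 by move: hr; rewrite notin_setE /= in_itv /= andbT => /negP/negbTE ->; rewrite mul0r.
case: h => [[f0 g0]|hI].
 rewrite int_sprod // => x.
 by rewrite lee_fin /integrand !mulr_ge0.
by rewrite integral_sprod.
Qed.

Definition riesz_kappa (beta : R) (x : mR * (Y * Y)) : R :=
 (0 <= x.1)%R%:R * euclidean_norm (rowt x.2.1 - rowt x.2.2) `^ (- beta).
Definition riesz_p1 (x : mR * (Y * Y)) : V := (x.1, rowt x.2.1).
Definition riesz_p2 (x : mR * (Y * Y)) : V := (x.1, rowt x.2.2).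

Lemma fmeas_riesz f : fmeas f -> form_meas riesz_p1 riesz_p2 f.
move=> mf; split.
 apply: (mcomp mf (f := fun e => f (e.1, rowt e.2)) (g := fun x : mR * (Y * Y) => (x.1, x.2.1))).
 apply: mfun_pair => //.
 exact: (mcomp mfst msnd).
apply: (mcomp mf (f := fun e => f (e.1, rowt e.2)) (g := fun x : mR * (Y * Y) => (x.1, x.2.2))).
apply: mfun_pair => //.
exact: (mcomp msnd msnd).
Qed.

Lemma mfun_rowtB d (T : measurableType d) (g h : T -> Y) i :
 mfun g -> mfun h ->
 mfun (fun x => (rowt (g x) - rowt (h x)) 0 i).
move=> mg mh; under eq_fun do rewrite !mxE.
have h' (u : T -> Y) : mfun u -> mfun (fun x => tnth (u x) i : R).
 by move=> /measurable_fun_tnthP /(_ i).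
exact: (mfunB (h' _ mg) (h' _ mh)).
Qed.

Lemma mfun_riesz_kappa beta : mfun (riesz_kappa beta).
apply: mfunM; first exact: mfun_nneg_nat.
apply: mfun_powRr; apply: mfun_euclidean_norm => i.
apply: mfun_rowtB.
 exact: (mcomp mfst msnd).
exact: (mcomp msnd msnd).
Qed.

Notation lk2 := (sprod lk lk).

Lemma riesz_innerE beta f g : fmeas f -> fmeas g ->
 nonneg f /\ nonneg g \/
  intg (sprod leb lk2) (integrand (riesz_kappa beta) riesz_p1 riesz_p2 f g) ->
 riesz_inner beta f g =
 (\int[(sprod leb lk2)]_x
   (integrand (riesz_kappa beta) riesz_p1 riesz_p2 f g x)%:E)%E.
move=> mf mg h; set I := integrand _ _ _ _ _.
have mI : mfun (fun x => (I x)%:E).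
 apply: mEFin; apply: form_measurable; [exact: mfun_riesz_kappa|exact: fmeas_riesz|exact: fmeas_riesz].
have -> : riesz_inner beta f g = (\int[leb]_r \int[lk]_y \int[lk]_z (I (r, (y, z)))%:E)%E.
 rewrite /riesz_inner integral_mkcond; apply: eq_integral => r _; rewrite patchE /integral_rV.
 case: ifPn => hr.
  apply: eq_integral => y _; apply: eq_integral => z _; rewrite /I /integrand /riesz_kappa /=.
  by move: hr; rewrite inE /= in_itv /= andbT => ->; rewrite mul1r; congr EFin; rewrite /rowt; ring.
 rewrite integral0_eq // => y _; rewrite integral0_eq // => z _.
 rewrite /I /integrand /riesz_kappa /=.
 by move: hr; rewrite notin_setE /= in_itv /= andbT => /negP/negbTE ->; rewrite !mul0r.
have mIr r : mfun (fun yz => (I (r, yz))%:E).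
 by apply: (mcomp mI); exact: mfun_pair.
case: h => [[f0 g0]|hI].
 have I0 x : (0 <= (I x)%:E)%E by rewrite lee_fin /I /integrand !mulr_ge0 ?powR_ge0.
 rewrite int_sprod //; apply: eq_integral => r _.
 by rewrite int_sprod.
rewrite integral_sprod //; apply: ae_eq_integral => //.
- apply: (@mfun_integral_F _ _ _ _ _ lk (fun ry => \int[lk]_z (I (ry.1, (ry.2, z)))%:E)%E).
 apply: (@mfun_integral_F _ _ _ _ _ lk (fun p : (mR * Y) * Y => (I (p.1.1, (p.1.2, p.2)))%:E)).
 apply: (mcomp mI); apply: mfun_pair => //.
  exact: (mcomp mfst mfst).
 apply: mfun_pair => //.
 exact: (mcomp msnd mfst).
- exact: (@mfun_integral_F _ _ _ _ _ lk2 (fun x => (I x)%:E)).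
have := ae_integrable_sprod hI; apply: filterS => r hr _.
by rewrite integral_sprod.
Qed.

End noise_forms.

(** * Features of the Riesz covariance *)

Section riesz_feature.
Context {R : realType} (k : nat) (beta : R).
Notation mR := (measurableTypeR R).
Notation leb := (@lebesgue_measure R).
Notation Y := (k.-tuple mR).
Notation V := (R * 'rV[R]_k)%type.
Notation lk := (lebesgue_tuple R k).
Hypotheses (k0 : (0 < k)%N) (beta0 : 0 < beta) (betak : beta < k%:R).
Notation A := (riesz_time k beta).
Implicit Types f g : V -> R.
Variable c0 : R.
Hypothesis c00 : 0 < c0.
Hypothesis sub : forall u : 'rV[R]_k, u != 0 ->
 (\int[leb]_s (heat_kernel (2 * A s) u)%:E = (c0 * euclidean_norm u `^ (- beta))%:E)%E.
Notation I := (integrand (@riesz_kappa R k beta) (@riesz_p1 R k) (@riesz_p2 R k)).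

Definition riesz_a f (e : mR * (mR * Y)) (y : Y) : R :=
 (0 <= e.1)%R%:R * heat_kernel (A e.2.1) (rowt e.2.2 - rowt y) * f (e.1, rowt y).
(** The feature of f at scale s is its heat smoothing of duration [A s]. Two such smoothings compose
    to duration [2 * A s], and integrating over s gives the Riesz kernel. Values are extended reals,
    so that f need not be integrable. *)
Definition riesz_T f e : \bar R := (\int[lk]_y (riesz_a f e y)%:E)%E.

Lemma riesz_a_ge0 f e y : nonneg f -> 0 <= riesz_a f e y.
by move=> f0; apply: mulr_ge0 => //; apply: mulr_ge0; [exact: ler0n|exact: hker_ge0]. Qed.

Lemma rowt_inj : injective (@rowt R k).
move=> x y /rowP h; apply: eq_from_tnth => i; by have := h i; rewrite !mxE.
Qed.

Lemma mfun_riesz_a d (T : measurableType d) f (a b : T -> mR) (w y : T -> Y) : fmeas f ->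
 mfun a -> mfun b -> mfun w -> mfun y ->
 mfun (fun x => riesz_a f (a x, (b x, w x)) (y x)).
move=> mf ma mb mw my; apply: mfunM; first apply: mfunM.
- exact: mfun_nneg_nat.
- apply: mfun_hk; first exact: (mcomp (mfun_riesz_time k beta) mb).
 by move=> i; exact: mfun_rowtB.
- by apply: (mcomp mf (g := fun x => (a x, y x))); exact: mfun_pair.
Qed.

Lemma mfun_riesz_T f : fmeas f -> nonneg f -> mfun (riesz_T f).
move=> mf f0.
apply: (@mfun_sprod_F _ _ _ _ _ lk (fun p : (mR * (mR * Y)) * Y => (riesz_a f p.1 p.2)%:E)).
 apply: mEFin.
 have -> : (fun p : (mR * (mR * Y)) * Y => riesz_a f p.1 p.2) =
   (fun p => riesz_a f (p.1.1, (p.1.2.1, p.1.2.2)) p.2) by apply/funext => -[[? [? ?]] ?].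
 apply: mfun_riesz_a => //.
 - exact: (mcomp mfst mfst).
 - exact: (mcomp mfst (mcomp msnd mfst)).
 - exact: (mcomp msnd (mcomp msnd mfst)).
by move=> p; rewrite lee_fin riesz_a_ge0.
Qed.

Lemma riesz_T_ge0 f e : nonneg f -> (0 <= riesz_T f e)%E.
by move=> f0; apply: integral_ge0 => y _; rewrite lee_fin riesz_a_ge0. Qed.

Lemma riesz_inner_T_slice f g r : fmeas f -> fmeas g -> nonneg f -> nonneg g ->
 (\int[sprod leb lk]_sw (riesz_T f (r, sw) * riesz_T g (r, sw)) =
  c0%:E * \int[sprod lk lk]_yz (I f g (r, yz))%:E)%E.
move=> mf mg f0 g0.
pose F (p : (mR * Y) * (Y * Y)) : R := riesz_a f (r, p.1) p.2.1 * riesz_a g (r, p.1) p.2.2.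
have F0 p : 0 <= F p by rewrite mulr_ge0 ?riesz_a_ge0.
have ma h (u : (mR * Y) * (Y * Y) -> Y) : fmeas h -> mfun u ->
  mfun (fun p : (mR * Y) * (Y * Y) => riesz_a h (r, p.1) (u p)).
 move=> mh mu_.
 have -> : (fun p : (mR * Y) * (Y * Y) => riesz_a h (r, p.1) (u p)) =
   (fun p => riesz_a h (r, (p.1.1, p.1.2)) (u p)) by apply/funext => -[[? ?] ?].
 apply: mfun_riesz_a => //.
 - exact: (mcomp mfst mfst).
 - exact: (mcomp msnd mfst).
have mF : mfun (fun p => (F p)%:E).
 apply: mEFin; apply: mfunM; apply: ma => //.
 - exact: (mcomp mfst msnd).
 - exact: (mcomp msnd msnd).
have mas h sw : fmeas h -> mfun (fun y : Y => (riesz_a h (r, sw) y)%:E).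
 by case: sw => s w mh; apply: mEFin; apply: (mfun_riesz_a (a := cst r) (b := cst s) (w := cst w) (y := id)).
have pa h sw y : nonneg h -> (0 <= (riesz_a h (r, sw) y)%:E)%E.
 by move=> h0; rewrite lee_fin riesz_a_ge0.
have mIr : mfun (fun yz => (I f g (r, yz))%:E).
 have mI : mfun (fun x => (I f g x)%:E).
  by apply: mEFin; apply: form_measurable; [exact: mfun_riesz_kappa|exact: fmeas_riesz|exact: fmeas_riesz].
 by apply: (mcomp mI); exact: mfun_pair.
have I0 yz : (0 <= (I f g (r, yz))%:E)%E by rewrite lee_fin /integrand !mulr_ge0 ?powR_ge0.
transitivity (\int[sprod leb lk]_sw \int[sprod lk lk]_yz (F (sw, yz))%:E)%E.
 apply: eq_integral => sw _.
 rewrite int_sprod; last 2 first.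
 - by apply: (mcomp mF); exact: mfun_pair.
 - by move=> yz; rewrite lee_fin.
 rewrite -ge0_integralZr //; last 3 first.
 - exact: mas.
 - by move=> y _; exact: pa.
 - exact: riesz_T_ge0.
 apply: eq_integral => y _; rewrite -ge0_integralZl //.
 - exact: mas.
 - by move=> z _; exact: pa.
 - exact: pa.
rewrite (fubini_tonelli (m1 := sprod leb lk) (m2 := sprod lk lk) (fun p => (F p)%:E)) //.
have mG : mfun (fun yz => \int[sprod leb lk]_x (F (x, yz))%:E)%E.
 by apply: (@measurable_fun_fubini_tonelli_G _ _ _ _ _ (sprod leb lk) (fun p => (F p)%:E)) => // p; rewrite lee_fin.
rewrite [LHS]int_sprod //; last by move=> yz; apply: integral_ge0 => x _; rewrite lee_fin.
rewrite -ge0_integralZl //; last by rewrite lee_fin ltW.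
rewrite [RHS]int_sprod //; last 2 first.
- exact: mfunZe.
- by move=> yz; rewrite mule_ge0 // lee_fin ltW.
apply: eq_integral => y _.
have [mset1y null1y] := lebesgue_tuple_set1 y k0.
apply: ae_eq_integral => //.
- by apply: (mcomp mG); exact: mfun_pair.
- by apply: mfunZe; apply: (mcomp mIr); exact: mfun_pair.
(* The subordination formula is available only off the diagonal z = y, which is null because k >
   0. *)
exists [set y]; split => // z /= h; apply: contrapT => zy; apply: h => _.
have yz0 : rowt y - rowt z != 0.
 by rewrite subr_eq0; apply/eqP => /rowt_inj yz; apply: zy.
rewrite int_sprod; last 2 first.
- by apply: (mcomp mF); exact: mfun_pair.
- by move=> x; rewrite lee_fin.
pose C : R := (0 <= r)%R%:R * (f (r, rowt y) * g (r, rowt z)).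
have C0 : 0 <= C by rewrite !mulr_ge0.
transitivity (\int[leb]_s (C%:E * (heat_kernel (2 * A s) (rowt y - rowt z))%:E))%E.
 apply: eq_integral => s _.
 have A0 := riesz_time_gt0 k beta s.
 rewrite (_ : 2 * A s = A s + A s); last by ring.
 rewrite -(heat_semigroup (rowt y) (rowt z) A0 A0) -ge0_integralZl //; last 2 first.
 - apply: mEFin; apply: mfunM; apply: mfun_hk => // i.
  + exact: (mfun_rowtB (g := cst y) (h := id)).
  + exact: (mfun_rowtB (g := id) (h := cst z)).
 - by move=> w _; rewrite lee_fin mulr_ge0 ?hker_ge0.
 apply: eq_integral => w _; rewrite -EFinM; congr EFin; rewrite /F /riesz_a /C /=.
 by rewrite [heat_kernel (A s) (rowt y - rowt w)]heat_kernelC; case: (0 <= r); rewrite /= ?mul0r // !mul1r; ring.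
rewrite ge0_integralZl //; last 2 first.
- by apply: mEFin; apply: mfun_hk => //; apply: mfunM => //; exact: mfun_riesz_time.
- by move=> s _; rewrite lee_fin hker_ge0.
by rewrite sub // -!EFinM; congr EFin; rewrite /C /integrand /riesz_kappa /=; ring.
Qed.

Notation nu := (sprod leb (sprod leb lk)).

Lemma riesz_form_T f g : fmeas f -> fmeas g -> nonneg f -> nonneg g ->
 (\int[nu]_e (riesz_T f e * riesz_T g e) =
  c0%:E * \int[sprod leb (sprod lk lk)]_x (I f g x)%:E)%E.
move=> mf mg f0 g0.
have mI : mfun (fun x => (I f g x)%:E).
 by apply: mEFin; apply: form_measurable; [exact: mfun_riesz_kappa|exact: fmeas_riesz|exact: fmeas_riesz].
have I0 x : (0 <= (I f g x)%:E)%E by rewrite lee_fin /integrand !mulr_ge0 ?powR_ge0.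
rewrite int_sprod; last 2 first.
- by apply: emfunM; exact: mfun_riesz_T.
- by move=> e; rewrite mule_ge0 // riesz_T_ge0.
rewrite [X in (_ = _ * X)%E]int_sprod // -ge0_integralZl //.
- by apply: eq_integral => r _; exact: riesz_inner_T_slice.
- exact: (@mfun_sprod_F _ _ _ _ _ (sprod lk lk) (fun x => (I f g x)%:E)).
- by move=> r _; apply: integral_ge0.
- by rewrite lee_fin ltW.
Qed.

(** Multiplied by c0, all three terms are integrals of products of features, where AM-GM holds
    pointwise. *)
Lemma riesz_form_cs f g : nonneg f -> nonneg g -> fmeas f -> fmeas g ->
 (2%:E * \int[sprod leb (sprod lk lk)]_x (I f g x)%:E <=
  \int[sprod leb (sprod lk lk)]_x (I f f x)%:E + \int[sprod leb (sprod lk lk)]_x (I g g x)%:E)%E.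
move=> f0 g0 mf mg.
have pos h1 h2 : nonneg h1 -> nonneg h2 ->
  (0 <= \int[sprod leb (sprod lk lk)]_x (I h1 h2 x)%:E)%E.
 by move=> h10 h20; apply: integral_ge0 => x _; rewrite lee_fin /integrand !mulr_ge0 ?powR_ge0.
have [mTf mTg] := (mfun_riesz_T mf f0, mfun_riesz_T mg g0).
have [EX [E1 E2]] := (riesz_form_T mf mg f0 g0, (riesz_form_T mf mf f0 f0, riesz_form_T mg mg g0 g0)).
move: EX E1 E2; set X := (\int[_]_x (I f g x)%:E)%E; set Y1 := (\int[_]_x (I f f x)%:E)%E; set Y2 := (\int[_]_x (I g g x)%:E)%E => EX E1 E2.
suff : (c0%:E * (2%:E * X) <= c0%:E * (Y1 + Y2))%E by rewrite lee_pmul2l // lte_fin.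
have [Y10 Y20] : (0 <= Y1)%E /\ (0 <= Y2)%E by split; exact: pos.
have -> : (c0%:E * (2%:E * X) = 2%:E * (c0%:E * X))%E by rewrite !muleA [(2%:E * _)%E]muleC.
have -> : (c0%:E * (Y1 + Y2) = c0%:E * Y1 + c0%:E * Y2)%E by rewrite ge0_muleDr.
rewrite -EX -E1 -E2.
rewrite -ge0_integralZl //; last 2 first.
- exact: emfunM.
- by move=> e _; rewrite mule_ge0 ?riesz_T_ge0.
rewrite -ge0_integralD //; last 4 first.
- by move=> e _; rewrite mule_ge0 ?riesz_T_ge0.
- exact: emfunM.
- by move=> e _; rewrite mule_ge0 ?riesz_T_ge0.
- exact: emfunM.
apply: ge0_le_integral => //.
- by move=> e _; rewrite !mule_ge0 ?riesz_T_ge0.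
- by apply: mfunZe; exact: emfunM.
- by apply: emeasurable_funD; exact: emfunM.
- by move=> e _; apply: ereal_amgm; exact: riesz_T_ge0.
Qed.

Lemma riesz_form_sym f g : nonneg f -> nonneg g -> fmeas f -> fmeas g ->
 (\int[sprod leb (sprod lk lk)]_x (I f g x)%:E = \int[sprod leb (sprod lk lk)]_x (I g f x)%:E)%E.
move=> f0 g0 mf mg.
have := riesz_form_T mg mf g0 f0; under eq_integral do rewrite muleC.
rewrite riesz_form_T // => /(congr1 (fun x => (c0^-1)%:E * x)%E).
by rewrite !muleA -EFinM mulVf ?gt_eqF // !mul1e.
Qed.

(** The Wiener integrand that defines the mild solution at p. *)
Definition hk (p : V) (e : V) : R :=
 if 0 <= e.1 < p.1 then heat_kernel (p.1 - e.1) (p.2 - e.2) else 0.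

Lemma hk_ge0 p e : 0 <= hk p e.
by rewrite /hk; case: ifP => // _; exact: hker_ge0. Qed.

Lemma fmeas_hk p : fmeas (hk p).
rewrite /fmeas /hk /=; apply: mfun_if => //.
 by apply: measurable_and; [exact: measurable_fun_ler|exact: measurable_fun_ltr].
apply: mfun_hk; first exact: mfunB.
by move=> i; under eq_fun do rewrite !mxE; apply: mfunB => //; exact: (mcomp (measurable_tnth i) msnd).
Qed.

(** The semigroup law keeps features of heat kernels explicit: smoothing merely adds [A s] to the
    age. *)
Lemma riesz_T_hk p r s w : riesz_T (hk p) (r, (s, w)) =
 (if 0 <= r < p.1 then heat_kernel (p.1 - r + A s) (p.2 - rowt w) else 0)%:E.
rewrite /riesz_T /riesz_a /hk /=; case: ifPn => [/andP[r0 rp]|h]; last first.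
 by rewrite integral0_eq // => y _; rewrite mulr0.
have A0 := riesz_time_gt0 k beta s; have t0 : 0 < p.1 - r by rewrite subr_gt0.
rewrite -(heat_semigroup p.2 (rowt w) t0 A0); apply: eq_integral => y _; congr EFin.
by rewrite r0 mul1r [heat_kernel (A s) _]heat_kernelC mulrC.
Qed.

End riesz_feature.

(** * Domination of test functions by heat kernels *)

Section test_function_bounds.
Context {R : realType} (k : nat).
Notation V := (R * 'rV[R]_k)%type.

Lemma normr_coord_le (x : 'rV[R]_k) i : `|x 0 i| <= `|x|.
rewrite [leRHS](mx_normrE x).
exact: (@le_bigmax _ _ _ _ (fun ij : 'I_1 * 'I_k => `|x ij.1 ij.2|) (0, i)).
Qed.

Lemma fmeas_test (phi : test_function R k) : fmeas phi.
have [cphi _] := test_fun_smooth phi [::].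
apply: (@mfun_continuous_prod R _ _ k phi (fun e => e.1) (fun e => rowt e.2)) => //.
 exact: mfst.
by move=> i; exact: (mcomp (mfun_rowt i) msnd).
Qed.

(** If the support lies in the ball of radius M, the kernel [hk (M + 1, 0)] has age between 1 and M
    + 1 there at nonnegative times and is bounded below. Finite covariance of test functions then
    follows from that of heat kernels, with no estimate of the noise kernel. *)
Lemma test_dominated (phi : test_function R k) : exists t C, [/\ 0 <= t, 0 <= C &
 forall e : V, 0 <= e.1 -> `|phi e| <= C * hk (t, 0) e].
have [cphi _] := test_fun_smooth phi [::].
pose K := closure [set p | phi p != 0].
have cK : compact K := @test_fun_support _ _ phi.
have [M [M0 HM]] : exists M, 0 <= M /\ forall p, K p -> `|p| <= M.
 have [M [Mr HM]] := compact_bounded cK.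
 exists (`|M| + 1); split; first by rewrite addr_ge0.
 by move=> p Kp; apply: (HM (`|M| + 1)) => //; rewrite (le_lt_trans (ler_norm M)) // ltrDl.
have [B [B0 HB]] : exists B, 0 <= B /\ forall p, K p -> `|phi p| <= B.
 have cphiK : compact (phi @` K) by apply: continuous_compact => //; exact: continuous_subspaceT.
 have [B [Br HB]] := compact_bounded cphiK.
 exists (`|B| + 1); split; first by rewrite addr_ge0.
 move=> p Kp; apply: (HB (`|B| + 1)); first by rewrite (le_lt_trans (ler_norm B)) // ltrDl.
 by exists p.
(* A lower bound of the kernel on the support: largest age M + 1 in the prefactor, smallest age 1 in
   the exponent. *)
pose c : R := (4 * pi * (M + 1)) `^ (- (k%:R / 2)) * expR (- (k%:R * M ^+ 2 / 4)).
have c0 : 0 < c by rewrite mulr_gt0 ?expR_gt0 // powR_gt0 // !mulr_gt0 ?pi_gt0 // ltr_wpDl.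
exists (M + 1), (B / c); split; first by rewrite addr_ge0.
 by rewrite divr_ge0 // ltW.
move=> e e0; have [->|pe] := eqVneq (phi e) 0.
 by rewrite normr0 mulr_ge0 ?hk_ge0 // divr_ge0 // ltW.
have Ke : K e by apply: subset_closure.
have [h1 h2] : `|e.1| <= M /\ `|e.2| <= M.
 by have := HM _ Ke; rewrite {1}/Num.norm /= ge_max => /andP.
have e1M : e.1 <= M by rewrite (le_trans (ler_norm _)).
apply: (le_trans (HB _ Ke)); rewrite -[leLHS](divfK (lt0r_neq0 c0)).
apply: ler_wpM2l; first by rewrite divr_ge0 // ltW.
rewrite /hk /= e0 /= (_ : e.1 < M + 1); last by rewrite (le_lt_trans e1M) // ltrDl.
rewrite /heat_kernel; set tau := M + 1 - e.1.
have tau1 : 1 <= tau by rewrite /tau; lra.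
have tauM : tau <= M + 1 by rewrite /tau; lra.
have tau0 : 0 < tau by lra.
rewrite /c; apply: ler_pM; rewrite ?powR_ge0 ?expR_ge0 //.
 rewrite !powRN lef_pV2 ?posrE ?powR_gt0 ?mulr_gt0 ?pi_gt0 //; last lra.
 apply: ge0_ler_powR; rewrite ?nnegrE ?divr_ge0 ?mulr_ge0 ?pi_ge0 ?(ltW tau0) ?addr_ge0 //.
 by apply: ler_wpM2l => //; rewrite mulr_ge0 ?pi_ge0.
rewrite ler_expR lerN2 sqr_norm.
have hs : \sum_(i < k) (0 - e.2) 0 i ^+ 2 <= k%:R * M ^+ 2.
 apply: (@le_trans _ _ (\sum_(i < k) M ^+ 2)); last by rewrite sumr_const card_ord mulr_natl.
 apply: ler_sum => i _; rewrite !mxE sub0r sqrrN -[leLHS]real_normK ?num_real //.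
 rewrite lerXn2r ?nnegrE //; apply: le_trans h2.
 exact: normr_coord_le.
rewrite ler_pdivrMr ?mulr_gt0 //; apply: (le_trans hs).
rewrite (_ : k%:R * M ^+ 2 / 4 * (4 * tau) = k%:R * M ^+ 2 * tau); last by field.
by rewrite ler_peMr // mulr_ge0 // sqr_ge0.
Qed.
End test_function_bounds.

(** * A common model of both noises *)

Section feature_model.
Context {R : realType}.
Notation mR := (measurableTypeR R).
Notation leb := (@lebesgue_measure R).

Definition feature_mu k (mu : {sigma_finite_measure set mR -> \bar R}) :
 {measure set (mR * (mR * k.-tuple mR))%type -> \bar R} :=
 sprod leb (sprod mu (lebesgue_tuple R k)).

Definition feature k (A : mR -> R) (kap : R) (p : R * 'rV[R]_k) (e : mR * (mR * k.-tuple mR)) : R :=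
 if 0 <= e.1 < p.1 then kap * heat_kernel (p.1 - e.1 + A e.2.1) (p.2 - rowt e.2.2) else 0.

(** This finiteness is a clause of being a Wiener integral, so any mild solution with at least one
    component supplies it. *)
Definition kernels_finite k beta := forall p : R * 'rV[R]_k, 0 <= p.1 ->
 (noise_inner beta (fun e => `|hk p e|)%R (fun e => `|hk p e|)%R < +oo)%E.

(** Space-time white noise takes a Dirac mass for [fm_mu] and 0 for [fm_A]; Riesz noise takes
    Lebesgue measure and [riesz_time]. [fm_scale] carries the self-similarity from which the
    exponents in beta come, and [fm_mass] makes the cut-off [fm_A <= rho] in the ramps a set of
    positive finite measure. *)
Record feature_model (k : nat) (beta : R) := FeatureModel {
 fm_mu : {sigma_finite_measure set mR -> \bar R};
 fm_A : mR -> R;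
 fm_kap : R;
 fm_kap0 : 0 < fm_kap;
 fm_measurable : mfun fm_A;
 fm_A0 : forall s, 0 <= fm_A s;
 fm_scale : forall (lam : R) (f : R -> \bar R), 0 < lam -> mfun f ->
  (forall x, 0 <= f x)%E ->
  (\int[fm_mu]_s f (lam * fm_A s)%R =
   (lam `^ (- ((k%:R - beta) / 2)))%:E * \int[fm_mu]_s f (fm_A s))%E;
 fm_mass : (0 < fm_mu [set s | (fm_A s <= 1)%R] < +oo)%E;
 fm_intg : kernels_finite k beta -> forall p q : R * 'rV[R]_k, 0 <= p.1 -> 0 <= q.1 ->
  intg (feature_mu k fm_mu) (fun e => feature fm_A fm_kap p e * feature fm_A fm_kap q e);
 fm_cvg : kernels_finite k beta ->
  forall (p q : R * 'rV[R]_k) (phi psi : nat -> test_function R k), 0 <= p.1 -> 0 <= q.1 ->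
  (noise_inner beta (fun e => phi n e - hk p e) (fun e => phi n e - hk p e))%R
   @[n --> \oo] --> 0%E ->
  (noise_inner beta (fun e => psi n e - hk q e) (fun e => psi n e - hk q e))%R
   @[n --> \oo] --> 0%E ->
  (forall n, noise_inner beta (phi n) (psi n) \is a fin_num) /\
  fine (noise_inner beta (phi n) (psi n)) @[n --> \oo] -->
   (\int[feature_mu k fm_mu]_e (feature fm_A fm_kap p e * feature fm_A fm_kap q e))%R
}.

End feature_model.

(** * From a bilinear form to a feature model *)

Section feature_model_from_form.
Context {R : realType} (k : nat) (beta : R).
Notation mR := (measurableTypeR R).
Notation V := (R * 'rV[R]_k)%type.
Context d (X : measurableType d) (mu : {measure set X -> \bar R}).
Variables (kappa : X -> R) (p1 p2 : X -> V) (m : {sigma_finite_measure set mR -> \bar R}).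
Variables (A : mR -> R) (kap : R).
Notation I := (integrand kappa p1 p2).
Hypotheses (mkappa : mfun kappa) (kappa0 : nonneg kappa).
Hypothesis kappa_neg : forall f g, (forall e : V, 0 <= e.1 -> `|f e| <= `|g e|) ->
 forall x, `|I f f x| <= `|I g g x|.
Hypothesis fmeasE : forall f, fmeas f <-> form_meas p1 p2 f.
Hypothesis innerE : forall f g, fmeas f -> fmeas g ->
 nonneg f /\ nonneg g \/ intg mu (I f g) ->
 noise_inner beta f g = (\int[mu]_x (I f g x)%:E)%E.
Hypothesis sym0 : forall f g : V -> R, nonneg f -> nonneg g ->
 form_meas p1 p2 f -> form_meas p1 p2 g -> (\int[mu]_x (I f g x)%:E = \int[mu]_x (I g f x)%:E)%E.
Hypothesis cs0 : forall f g : V -> R, nonneg f -> nonneg g ->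
 form_meas p1 p2 f -> form_meas p1 p2 g ->
 (2%:E * \int[mu]_x (I f g x)%:E <= \int[mu]_x (I f f x)%:E + \int[mu]_x (I g g x)%:E)%E.
Hypothesis mfeat : forall p : V, mfun (feature A kap p).
Hypothesis featE : forall p q : V,
 (\int[feature_mu k m]_e (feature A kap p e * feature A kap q e)%:E =
  \int[mu]_x (I (hk p) (hk q) x)%:E)%E.
Hypotheses (feat0 : forall p e, 0 <= feature (k := k) A kap p e) (fin : kernels_finite k beta).

Notation dom := (form_dom mu kappa p1 p2).
Notation fm := (form mu kappa p1 p2).

Lemma hk_dom (p : V) : 0 <= p.1 -> dom (hk p).
move=> p0; split; first by apply/fmeasE; exact: fmeas_hk.
apply: intg_ge0P.
- by apply: form_measurable => //; apply/fmeasE; exact: fmeas_hk.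
- by move=> x; rewrite /integrand !mulr_ge0 ?hk_ge0.
have := fin p0.
have -> : (fun e => `|hk p e|) = hk p by apply/funext => e; rewrite ger0_norm ?hk_ge0.
by rewrite innerE //; [exact: fmeas_hk|exact: fmeas_hk|left; split => e; exact: hk_ge0].
Qed.

Lemma test_dom (phi : test_function R k) : dom phi.
have [t [C [t0 C0 H]]] := test_dominated phi.
have hC := form_dom_lin mkappa kappa0 cs0 C 0 (@hk_dom (t, 0) t0) (@hk_dom (t, 0) t0).
have mphi : form_meas p1 p2 phi by apply/fmeasE; exact: fmeas_test.
split => //; apply: (intg_le _ _ hC.2); first exact: form_measurable.
apply: kappa_neg => e e0; rewrite mul0r addr0 [leRHS]ger0_norm ?mulr_ge0 ?hk_ge0 //.
exact: H.
Qed.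

Lemma inner_dom f g : dom f -> dom g -> noise_inner beta f g = (fm f g)%:E.
move=> hf hg; have hI := form_intg mkappa kappa0 cs0 hf hg.
rewrite innerE ?EFin_Rint //; first by apply/fmeasE; case: hf.
- by apply/fmeasE; case: hg.
- by right.
Qed.

Lemma feature_intg (p q : V) : 0 <= p.1 -> 0 <= q.1 ->
 intg (feature_mu k m) (fun e => feature A kap p e * feature A kap q e).
move=> p0 q0; apply: intg_ge0P.
- exact: mfunM.
- by move=> e; rewrite mulr_ge0.
rewrite featE; apply: intg_lty.
 by apply: (form_intg mkappa kappa0 cs0); exact: hk_dom.
by move=> x; rewrite /integrand !mulr_ge0 ?hk_ge0.
Qed.

(** The covariances of approximating test functions converge to the form of two heat kernels by
    [form_cvg], and [featE] rewrites that form as an inner product of features. *)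
Lemma feature_cvg (p q : V) (phi psi : nat -> test_function R k) : 0 <= p.1 -> 0 <= q.1 ->
 (noise_inner beta (fun e => phi n e - hk p e) (fun e => phi n e - hk p e))%R
  @[n --> \oo] --> 0%E ->
 (noise_inner beta (fun e => psi n e - hk q e) (fun e => psi n e - hk q e))%R
  @[n --> \oo] --> 0%E ->
 (forall n, noise_inner beta (phi n) (psi n) \is a fin_num) /\
 fine (noise_inner beta (phi n) (psi n)) @[n --> \oo] -->
  (\int[feature_mu k m]_e (feature A kap p e * feature A kap q e))%R.
move=> p0 q0 c1 c2.
have [hp hq] := (hk_dom p0, hk_dom q0).
have dB (f g : V -> R) : dom f -> dom g -> dom (fun e => f e - g e).
 move=> hf hg; have := form_dom_lin mkappa kappa0 cs0 1 (-1) hf hg.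
 by congr form_dom; apply/funext => e; rewrite mul1r mulN1r.
split; first by move=> n; rewrite inner_dom //; exact: test_dom.
have cv (x : V) (f : nat -> test_function R k) : dom (hk x) ->
  (noise_inner beta (fun e => f n e - hk x e) (fun e => f n e - hk x e))%R
   @[n --> \oo] --> 0%E ->
  fm (fun e => f n e - hk x e) (fun e => f n e - hk x e) @[n --> \oo] --> (0 : R).
 move=> hx /fine_cvgP[_ c].
 apply: cvg_trans c; apply: near_eq_cvg; near=> n; rewrite /= inner_dom //; exact: dB (test_dom _) hx.
have := form_cvg mkappa kappa0 sym0 cs0 (fun n => test_dom (phi n)) (fun n => test_dom (psi n)) hp hq (cv _ _ hp c1) (cv _ _ hq c2).
have -> : fm (hk p) (hk q) = (\int[feature_mu k m]_e (feature A kap p e * feature A kap q e))%R.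
 by rewrite /form /Rintegral featE.
apply: cvg_trans; apply: near_eq_cvg; near=> n.
by rewrite inner_dom //; exact: test_dom.
Unshelve. all: by end_near. Qed.

End feature_model_from_form.

(** * The white-noise and Riesz instances *)

Section feature_model_exists.
Context {R : realType}.
Notation mR := (measurableTypeR R).
Notation leb := (@lebesgue_measure R).

Lemma mfun_feature k (A : mR -> R) (kap : R) (p : R * 'rV[R]_k) :
 mfun A -> mfun (feature A kap p).
move=> mA; rewrite /feature; apply: mfun_if => //.
 by apply: measurable_and; [exact: measurable_fun_ler|exact: measurable_fun_ltr].
apply: mfunM => //; apply: mfun_hk.
 apply: mfunD; first exact: mfunB.
 exact: (mcomp mA (mcomp mfst msnd)).
move=> i; under eq_fun do rewrite !mxE.
apply: mfunB => //.
exact: (mcomp (measurable_tnth i) (mcomp msnd msnd)).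
Qed.

Lemma feature_ge0 k (A : mR -> R) (kap : R) (p : R * 'rV[R]_k) e : 0 <= kap ->
 0 <= feature A kap p e.
by move=> k0; rewrite /feature; case: ifP => // _; rewrite mulr_ge0 ?hker_ge0. Qed.

(** With a Dirac mass at 0 and A = 0 the features are the heat kernels themselves. Since k = beta =
    1, the scaling exponent is 0. *)
Lemma white_model : inhabited (@feature_model R 1 1).
pose m : {sigma_finite_measure set mR -> \bar R} := \d_(0 : mR).
pose A : mR -> R := cst 0.
have mA : mfun A by exact: measurable_cst.
pose kap := @white_kappa R 1; pose p1 := @white_p R 1.
have mk : mfun kap by exact: mfun_nneg_nat.
have kap0 x : 0 <= kap x by rewrite /kap /white_kappa.
have mf p : mfun (feature A 1 p) := mfun_feature 1 p mA.
have f0 p e : 0 <= feature (k := 1) A 1 p e by exact: feature_ge0.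
have kneg (f g : R * 'rV[R]_1 -> R) : (forall e, 0 <= e.1 -> `|f e| <= `|g e|) ->
  forall x, `|integrand kap p1 p1 f f x| <= `|integrand kap p1 p1 g g x|.
 move=> fg x; rewrite /integrand /kap /white_kappa.
 case: (boolP ((0 : R) <= x.1)) => h; rewrite /= ?mul0r // !mul1r !normrM.
 by apply: ler_pM => //; exact: fg.
have mE f : fmeas f <-> form_meas p1 p1 f by split=> [h|[h _]].
have iE (f g : R * 'rV[R]_1 -> R) : fmeas f -> fmeas g ->
  nonneg f /\ nonneg g \/ intg (sprod leb (lebesgue_tuple R 1)) (integrand kap p1 p1 f g) ->
  noise_inner 1 f g = (\int[sprod leb (lebesgue_tuple R 1)]_x (integrand kap p1 p1 f g x)%:E)%E.
 by move=> *; rewrite /noise_inner !eqxx; exact: white_innerE.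
have sy (f g : R * 'rV[R]_1 -> R) : (\int[sprod leb (lebesgue_tuple R 1)]_x (integrand kap p1 p1 f g x)%:E =
  \int[sprod leb (lebesgue_tuple R 1)]_x (integrand kap p1 p1 g f x)%:E)%E.
 by apply: eq_integral => x _; rewrite /integrand [X in _ * X]mulrC.
have cs (f g : R * 'rV[R]_1 -> R) : nonneg f -> nonneg g ->
 form_meas p1 p1 f -> form_meas p1 p1 g ->
 (2%:E * \int[sprod leb (lebesgue_tuple R 1)]_x (integrand kap p1 p1 f g x)%:E <=
  \int[sprod leb (lebesgue_tuple R 1)]_x (integrand kap p1 p1 f f x)%:E +
  \int[sprod leb (lebesgue_tuple R 1)]_x (integrand kap p1 p1 g g x)%:E)%E.
 move=> fp gp mf_ mg_.
 have mI u v : form_meas p1 p1 u -> form_meas p1 p1 v ->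
   mfun (fun x => (integrand kap p1 p1 u v x)%:E).
  by move=> mu_ mv; apply: mEFin; exact: form_measurable.
 have I0 u v x : nonneg u -> nonneg v -> (0 <= (integrand kap p1 p1 u v x)%:E)%E.
  by move=> u0 v0; rewrite lee_fin /integrand !mulr_ge0.
 rewrite -ge0_integralZl //; [|exact: mI|by move=> x _; exact: I0].
 rewrite -ge0_integralD //; [|by move=> x _; exact: I0|exact: mI|by move=> x _; exact: I0|exact: mI].
 apply: ge0_le_integral => //.
 - by move=> x _; rewrite mule_ge0 ?I0.
 - by apply: mfunZe; exact: mI.
 - by apply: emeasurable_funD; exact: mI.
 move=> x _; rewrite -EFinM -EFinD lee_fin /integrand.
 have := kap0 x; set a := f _; set b := g _ => k0.
 by have := mulr_ge0 k0 (sqr_ge0 (a - b)); nra.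
have fE (p q : R * 'rV[R]_1) :
 (\int[feature_mu 1 m]_e (feature A 1 p e * feature A 1 q e)%:E =
  \int[sprod leb (lebesgue_tuple R 1)]_x (integrand kap p1 p1 (hk p) (hk q) x)%:E)%E.
 have mI : mfun (fun x => (integrand kap p1 p1 (hk p) (hk q) x)%:E).
  by apply: mEFin; apply: form_measurable => //; apply/mE; exact: fmeas_hk.
 have mff : mfun (fun e => (feature A 1 p e * feature A 1 q e)%:E).
  by apply: mEFin; apply: mfunM; apply: mfun_feature.
 rewrite /feature_mu [LHS]int_sprod //; last by move=> e; rewrite lee_fin mulr_ge0.
 rewrite int_sprod //; last by move=> x; rewrite lee_fin /integrand !mulr_ge0 ?hk_ge0.
 apply: eq_integral => r _; rewrite int_sprod //; last 2 first.
 - by apply: (mcomp mff); exact: mfun_pair.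
 - by move=> e; rewrite lee_fin mulr_ge0.
 have mS : mfun (fun s => \int[lebesgue_tuple R 1]_w (feature A 1 p (r, (s, w)) * feature A 1 q (r, (s, w)))%:E)%E.
  apply: (@mfun_sprod_F _ _ _ _ _ (lebesgue_tuple R 1) (fun sw => (feature A 1 p (r, sw) * feature A 1 q (r, sw))%:E)).
   by apply: (mcomp mff); exact: mfun_pair.
  by move=> sw; rewrite lee_fin mulr_ge0.
 rewrite (integral_dirac (0 : mR) measurableT mS) diracT mul1e.
 apply: eq_integral => w _; congr EFin; rewrite /feature /integrand /hk /kap /white_kappa /A /= !mul1r !addr0.
 by case: (leP 0 r) => r0 /=; rewrite ?mul0r // mul1r.
constructor; apply: (@FeatureModel R 1 1 m A 1) => //.
- move=> lam f lam0 mf_ f0_; rewrite subrr mul0r oppr0 powRr0 mul1e.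
 by apply: eq_integral => s _; rewrite /A mulr0.
- have -> : [set s | A s <= 1] = setT by apply/seteqP; split => // s _; rewrite /A /= ler01.
 by rewrite /m /= diracT lte01 ltry.
- move=> fin p q p0 q0.
 by apply: (@feature_intg R 1 1 _ _ _ kap p1 p1 m A 1) => //.
- move=> fin p q phi psi p0 q0 c1 c2.
 exact: (@feature_cvg R 1 1 _ _ (sprod leb (lebesgue_tuple R 1)) kap p1 p1 m A 1 mk kap0 kneg mE iE (fun f g _ _ _ _ => sy f g) cs fE fin p q phi psi p0 q0 c1 c2).
Qed.

(** The prefactor c is c0^(-1/2): the product of two features then absorbs the constant of the
    subordination formula. *)
Lemma riesz_model k beta : (0 < k)%N -> 0 < beta -> beta < k%:R ->
 (k == 1%N) && (beta == 1) = false -> inhabited (@feature_model R k beta).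
move=> k0 beta0 betak notw.
have [c0 c00 sub] := riesz_subordination k0 beta0 betak.
pose A := @riesz_time R k beta.
have mA : mfun A := mfun_riesz_time k beta.
pose c := Num.sqrt c0^-1.
have cpos : 0 < c by rewrite sqrtr_gt0 invr_gt0.
pose kap := @riesz_kappa R k beta; pose p1 := @riesz_p1 R k; pose p2 := @riesz_p2 R k.
have mk : mfun kap by exact: mfun_riesz_kappa.
have kap0 x : 0 <= kap x by rewrite /kap /riesz_kappa mulr_ge0 // powR_ge0.
have mf p : mfun (feature A c p) := mfun_feature c p mA.
have f0 p e : 0 <= feature (k := k) A c p e by apply: feature_ge0; exact: ltW.
have kneg (f g : R * 'rV[R]_k -> R) : (forall e, 0 <= e.1 -> `|f e| <= `|g e|) ->
  forall x, `|integrand kap p1 p2 f f x| <= `|integrand kap p1 p2 g g x|.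
 move=> fg x; rewrite /integrand /kap /riesz_kappa.
 case: (boolP ((0 : R) <= x.1)) => h; rewrite /= ?mul0r // !mul1r !normrM.
 by apply: ler_wpM2l => //; apply: ler_pM => //; exact: fg.
have mE f : fmeas f <-> form_meas p1 p2 f.
 split=> [h|[h _]]; first exact: fmeas_riesz.
 by apply: (mcomp h (g := fun e : mR * k.-tuple mR => (e.1, (e.2, e.2)))); do 2 apply: mfun_pair => //.
pose X := sprod leb (sprod (lebesgue_tuple R k) (lebesgue_tuple R k)).
have iE (f g : R * 'rV[R]_k -> R) : fmeas f -> fmeas g ->
  nonneg f /\ nonneg g \/ intg X (integrand kap p1 p2 f g) ->
  noise_inner beta f g = (\int[X]_x (integrand kap p1 p2 f g x)%:E)%E.
 by move=> *; rewrite /noise_inner notw; exact: riesz_innerE.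
have sy (f g : R * 'rV[R]_k -> R) : nonneg f -> nonneg g ->
 form_meas p1 p2 f -> form_meas p1 p2 g ->
 (\int[X]_x (integrand kap p1 p2 f g x)%:E = \int[X]_x (integrand kap p1 p2 g f x)%:E)%E.
 by move=> fp gp /mE mf_ /mE mg_; exact: (riesz_form_sym k0 c00 sub).
have cs (f g : R * 'rV[R]_k -> R) : nonneg f -> nonneg g ->
 form_meas p1 p2 f -> form_meas p1 p2 g ->
 (2%:E * \int[X]_x (integrand kap p1 p2 f g x)%:E <=
  \int[X]_x (integrand kap p1 p2 f f x)%:E + \int[X]_x (integrand kap p1 p2 g g x)%:E)%E.
 by move=> fp gp /mE mf_ /mE mg_; exact: (riesz_form_cs k0 c00 sub).
have fE (p q : R * 'rV[R]_k) :
 (\int[feature_mu k leb]_e (feature A c p e * feature A c q e)%:E =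
  \int[X]_x (integrand kap p1 p2 (hk p) (hk q) x)%:E)%E.
 have H := riesz_form_T k0 c00 sub (fmeas_hk p) (fmeas_hk q) (hk_ge0 p) (hk_ge0 q).
 have -> : (\int[X]_x (integrand kap p1 p2 (hk p) (hk q) x)%:E = (c0^-1)%:E *
   (c0%:E * \int[X]_x (integrand kap p1 p2 (hk p) (hk q) x)%:E))%E.
  by rewrite muleA -EFinM mulVf ?mul1e // gt_eqF.
 rewrite -H -ge0_integralZl //; last 3 first.
 - by apply: emfunM; apply: mfun_riesz_T => //; exact: fmeas_hk || exact: hk_ge0.
 - by move=> e _; rewrite mule_ge0 ?riesz_T_ge0 //; exact: hk_ge0.
 - by rewrite lee_fin invr_ge0 ltW.
 apply: eq_integral => -[r [s w]] _; rewrite !riesz_T_hk // -!EFinM; congr EFin.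
 rewrite /feature /=; case: ifP => _; rewrite ?mul0r ?mulr0 //.
 case: ifP => _; rewrite ?mul0r ?mulr0 //.
 rewrite mulrACA; congr (_ * _).
 by rewrite -expr2 sqr_sqrtr // invr_ge0 ltW.
constructor; apply: (@FeatureModel R k beta leb A c) => //.
- by move=> s; exact/ltW/riesz_time_gt0.
- by move=> lam f lam0 mf_ f0_; exact: riesz_time_scale.
- have th : 0 < ((k%:R - beta) / 2)^-1 by rewrite invr_gt0 divr_gt0 // subr_gt0.
 have -> : [set s | A s <= 1] = `[(-1)%R, 1%R]%classic.
  apply/seteqP; split => s; rewrite /= in_itv /= -ler_norml /A /riesz_time.
   have [->|s0] := eqVneq s 0; first by rewrite normr0.
   move=> h; rewrite leNgt; apply/negP => s1.
   move: h; rewrite leNgt => /negP; apply; rewrite -[ltLHS](powR1r ((k%:R - beta) / 2)^-1).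
   by apply: gt0_ltr_powR; rewrite ?nnegrE.
  have [->|s0 s1] := eqVneq s 0; first by rewrite lexx.
  rewrite -[leRHS](powR1r ((k%:R - beta) / 2)^-1); apply: ge0_ler_powR; rewrite ?nnegrE //; exact: ltW.
 have := lebesgue_measure_itv `[(-1)%R, 1%R] => /= h; rewrite [X in (_ < X < _)%E]h.
 have l1 : (-1 : R) < 1 by rewrite (lt_trans (ltrN10 R)).
 by rewrite lte_fin l1 -EFinB ltry andbT lte_fin subr_gt0.
- move=> fin p q p0 q0.
 by apply: (@feature_intg R k beta _ _ X kap p1 p2 leb A c) => //.
- move=> fin p q phi psi p0 q0 c1 c2.
 exact: (@feature_cvg R k beta _ _ X kap p1 p2 leb A c mk kap0 kneg mE iE sy cs fE fin p q phi psi p0 q0 c1 c2).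
Qed.

End feature_model_exists.

(** * Integration against a density *)

Section density.
Context d (T : measurableType d) {R : realType} (mu m : {measure set T -> \bar R}).
Variable g : T -> R.
Hypotheses (mg : mfun g) (g0 : nonneg g)
 (mE : forall A, measurable A -> m A = (\int[mu]_(x in A) (g x)%:E)%E).

Let densityI A : measurable A ->
 (\int[m]_x (\1_A x)%:E = \int[mu]_x ((g x)%:E * (\1_A x)%:E))%E.
move=> mA; rewrite integral_indic // setIT mE // integral_mkcond.
apply: eq_integral => x _; rewrite patchE indicE.
by case: (x \in A); rewrite ?mule1 ?mule0.
Qed.

Import HBNNSimple.

Let nnsfunE (f : {nnsfun T >-> R}) :
 (\int[m]_x (f x)%:E = \int[mu]_x ((g x)%:E * (f x)%:E))%E.
under [LHS]eq_integral do rewrite fimfunE -fsumEFin//.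
rewrite [LHS]ge0_integral_fsum//; last 2 first.
 - by move=> r; exact/measurable_EFinP/mcomp.
 - by move=> n x _; rewrite EFinM nnfun_muleindic_ge0.
under [RHS]eq_integral.
 move=> x xD; rewrite fimfunE -fsumEFin// ge0_mule_fsumr; last first.
  by move=> r; rewrite EFinM nnfun_muleindic_ge0.
 over.
rewrite [RHS]ge0_integral_fsum//; last 2 first.
 - by move=> r; apply: emfunM; [exact: mEFin|apply: mEFin; exact: mcomp].
 - by move=> n x _; apply: mule_ge0; [rewrite lee_fin|rewrite EFinM nnfun_muleindic_ge0].
apply: eq_fsbigr => r _; rewrite integralZl_indic_nnsfun // densityI //.
transitivity (\int[mu]_x (r%:E * ((g x)%:E * (\1_(f @^-1` [set r]) x)%:E)))%E; last first.
 by apply: eq_integral => x _; rewrite EFinM muleCA.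
have [r0|r0] := leP 0 r.
 rewrite ge0_integralZl //.
 - by apply: emfunM; exact: mEFin.
 - by move=> x _; rewrite mule_ge0 // lee_fin.
rewrite preimage_nnfun0 //.
rewrite [X in (_ * X)%E]integral0_eq ?mule0; last by move=> x _; rewrite indic0 mule0.
by rewrite integral0_eq // => x _; rewrite indic0 !mule0.
Qed.

Lemma int_density (f : T -> \bar R) :
 mfun f -> (forall x, 0 <= f x)%E ->
 (\int[m]_x f x = \int[mu]_x ((g x)%:E * f x))%E.
move=> mf f0; pose f_ := nnsfun_approx measurableT mf.
transitivity (limn (fun n => \int[m]_x (f_ n x)%:E)%E).
 rewrite -monotone_convergence//=.
 - apply: eq_integral => x _; apply/esym/cvg_lim => //=.
  exact: cvg_nnsfun_approx.
 - by move=> n; exact/measurable_EFinP/measurable_funTS.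
 - by move=> n x _; rewrite lee_fin.
 - by move=> x _ a b ab; rewrite lee_fin; exact/lefP/nd_nnsfun_approx.
under eq_fun do rewrite nnsfunE.
rewrite -monotone_convergence//=.
- apply: eq_integral => x _; apply/cvg_lim => //=; apply: cvgeZl => //.
 exact: cvg_nnsfun_approx.
- by move=> n; apply: emfunM; [exact: mEFin|exact/measurable_EFinP/measurable_funTS].
- by move=> n x _; rewrite mule_ge0 ?lee_fin.
- move=> x _ a b ab; rewrite -!EFinM lee_fin ler_wpM2l //; exact/lefP/nd_nnsfun_approx.
Qed.

End density.

(** * Taylor bounds for sine and cosine *)

Section cosine_bounds.
Context {R : realType}.

(** Each Taylor bound below has the preceding one as its derivative and follows by this mean value
    argument. *)
Lemma ge0_from_derive (f df : R -> R) : (forall x : R, is_derive x (1 : R) f (df x)) ->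
 (forall x, 0 <= x -> 0 <= df x) -> f 0 = 0 -> forall x, 0 <= x -> 0 <= f x.
move=> fd df0 f00 x x0.
have cf : {within `[0, x], continuous f}.
 apply: continuous_subspaceT => y; apply: differentiable_continuous; apply/derivable1_diffP.
 by have [] := fd y.
have [c] := @MVT_segment R f df 0 x x0 (fun y _ => fd y) cf.
rewrite f00 !subr0 in_itv /= => /andP[c0 _] ->.
by rewrite mulr_ge0 // df0.
Qed.

Lemma sin_le_id (x : R) : 0 <= x -> sin x <= x.
move=> x0; rewrite -subr_ge0.
have d y : is_derive y (1 : R) (fun y => y - sin y) (1 - cos y) by apply: is_derive_eq.
by apply: (ge0_from_derive d) => //; rewrite ?sin0 ?subr0 // => y _; rewrite subr_ge0 cos_le1.
Qed.

Lemma cos_ge_taylor2 (x : R) : 1 - x ^+ 2 / 2 <= cos x.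
wlog x0 : x / 0 <= x.
 move=> h; have [|x0] := leP 0 x; first exact: h.
 by have := h (- x); rewrite sqrrN cosN; apply; rewrite oppr_ge0 ltW.
suff : 0 <= cos x - (1 - x ^+ 2 / 2) by rewrite subr_ge0.
have d y : is_derive y (1 : R) (fun y => cos y - (1 - y ^+ 2 / 2)) (y - sin y).
 by apply: is_derive_eq; rewrite /GRing.scale /=; lra.
apply: (ge0_from_derive d) => //.
- by move=> y y0; rewrite subr_ge0 sin_le_id.
- by rewrite /= cos0 expr0n /= mul0r subr0 subrr.
Qed.

Lemma sin_ge_taylor3 (x : R) : 0 <= x -> x - x ^+ 3 / 6 <= sin x.
move=> x0; suff : 0 <= sin x - (x - x ^+ 3 / 6) by rewrite subr_ge0.
have d y : is_derive y (1 : R) (fun y => sin y - (y - y ^+ 3 / 6)) (cos y - (1 - y ^+ 2 / 2)).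
 by apply: is_derive_eq; rewrite /GRing.scale /=; lra.
apply: (ge0_from_derive d) => //.
- by move=> y _; rewrite subr_ge0 cos_ge_taylor2.
- by rewrite /= sin0 expr0n /= mul0r !subr0.
Qed.

Lemma cos_le_taylor4 (x : R) : cos x <= 1 - x ^+ 2 / 2 + x ^+ 4 / 24.
wlog x0 : x / 0 <= x.
 move=> h; have [|x0] := leP 0 x; first exact: h.
 have := h (- x); rewrite sqrrN cosN (_ : (- x) ^+ 4 = x ^+ 4); last by ring.
 by apply; rewrite oppr_ge0 ltW.
suff : 0 <= 1 - x ^+ 2 / 2 + x ^+ 4 / 24 - cos x by rewrite subr_ge0.
have d y : is_derive y (1 : R) (fun y => 1 - y ^+ 2 / 2 + y ^+ 4 / 24 - cos y) (sin y - (y - y ^+ 3 / 6)).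
 by apply: is_derive_eq; rewrite /GRing.scale /=; lra.
apply: (ge0_from_derive d) => //.
- by move=> y y0; rewrite subr_ge0 sin_ge_taylor3.
- by rewrite /= cos0 !expr0n /= !mul0r subr0 addr0 subrr.
Qed.

Lemma cos_lip (x y : R) : `|cos x - cos y| <= `|x - y|.
wlog xy : x y / y <= x.
 move=> h; have [|/ltW] := leP y x; first exact: h.
 by move=> /h; rewrite distrC [leRHS]distrC.
have cc : {within `[y, x], continuous cos}.
 by apply: continuous_subspaceT => z; exact: continuous_cos.
have [c _ ->] := @MVT_segment R cos (fun y => - sin y) y x xy (fun z _ => is_derive_cos z) cc.
rewrite normrM normrN ler_piMl // ler_norml sin_le1 andbT.
exact: sin_geN1.
Qed.

End cosine_bounds.

(** * Real integrals over a probability space *)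

Section finite_integrals.
Context d (T : measurableType d) {R : realType} (P : probability T R).

Lemma intg_bdd (f : T -> R) (M : R) : mfun f ->
 (forall x, `|f x| <= M) -> intg P f.
move=> mf fM; apply: (intg_le mf (g := fun=> M)).
 by move=> x; exact: (le_trans (fM x) (ler_norm _)).
apply/integrableP; split; first exact: measurable_cst.
have -> : (\int[P]_x `|(EFin \o (fun=> M)) x| = `|M|%:E * P setT)%E by rewrite -integral_cst.
have -> : (`|M|%:E * P setT = `|M|%:E * 1)%E by congr (_ * _)%E; exact: probability_setT.
by rewrite mule1 ltry.
Qed.

Lemma intg_cst (r : R) : intg P (fun=> r).
exact: (@intg_bdd _ `|r|). Qed.

Lemma Rint_cst (r : R) : (\int[P]_x r)%R = r.
rewrite Rintegral_cst // -[RHS]mulr1; congr (_ * _).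
exact: (congr1 fine (probability_setT P)).
Qed.

Lemma RintD (f g : T -> R) : intg P f -> intg P g ->
 (\int[P]_x (f x + g x) = \int[P]_x f x + \int[P]_x g x)%R.
by move=> hf hg; rewrite RintegralD. Qed.

Lemma RintB (f g : T -> R) : intg P f -> intg P g ->
 (\int[P]_x (f x - g x) = \int[P]_x f x - \int[P]_x g x)%R.
by move=> hf hg; rewrite RintegralB. Qed.

Lemma RintZ (r : R) (f : T -> R) : intg P f ->
 (\int[P]_x (r * f x) = r * \int[P]_x f x)%R.
by move=> hf; rewrite RintegralZl. Qed.

Lemma intgB (f g : T -> R) : intg P f -> intg P g -> intg P (fun x => f x - g x).
by move=> hf hg; exact: (integrableB _ hf hg). Qed.

Lemma Rint_le (f g : T -> R) : intg P f -> intg P g -> (forall x, f x <= g x) ->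
 (\int[P]_x f x <= \int[P]_x g x)%R.
by move=> hf hg fg; apply: le_Rintegral => // x _; exact: fg. Qed.

Lemma Rint_norm_le (f g : T -> R) : intg P f -> intg P g -> (forall x, `|f x| <= g x) ->
 (`|\int[P]_x f x| <= \int[P]_x g x)%R.
move=> hf hg fg; rewrite ler_norml -mulN1r -RintZ //.
apply/andP; split; apply: Rint_le => //.
- exact: intgZ.
- by move=> x; rewrite mulN1r lerNl; have := fg x; rewrite ler_norml => /andP[+ _]; rewrite lerNl.
- by move=> x; have := fg x; rewrite ler_norml => /andP[].
Qed.

Lemma Rint_bounded (f : T -> R) (M : R) : mfun f ->
 (forall x, `|f x| <= M) -> (`|\int[P]_x f x| <= M)%R.
move=> mf fM; rewrite -[leRHS](Rint_cst M); apply: Rint_norm_le => //; last exact: intg_cst.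
exact: intg_bdd fM.
Qed.

End finite_integrals.

(** * The standard Gaussian and its cosine transform *)

Section standard_gaussian.
Context {R : realType}.
Notation mR := (measurableTypeR R).
Notation leb := (@lebesgue_measure R).
Notation gam := (normal_prob (0 : R) 1).
Notation gpdf := (normal_pdf (0 : R) 1).

Lemma gpdfE x : gpdf x = normal_peak (1 : R) * expR (- (x ^+ 2 / 2)).
rewrite normal_pdfE ?oner_eq0 // /normal_fun subr0 expr1n mulNr.
by rewrite -mulr_natr mul1r.
Qed.

Lemma gpdfN x : gpdf (- x) = gpdf x.
by rewrite !gpdfE sqrrN. Qed.

Lemma mfun_gpdf : measurable_fun [set: mR] gpdf.
exact: measurable_normal_pdf. Qed.

Lemma int_gauss (f : mR -> \bar R) : mfun f -> (forall x, 0 <= f x)%E ->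
 (\int[gam]_x f x = \int[leb]_x ((gpdf x)%:E * f x))%E.
move=> mf f0; apply: int_density => //; first exact: mfun_gpdf.
by move=> x; exact: normal_pdf_ge0.
Qed.

Lemma int_gaussN (f : mR -> \bar R) : mfun f -> (forall x, 0 <= f x)%E ->
 (\int[gam]_x f (- x)%R = \int[gam]_x f x)%E.
move=> mf f0; rewrite !int_gauss //; last first.
 by apply: (mcomp mf); exact: oppr_measurable.
have N0 : (-1 : R) != 0 by rewrite oppr_eq0 oner_neq0.
have mG : mfun (fun x : mR => ((gpdf x)%:E * f x)%E).
 by apply: emfunM => //; apply: mEFin; exact: mfun_gpdf.
have G0 x : (0 <= (gpdf x)%:E * f x)%E by rewrite mule_ge0 // lee_fin normal_pdf_ge0.
have := int_affine 0 N0 mG G0; rewrite normrN1 invr1 mul1e => <-.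
by apply: eq_integral => x _; rewrite addr0 mulN1r gpdfN.
Qed.

(** The standard density is the heat kernel of age 1/2, so this is the semigroup law up to age 1. *)
Lemma gpdf_conv (u : R) : (\int[leb]_x (gpdf x * gpdf (u - x))%:E =
 ((Num.sqrt 2)^-1 * gpdf ((Num.sqrt 2)^-1 * u))%:E)%E.
have s20 : Num.sqrt (2 : R) != 0 by rewrite gt_eqF // sqrtr_gt0.
have h2 : (0 : R) < 2^-1 by rewrite invr_gt0.
have gE x : gpdf x = G1 2^-1 x.
 rewrite gpdfE /G1 /normal_peak expr1n mul1r -mulr_natr.
 by congr (_^-1 * expR _); [congr Num.sqrt; field|congr (- _); field].
under eq_integral.
 move=> x _; rewrite !gE mulrC.
 have -> : G1 2^-1 x = G1 2^-1 (x - 0) by rewrite subr0.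
 rewrite G1_semigroup // EFinM; over.
rewrite ge0_integralZl //=; last 3 first.
- by apply: mEFin; exact: measurable_normal_pdf.
- by move=> x _; rewrite lee_fin normal_pdf_ge0.
- by rewrite lee_fin G1_ge0.
rewrite integral_normal_pdf mule1; congr EFin.
rewrite gE /G1 subr0 mulrA -invfM -sqrtrM //; congr (_^-1 * expR _).
 by congr Num.sqrt; field.
by rewrite exprMn exprVn sqr_sqrtr //; congr (- _); field.
Qed.

Lemma gauss_conv (h : mR -> \bar R) : mfun h -> (forall x, 0 <= h x)%E ->
 (\int[gam]_x \int[gam]_y h (x + y)%R = \int[gam]_u h (Num.sqrt 2 * u)%R)%E.
move=> mh h0.
have s20 : 0 < Num.sqrt (2 : R) by rewrite sqrtr_gt0.
have mhD x : mfun (fun y : mR => h (x + y)%R).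
 by apply: (mcomp mh); exact: mfunD.
have mF : measurable_fun [set: mR * mR] (fun z => ((gpdf z.1 * gpdf (z.2 - z.1))%:E * h z.2)%E).
 apply: emfunM; last exact: (mcomp mh).
 apply: mEFin; apply: mfunM; first exact: (mcomp mfun_gpdf).
 by apply: (mcomp mfun_gpdf); exact: mfunB.
have F0 z : (0 <= (gpdf z.1 * gpdf (z.2 - z.1))%:E * h z.2)%E.
 by rewrite mule_ge0 // lee_fin mulr_ge0 ?normal_pdf_ge0.
transitivity (\int[leb]_x \int[leb]_u ((gpdf x * gpdf (u - x))%:E * h u))%E.
 have inner x : (\int[gam]_y h (x + y)%R = \int[leb]_u ((gpdf (u - x))%:E * h u))%E.
  have mG : mfun (fun u : mR => ((gpdf (u - x))%:E * h u)%E).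
   apply: emfunM => //; apply: mEFin.
   by apply: (mcomp mfun_gpdf); exact: mfunB.
  have G0 u : (0 <= (gpdf (u - x))%:E * h u)%E by rewrite mule_ge0 // lee_fin normal_pdf_ge0.
  rewrite (int_gauss (mhD x) (fun y => h0 _)).
  have := @int_affine R 1 x _ (oner_neq0 _) mG G0.
  rewrite normr1 invr1 mul1e => <-.
  by apply: eq_integral => y _; rewrite mul1r addrK addrC.
 have mI : mfun (fun x : mR => \int[gam]_y h (x + y)%R)%E.
  apply: (@mfun_sprod_F _ _ _ _ _ gam (fun z : mR * mR => h (z.1 + z.2)%R)) => //.
  by apply: (mcomp mh); exact: mfunD.
 rewrite (int_gauss mI (fun x => integral_ge0 _ _)) //.
 apply: eq_integral => x _; rewrite inner -ge0_integralZl //; last 3 first.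
 - apply: emfunM => //; apply: mEFin.
  by apply: (mcomp mfun_gpdf); exact: mfunB.
 - by move=> u _; rewrite mule_ge0 // lee_fin normal_pdf_ge0.
 - by rewrite lee_fin normal_pdf_ge0.
 by apply: eq_integral => u _; rewrite muleA EFinM.
have := int_sprod leb leb mF F0; rewrite (int_sprod_swap leb leb mF F0) => <- /=.
have ms : mfun (fun u : mR => h (Num.sqrt 2 * u)%R).
 by apply: (mcomp mh); exact: mfunM.
rewrite (int_gauss ms (fun u => h0 _)).
pose F u := ((gpdf ((Num.sqrt 2)^-1 * u))%:E * h u)%E.
have mF' : mfun F.
 apply: emfunM => //; apply: mEFin.
 by apply: (mcomp mfun_gpdf); exact: mfunM.
have F0' u : (0 <= F u)%E by rewrite mule_ge0 // lee_fin normal_pdf_ge0.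
transitivity (\int[leb]_u ((Num.sqrt 2)^-1%:E * F u))%E.
 apply: eq_integral => u _; under eq_integral do rewrite muleC.
 have mg : mfun (fun x : mR => (gpdf x * gpdf (u - x))%:E).
  apply: mEFin; apply: mfunM; first exact: mfun_gpdf.
  by apply: (mcomp mfun_gpdf); exact: mfunB.
 have g0 x : (0 <= (gpdf x * gpdf (u - x))%:E)%E by rewrite lee_fin mulr_ge0 ?normal_pdf_ge0.
 by rewrite ge0_integralZl // gpdf_conv EFinM muleC muleA.
rewrite ge0_integralZl //.
have := int_affine 0 (lt0r_neq0 s20) mF' F0'.
rewrite (gtr0_norm s20) => h'; apply: (etrans (esym h')).
by apply: eq_integral => x _; rewrite /F addr0 mulKf // gt_eqF.
Qed.

(** Against the density this is, up to a constant, a normal density of parameter sqrt 2. It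
    dominates every power and so gives all moments. *)
Lemma gauss_expR_sqr4 : intg gam (fun x : R => expR (x ^+ 2 / 4)).
have me : mfun (fun x : mR => (expR (x ^+ 2 / 4))%:E).
 by apply: mEFin; apply: mfun_expRr; apply: mfunM => //; exact: mfunX.
apply: intg_ge0P; first by apply: mfun_expRr; apply: mfunM => //; exact: mfunX.
 by move=> x; exact: expR_ge0.
rewrite (int_gauss me (fun x => expR_ge0 _)).
pose s := Num.sqrt (2 : R).
have s0 : s != 0 by rewrite gt_eqF // sqrtr_gt0.
have ps : 0 < normal_peak s by exact: normal_peak_gt0.
have -> : (\int[leb]_x ((gpdf x)%:E * (expR (x ^+ 2 / 4))%:E) =
  \int[leb]_x ((normal_peak 1 / normal_peak s)%:E * (normal_pdf 0 s x)%:E))%E.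
 apply: eq_integral => x _; rewrite -!EFinM; congr EFin.
 rewrite gpdfE normal_pdfE // mulrA mulfVK ?gt_eqF // -mulrA; congr (_ * _).
 rewrite /normal_fun subr0 sqr_sqrtr // -expRD; congr expR.
 by rewrite -mulr_natr; field.
rewrite ge0_integralZl //=; last 3 first.
- by apply: mEFin; exact: measurable_normal_pdf.
- by move=> x _; rewrite lee_fin normal_pdf_ge0.
- by rewrite lee_fin divr_ge0 // ?normal_peak_ge0.
by rewrite integral_normal_pdf mule1 ltry.
Qed.

Lemma expR_ge_pow (x : R) n : 0 <= x -> x ^+ n <= (n`!)%:R * expR x.
move=> x0; have f0 : 0 < (n`!)%:R :> R by rewrite ltr0n fact_gt0.
rewrite mulrC -ler_pdivrMr //; case: n f0 => [|n] f0.
 by rewrite expr0 fact0 divr1 -[leLHS]expR0 ler_expR.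
by apply: le_trans (expR_ge1Dxn n x0); rewrite lerDr.
Qed.

Lemma intg_gauss_pow n : intg gam (fun x : R => x ^+ n).
pose K : R := 1 + 4 ^+ n * (n`!)%:R.
apply: (intg_le _ _ (intgZ K gauss_expR_sqr4)); first exact: mfunX.
move=> x; rewrite normrX; set y := `|x|; have y0 : 0 <= y by exact: normr_ge0.
have e1 : 1 <= expR (x ^+ 2 / 4).
 by rewrite -[leLHS]expR0 ler_expR divr_ge0 // sqr_ge0.
have h : y ^+ n <= 1 + (y ^+ 2) ^+ n.
 rewrite -exprM mulnC exprM; have [y1|y1] := leP (y ^+ n) 1.
  by apply: (le_trans y1); rewrite lerDl sqr_ge0.
 rewrite (le_trans (_ : _ <= (y ^+ n) ^+ 2)) ?lerDr //.
 by rewrite expr2 ler_peMl ?exprn_ge0 // ltW.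
apply: (le_trans h); rewrite ger0_norm; last first.
 by rewrite mulr_ge0 ?expR_ge0 // addr_ge0 // mulr_ge0 ?exprn_ge0.
rewrite /K mulrDl mul1r; apply: lerD => //.
have -> : y ^+ 2 = 4 * (x ^+ 2 / 4) by rewrite real_normK ?num_real // mulrCA divff ?mulr1.
by rewrite exprMn -mulrA ler_wpM2l ?exprn_ge0 // expR_ge_pow // divr_ge0 // sqr_ge0.
Qed.

(** The moment of order 2n. [gmoment 1] is the variance, kept as a symbol: a normal density of
    parameter tau has variance [gmoment 1 * tau ^+ 2] in all later formulas. *)
Definition gmoment n : R := (\int[gam]_x (x ^+ n.*2))%R.

Lemma gauss_moment_ge0 n : 0 <= gmoment n.
by apply: Rintegral_ge0 => x _; rewrite -mul2n exprM exprn_ge0 // sqr_ge0. Qed.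

(** A vanishing second moment would concentrate the Gaussian on the point 0, which is null because
    the law is dominated by Lebesgue measure. *)
Lemma gmoment1_gt0 : 0 < gmoment 1.
rewrite lt0r gauss_moment_ge0 andbT; apply/negP => /eqP c0.
have m2 : mfun (fun x : mR => ((x ^+ 2)%:E : \bar R)).
 by apply: mEFin; exact: mfunX.
have : (\int[gam]_x `|(x ^+ 2)%:E| = 0)%E.
 under eq_integral do rewrite gee0_abs ?lee_fin ?sqr_ge0 //.
 by rewrite -(EFin_Rint (intg_gauss_pow 2)) -[2%N]/(1.*2) -/(gmoment 1) c0.
move/(ae_eq_integral_abs gam measurableT m2).
move=> [N [mN N0 sN]].
have g0 : gam [set (0 : mR)] = 0%E.
 apply: (null_content_dominatesP _ _).1; [exact: normal_prob_dominates|exact: measurable_set1|exact: lebesgue_measure_set1].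
have : (gam setT <= gam (N `|` [set (0%R : mR)]))%E.
 apply: le_measure; rewrite ?inE //; first by apply: measurableU => //; exact: measurable_set1.
 move=> x _; have [->|x0] := eqVneq x 0; first by right.
 left; apply: sN => /= h; have /eqP := h I; rewrite eqe sqrf_eq0.
 by apply/negP.
have -> : gam setT = 1%E := probability_setT gam.
have h2 : (gam (N `|` [set (0%R : mR)]) <= gam N + gam [set (0%R : mR)])%E.
 by apply: measureU2 => //; exact: measurable_set1.
move=> h; have := le_trans h h2.
by rewrite N0 g0 adde0 leNgt lte01.
Qed.

Let mcos (a b : R) : mfun (fun x : mR => cos (a * x + b)).
by apply: mfun_cosr; apply: mfunD => //; exact: mfunM. Qed.

Let cos_b (y : R) : `|cos y| <= 1.
by rewrite ler_norml cos_geN1 cos_le1. Qed.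

Lemma intg_gauss_cos (a b : R) : intg gam (fun x : R => cos (a * x + b)).
by apply: intg_bdd (mcos a b) _ => x; exact: cos_b. Qed.

Definition gauss_char (a : R) : R := (\int[gam]_x cos (a * x))%R.

(** Symmetry cancels the sine in the addition formula. The phase b makes cosines carry the
    information of the complex characteristic function. *)
Lemma gauss_cos_shift (a b : R) : (\int[gam]_x cos (a * x + b))%R = cos b * gauss_char a.
have h (s : R) : (\int[gam]_x cos (a * (- x) + s) = \int[gam]_x cos (a * x + s))%R.
 have m1 : mfun (fun x : mR => (1 + cos (a * x + s))%:E).
  by apply: mEFin; apply: mfunD.
 have p1 (x : mR) : (0 <= (1 + cos (a * x + s))%:E)%E.
  by rewrite lee_fin -lerBlDl sub0r cos_geN1.
 have := int_gaussN m1 p1.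
 have i2 : intg gam (fun x : R => cos (a * (- x) + s)).
  apply: (@intg_bdd _ _ _ _ _ 1) => [|x]; last exact: cos_b.
  by have := mcos (- a) s; under eq_fun do rewrite mulNr -mulrN.
 have i1 := intg_gauss_cos a s; have ic := intg_cst gam 1.
 rewrite -!EFin_Rint; [|exact: intgD|exact: intgD].
 by case; rewrite !RintD // => /addrI.
have e (x : R) : cos (a * (- x) + b) + cos (a * x + b) = (2 * cos b) * cos (a * x + 0).
 by rewrite mulrN addr0 !cosD sinN cosN; ring.
have i2 : intg gam (fun x : R => cos (a * (- x) + b)).
 apply: (@intg_bdd _ _ _ _ _ 1) => [|x]; last exact: cos_b.
 by have := mcos (- a) b; under eq_fun do rewrite mulNr -mulrN.
have : (\int[gam]_x (cos (a * (- x) + b) + cos (a * x + b)) = (2 * cos b) * gauss_char a)%R.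
 under eq_Rintegral do rewrite e.
 rewrite RintZ; last exact: intg_gauss_cos.
 by rewrite /gauss_char; congr (_ * _); apply: eq_Rintegral => x _; rewrite addr0.
rewrite RintD //; last exact: intg_gauss_cos.
rewrite h; set I := (\int[gam]_x _)%R => hh.
by apply: (mulfI (_ : 2 != 0)) => //; rewrite mulrA -hh; ring.
Qed.

(** The sum of two independent standard Gaussians is sqrt 2 times one. Adding 1 to the cosine keeps
    integrands nonnegative for Tonelli, a device that recurs below. *)
Lemma gauss_char_sqrt2 a : gauss_char (a * Num.sqrt 2) = gauss_char a ^+ 2.
have m1 : mfun (fun x : mR => (1 + cos (a * x))%:E).
 apply: mEFin; apply: mfunD => //.
 by have := mcos a 0; under eq_fun do rewrite addr0.
have p1 (x : mR) : (0 <= (1 + cos (a * x))%:E)%E.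
 by rewrite lee_fin -lerBlDl sub0r cos_geN1.
have := gauss_conv m1 p1.
have ic := intg_cst gam 1.
have i0 c : intg gam (fun x : R => cos (c * x)).
 by have := intg_gauss_cos c 0; under eq_fun do rewrite addr0.
have in1 (x : R) : (\int[gam]_y (1 + cos (a * (x + y)))%:E = (1 + gauss_char a * cos (a * x))%:E)%E.
 have i1 : intg gam (fun y : R => cos (a * (x + y))).
  by have := intg_gauss_cos a (a * x); under eq_fun do rewrite -mulrDr addrC.
 rewrite -EFin_Rint; last exact: intgD.
 rewrite RintD // Rint_cst; congr (1 + _)%:E.
 rewrite mulrC -gauss_cos_shift; apply: eq_Rintegral => y _.
 by rewrite mulrDr addrC.
under eq_integral do rewrite in1.
under [X in _ = X -> _]eq_integral do rewrite mulrA.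
rewrite -!EFin_Rint; [|exact: intgD|by apply: intgD => //; exact: intgZ].
by case; rewrite !RintD ?Rint_cst ?RintZ //; [move=> /addrI h; rewrite expr2; exact: esym h|exact: intgZ].
Qed.

Lemma gauss_char_taylor a :
 `|gauss_char a - (1 - gmoment 1 * a ^+ 2 / 2)| <= a ^+ 4 / 24 * gmoment 2.
have i0 : intg gam (fun x : R => cos (a * x)).
 by have := intg_gauss_cos a 0; under eq_fun do rewrite addr0.
have i2 := intg_gauss_pow 2; have i4 := intg_gauss_pow 4.
have ic := intg_cst gam 1.
have -> : gauss_char a - (1 - gmoment 1 * a ^+ 2 / 2) =
  (\int[gam]_x (cos (a * x) - (1 - (a ^+ 2 / 2) * x ^+ 2)))%R.
 rewrite RintB //; last by apply: intgB => //; exact: intgZ.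
 rewrite RintB //; last exact: intgZ.
 by rewrite Rint_cst RintZ // /gmoment /=; congr (_ - (1 - _)); ring.
rewrite /gmoment -RintZ //; apply: Rint_norm_le.
- by apply: intgB => //; apply: intgB => //; exact: intgZ.
- exact: intgZ.
move=> x; have := cos_ge_taylor2 (a * x); have := cos_le_taylor4 (a * x).
rewrite !exprMn => h1 h2; rewrite ler_norml; apply/andP; split.
 rewrite (le_trans (_ : _ <= 0)) //; last by lra.
 by rewrite oppr_le0 mulr_ge0 ?divr_ge0 ?exprn_even_ge0.
by rewrite /=; lra.
Qed.

Lemma expRN_taylor (u : R) : 0 <= u -> `|expR (- u) - (1 - u)| <= u ^+ 2.
move=> u0; have := expR_ge1Dx (- u) => h1.
have h2 : expR (- u) * (1 + u) <= 1.
 by rewrite -[leRHS](expRxMexpNx_1 u) mulrC ler_wpM2r ?expR_ge0 // expR_ge1Dx.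
rewrite ger0_norm ?subr_ge0 // lerBlDr.
have h3 : 0 < 1 + u by lra.
rewrite -(ler_pM2r h3); apply: (le_trans h2); nra.
Qed.

Lemma le_half_powers (x C : R) : (forall n, x <= C / 2 ^+ n) -> x <= 0.
move=> h; rewrite leNgt; apply/negP => x0.
have C0 : 0 <= C / x by rewrite divr_ge0 ?(ltW x0) //; have := h 0%N; rewrite expr0 divr1 => /(lt_le_trans x0)/ltW.
have := archi_boundP C0; set n := Num.bound _ => hn.
have := h n; rewrite leNgt => /negP; apply.
rewrite ltr_pdivrMr ?exprn_gt0 // mulrC -ltr_pdivrMr //; apply: (lt_le_trans hn).
by rewrite -natrX ler_nat ltnW // ltn_expl.
Qed.

Lemma exp_diff_le (x y : R) n : `|x| <= 1 -> `|y| <= 1 -> `|x ^+ n - y ^+ n| <= n%:R * `|x - y|.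
move=> x1 y1; rewrite subrXX mulrC normrM ler_wpM2r //.
apply: (le_trans (ler_norm_sum _ _ _)).
rewrite -[n in leRHS]card_ord -sum1_card natr_sum; apply: ler_sum => i _.
by rewrite normrM !normrX mulr_ile1 ?exprn_ge0 // exprn_ile1.
Qed.

(** The relation between a and a sqrt 2 writes the transform at a as the 2^n-th power of the
    transform at b = a / sqrt 2^n. There it agrees with the exponential up to K b^4, and raising
    numbers of size at most 1 to the power 2^n multiplies the error by at most 2^n, which leaves K
    a^4 / 2^n. *)
Lemma gauss_charE a : gauss_char a = expR (- (gmoment 1 * a ^+ 2 / 2)).
set c := gmoment 1; have c0 : 0 <= c by exact: gauss_moment_ge0.
pose K := gmoment 2 / 24 + c ^+ 2 / 4.
have small b : `|gauss_char b - expR (- (c * b ^+ 2 / 2))| <= K * b ^+ 4.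
 have u0 : 0 <= c * b ^+ 2 / 2 by rewrite divr_ge0 // mulr_ge0 // sqr_ge0.
 have := gauss_char_taylor b; have := expRN_taylor u0; rewrite distrC -/c => h1 h2.
 have := le_trans (ler_distD (1 - c * b ^+ 2 / 2) _ _) (lerD h2 h1).
 move=> h; apply: (le_trans h); rewrite le_eqVlt; apply/orP; left; apply/eqP; rewrite /K.
 by field.
have sq n b : gauss_char (b * Num.sqrt 2 ^+ n) = gauss_char b ^+ (2 ^ n).
 elim: n b => [|n IH] b; first by rewrite expr0 mulr1 expn0 expr1.
 by rewrite exprS mulrA IH gauss_char_sqrt2 -exprM expnS.
have s20 : Num.sqrt (2 : R) != 0 by rewrite gt_eqF // sqrtr_gt0.
have bound n : `|gauss_char a - expR (- (c * a ^+ 2 / 2))| <= (K * a ^+ 4) / 2 ^+ n.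
 pose b := a / Num.sqrt 2 ^+ n.
 have aE : a = b * Num.sqrt 2 ^+ n by rewrite mulfVK // expf_eq0 (negbTE s20) andbF.
 have a2E : a ^+ 2 = b ^+ 2 * 2 ^+ n by rewrite {1}aE exprMn -exprM mulnC exprM sqr_sqrtr.
 have eE : expR (- (c * a ^+ 2 / 2)) = expR (- (c * b ^+ 2 / 2)) ^+ (2 ^ n).
  by rewrite -expRM_natr natrX a2E; congr expR; ring.
 rewrite eE {1}aE sq; apply: (le_trans (exp_diff_le _ _ _)).
 - by apply: Rint_bounded => [|x]; [have := mcos b 0; under eq_fun do rewrite addr0|exact: cos_b].
 - by rewrite ger0_norm ?expR_ge0 // -[leRHS]expR0 ler_expR oppr_le0 divr_ge0 // mulr_ge0 // sqr_ge0.
 rewrite natrX; have t0 : 0 < (2 : R) ^+ n by rewrite exprn_gt0.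
 rewrite (_ : K * a ^+ 4 / 2 ^+ n = 2 ^+ n * (K * b ^+ 4)); first by rewrite ler_wpM2l // ltW.
 by rewrite -[4%N]/(2 * 2)%N !exprM a2E; field; rewrite gt_eqF.
apply/eqP; rewrite -subr_eq0 -normr_le0; exact: le_half_powers bound.
Qed.

End standard_gaussian.

(** * Gaussian variables and their L2 limits *)

Section gaussian_variables.
Context d (T : measurableType d) {R : realType} (P : probability T R).
Notation mR := (measurableTypeR R).
Notation leb := (@lebesgue_measure R).
Notation gam := (normal_prob (0 : R) 1).
Notation gpdf := (normal_pdf (0 : R) 1).

Lemma normal_prob_scale (s : R) (A : set mR) : s != 0 -> measurable A ->
 normal_prob 0 s A = gam ((fun x => s * x) @^-1` A).
move=> s0 mA.
have ms : measurable_fun [set: mR] (fun x : mR => (s * x : mR)) by exact: mfunM.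
have msA : measurable ((fun x : mR => (s * x : mR)) @^-1` A).
 by rewrite -[X in measurable X]setTI; exact: ms.
pose F x := ((gpdf (s^-1 * x))%:E * (\1_A x)%:E)%E.
have mF : measurable_fun [set: mR] F.
 apply: emfunM; apply: mEFin; last exact: measurable_indic.
 by apply: (mcomp (@mfun_gpdf R)); exact: mfunM.
have F0 x : (0 <= F x)%E by rewrite mule_ge0 // lee_fin ?normal_pdf_ge0.
transitivity (\int[leb]_x F (s * x + 0)%R)%E.
 rewrite (int_affine 0 s0 mF F0) /normal_prob integral_mkcond.
 rewrite -ge0_integralZl //.
 apply: eq_integral => x _; rewrite patchE /F indicE; case: (x \in A); last by rewrite !mule0.
 rewrite mule1 -EFinM gpdfE normal_pdfE // /normal_fun subr0 mulrA; congr (_ * expR _)%:E.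
  rewrite /normal_peak expr1n mul1r -sqrtr_sqr -invfM -sqrtrM ?sqr_ge0 //.
  by rewrite -mulr_natr -[pi *+ 2]mulr_natr mulrA.
 by rewrite -mulr_natr exprMn exprVn; field.
rewrite /normal_prob [RHS]integral_mkcond; apply: eq_integral => x _.
rewrite addr0 /F mulKf // patchE indicE /=.
have -> : (x \in (fun x : mR => s * x) @^-1` A) = (s * x \in A).
 by apply/idP/idP; rewrite !inE.
by case: ifP; rewrite ?mule1 ?mule0.
Qed.

(** A single scale s covers both cases of [centered_gaussian], s = 0 being the Dirac mass at 0. *)
Lemma gaussian_law (X : T -> R) : centered_gaussian P X ->
 exists s : R, forall h : mR -> \bar R, mfun h -> (forall x, 0 <= h x)%E ->
  (\int[P]_w h (X w) = \int[gam]_x h (s * x)%R)%E.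
move=> [mX [s hs]]; exists s => h mh h0.
have ms : measurable_fun [set: mR] (fun x : mR => (s * x : mR)) by exact: mfunM.
transitivity (\int[pushforward P (X : T -> mR)]_y h y)%E.
 by rewrite ge0_integral_pushforward.
transitivity (\int[pushforward gam (fun x : mR => (s * x)%R : mR)]_y h y)%E; last first.
 by rewrite ge0_integral_pushforward.
apply: eq_measure_integral => A mA _; apply: (etrans (hs A mA)).
case: eqVneq => [s0|s0]; last exact: normal_prob_scale.
transitivity (gam ((fun x : mR => (s * x)%R : mR) @^-1` A)); last by [].
rewrite s0; have -> : (fun x : mR => 0 * x : mR) = cst 0 by apply/funext => x; rewrite mul0r.
rewrite preimage_cst diracE; case: (0 \in A); last by rewrite measure0.
by rewrite (probability_setT gam).
Qed.

Lemma gaussian_sq_cos (X : T -> R) : centered_gaussian P X ->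
 intg P (fun w => X w ^+ 2) /\
 forall b, (\int[P]_w cos (X w + b) = cos b * expR (- ((\int[P]_w (X w ^+ 2)) / 2)))%R.
move=> gX; have [mX _] := gX; have [s hs] := gaussian_law gX.
have m2 : measurable_fun [set: mR] (fun x : mR => (x ^+ 2)%:E).
 by apply: mEFin; exact: mfunX.
have h2 := hs _ m2 (fun x => sqr_ge0 x).
have i2 : intg gam (fun x : R => (s * x) ^+ 2).
 have := intgZ (s ^+ 2) (intg_gauss_pow (R := R) 2).
 by congr intg; apply/funext => x; rewrite exprMn.
have iX : intg P (fun w => X w ^+ 2).
 apply: intg_ge0P; [exact: mfunX|by move=> x; exact: sqr_ge0|].
 by rewrite h2; apply: intg_lty => // x; exact: sqr_ge0.
split => // b.
have e2 : (\int[P]_w (X w ^+ 2) = gmoment 1 * s ^+ 2)%R.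
 move: h2; rewrite -!EFin_Rint //; case => ->.
 under eq_Rintegral do rewrite exprMn.
 by rewrite (RintZ (s ^+ 2) (intg_gauss_pow 2)) mulrC.
have mc : measurable_fun [set: mR] (fun x : mR => (1 + cos (x + b))%:E).
 by apply: mEFin; apply: mfunD => //; apply: mfun_cosr; exact: mfunD.
have := hs _ mc (fun x => _).
have p x : (0 <= (1 + cos (x + b))%:E)%E by rewrite lee_fin -lerBlDl sub0r cos_geN1.
move=> /(_ p).
have ic := intg_gauss_cos s b.
have icX : intg P (fun w => cos (X w + b)).
 apply: (@intg_bdd _ _ _ _ _ 1); first by apply: mfun_cosr; exact: mfunD.
 by move=> w; rewrite ler_norml cos_geN1 cos_le1.
rewrite -!EFin_Rint; [|apply: intgD => //; exact: intg_cst|apply: intgD => //; exact: intg_cst].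
case; rewrite !RintD // ?Rint_cst; [|exact: intg_cst..].
by move=> /addrI ->; rewrite gauss_cos_shift gauss_charE e2.
Qed.

Lemma gaussian_limit (X : nat -> T -> R) (Y : T -> R) (v : R) :
 (forall n, centered_gaussian P (X n)) -> mfun Y ->
 (\int[P]_w ((X n w - Y w) ^+ 2)%:E @[n --> \oo] --> 0)%E ->
 (\int[P]_w (X n w ^+ 2))%R @[n --> \oo] --> v ->
 forall b, (\int[P]_w cos (Y w + b) = cos b * expR (- (v / 2)))%R.
move=> gX mY cD cv b.
have mc (Z : T -> R) : mfun Z -> intg P (fun w => cos (Z w + b)).
 move=> mZ; apply: (@intg_bdd _ _ _ _ _ 1).
  by apply: mfun_cosr; exact: mfunD.
 by move=> w; rewrite ler_norml cos_geN1 cos_le1.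
have c1 : (\int[P]_w cos (X n w + b))%R @[n --> \oo] --> cos b * expR (- (v / 2)).
 under eq_fun do rewrite (gaussian_sq_cos (gX _)).2.
 apply: cvgMr; apply: (cvg_comp _ expR); last exact: continuous_expR.
 by apply: cvgN; apply: cvgMl.
suff c2 : (\int[P]_w cos (X n w + b))%R @[n --> \oo] --> (\int[P]_w cos (Y w + b))%R.
 exact: (cvg_unique _ c2 c1).
apply/cvgrPdist_le => e e0.
move/fine_cvgP: cD => [fD rD].
have e20 : 0 < e ^+ 2 by rewrite exprn_gt0.
near=> n; rewrite -RintB; [|exact: mc|by apply: mc; have [] := gX n].
have mXn : mfun (X n) by have [] := gX n.
have iD : intg P (fun w => (X n w - Y w) ^+ 2).
 apply: intg_ge0P; [by apply: mfunX; exact: mfunB|by move=> w; exact: sqr_ge0|].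
 by rewrite ltey_eq; apply/orP; left; near: n.
have bD : (\int[P]_w ((X n w - Y w) ^+ 2) <= e ^+ 2)%R.
 have : `|0 - (\int[P]_w ((X n w - Y w) ^+ 2))%R| <= e ^+ 2.
  by near: n; move/cvgrPdist_le: rD => /(_ _ e20).
 by rewrite sub0r normrN; apply: le_trans; exact: ler_norm.
(* With u the difference, |u| is at most e/2 + u^2/(2e); the mean of u^2 is at most e^2, so the
   total is e. *)
apply: (@le_trans _ _ (\int[P]_w (e / 2 + (2 * e)^-1 * (X n w - Y w) ^+ 2))%R).
 apply: Rint_norm_le.
 - by apply: intgB; exact: mc.
 - by apply: intgD; [exact: intg_cst|exact: intgZ].
 move=> w; apply: (le_trans (cos_lip _ _)); rewrite opprD addrACA subrr addr0.
 rewrite distrC; set u := X n w - Y w.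
 have -> : e / 2 + (2 * e)^-1 * u ^+ 2 = (2 * e)^-1 * (e ^+ 2 + `|u| ^+ 2).
  by rewrite real_normK ?num_real //; field; rewrite gt_eqF.
 rewrite ler_pdivlMl ?mulr_gt0 //; have := sqr_ge0 (e - `|u|); nra.
rewrite RintD ?Rint_cst ?RintZ //; [|exact: intg_cst|exact: intgZ].
have eE : e = e / 2 + (2 * e)^-1 * e ^+ 2 by field; rewrite gt_eqF.
by rewrite [leRHS]eE lerD2l ler_wpM2l // invr_ge0 mulr_ge0 // ltW.
Unshelve. all: by end_near. Qed.

End gaussian_variables.

(** * Half-line indicators smoothed by Gaussian noise *)

Section half_lines.
Context {R : realType}.
Notation mR := (measurableTypeR R).
Notation gam := (normal_prob (0 : R) 1).
Notation c := (gmoment (R := R) 1).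

Lemma gauss_tail (t : R) : 0 < t -> (gam [set x | (t <= `|x|)%R] <= (c / t ^+ 2)%:E)%E.
move=> t0; have m2 : mfun (fun x : mR => (x ^+ 2)%:E : \bar R).
 by apply: mEFin; exact: mfunX.
have mS : measurable [set x : mR | t <= `|x|].
 rewrite -[X in measurable X]setTI; apply: (measurable_fun_ler (f := cst t) (g := fun x : mR => `|x|)) => //.
 exact: mcomp.
have t20 : 0 < t ^+ 2 by rewrite exprn_gt0.
have : ((t ^+ 2)%:E * gam [set x | (t <= `|x|)%R] <= c%:E)%E.
 rewrite -integral_cst // /gmoment EFin_Rint; last exact: (intg_gauss_pow 2).
 rewrite integral_mkcond; apply: ge0_le_integral => //.
 - by move=> x _; rewrite patchE; case: ifP => // _; rewrite lee_fin ltW.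
 - by apply/(measurable_restrictT _ mS); exact: measurable_cst.
 - move=> x _; rewrite patchE; case: ifP => [|_]; last by rewrite lee_fin sqr_ge0.
  rewrite inE /= => h; rewrite lee_fin -(real_normK (num_real x)).
  by rewrite ler_sqr // ?nnegrE // ltW.
have -> : (c / t ^+ 2)%:E = ((t ^+ 2)^-1%:E * c%:E)%E by rewrite -EFinM mulrC.
by rewrite lee_pdivlMl.
Qed.

(** With N = n + 1 the threshold is lowered by 1/N while the noise has scale 1/N^2. On the event
    |xi| < N the comparison is therefore decided correctly for x >= cc, and for x < cc once cc - x
    >= 2/N; the error is a Gaussian tail. *)
Definition smooth_step (cc : R) (n : nat) (x : R) : \bar R :=
 (\int[gam]_xi (((x + (n.+1%:R ^+ 2)^-1 * xi < cc - n.+1%:R^-1)%R)%:R : R)%:E)%E.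

Let mstep (cc : R) (n : nat) (x : R) : measurable_fun [set: mR]
 (fun xi : mR => (((x + (n.+1%:R ^+ 2)^-1 * xi < cc - n.+1%:R^-1)%R)%:R : R)%:E).
apply: mEFin.
have -> : (fun xi : mR => ((x + (n.+1%:R ^+ 2)^-1 * xi < cc - n.+1%:R^-1)%R)%:R : R) =
 (fun xi : mR => if (x + (n.+1%:R ^+ 2)^-1 * xi < cc - n.+1%:R^-1)%R then 1 else 0).
 by apply/funext => xi; case: ifP.
apply: mfun_if => //; apply: measurable_fun_ltr => //.
by apply: mfunD => //; exact: mfunM.
Qed.

Lemma smooth_step_le1 cc n x : (0 <= smooth_step cc n x <= 1)%E.
apply/andP; split; first by apply: integral_ge0 => xi _; rewrite lee_fin ler0n.
rewrite -(@probability_setT _ _ _ gam) -[leRHS]mul1e -integral_cst //.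
apply: ge0_le_integral => //.
by move=> xi _; rewrite lee_fin; case: (_ < _).
Qed.

Lemma smooth_step_dist cc n x : (x < cc -> 2 / (cc - x) <= n.+1%:R) ->
 (`|smooth_step cc n x - (((x < cc)%R)%:R : R)%:E| <= (c / n.+1%:R ^+ 2)%:E)%E.
move=> hn; set N : R := n.+1%:R in hn *.
have N0 : 0 < N by rewrite ltr0n.
have mS : measurable [set xi : mR | N <= `|xi|].
 rewrite -[X in measurable X]setTI; apply: (measurable_fun_ler (f := cst N) (g := fun x : mR => `|x|)) => //.
 exact: mcomp.
apply: le_trans (gauss_tail N0).
have /andP[s0 s1] := smooth_step_le1 cc n x.
have fS : smooth_step cc n x \is a fin_num.
 by rewrite ge0_fin_numE //; apply: (le_lt_trans s1); rewrite ltry.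
have [xc|xc] := ltP x cc; last first.
 rewrite sube0 gee0_abs // -[leRHS]mul1e -integral_cst // [leRHS]integral_mkcond.
 apply: ge0_le_integral => //.
  by apply/(measurable_restrictT _ mS); exact: measurable_cst.
 move=> xi _; rewrite patchE; case: ifP => [|h]; first by case: (_ < _); rewrite lee_fin.
 have {h} h : `|xi| < N.
  by rewrite ltNge; apply/negP => h'; move/negP: h; apply; rewrite inE.
 rewrite lee_fin; case: ltP => // h2; exfalso.
 move: h2; rewrite -/N; have -> : (N ^+ 2)^-1 = N^-1 * N^-1 by rewrite expr2 invfM.
 move: h; rewrite ltr_norml => /andP[h _].
 have : - 1 < N^-1 * xi by rewrite ltr_pdivlMl // mulrN1.
 set u := N^-1 * xi => hu; rewrite -mulrA -/u.
 have Ni : 0 < N^-1 by rewrite invr_gt0.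
 have h3 : - N^-1 < N^-1 * u by rewrite -mulrN1 ltr_pM2l.
 by rewrite ltNge => /negP; apply; apply: lerD => //; exact: ltW.
have one : (1 - smooth_step cc n x = \int[gam]_xi (1 - ((x + (N ^+ 2)^-1 * xi < cc - N^-1)%R)%:R : R)%:E)%E.
 have i1 : intg gam (fun xi : R => ((x + (N ^+ 2)^-1 * xi < cc - N^-1)%R)%:R).
  apply: (@intg_bdd _ _ _ _ _ 1); first by apply/measurable_EFinP; exact: mstep.
  by move=> xi; case: (_ < _); rewrite ?normr1 ?normr0.
 have ic := intg_cst gam 1.
 by rewrite -EFin_Rint ?RintB ?Rint_cst ?EFinB ?EFin_Rint //; exact: intgB.
have -> : (`|smooth_step cc n x - 1%:E| = 1 - smooth_step cc n x)%E.
 rewrite -[in LHS](fineK fS) -[in RHS](fineK fS) -EFinB -EFinB /= distrC ger0_norm //.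
 by rewrite subr_ge0 -lee_fin fineK.
rewrite one -[leRHS]mul1e -integral_cst // [leRHS]integral_mkcond.
apply: ge0_le_integral => //.
- by move=> xi _; rewrite lee_fin subr_ge0; case: (_ < _).
- apply: mEFin; apply: mfunB => //; apply/measurable_EFinP; exact: mstep.
- by apply/(measurable_restrictT _ mS); exact: measurable_cst.
move=> xi _; rewrite patchE; case: ifP => [|h]; first by case: (_ < _); rewrite lee_fin ?subrr // subr0.
have {h} h : `|xi| < N.
 by rewrite ltNge; apply/negP => h'; move/negP: h; apply; rewrite inE.
rewrite lee_fin; case: ltP => [_|h2]; first by rewrite subrr.
exfalso; move: h2; have -> : (N ^+ 2)^-1 = N^-1 * N^-1 by rewrite expr2 invfM.
move: h; rewrite ltr_norml => /andP[_ h].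
have : N^-1 * xi < 1 by rewrite ltr_pdivrMl // mulr1.
set u := N^-1 * xi => hu; rewrite -mulrA -/u.
have Ni : 0 < N^-1 by rewrite invr_gt0.
have : 2 * N^-1 <= cc - x.
 have := hn xc; rewrite ler_pdivrMr ?subr_gt0 // mulrC => h3.
 by rewrite ler_pdivrMr.
have h3 : N^-1 * u < N^-1 by rewrite -[ltRHS]mulr1 ltr_pM2l.
move=> h4; rewrite leNgt => /negP; apply; apply: (lt_le_trans (_ : _ < x + N^-1)); rewrite ?ltrD2l //.
by rewrite -lerBrDl addrAC lerBrDr -mulr2n -mulr_natl.
Qed.

End half_lines.

(** * Weighted laws on the line determined by cosine transforms *)

Section law_determination.
Context {R : realType}.
Notation mR := (measurableTypeR R).
Notation leb := (@lebesgue_measure R).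
Notation gam := (normal_prob (0 : R) 1).
Notation gpdf := (normal_pdf (0 : R) 1).

Section weighted.
Context d (T : measurableType d) (P : probability T R) (h X : T -> R) (M : R).
Hypotheses (mh : mfun h) (h0 : nonneg h) (hM : forall w, h w <= M) (mX : mfun X).

Lemma weighted_intg (f : T -> R) (K : R) : mfun f -> (forall w, `|f w| <= K) ->
 intg P (fun w => h w * f w).
move=> mf fK; apply: (@intg_bdd _ _ _ _ _ (M * K)); first exact: mfunM.
by move=> w; rewrite normrM ler_pM // ger0_norm.
Qed.

(** Averaging over a Gaussian frequency xi turns the cosine transform into a Gaussian bump around y,
    that is, into the weighted law of X smoothed by independent noise. *)
Lemma weighted_char (kap y : R) :
 (\int[gam]_xi ((\int[P]_w (h w * 1)) + (\int[P]_w (h w * cos (xi * kap * X w + - (xi * kap * y)))))%:E =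
  ((\int[P]_w (h w * 1)) + \int[P]_w (h w * gauss_char (kap * (X w - y))))%R%:E)%E.
have cb (x : R) : `|cos x| <= 1 by rewrite ler_norml cos_geN1 cos_le1.
pose F (z : mR * T) := ((h z.2 * (1 + cos (z.1 * (kap * (X z.2 - y)))))%:E)%E.
have mF : mfun F.
 apply: mEFin; apply: mfunM; first exact: (mcomp mh).
 apply: mfunD => //; apply: mfun_cosr; apply: mfunM => //.
 by apply: mfunM => //; apply: mfunB => //; exact: (mcomp mX).
have F0 z : (0 <= F z)%E by rewrite lee_fin mulr_ge0 // -lerBlDl sub0r cos_geN1.
have i1 : intg P (fun w => h w * 1).
 by apply: (@weighted_intg _ 1) => // w; rewrite normr1.
transitivity (\int[gam]_xi \int[P]_w F (xi, w))%E.
 apply: eq_integral => xi _.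
 have ic : intg P (fun w => h w * cos (xi * kap * X w + - (xi * kap * y))).
  apply: (@weighted_intg _ 1) => // ; apply: mfun_cosr; apply: mfunD => //.
  exact: mfunM.
 rewrite -RintD // EFin_Rint; last exact: intgD.
 apply: eq_integral => w _; rewrite /F /= -mulrDr; congr (_ * (1 + cos _))%:E; ring.
have := int_sprod gam P mF F0; rewrite (int_sprod_swap gam P mF F0) => <-.
have mg : mfun (fun w => gauss_char (kap * (X w - y))).
 under eq_fun do rewrite gauss_charE.
 apply: mfun_expRr; apply: mcomp => //; apply: mfunM => //.
 apply: mfunM => //; apply: mfunX; apply: mfunM => //.
 exact: mfunB.
have ig : intg P (fun w => h w * gauss_char (kap * (X w - y))).
 apply: (@weighted_intg _ 1) => // w; rewrite gauss_charE ger0_norm ?expR_ge0 //.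
 rewrite -[leRHS]expR0 ler_expR oppr_le0 divr_ge0 // mulr_ge0 ?sqr_ge0 //.
 exact: gauss_moment_ge0.
rewrite -RintD // EFin_Rint; last exact: intgD.
apply: eq_integral => w _; rewrite /F /=.
have i2 : intg gam (fun xi : R => cos (xi * (kap * (X w - y)))).
 have := intg_gauss_cos (kap * (X w - y)) 0.
 by under eq_fun do rewrite addr0 mulrC.
have i3 : intg gam (fun xi : R => 1 + cos (xi * (kap * (X w - y)))).
 by apply: intgD => //; exact: intg_cst.
rewrite -(EFin_Rint (intgZ (h w) i3)) RintZ // RintD //; last exact: intg_cst.
rewrite Rint_cst mulrDr; congr (_ + _ * _)%:E.
by apply: eq_Rintegral => xi _; rewrite mulrC.
Qed.

(** A smoothed half-line probability is the integral of Gaussian bumps over centers y below the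
    threshold. The scale [(e * Num.sqrt (gmoment 1))^-1] is the one at which [gauss_char] is
    proportional to the density of e xi. *)
Lemma weighted_step (e c' : R) : 0 < e ->
 (\int[P]_w ((h w)%:E * \int[gam]_xi (((X w + e * xi < c')%R)%:R : R)%:E) =
  \int[leb]_y ((e^-1 * normal_peak 1 * ((y < c')%R)%:R)%:E *
   (\int[P]_w (h w * gauss_char ((e * Num.sqrt (gmoment 1))^-1 * (X w - y))))%R%:E))%E.
move=> e0; have en : e != 0 by rewrite gt_eqF.
have c0 := @gmoment1_gt0 R.
have gcE x y : normal_peak 1 * gauss_char ((e * Num.sqrt (gmoment 1))^-1 * (x - y)) =
  gpdf (e^-1 * (y - x)).
 rewrite gauss_charE gpdfE; congr (_ * expR (- _)).
 rewrite !exprMn exprVn exprMn sqr_sqrtr ?(ltW c0) // exprVn -[(x - y) ^+ 2]sqrrN opprB.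
 by field; rewrite en gt_eqF.
have mlt (Z : Type) d' (U : measurableType d') (f : U -> R) : mfun f ->
  mfun (fun u => ((f u < c')%R)%:R : R).
 move=> mf; have -> : (fun u => ((f u < c')%R)%:R : R) = (fun u => if (f u < c')%R then 1 else 0).
  by apply/funext => u; case: ifP.
 by apply: mfun_if => //; exact: measurable_fun_ltr.
have mgp d' (U : measurableType d') (f : U -> R) : mfun f ->
  mfun (fun u => gpdf (e^-1 * f u)).
 move=> mf; apply: (mcomp (@mfun_gpdf R) (g := fun u => e^-1 * f u)).
 exact: mfunM.
have inner w : (\int[gam]_xi (((X w + e * xi < c')%R)%:R : R)%:E =
  \int[leb]_y (e^-1 * gpdf (e^-1 * (y - X w)) * ((y < c')%R)%:R)%:E)%E.
 rewrite int_gauss //; last first.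
  by apply: mEFin; apply: (mlt unit) => //; apply: mfunD => //; exact: mfunM.
 pose F y := (gpdf (e^-1 * (y - X w)) * ((y < c')%R)%:R)%:E.
 have mF : measurable_fun [set: mR] F.
  apply: mEFin; apply: mfunM; last exact: (mlt unit).
  by apply: mgp; exact: mfunB.
 have F0 y : (0 <= F y)%E by rewrite lee_fin mulr_ge0 ?normal_pdf_ge0.
 have := int_affine (X w) en mF F0; rewrite gtr0_norm // => h1.
 transitivity (\int[leb]_x F (e * x + X w)%R)%E.
  by apply: eq_integral => x _; rewrite /F addrK mulKf // -EFinM addrC.
 rewrite h1 -ge0_integralZl //; last by rewrite lee_fin invr_ge0 ltW.
 by apply: eq_integral => y _; rewrite /F -EFinM mulrA.
pose G (z : T * mR) := ((h z.1 * (e^-1 * gpdf (e^-1 * (z.2 - X z.1)) * ((z.2 < c')%R)%:R))%:E)%E.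
have mG : mfun G.
 apply: mEFin; apply: mfunM; first exact: (mcomp mh).
 apply: mfunM; last exact: (mlt unit).
 apply: mfunM => //; apply: mgp; apply: mfunB => //.
 exact: (mcomp mX).
have ei : 0 <= e^-1 by rewrite invr_ge0 ltW.
have G0 z : (0 <= G z)%E by rewrite lee_fin !mulr_ge0 ?normal_pdf_ge0.
transitivity (\int[P]_w \int[leb]_y G (w, y))%E.
 apply: eq_integral => w _; rewrite inner -ge0_integralZl //.
 - apply: mEFin; apply: mfunM; last exact: (mlt unit).
  by apply: mfunM => //; apply: mgp; exact: mfunB.
 - by move=> y _; rewrite lee_fin !mulr_ge0 ?normal_pdf_ge0.
 - by rewrite lee_fin.
have := int_sprod P leb mG G0; rewrite (int_sprod_swap P leb mG G0) => <-.
apply: eq_integral => y _; rewrite /G /=.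
have ig : intg P (fun w => h w * gauss_char ((e * Num.sqrt (gmoment 1))^-1 * (X w - y))).
 apply: (@weighted_intg _ 1); last first.
  move=> w; rewrite gauss_charE ger0_norm ?expR_ge0 // -[leRHS]expR0 ler_expR oppr_le0.
  by rewrite divr_ge0 // mulr_ge0 ?sqr_ge0 // ltW.
 under eq_fun do rewrite gauss_charE.
 apply: mfun_expRr; apply: mcomp => //; apply: mfunM => //.
 apply: mfunM => //; apply: mfunX; apply: mfunM => //.
 exact: mfunB.
rewrite EFin_Rint // -integralZl //.
by apply: eq_integral => w _; rewrite -EFinM -gcE; congr EFin; ring.
Qed.

End weighted.

Section two_weighted.
Context d1 (T1 : measurableType d1) (P1 : probability T1 R) (h1 X1 : T1 -> R).
Context d2 (T2 : measurableType d2) (P2 : probability T2 R) (h2 X2 : T2 -> R).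
Variable M : R.
Hypotheses (mh1 : mfun h1) (mh2 : mfun h2).
Hypotheses (h10 : nonneg h1) (h20 : nonneg h2).
Hypotheses (h1M : forall w, h1 w <= M) (h2M : forall w, h2 w <= M).
Hypotheses (mX1 : mfun X1) (mX2 : mfun X2).
Hypothesis same : forall a b : R,
 (\int[P1]_w (h1 w * cos (a * X1 w + b)) = \int[P2]_w (h2 w * cos (a * X2 w + b)))%R.

Let same_mass : (\int[P1]_w (h1 w * 1) = \int[P2]_w (h2 w * 1))%R.
have := same 0 0; under eq_Rintegral do rewrite mul0r addr0 cos0.
by under [X in _ = X -> _]eq_Rintegral do rewrite mul0r addr0 cos0.
Qed.

Let same_gauss kap y : (\int[P1]_w (h1 w * gauss_char (kap * (X1 w - y))) =
 \int[P2]_w (h2 w * gauss_char (kap * (X2 w - y))))%R.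
have := weighted_char P1 mh1 h10 h1M mX1 kap y.
have := weighted_char P2 mh2 h20 h2M mX2 kap y.
under eq_integral do rewrite -same_mass -same.
by move=> ->; rewrite -same_mass => -[/addrI].
Qed.

Let limit_step d (T : measurableType d) (P : probability T R) (h X : T -> R) cc :
 mfun h -> nonneg h -> (forall w, h w <= M) -> mfun X ->
 (\int[P]_w ((h w)%:E * smooth_step cc n (X w)) @[n --> \oo] -->
  \int[P]_w (h w * ((X w < cc)%R)%:R)%:E)%E.
move=> mh h0 hM mX.
have mlt d' (U : measurableType d') (f g : U -> R) : mfun f -> mfun g ->
  mfun (fun u => ((f u < g u)%R)%:R : R).
 move=> mf mg; have -> : (fun u => ((f u < g u)%R)%:R : R) = (fun u => if (f u < g u)%R then 1 else 0).
  by apply/funext => u; case: ifP.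
 by apply: mfun_if => //; exact: measurable_fun_ltr.
have ms n : mfun (fun w => ((h w)%:E * smooth_step cc n (X w))%E).
 apply: emfunM; first exact: mEFin.
 apply: (@mfun_sprod_F _ _ _ _ _ gam
  (fun z : T * mR => (((X z.1 + (n.+1%:R ^+ 2)^-1 * z.2 < cc - n.+1%:R^-1)%R)%:R : R)%:E)).
  apply: mEFin; apply: mlt => //; apply: mfunD => //.
   exact: (mcomp mX).
  exact: mfunM.
 by move=> z; rewrite lee_fin.
have mlim : mfun (fun w => (h w * ((X w < cc)%R)%:R)%:E).
 by apply: mEFin; apply: mfunM => //; exact: mlt.
have ih : intg P h.
 apply: (@intg_bdd _ _ _ _ _ M) => // w; rewrite ger0_norm //.
have [] // := dominated_convergence (mu := P) measurableT ms mlim _ ih _.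
- apply: aeW => w _.
 have -> : (h w * (X w < cc)%R%:R)%:E = ((h w)%:E * (((X w < cc)%R)%:R : R)%:E)%E by [].
 apply: cvgeZl => //.
 apply/cvge_sub0 => //.
 apply/cvg_abse0P.
 apply: (@squeeze_cvge _ _ _ _ (cst 0%E) _ (fun n : nat => ((gmoment 1 : R) / n.+1%:R ^+ 2)%:E)) => //.
 + near=> n; rewrite abse_ge0 /=; apply: smooth_step_dist => xc.
  near: n; exists (Num.bound `|2 / (cc - X w)|) => // n /= hn.
  apply: ltW; apply: (le_lt_trans (ler_norm _)).
  by apply: (lt_le_trans (archi_boundP (normr_ge0 _))); rewrite ler_nat (leq_trans hn).
 + exact: cvg_cst.
 + apply: cvg_EFin; first by near=> n.
  have -> : (0 : R) = gmoment 1 * 0 by rewrite mulr0.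
  apply: cvgMr.
  have := @cvg_harmonic R; have -> : (fun n : nat => (n.+1%:R ^+ 2)^-1 : R) = (fun n => harmonic n * harmonic n).
   by apply/funext => n; rewrite expr2 invfM.
  by move=> hh; rewrite -[X in _ --> X](mulr0 (0 : R)); exact: cvgM.
- apply: aeW => w n _; rewrite abseM /= ger0_norm //.
 have /andP[s0 s1] := smooth_step_le1 cc n (X w).
 by rewrite gee0_abs // -[leRHS]mule1 lee_wpmul2l // lee_fin.
Unshelve. all: by end_near. Qed.

(** Equal transforms give equal smoothed steps by the inversion above, and dominated convergence
    removes the smoothing. *)
Lemma cos_half_line (cc : R) : (\int[P1]_w (h1 w * ((X1 w < cc)%R)%:R) =
 \int[P2]_w (h2 w * ((X2 w < cc)%R)%:R))%R.
have l1 := @limit_step _ _ P1 h1 X1 cc mh1 h10 h1M mX1.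
have l2 := @limit_step _ _ P2 h2 X2 cc mh2 h20 h2M mX2.
rewrite /Rintegral; congr fine.
apply: (cvg_unique _ l1) => //; suff -> : (fun n => (\int[P1]_w ((h1 w)%:E * smooth_step cc n (X1 w)))%E) =
  (fun n => (\int[P2]_w ((h2 w)%:E * smooth_step cc n (X2 w)))%E) by exact: l2.
apply/funext => n; have e0 : 0 < (n.+1%:R ^+ 2)^-1 :> R by rewrite invr_gt0 exprn_gt0.
rewrite /smooth_step (weighted_step P1 mh1 h10 h1M mX1 _ e0) (weighted_step P2 mh2 h20 h2M mX2 _ e0).
by apply: eq_integral => y _; rewrite same_gauss.
Qed.

End two_weighted.

End law_determination.

Section measurable_big.
Context d (T : measurableType d) {R : realType} (I : Type) (s : seq I) (Q : pred I).
Variable f : I -> T -> R.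
Hypothesis mf : forall i, mfun (f i).

Lemma mfun_sumr : mfun (fun w => \sum_(i <- s | Q i) f i w).
elim: s => [|i r IH]; first by under eq_fun do rewrite big_nil; exact: measurable_cst.
under eq_fun do rewrite big_cons; case: (Q i) => //.
exact: mfunD.
Qed.

Lemma mfun_prodr : mfun (fun w => \prod_(i <- s | Q i) f i w).
elim: s => [|i r IH]; first by under eq_fun do rewrite big_nil; exact: measurable_cst.
under eq_fun do rewrite big_cons; case: (Q i) => //.
exact: mfunM.
Qed.

End measurable_big.

Section cosine_weights.
Context d (T : measurableType d) {R : realType} (P : probability T R).
Variables (h : T -> R) (M : R).
Hypotheses (mh : mfun h) (hM : forall w, `|h w| <= M).

Lemma weight_cos_intg (Y : T -> R) : mfun Y -> intg P (fun w => h w * cos (Y w)).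
move=> mY; apply: (@intg_bdd _ _ _ _ _ M).
 by apply: mfunM => //; exact: mfun_cosr.
move=> w; rewrite normrM -[leRHS]mulr1 ler_pM // ler_norml cos_geN1 cos_le1 //.
Qed.

Lemma weight_cos_product (Y Z : T -> R) : mfun Y -> mfun Z ->
 (\int[P]_w (h w * (1 + cos (Z w)) * cos (Y w)) =
  \int[P]_w (h w * cos (Y w)) + 2^-1 * (\int[P]_w (h w * cos (Y w + Z w))) +
  2^-1 * (\int[P]_w (h w * cos (Y w - Z w))))%R.
move=> mY mZ.
have i0 := weight_cos_intg mY.
have i1 := weight_cos_intg (mfunD mY mZ).
have i2 := weight_cos_intg (mfunB mY mZ).
rewrite -!RintZ // -RintD //; last exact: intgZ.
rewrite -RintD //; [|by apply: intgD => //; exact: intgZ|exact: intgZ].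
apply: eq_Rintegral => w _; rewrite /= cosD cosB; by field.
Qed.

End cosine_weights.

(** * Joint laws of finite families from cosine transforms *)

Section law_equality.
Context {R : realType}.
Notation mR := (measurableTypeR R).
Variable n : nat.

Definition half_or_full (A : set mR) := A = setT \/ exists c : R, A = `]-oo, c[%classic.

(** Mixed tests: the coordinates below m are tested by half-lines through [box_ind], those from m on
    by the cosine of [tail_sum]. *)
Definition box_ind d (T : measurableType d) (X : 'I_n -> T -> R) (A : 'I_n -> set mR) (m : nat) (w : T) : R :=
 \prod_(i < n | (i < m)%N) \1_(A i) (X i w).

Definition tail_sum d (T : measurableType d) (X : 'I_n -> T -> R) (b : 'I_n -> R) (m : nat) (w : T) : R :=
 \sum_(i < n | (m <= i)%N) b i * X i w.

Lemma mfun_half (A : set mR) : half_or_full A -> measurable A.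
by case=> [->|[c ->]]. Qed.

Section one_space.
Context d (T : measurableType d) (X : 'I_n -> T -> R).
Hypothesis mX : forall i, mfun (X i).

Lemma mfun_tail_sum b m : mfun (tail_sum X b m).
by rewrite /tail_sum; apply: mfun_sumr => i; exact: mfunM.
Qed.

Lemma mfun_box_ind A m : (forall i, half_or_full (A i)) -> mfun (box_ind X A m).
move=> hA; rewrite /box_ind; apply: mfun_prodr => i.
by apply: (mcomp _ (mX i)); apply: measurable_indic; exact: mfun_half.
Qed.

Lemma box_ind_ge0 A m w : 0 <= box_ind X A m w.
by apply: prodr_ge0 => i _; rewrite indicE. Qed.

Lemma box_ind_le1 A m w : box_ind X A m w <= 1.
by apply: prodr_ile1 => i _; rewrite indicE; case: (_ \in _); rewrite ?lexx ?ler01. Qed.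

Lemma box_indS A m (lt_mn : (m < n)%N) w :
 box_ind X A m.+1 w = box_ind X A m w * \1_(A (Ordinal lt_mn)) (X (Ordinal lt_mn) w).
rewrite /box_ind (bigD1 (Ordinal lt_mn)) //= mulrC; congr (_ * _).
apply: eq_bigl => i; rewrite ltnS ltn_neqAle -(inj_eq val_inj) /= andbC; by [].
Qed.

Lemma tail_sumS b m (lt_mn : (m < n)%N) w :
 tail_sum X b m w = b (Ordinal lt_mn) * X (Ordinal lt_mn) w + tail_sum X b m.+1 w.
rewrite /tail_sum (bigD1 (Ordinal lt_mn)) //=; congr (_ + _).
apply: eq_bigl => i; rewrite ltn_neqAle andbC -(inj_eq val_inj) /= eq_sym; by [].
Qed.

Lemma box_ind_all A w : box_ind X A n w = \1_[set x : n.-tuple mR | forall i, A i (tnth x i)] (mktuple (fun i => X i w)).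
rewrite indicE /box_ind; case: (boolP (_ \in _)) => [|].
 rewrite inE /= => h; rewrite big1 // => i _.
 by rewrite indicE; have := h i; rewrite tnth_mktuple => hi; rewrite mem_set.
move=> /negP h; apply/eqP; rewrite prodf_seq_eq0; apply/hasP.
have [i hi] : exists i, ~ A i (X i w).
 apply/existsNP => h'; apply: h; rewrite inE /= => i; rewrite tnth_mktuple; exact: h'.
by exists i; [exact: mem_index_enum|rewrite ltn_ord /= indicE memNset].
Qed.

Lemma mfun_mktuple : mfun (fun w => mktuple (fun i => X i w) : n.-tuple mR).
apply/measurable_fun_tnthP => i.
rewrite (_ : _ \o _ = X i); first exact: mX.
by apply/funext => w; rewrite /= tnth_mktuple.
Qed.

End one_space.

Section two_spaces.
Context d1 (T1 : measurableType d1) (P1 : probability T1 R) (X1 : 'I_n -> T1 -> R).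
Context d2 (T2 : measurableType d2) (P2 : probability T2 R) (X2 : 'I_n -> T2 -> R).
Hypotheses (mX1 : forall i, mfun (X1 i)) (mX2 : forall i, mfun (X2 i)).
Hypothesis same : forall (b : 'I_n -> R) (b0 : R),
 (\int[P1]_w cos (\sum_i b i * X1 i w + b0) = \int[P2]_w cos (\sum_i b i * X2 i w + b0))%R.

(** Each induction step exchanges one frequency for a half-line. The one-dimensional result needs
    nonnegative weights, so it is applied to [box_ind] and to [box_ind * (1 + cos Z)], with Z the
    remaining phase; subtraction leaves the signed weight [box_ind * cos Z]. *)
Let claim m A b b0 : (m <= n)%N -> (forall i, half_or_full (A i)) ->
 (\int[P1]_w (box_ind X1 A m w * cos (tail_sum X1 b m w + b0)) =
  \int[P2]_w (box_ind X2 A m w * cos (tail_sum X2 b m w + b0)))%R.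
move=> + hA; elim: m b b0 => [|m IH] b b0 le_mn.
 have e d (T : measurableType d) (P : probability T R) X :
  (\int[P]_w (box_ind X A 0 w * cos (tail_sum X b 0 w + b0)) = \int[P]_w cos (\sum_i b i * X i w + b0))%R.
  by apply: eq_Rintegral => w _; rewrite /box_ind big_pred0 // mul1r.
 by rewrite !e.
pose om := Ordinal le_mn.
have ltmn := ltnW le_mn.
have [Am|[c Am]] := hA om.
 (* A full line corresponds to frequency 0 in that coordinate. *)
 pose b' i := if i == om then 0 else b i.
 have e d (T : measurableType d) (P : probability T R) X :
  (\int[P]_w (box_ind X A m.+1 w * cos (tail_sum X b m.+1 w + b0)) =
   \int[P]_w (box_ind X A m w * cos (tail_sum X b' m w + b0)))%R.
  apply: eq_Rintegral => w _; rewrite (box_indS _ _ le_mn) -/om Am indicT mulr1.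
  rewrite (tail_sumS _ b' le_mn) -/om /b' eqxx mul0r add0r; congr (_ * cos (_ + _)).
  apply: eq_bigr => i im; case: eqP => // iE; move: im; by rewrite iE /= ltnn.
 by rewrite !e; exact: IH.
have mb1 m' := mfun_box_ind mX1 m' hA.
have mb2 m' := mfun_box_ind mX2 m' hA.
have n1 w : `|box_ind X1 A m w| <= 1 by rewrite ger0_norm ?box_ind_ge0 ?box_ind_le1.
have n2 w : `|box_ind X2 A m w| <= 1 by rewrite ger0_norm ?box_ind_ge0 ?box_ind_le1.
pose Z1 w := tail_sum X1 b m.+1 w + b0.
pose Z2 w := tail_sum X2 b m.+1 w + b0.
have mZ1 : mfun Z1 by apply: mfunD => //; exact: mfun_tail_sum.
have mZ2 : mfun Z2 by apply: mfunD => //; exact: mfun_tail_sum.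
have mY d (T : measurableType d) (X : T -> R) a c' : mfun X ->
  mfun (fun w => a * X w + c').
 by move=> mX; apply: mfunD => //; exact: mfunM.
(* The values s = 0, 1, -1 cover the three cosines produced by the product-to-sum formula. *)
have lin (a c' s : R) : (\int[P1]_w (box_ind X1 A m w * cos (a * X1 om w + c' + s * tail_sum X1 b m.+1 w)) =
  \int[P2]_w (box_ind X2 A m w * cos (a * X2 om w + c' + s * tail_sum X2 b m.+1 w)))%R.
 pose b' i := if i == om then a else s * b i.
 have e d (T : measurableType d) (P : probability T R) X :
  (\int[P]_w (box_ind X A m w * cos (a * X om w + c' + s * tail_sum X b m.+1 w)) =
   \int[P]_w (box_ind X A m w * cos (tail_sum X b' m w + c')))%R.
  apply: eq_Rintegral => w _; rewrite (tail_sumS _ b' le_mn) -/om /b' eqxx addrAC; congr (_ * cos (_ + _ + _)).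
  rewrite /tail_sum mulr_sumr; apply: eq_bigr => i im; case: eqP => [iE|_]; last by rewrite mulrA.
  by move: im; rewrite iE /= ltnn.
 by rewrite !e; exact: IH.
have sameA (a c' : R) : (\int[P1]_w (box_ind X1 A m w * cos (a * X1 om w + c')) =
  \int[P2]_w (box_ind X2 A m w * cos (a * X2 om w + c')))%R.
 have := lin a c' 0; under eq_Rintegral do rewrite mul0r addr0.
 by under [X in _ = X -> _]eq_Rintegral do rewrite mul0r addr0.
have sameB (a c' : R) : (\int[P1]_w (box_ind X1 A m w * (1 + cos (Z1 w)) * cos (a * X1 om w + c')) =
  \int[P2]_w (box_ind X2 A m w * (1 + cos (Z2 w)) * cos (a * X2 om w + c')))%R.
 rewrite (weight_cos_product P1 (mb1 m) n1 (mY _ _ _ a c' (mX1 om)) mZ1).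
 rewrite (weight_cos_product P2 (mb2 m) n2 (mY _ _ _ a c' (mX2 om)) mZ2).
 rewrite sameA; congr (_ + _ * _ + _ * _).
  have e1 w : a * X1 om w + c' + Z1 w = a * X1 om w + (c' + b0) + 1 * tail_sum X1 b m.+1 w.
   by rewrite /Z1; ring.
  have e2 w : a * X2 om w + c' + Z2 w = a * X2 om w + (c' + b0) + 1 * tail_sum X2 b m.+1 w.
   by rewrite /Z2; ring.
  under eq_Rintegral do rewrite e1; under [RHS]eq_Rintegral do rewrite e2; exact: lin.
 have e1 w : a * X1 om w + c' - Z1 w = a * X1 om w + (c' - b0) + (-1) * tail_sum X1 b m.+1 w.
  by rewrite /Z1; ring.
 have e2 w : a * X2 om w + c' - Z2 w = a * X2 om w + (c' - b0) + (-1) * tail_sum X2 b m.+1 w.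
  by rewrite /Z2; ring.
 under eq_Rintegral do rewrite e1; under [RHS]eq_Rintegral do rewrite e2; exact: lin.
have cb (x : R) : 0 <= 1 + cos x <= 2.
 by apply/andP; split; have := cos_geN1 x; have := cos_le1 x; lra.
have H1 := cos_half_line (mb1 m) (mb2 m) (box_ind_ge0 X1 A m) (box_ind_ge0 X2 A m)
 (box_ind_le1 X1 A m) (box_ind_le1 X2 A m) (mX1 om) (mX2 om) sameA c.
have mc1 : mfun (fun w => 1 + cos (Z1 w)) by apply: mfunD => //; exact: mfun_cosr.
have mc2 : mfun (fun w => 1 + cos (Z2 w)) by apply: mfunD => //; exact: mfun_cosr.
have H2 := @cos_half_line R _ _ P1 (fun w => box_ind X1 A m w * (1 + cos (Z1 w))) (X1 om)
  _ _ P2 (fun w => box_ind X2 A m w * (1 + cos (Z2 w))) (X2 om) (1 * 2)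
 (mfunM (mb1 m) mc1) (mfunM (mb2 m) mc2).
have {}H2 : (\int[P1]_w (box_ind X1 A m w * (1 + cos (Z1 w)) * ((X1 om w < c)%R)%:R) =
 \int[P2]_w (box_ind X2 A m w * (1 + cos (Z2 w)) * ((X2 om w < c)%R)%:R))%R.
 apply: H2 => //.
 - by move=> w; have /andP[? _] := cb (Z1 w); rewrite mulr_ge0 // box_ind_ge0.
 - by move=> w; have /andP[? _] := cb (Z2 w); rewrite mulr_ge0 // box_ind_ge0.
 - by move=> w; have /andP[? ?] := cb (Z1 w); rewrite ler_pM // ?box_ind_ge0 ?box_ind_le1.
 - by move=> w; have /andP[? ?] := cb (Z2 w); rewrite ler_pM // ?box_ind_ge0 ?box_ind_le1.
have fin d (T : measurableType d) (P : probability T R) X (mX : forall i, mfun (X i)) :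
 (\int[P]_w (box_ind X A m.+1 w * cos (tail_sum X b m.+1 w + b0)) =
  \int[P]_w (box_ind X A m w * (1 + cos (tail_sum X b m.+1 w + b0)) * ((X om w < c)%R)%:R) -
  \int[P]_w (box_ind X A m w * ((X om w < c)%R)%:R))%R.
 have mi : mfun (fun w => ((X om w < c)%R)%:R : R).
  have -> : (fun w => ((X om w < c)%R)%:R : R) = (fun w => if (X om w < c)%R then 1 else 0).
   by apply/funext => w; case: ifP.
  by apply: mfun_if => //; exact: measurable_fun_ltr.
 have mb := mfun_box_ind mX m hA.
 rewrite -RintB.
 - apply: eq_Rintegral => w _; rewrite (box_indS _ _ le_mn) -/om Am indicE.
  have -> : (X om w \in `]-oo, c[%classic) = (X om w < c) by rewrite mem_setE in_itv.
  by ring.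
 - apply: (@intg_bdd _ _ _ _ _ (1 * 2 * 1)).
   do 2 apply: mfunM => //; apply: mfunD => //; apply: mfun_cosr.
   by apply: mfunD => //; exact: mfun_tail_sum.
  move=> w; have /andP[? ?] := cb (tail_sum X b m.+1 w + b0).
  rewrite !normrM ler_pM // ?mulr_ge0 //; last by case: (_ < _); rewrite ?normr1 ?normr0.
  by rewrite ler_pM // ger0_norm ?box_ind_ge0 ?box_ind_le1.
 - apply: (@intg_bdd _ _ _ _ _ (1 * 1)); first exact: mfunM.
  move=> w; rewrite normrM ler_pM //; last by case: (_ < _); rewrite ?normr1 ?normr0.
  by rewrite ger0_norm ?box_ind_ge0 ?box_ind_le1.
by rewrite !fin // H1 H2.
Qed.

Let boxes : set (set (n.-tuple mR)) :=
 [set B | exists A : 'I_n -> set mR, (forall i, half_or_full (A i)) /\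
  B = [set x : n.-tuple mR | forall i, A i (tnth x i)]].

Let boxesI : setI_closed boxes.
move=> _ _ [A [hA ->]] [B [hB ->]]; exists (fun i => A i `&` B i); split.
 move=> i; case: (hA i) => [->|[a ->]]; first by rewrite setTI.
 case: (hB i) => [->|[b ->]]; first by rewrite setIT; right; exists a.
 right; exists (Num.min a b); apply/seteqP; split => x /=; rewrite !in_itv /= lt_min.
  by move=> [-> ->].
 by move=> /andP[].
apply/seteqP; split => x /=; first by move=> [h1 h2] i; split.
by move=> h; split => i; have [] := h i.
Qed.

Let boxes_measurable B : boxes B -> measurable B.
move=> [A [hA ->]].
have -> : [set x : n.-tuple mR | forall i, A i (tnth x i)] =
  \bigcap_(i in setT) ((fun x : n.-tuple mR => tnth x i) @^-1` A i).
 by apply/seteqP; split => x /= h i; [move=> _; exact: h|exact: (h i)].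
apply: fin_bigcap_measurable => [|i _]; first exact: finite_finset.
by rewrite -[X in measurable X]setTI; apply: measurable_tnth => //; exact: mfun_half.
Qed.

Let boxes_gen : @measurable _ (n.-tuple mR) = <<s boxes >>.
apply/seteqP; split; last first.
 by apply: smallest_sub; [exact: sigma_algebra_measurable|move=> B; exact: boxes_measurable].
apply: smallest_sub; first exact: smallest_sigma_algebra.
apply: (big_ind (fun S => S `<=` <<s boxes >>)) => [//|S S' hS hS'|i _]; first by move=> x [/hS|/hS'].
move=> _ [A mA <-]; move: A mA.
have := @sigma_algebra_image _ _ setT (fun x : n.-tuple mR => tnth x i) <<s boxes >>.
rewrite RGenInftyO.measurableE => h; apply: smallest_sub => [|A [c ->]].
 by apply: h; exact: smallest_sigma_algebra.
apply: sub_sigma_algebra; rewrite setTI.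
exists (fun j => if j == i then `]-oo, c[%classic else setT); split.
 by move=> j; case: ifP => _; [right; exists c|left].
apply/seteqP; split => x /= h' => [j|]; first by case: eqP => [->|].
by have := h' i; rewrite eqxx.
Qed.

(** Boxes of half-lines and full lines form a generating pi-system, on which the two laws agree by
    [claim] at m = n. *)
Lemma int_same_law (h : n.-tuple mR -> \bar R) :
 mfun h -> (forall x, 0 <= h x)%E ->
 (\int[P1]_w h (mktuple (fun i => X1 i w)) = \int[P2]_w h (mktuple (fun i => X2 i w)))%E.
move=> mh h0.
pose Y1 w : n.-tuple mR := mktuple (fun i => X1 i w).
pose Y2 w : n.-tuple mR := mktuple (fun i => X2 i w).
have mY1 : mfun Y1 := mfun_mktuple mX1.
have mY2 : mfun Y2 := mfun_mktuple mX2.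
rewrite -[LHS](ge0_integral_pushforward mY1 P1 measurableT mh) // -[RHS](ge0_integral_pushforward mY2 P2 measurableT mh) //.
apply: eq_measure_integral => B mB _.
apply: (@measure_unique _ _ _ boxes (fun=> setT)) => //.
- by move=> _; exists (fun=> setT); split => [i|]; [left|apply/seteqP; split].
- by apply/seteqP; split => // x _; exists 0%N.
- move=> _ [A [hA ->]] /=; set S := [set x | _].
 have mS : measurable S by apply: boxes_measurable; exists A.
 have e d (T : measurableType d) (P : probability T R) (X : 'I_n -> T -> R) (mX : forall i, mfun (X i)) :
   (P ((fun w => mktuple (fun i => X i w) : n.-tuple mR) @^-1` S) =
    (\int[P]_w (box_ind X A n w * cos (tail_sum X (fun=> 0) n w + 0)))%R%:E)%E.
  have mi := mfun_box_ind mX n hA.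
  have -> : (\int[P]_w (box_ind X A n w * cos (tail_sum X (fun=> 0%R) n w + 0)) = \int[P]_w (box_ind X A n w))%R.
   apply: eq_Rintegral => w _; rewrite /tail_sum big1 ?addr0 ?cos0 ?mulr1 // => i; by rewrite mul0r.
  rewrite EFin_Rint; last first.
   by apply: (@intg_bdd _ _ _ _ _ 1) => // w; rewrite ger0_norm ?box_ind_ge0 ?box_ind_le1.
  under eq_integral do rewrite box_ind_all.
  pose Y w : n.-tuple mR := mktuple (fun i => X i w).
  have mYS : measurable (Y @^-1` S).
   by rewrite -[X in measurable X]setTI; exact: mfun_mktuple.
  transitivity (\int[P]_w (\1_(Y @^-1` S) w)%:E)%E; first by rewrite integral_indic // setIT.
  by apply: eq_integral => w _; rewrite !indicE; congr (_%:R%:E); apply/idP/idP; rewrite !inE.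
 by rewrite [LHS](e _ _ P1 X1 mX1) [RHS](e _ _ P2 X2 mX2) claim.
- move=> _; have h1 : (P1 setT < +oo)%E; last exact: h1.
 have -> : (P1 setT < +oo)%E = (1 < +oo :> \bar R)%E by congr (_ < _)%E; exact: probability_setT.
 by rewrite ltry.
Qed.

End two_spaces.
End law_equality.

(** * Finite sums: squares and limits *)

Section sum_of_squares.
Context {R : realType}.

Lemma sqr_sum_le (J : finType) (c : J -> R) : (\sum_m c m) ^+ 2 <= #|J|%:R * \sum_m c m ^+ 2.
have h : 0 <= \sum_m \sum_l (c m - c l) ^+ 2 by do 2 apply: sumr_ge0 => ? _; exact: sqr_ge0.
have e : \sum_m \sum_l (c m - c l) ^+ 2 = 2 * (#|J|%:R * \sum_m c m ^+ 2 - (\sum_m c m) ^+ 2).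
 transitivity (\sum_m (#|J|%:R * c m ^+ 2 + (- (2 * c m) * \sum_l c l) + \sum_l c l ^+ 2)).
  apply: eq_bigr => m _; rewrite -sum1_card natr_sum mulr_suml mulr_sumr -!big_split /=.
  by apply: eq_bigr => l _; ring.
 rewrite !big_split /= -mulr_sumr -mulr_suml sumr_const cardT -cardE -mulr_natl sumrN -mulr_sumr.
 by ring.
by move: h; rewrite e pmulr_rge0 // subr_ge0.
Qed.

Lemma cvg_sumr (J : Type) (s : seq J) (f : J -> nat -> R) (l : J -> R) :
 (forall m, f m n @[n --> \oo] --> l m) ->
 (\sum_(m <- s) f m n) @[n --> \oo] --> \sum_(m <- s) l m.
move=> h; elim: s => [|m s IH].
 by under eq_fun do rewrite big_nil; rewrite big_nil; exact: cvg_cst.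
by under eq_fun do rewrite big_cons; rewrite big_cons; apply: cvgD.
Qed.

End sum_of_squares.

(** * L2 limits of Gaussian families *)

Section gaussian_family_limit.
Context d (T : measurableType d) {R : realType} (P : probability T R) (J : finType).
Variables (G : J -> nat -> T -> R) (Y : J -> T -> R) (K : J -> J -> R).
Hypotheses (gG : forall n (a : J -> R), centered_gaussian P (fun w => \sum_m a m * G m n w))
 (mY : forall m, mfun (Y m)) (cY : forall m, (\int[P]_w ((G m n w - Y m w) ^+ 2)%:E @[n --> \oo] --> 0)%E)
 (cK : forall m l, (\int[P]_w (G m n w * G l n w))%R @[n --> \oo] --> K m l).

Let gG1 m n : centered_gaussian P (G m n).
have := gG n (fun l => (l == m)%:R); congr centered_gaussian.
apply/funext => w; rewrite (bigD1 m) //= eqxx mul1r big1 ?addr0 // => l /negbTE ->.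
by rewrite mul0r.
Qed.

Let mG m n : mfun (G m n). by have [] := gG1 m n. Qed.

Let iGG m l n : intg P (fun w => G m n w * G l n w).
have [i1 _] := gaussian_sq_cos (gG1 m n); have [i2 _] := gaussian_sq_cos (gG1 l n).
apply: (intg_le _ _ (intgD i1 i2)); first exact: mfunM.
move=> w; rewrite [leRHS]ger0_norm ?addr_ge0 ?sqr_ge0 // normrM.
rewrite -(real_normK (num_real (G m n w))) -(real_normK (num_real (G l n w))).
have := sqr_ge0 (`|G m n w| - `|G l n w|); have := normr_ge0 (G m n w); have := normr_ge0 (G l n w); nra.
Qed.

(** A linear combination of the approximants is a centered Gaussian, converges in L2 since the sum
    is finite, and its variance converges to the quadratic form of K. *)
Lemma gaussian_family_limit (b : J -> R) (b0 : R) :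
 (\int[P]_w cos (\sum_m b m * Y m w + b0) =
  cos b0 * expR (- ((\sum_m \sum_l b m * b l * K m l) / 2)))%R.
apply: (gaussian_limit (gG ^~ b)).
- by apply: mfun_sumr => m; exact: mfunM.
- pose B n := (\sum_m ((#|J|%:R * b m ^+ 2)%:E * \int[P]_w ((G m n w - Y m w) ^+ 2)%:E))%E.
 apply: (@squeeze_cvge _ _ _ _ (cst 0%E) _ B).
 + near=> n; apply/andP; split; first by apply: integral_ge0 => w _; rewrite lee_fin sqr_ge0.
  have mD m : mfun (fun w => ((G m n w - Y m w) ^+ 2)%:E).
   by apply: mEFin; apply: mfunX; exact: mfunB.
  have c0 m : 0 <= #|J|%:R * b m ^+ 2 by rewrite mulr_ge0 // sqr_ge0.
  have -> : B n = (\int[P]_w \sum_m ((#|J|%:R * b m ^+ 2)%:E * ((G m n w - Y m w) ^+ 2)%:E))%E.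
   rewrite ge0_integral_sum //.
   * by apply: eq_bigr => m _; rewrite ge0_integralZl //; [move=> w _; rewrite lee_fin sqr_ge0|rewrite lee_fin].
   * by move=> m; exact: mfunZe.
   * by move=> m w _; rewrite -EFinM lee_fin mulr_ge0 // sqr_ge0.
  apply: ge0_le_integral => //.
  * by move=> w _; rewrite lee_fin sqr_ge0.
  * apply: mEFin; apply: mfunX; apply: mfunB; apply: mfun_sumr => m; exact: mfunM.
  * by apply: emeasurable_sum => m; exact: mfunZe.
  move=> w _; rewrite -sumrB; under eq_bigr do rewrite -mulrBr.
  under [X in (_ <= X)%E]eq_bigr do rewrite -EFinM.
  rewrite sumEFin lee_fin; apply: (le_trans (sqr_sum_le _)).
  by rewrite mulr_sumr; apply: ler_sum => m _; rewrite exprMn mulrA.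
 + exact: cvg_cst.
 + have -> : (0 : \bar R) = (\sum_(m : J) 0)%E by rewrite big1.
  apply: cvg_nnesum => [m _|m _]; first by near=> n; apply: mule_ge0; [rewrite lee_fin mulr_ge0 // sqr_ge0|apply: integral_ge0 => w _; rewrite lee_fin sqr_ge0].
  have -> : (0 : \bar R) = ((#|J|%:R * b m ^+ 2)%:E * 0)%E by rewrite mule0.
  by apply: cvgeZl.
- have e n : (\int[P]_w ((\sum_m b m * G m n w) ^+ 2) =
   \sum_m \sum_l b m * b l * \int[P]_w (G m n w * G l n w))%R.
  transitivity (\int[P]_w (\sum_m \sum_l b m * b l * (G m n w * G l n w)))%R.
   apply: eq_Rintegral => w _; rewrite expr2 mulr_suml; apply: eq_bigr => m _.
   by rewrite mulr_sumr; apply: eq_bigr => l _; ring.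
  rewrite Rintegral_sum; last by move=> m; apply: intg_sum => l; exact: intgZ.
  apply: eq_bigr => m _; rewrite Rintegral_sum; last by move=> l; exact: intgZ.
  by apply: eq_bigr => l _; rewrite RintZ.
 under eq_fun do rewrite e.
 apply: cvg_sumr => m; apply: cvg_sumr => l; apply: cvgMr; exact: cK.
Unshelve. all: by end_near. Qed.

End gaussian_family_limit.

(** * Finite-dimensional laws of the mild solution *)

Section mild_solution_law.
Context d (T : measurableType d) {R : realType} (P : probability T R).
Context (k n : nat) (beta : R).
Variables (W : 'I_n -> test_function R k -> T -> R) (v : R -> 'rV[R]_k -> T -> 'rV[R]_n).
Hypotheses (hW : is_noise P beta W) (hv : is_mild_solution P beta W v).
Variable fm : feature_model k beta.
Notation V := (R * 'rV[R]_k)%type.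

Definition Gam (p q : V) : R :=
 (\int[feature_mu k (fm_mu fm)]_e
   (feature (fm_A fm) (fm_kap fm) p e * feature (fm_A fm) (fm_kap fm) q e))%R.

Lemma mild_kernels_finite (j : 'I_n) : kernels_finite k beta.
by move=> [t x] t0; have [_ h _] := hv j x t0. Qed.

Lemma mild_measurable (j : 'I_n) (p : V) : 0 <= p.1 ->
 mfun (fun w => v p.1 p.2 w 0 j).
by move=> t0; have [h _ _] := hv j p.2 t0. Qed.

(** Distinct components are uncorrelated by the noise covariance, whence the case distinction on
    [j m == j l]; inside a component [fm_cvg] identifies the limit covariance. *)
Lemma mild_char N (j : 'I_N -> 'I_n) (p : 'I_N -> V) : (forall m, 0 <= (p m).1) ->
 forall (b : 'I_N -> R) (b0 : R),
 (\int[P]_w cos (\sum_m b m * v (p m).1 (p m).2 w 0 (j m) + b0) =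
  cos b0 * expR (- ((\sum_m \sum_l b m * b l *
   (if j m == j l then Gam (p m) (p l) else 0)) / 2)))%R.
move=> p0 b b0.
have [gW _ cW] := hW.
have H m : exists phi : nat -> test_function R k,
  (noise_inner beta (fun e => phi q e - hk (p m) e) (fun e => phi q e - hk (p m) e))%R
   @[q --> \oo] --> 0%E /\
  (\int[P]_w ((W (j m) (phi q) w - v (p m).1 (p m).2 w 0 (j m)) ^+ 2)%:E @[q --> \oo] --> 0)%E.
 have [_ _ [phi [h1 h2]]] := hv (j m) (p m).2 (p0 m).
 exists phi; split; first exact: h1.
 by move: h2; rewrite unlock.
have [phi hphi] := choice H.
apply: (@gaussian_family_limit _ _ _ P _ (fun m q w => W (j m) (phi m q) w)
 (fun m w => v (p m).1 (p m).2 w 0 (j m))).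
- by move=> q a; exact: (gW N (fun m => (j m, phi m q)) a).
- by move=> m; exact: mild_measurable.
- by move=> m; have [] := hphi m.
move=> m l.
have e q : (\int[P]_w (W (j m) (phi m q) w * W (j l) (phi l q) w))%R =
  fine (if j m == j l then noise_inner beta (phi m q) (phi l q) else 0%E).
 by rewrite -cW unlock.
under eq_fun do rewrite e.
case: eqP => [jml|_]; last exact: cvg_cst.
have fin := mild_kernels_finite (j m).
have [h1 _] := hphi m; have [h2 _] := hphi l.
by have [] := fm_cvg fm fin (p0 m) (p0 l) h1 h2.
Qed.

Definition inc_variance (p q : V) : R := Gam p p - 2 * Gam p q + Gam q q.

Lemma Gam_sym p q : Gam p q = Gam q p.
by apply: eq_Rintegral => e _; rewrite mulrC. Qed.

Lemma increment_char (j : 'I_n) (p q : V) : 0 <= p.1 -> 0 <= q.1 -> forall a b0 : R,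
 (\int[P]_w cos (a * (v p.1 p.2 w 0 j - v q.1 q.2 w 0 j) + b0) =
  cos b0 * expR (- (inc_variance p q * a ^+ 2 / 2)))%R.
move=> p0 q0 a b0.
transitivity (\int[P]_w cos (a * v p.1 p.2 w 0 j + - a * v q.1 q.2 w 0 j + b0))%R.
 by apply: eq_Rintegral => w _; congr (cos (_ + _)); ring.
under eq_Rintegral => w _.
 have -> : a * v p.1 p.2 w 0 j + - a * v q.1 q.2 w 0 j =
  \sum_(m < 2) (if m == ord0 then a else - a) *
   v (if m == ord0 then p else q).1 (if m == ord0 then p else q).2 w 0 j.
  by rewrite !big_ord_recl big_ord0 /= addr0.
 over.
rewrite mild_char; last by move=> m; case: ifP.
have S2 (F : 'I_2 -> R) : \sum_m F m = F ord0 + F (lift ord0 ord0) by rewrite big_ord_recl big_ord1.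
have key (Gm : V -> V -> R) : \sum_(m < 2) \sum_(l < 2)
  (if m == ord0 then a else - a) * (if l == ord0 then a else - a) *
  (if j == j then Gm (if m == ord0 then p else q) (if l == ord0 then p else q) else 0) =
  (Gm p p - Gm p q - Gm q p + Gm q q) * a ^+ 2.
 have l0 : (lift ord0 ord0 == ord0 :> 'I_2) = false by [].
 by rewrite !S2 !eqxx !l0; ring.
have -> : inc_variance p q = Gam p p - Gam p q - Gam q p + Gam q q.
 rewrite /inc_variance (Gam_sym q p); move: (Gam p p) (Gam p q) (Gam q q) => x y z.
 by ring.
by rewrite key.
Qed.

End mild_solution_law.

Lemma inc_var_aux (R : realType) (a b D G M c : R) : b <= a + (D * G + M * (D * c)) ->
 b - 2 * a + b <= 2 * (G + c * M) * D.
by move=> h; rewrite (_ : 2 * (G + c * M) * D = 2 * (D * G + M * (D * c))); [lra|ring]. Qed.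

Lemma indicator_le_aux (R : realType) (b : bool) (x y z : \bar R) : (0 <= z)%E -> (b -> x <= y + z)%E ->
 ((b%:R : R)%:E * x <= (b%:R : R)%:E * y + z)%E.
by case: b => z0 h; rewrite ?mul1e ?mul0e ?add0e //; exact: h. Qed.

(** * Scaling of the covariance and variance of increments *)

Section covariance.
Context {R : realType} (k : nat) (beta : R).
Variable fm : feature_model k beta.
Hypotheses (beta0 : 0 < beta) (beta2 : beta < 2) (kfin : kernels_finite k beta).
Notation mR := (measurableTypeR R).
Notation leb := (@lebesgue_measure R).
Notation V := (R * 'rV[R]_k)%type.
Notation A := (fm_A fm).
Notation kap := (fm_kap fm).
Notation mu := (fm_mu fm).
Notation ft := (feature (fm_A fm) (fm_kap fm)).
Notation FM := (feature_mu k (fm_mu fm)).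
Notation Gam := (Gam fm).

Let mA := fm_measurable fm.
Let A0 := fm_A0 fm.
Let kap0 : 0 < kap := fm_kap0 fm.

(** The noise covariance seen through two heat kernels of total age u and displacement x. [Gam]
    integrates it over the common past of two points. *)
Definition Mfun (u : R) (x : 'rV[R]_k) : \bar R :=
 (\int[mu]_s (kap ^+ 2 * heat_kernel (u + 2 * A s) x)%:E)%E.

Lemma mfun_heat2 d (T : measurableType d) (t : T -> R) (x : 'rV[R]_k) :
 mfun t -> mfun (fun w => heat_kernel (t w) x).
by move=> mt; apply: (mfun_hk mt) => i; exact: measurable_cst. Qed.

Lemma Mfun_ge0 u x : (0 <= Mfun u x)%E.
by apply: integral_ge0 => s _; rewrite lee_fin mulr_ge0 ?hker_ge0 // exprn_ge0 // ltW. Qed.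

Let mM_int (u : R) (x : 'rV[R]_k) : mfun (fun s => (kap ^+ 2 * heat_kernel (u + 2 * A s) x)%:E).
apply: mEFin; apply: mfunM => //; apply: mfun_heat2.
by apply: mfunD => //; exact: mfunM.
Qed.

Lemma mfun_Mfun (f : mR -> R) x : mfun f -> mfun (fun r => Mfun (f r) x).
move=> mf; apply: (@mfun_sprod_F _ _ _ _ _ mu
 (fun z : mR * mR => (kap ^+ 2 * heat_kernel (f z.1 + 2 * A z.2) x)%:E)).
 apply: mEFin; apply: mfunM => //; apply: mfun_heat2.
 apply: mfunD; first exact: (mcomp mf).
 by apply: mfunM => //; exact: (mcomp mA).
by move=> z; rewrite lee_fin mulr_ge0 ?hker_ge0 // exprn_ge0 // ltW.
Qed.

Let mft (p : V) : mfun (ft p) := mfun_feature kap p mA.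
Let ft0 (p : V) e : 0 <= ft p e. by apply: feature_ge0; exact: ltW. Qed.

Lemma Gam_intg (p q : V) : 0 <= p.1 -> 0 <= q.1 -> intg FM (fun e => ft p e * ft q e).
exact: fm_intg. Qed.

Lemma Gam_formula (p q : V) : 0 <= q.1 -> q.1 <= p.1 ->
 ((Gam p q)%:E = \int[leb]_r (((0 <= r < q.1)%R%:R)%:E * Mfun (p.1 + q.1 - 2 * r) (p.2 - q.2)))%E.
move=> q0 qp; rewrite EFin_Rint; last by apply: Gam_intg => //; exact: le_trans qp.
have mF : mfun (fun e => (ft p e * ft q e)%:E).
 by apply: mEFin; exact: (mfunM (mft p) (mft q)).
have F0 e : (0 <= (ft p e * ft q e)%:E)%E by rewrite lee_fin mulr_ge0.
rewrite /feature_mu [LHS](int_sprod _ _ mF F0).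
apply: eq_integral => r _.
have mFr : mfun (fun e => (ft p (r, e) * ft q (r, e))%:E).
 by apply: (mcomp mF); exact: mfun_pair.
rewrite (int_sprod _ _ mFr (fun e => F0 (r, e))).
have [/andP[r0 rq]|rn] := boolP (0 <= r < q.1); last first.
 rewrite mul0e integral0_eq // => s _; rewrite integral0_eq // => w _.
 by rewrite /feature /= (negbTE rn) mulr0.
rewrite mul1e; apply: eq_integral => s _; rewrite /feature /= r0 rq (lt_le_trans rq qp) /=.
have a0 : 0 < p.1 - r + A s by rewrite ltr_wpDr // subr_gt0 (lt_le_trans rq).
have b0 : 0 < q.1 - r + A s by rewrite ltr_wpDr // subr_gt0.
under eq_integral do rewrite mulrACA -expr2 [heat_kernel _ (q.2 - _)]heat_kernelC EFinM.
have k2 : 0 <= kap ^+ 2 by rewrite exprn_ge0 // ltW.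
rewrite ge0_integralZl //.
- rewrite heat_semigroup // EFinM; congr (_ * (heat_kernel _ _)%:E)%E; ring.
- apply: mEFin; apply: mfunM; apply: mfun_hk => // i;
  under eq_fun do rewrite !mxE; apply: mfunB => //; exact: measurable_tnth.
- by move=> w _; rewrite lee_fin mulr_ge0 ?hker_ge0.
Qed.

Lemma heat_kernel0 (t : R) : heat_kernel t (0 : 'rV[R]_k) = (4 * pi * t) `^ (- (k%:R / 2)).
rewrite /heat_kernel sqr_norm big1; last by move=> i _; rewrite mxE expr0n.
by rewrite mul0r oppr0 expR0 mulr1.
Qed.

Lemma heat_kernel0_le (s t : R) : 0 < s -> s <= t ->
 heat_kernel t (0 : 'rV[R]_k) <= heat_kernel s (0 : 'rV[R]_k).
move=> s0 st; rewrite !heat_kernel0 !powRN lef_pV2 ?posrE ?powR_gt0 ?mulr_gt0 ?pi_gt0 //; last exact: lt_le_trans st.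
have p4 : 0 <= 4 * pi :> R by rewrite mulr_ge0 // pi_ge0.
apply: ge0_ler_powR; rewrite ?nnegrE; last by rewrite ler_wpM2l.
- by rewrite divr_ge0.
- by rewrite mulr_ge0 // ltW.
- by rewrite mulr_ge0 // (le_trans (ltW s0)).
Qed.

Lemma Mfun_le s t : 0 < s -> s <= t -> (Mfun t 0 <= Mfun s 0)%E.
move=> s0 st; apply: ge0_le_integral => //.
- by move=> x _; rewrite lee_fin mulr_ge0 ?hker_ge0 // exprn_ge0 // ltW.
move=> x _; rewrite lee_fin ler_wpM2l ?exprn_ge0 ?(ltW kap0) //.
by apply: heat_kernel0_le; [rewrite ltr_wpDr // mulr_ge0|rewrite lerD2r].
Qed.

(** The heat kernel at 0 contributes the exponent -k/2 and the measure of A contributes (k -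
    beta)/2. *)
Lemma Mfun_scale lam u : 0 < lam -> 0 <= u -> (Mfun (lam * u) 0 = (lam `^ (- (beta / 2)))%:E * Mfun u 0)%E.
move=> l0 u0.
pose f (a : R) := (kap ^+ 2 * heat_kernel (lam * u + 2 * a) (0 : 'rV[R]_k))%:E.
have mf : mfun f.
 apply: mEFin; apply: mfunM => //; apply: mfun_heat2.
 by apply: mfunD => //; exact: mfunM.
have f0 a : (0 <= f a)%E by rewrite lee_fin mulr_ge0 ?hker_ge0 // exprn_ge0 // ltW.
have := fm_scale fm l0 mf f0.
have -> : (\int[mu]_s f (lam * A s)%R = (lam `^ (- (k%:R / 2)))%:E * Mfun u 0)%E.
 rewrite /Mfun -ge0_integralZl //; last 2 first.
 - by move=> s _; rewrite lee_fin mulr_ge0 ?hker_ge0 // exprn_ge0 // ltW.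
 - by rewrite lee_fin powR_ge0.
 apply: eq_integral => s _; rewrite /f -EFinM !heat_kernel0; congr EFin; rewrite [RHS]mulrCA; congr (_ * _).
 rewrite -powRM ?(ltW l0) ?mulr_ge0 ?pi_ge0 ?addr_ge0 ?mulr_ge0 //; congr (_ `^ _); ring.
rewrite -/(Mfun (lam * u) 0) => h.
have lp : 0 < lam `^ (- ((k%:R - beta) / 2)) by rewrite powR_gt0.
have -> : Mfun (lam * u) 0 = ((lam `^ (- ((k%:R - beta) / 2)))^-1%:E * ((lam `^ (- ((k%:R - beta) / 2)))%:E * Mfun (lam * u) 0))%E.
 by rewrite muleA -EFinM mulVf ?gt_eqF // mul1e.
rewrite -h muleA -EFinM -powRN -powRD; last by rewrite (gt_eqF l0) implybT.
by congr ((lam `^ _)%:E * _)%E; field.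
Qed.

Definition Gam1 : R := Gam (1, 0) (1, 0).

Lemma Gam1_ge0 : 0 <= Gam1.
by apply: Rintegral_ge0 => e _; rewrite mulr_ge0. Qed.

Let mI (a b : R) : mfun (fun r : mR => (((a <= r < b)%R%:R : R))).
have -> : (fun r : mR => ((a <= r < b)%R%:R : R)) = (fun r => if a <= r < b then 1 else 0).
 by apply/funext => r; case: ifP.
by apply: mfun_if => //; apply: measurable_and; [exact: measurable_fun_ler|exact: measurable_fun_ltr].
Qed.

Lemma Gam_diag_scale (t : R) (x : 'rV[R]_k) : 0 < t -> Gam (t, x) (t, x) = t `^ (1 - beta / 2) * Gam1.
move=> t0; apply: EFin_inj; rewrite EFinM /Gam1 !Gam_formula ?(ltW t0) //= !subrr.
pose F r := (((0 <= r < t)%R%:R)%:E * Mfun (t + t - 2 * r) (0 : 'rV[R]_k))%E.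
have mF : measurable_fun [set: mR] F.
 apply: emfunM; first exact: mEFin.
 by apply: mfun_Mfun; apply: mfunB => //; exact: mfunM.
have F0 r : (0 <= F r)%E by rewrite mule_ge0 ?Mfun_ge0 // lee_fin.
have := int_affine 0 (lt0r_neq0 t0) mF F0.
rewrite (gtr0_norm t0) => h.
have -> : (\int[leb]_r F r = t%:E * \int[leb]_x F (t * x + 0)%R)%E.
 by rewrite h muleA -EFinM divff ?gt_eqF // mul1e.
have -> : (t `^ (1 - beta / 2))%:E = (t%:E * (t `^ (- (beta / 2)))%:E)%E.
 by rewrite -EFinM -{2}(powRr1 (ltW t0)) -powRD // (gt_eqF t0) implybT.
rewrite -muleA; congr (t%:E * _)%E.
pose G r := (((0 <= r < 1)%R%:R)%:E * Mfun (1 + 1 - 2 * r) (0%R : 'rV[R]_k))%E.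
have mG : measurable_fun [set: mR] G.
 apply: emfunM; first exact: mEFin.
 by apply: mfun_Mfun; apply: mfunB => //; exact: mfunM.
have G0 r : (0 <= G r)%E by rewrite mule_ge0 ?Mfun_ge0 // lee_fin.
have c0 : (0 <= (t `^ (- (beta / 2)))%:E)%E by rewrite lee_fin powR_ge0.
apply: (etrans _ (ge0_integralZl leb measurableT mG (fun r _ => G0 r) c0)).
apply: eq_integral => r _; rewrite /F /G addr0 pmulr_rge0 // -[X in _ < X](mulr1 t) ltr_pM2l //.
have [/andP[r0 r1]|_] := boolP (0 <= r < 1); last by rewrite !mul0e mule0.
rewrite !mul1e -Mfun_scale //; last by lra.
by have -> : t + t - 2 * (t * r) = t * (1 + 1 - 2 * r) by ring.
Qed.

Definition Mone : \bar R := Mfun 1 0.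

Lemma Mfun0E (u : R) : 0 < u -> (Mfun u 0 = (u `^ (- (beta / 2)))%:E * Mone)%E.
by move=> u0; rewrite -Mfun_scale // mulr1. Qed.

(** By scaling, an infinite value would make the integrand of the real number [Gam1] infinite on all
    of [0, 1[. *)
Lemma Mone_lty : (Mone < +oo)%E.
have h : (Gam1%:E < +oo)%E by rewrite ltry.
rewrite /Gam1 Gam_formula // subrr /= in h; rewrite ltNge leye_eq; apply/negP => /eqP Moo.
move: h; apply/negP; rewrite -leNgt.
have mlow : measurable_fun [set: mR] (fun r : mR => (((0 <= r < 1)%R%:R)%:E : \bar R)) by exact: mEFin.
suff -> : (\int[leb]_r (((0 <= r < 1)%R%:R)%:E * Mfun (1 + 1 - 2 * r) (0%R : 'rV[R]_k)) =
  \int[leb]_(r in `[0%R, 1%R[) +oo)%E.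
 by rewrite integral_cst //= lebesgue_measure_itv /= lte_fin ltr01 sube0 mule1.
rewrite [RHS]integral_mkcond; apply: eq_integral => r _; rewrite patchE mem_setE in_itv /=.
have [/andP[r0 r1]|_] := boolP (0 <= r < 1); last by rewrite mul0e.
rewrite mul1e Mfun0E; last by lra.
by rewrite Moo mulry gtr0_sg ?powR_gt0 ?mul1e //; lra.
Qed.

Lemma Mone_fin : Mone \is a fin_num.
by rewrite ge0_fin_numE; [exact: Mone_lty|exact: Mfun_ge0]. Qed.

Lemma Mone_ge0e : (0 <= Mone)%E. exact: Mfun_ge0. Qed.

Lemma Mone_ge0 : 0 <= fine Mone.
by apply: fine_ge0; exact: Mfun_ge0. Qed.

(** The variance at time t is split at r = s. Before s the total age drops from 2(t - r) to (t - r)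
    + (s - r), which increases [Mfun] at 0; after s a translation of time by s gives the variance at
    time t - s. *)
Lemma Gam_time (t s : R) (x : 'rV[R]_k) : 0 <= s -> s < t ->
 Gam (t, x) (t, x) <= Gam (t - s, x) (t - s, x) + Gam (t, x) (s, x).
move=> s0 st; have t0 : 0 <= t by exact: le_trans (ltW st).
have d0 : 0 <= t - s by rewrite subr_ge0 ltW.
have e1 := @Gam_formula (t, x) (t, x) t0 (lexx t).
have e2 := @Gam_formula (t - s, x) (t - s, x) d0 (lexx _).
have e3 := @Gam_formula (t, x) (s, x) s0 (ltW st).
rewrite /= !subrr in e1 e2 e3.
move: (Gam (t, x) (t, x)) (Gam (t - s, x) (t - s, x)) (Gam (t, x) (s, x)) e1 e2 e3 => g1 g2 g3 e1 e2 e3.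
rewrite -lee_fin EFinD e1 e2 e3 {e1 e2 e3}.
pose F r := (((0 <= r < t - s)%R%:R)%:E * Mfun (t - s + (t - s) - 2 * r) (0%R : 'rV[R]_k))%E.
have mM a b : measurable_fun [set: mR] (fun r : mR => (((0 <= r < b)%R%:R)%:E * Mfun (a - 2 * r) (0%R : 'rV[R]_k))%E).
 apply: emfunM; first exact: mEFin.
 by apply: mfun_Mfun; apply: mfunB => //; exact: mfunM.
have M0 a b (r : mR) : (0 <= ((0 <= r < b)%R%:R)%:E * Mfun (a - 2 * r) (0%R : 'rV[R]_k))%E.
 by rewrite mule_ge0 ?Mfun_ge0 // lee_fin.
have h := int_affine (- s) (oner_neq0 R) (mM (t - s + (t - s)) (t - s)) (M0 _ _).
rewrite normr1 invr1 mul1e in h; rewrite -h.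
have mh : measurable_fun [set: mR] (fun r : mR => (((0 <= 1 * r + - s < t - s)%R%:R)%:E *
  Mfun (t - s + (t - s) - 2 * (1 * r + - s)) (0%R : 'rV[R]_k))%E).
 have ma : measurable_fun [set: mR] (fun r : mR => (1 * r + - s : mR)).
  by apply: mfunD => //; exact: mfunM.
 exact: (mcomp (mM (t - s + (t - s)) (t - s)) ma).
have hD := @ge0_integralD _ _ R leb setT measurableT _ _
 (fun r _ => M0 (t - s + (t - s)) (t - s) (1 * r + - s)) mh (fun r _ => M0 (t + s) s r) (mM (t + s) s).
rewrite -hD.
apply: ge0_le_integral.
- exact: measurableT.
- by move=> r _; exact: M0.
- exact: mM.
- exact: (emeasurable_funD mh (mM (t + s) s)).
move=> r _; rewrite mul1r subr_ge0 ltrD2r; clear h hD mh mM M0 F.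
have [/andP[r0 rt]|_] := boolP (0 <= r < t); last by rewrite mul0e adde_ge0 // mule_ge0 ?Mfun_ge0 // lee_fin.
rewrite mul1e rt andbT r0 /=; have [rs|sr] := ltP r s.
 by rewrite mul0e add0e mul1e; apply: Mfun_le; lra.
rewrite mul1e mul0e adde0 le_eqVlt; apply/orP; left; apply/eqP.
by have -> : t + t - 2 * r = t - s + (t - s) - 2 * (r - s) by ring.
Qed.

Lemma Gam_diag_mono (t s : R) (x : 'rV[R]_k) : 0 <= s -> s <= t ->
 Gam (s, x) (s, x) <= Gam (t, x) (t, x).
move=> s0; rewrite le_eqVlt => /orP[/eqP->//|st].
have [->|sn] := eqVneq s 0.
 rewrite [leLHS](_ : _ = 0); first by apply: Rintegral_ge0 => e _; rewrite mulr_ge0 // ft0.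
 rewrite /Gam /Rintegral integral0_eq // => e _; rewrite /feature /=.
 by case: (boolP (0 <= e.1)) => e0; rewrite ?mul0r //= ltNge e0 mul0r.
have s1 : 0 < s by rewrite lt0r sn.
rewrite !Gam_diag_scale //; last exact: lt_trans st.
rewrite ler_wpM2r ?Gam1_ge0 //; apply: ge0_ler_powR; rewrite ?nnegrE ?(ltW s1) //; last exact: ltW.
- by rewrite subr_ge0 ler_pdivrMr // mul1r ltW.
- exact/ltW/(lt_trans s1).
Qed.

(** The smaller of the two variances is replaced by the larger one, after which [Gam_time] leaves
    twice the variance at time t - s. *)
Lemma inc_var_time (t s : R) (x : 'rV[R]_k) : 0 <= s -> s < t ->
 inc_variance fm (t, x) (s, x) <= 2 * Gam1 * (t - s) `^ (1 - beta / 2).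
move=> s0 st; have h1 := Gam_time x s0 st; have h2 := Gam_diag_mono x s0 (ltW st).
rewrite (@Gam_diag_scale (t - s)) ?subr_gt0 // in h1; rewrite /inc_variance.
by move: h1 h2; move: (Gam _ _) (Gam _ _) (Gam _ _) => a b c; lra.
Qed.

(** Loss at remaining times sg above delta: the relative loss delta / sg multiplied by the size
    sg^(-beta/2) of the kernel. Its integral is of order delta^(1 - beta/2). *)
Definition far_tail (delta sg : R) : R := (delta <= sg)%R%:R * (delta * sg `^ (- (1 + beta / 2))).

Lemma mfun_far_tail delta : measurable_fun [set: mR] (fun sg : mR => (far_tail delta sg)%:E).
apply: mEFin; apply: mfunM; last by apply: mfunM => //; exact: mfun_powRr.
have -> : (fun sg : mR => (delta <= sg)%R%:R : R) = (fun sg => if delta <= sg then 1 else 0).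
 by apply/funext => r; case: ifP.
by apply: mfun_if => //; exact: measurable_fun_ler.
Qed.

Lemma far_tail_ge0 delta sg : 0 < delta -> 0 <= far_tail delta sg.
by move=> d0; rewrite mulr_ge0 // mulr_ge0 ?powR_ge0 // ltW. Qed.

Lemma integral_far_tail delta : 0 < delta ->
 (\int[leb]_sg (far_tail delta sg)%:E = (delta `^ (1 - beta / 2) * (2 / beta))%:E)%E.
move=> d0.
have h := int_affine 0 (lt0r_neq0 d0) (mfun_far_tail delta) (fun sg => far_tail_ge0 sg d0).
rewrite (gtr0_norm d0) in h.
have -> : (\int[leb]_sg (far_tail delta sg)%:E = delta%:E * \int[leb]_sg (far_tail delta (delta * sg + 0)%R)%:E)%E.
 by rewrite h muleA -EFinM divff ?gt_eqF // mul1e.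
have p1 : 1 < 1 + beta / 2 by rewrite ltrDl divr_gt0.
have := integral_powR_tail p1; rewrite integral_mkcond => ht.
have c0 : (0 <= (delta `^ (- (beta / 2)))%:E)%E by rewrite lee_fin powR_ge0.
transitivity (delta%:E * ((delta `^ (- (beta / 2)))%:E * \int[leb]_x ((fun s : R => (s `^ (- (1 + beta / 2)))%:E) \_ `[1%R, +oo[) x))%E.
 congr (delta%:E * _)%E; rewrite -ge0_integralZl //.
 - apply: eq_integral => r _; rewrite patchE mem_setE in_itv /= andbT /far_tail addr0.
  rewrite -[X in X <= _](mulr1 delta) ler_pM2l //.
  have [r1|_] := leP 1 r; last by rewrite mul0r mule0.
  rewrite mul1r -EFinM; congr EFin; rewrite powRM ?(ltW d0) ?(le_trans ler01) // mulrA; congr (_ * _).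
  rewrite -{1}(powRr1 (ltW d0)) -powRD ?(gt_eqF d0) ?implybT //; congr (_ `^ _); ring.
 - apply/(measurable_restrictT _ (measurable_itv _)); apply: measurable_funTS.
  by apply: mEFin; exact: mfun_powRr.
 - by move=> r _; rewrite patchE; case: ifP => // _; rewrite lee_fin powR_ge0.
rewrite ht -!EFinM; congr EFin; rewrite mulrA; congr (_ * _).
 by rewrite -{1}(powRr1 (ltW d0)) -powRD ?(gt_eqF d0) ?implybT.
by rewrite addrAC subrr add0r invf_div.
Qed.

Lemma Mone_far_tail delta : 0 < delta ->
 ((fine Mone * (delta `^ (1 - beta / 2) * (2 / beta)))%:E = Mone * \int[leb]_sg (far_tail delta sg)%:E)%E.
by move=> d0; rewrite (integral_far_tail d0) EFinM (fineK Mone_fin). Qed.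

Lemma heat_kernel_drop (u : R) (z : 'rV[R]_k) : 0 < u ->
 heat_kernel u (0 : 'rV[R]_k) <= heat_kernel u z + heat_kernel u (0 : 'rV[R]_k) * (euclidean_norm z ^+ 2 / (4 * u)).
move=> u0; rewrite heat_kernel0 /heat_kernel -mulrDr ler_peMr ?powR_ge0 //.
set y := euclidean_norm z ^+ 2 / (4 * u).
by have := expR_ge1Dx (- y); lra.
Qed.

(** The bound 1 - exp(-y) <= y is applied with y = |z|^2 / (4u), where u is at least 2 sg, so y is
    at most delta / sg. *)
Lemma Mfun_near_far (sg delta : R) (z : 'rV[R]_k) : 0 < delta -> euclidean_norm z ^+ 2 <= delta -> delta <= sg ->
 (Mfun (2 * sg) 0 <= Mfun (2 * sg) z + (far_tail delta sg)%:E * Mone)%E.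
move=> d0 zd ds; have s0 : 0 < sg by exact: lt_le_trans ds.
have s20 : 0 < 2 * sg by rewrite mulr_gt0.
apply: (@le_trans _ _ (Mfun (2 * sg) z + (delta / sg)%:E * Mfun (2 * sg) 0)%E).
 have c0 : (0 <= (delta / sg)%:E)%E by rewrite lee_fin divr_ge0 // ltW.
 have k20 : 0 <= kap ^+ 2 by rewrite exprn_ge0 // ltW.
 have h0 u x s : (0 <= (kap ^+ 2 * heat_kernel (u + 2 * A s) (x : 'rV[R]_k))%:E)%E.
  by rewrite lee_fin mulr_ge0 ?hker_ge0.
 have eZ := ge0_integralZl mu measurableT (mM_int (2 * sg) 0) (fun s _ => h0 (2 * sg) 0 s) c0.
 rewrite /Mfun -eZ.
 have eD := ge0_integralD mu measurableT (fun s _ => h0 (2 * sg) z s) (mM_int (2 * sg) z)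
  (fun s _ => mule_ge0 c0 (h0 (2 * sg) 0 s)) (mfunZe (delta / sg)%:E (mM_int (2 * sg) 0)).
 rewrite -eD; apply: ge0_le_integral; first exact: measurableT.
 - by move=> s _; exact: h0.
 - exact: mM_int.
 - by apply: emeasurable_funD; [exact: mM_int|apply: mfunZe; exact: mM_int].
 move=> s _; rewrite -EFinM -EFinD lee_fin.
 have A0s := A0 s.
 have u0 : 0 < 2 * sg + 2 * A s by rewrite ltr_wpDr // mulr_ge0.
 have key : heat_kernel (2 * sg + 2 * A s) (0 : 'rV[R]_k) <=
   heat_kernel (2 * sg + 2 * A s) z + delta / sg * heat_kernel (2 * sg + 2 * A s) (0 : 'rV[R]_k).
  apply: (le_trans (heat_kernel_drop z u0)); rewrite lerD2l mulrC ler_wpM2r ?hker_ge0 //.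
  rewrite ler_pdivrMr ?mulr_gt0 //; apply: (le_trans zd).
  rewrite -mulrA ler_peMr ?(ltW d0) // mulrC ler_pdivlMr // mul1r; lra.
 apply: (le_trans (ler_wpM2l k20 key)).
 by rewrite mulrDr lerD2l mulrCA lexx.
rewrite leeD2l // Mfun0E // muleA -EFinM.
apply: lee_wpmul2r; first exact: Mfun_ge0.
rewrite lee_fin /far_tail ds mul1r -mulrA ler_wpM2l ?(ltW d0) //.
have -> : sg `^ (- (1 + beta / 2)) = sg^-1 * sg `^ (- (beta / 2)).
 by rewrite opprD powRD ?(gt_eqF s0) ?implybT // powR_inv1 // ltW.
rewrite ler_wpM2l ?invr_ge0 ?(ltW s0) //.
rewrite !powRN lef_pV2 ?posrE ?powR_gt0 //; apply: ge0_ler_powR; rewrite ?nnegrE ?(ltW s0) ?(ltW s20) //.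
 by rewrite divr_ge0 // ltW.
lra.
Qed.

Local Opaque Mfun Mone.

(** The spatial loss is split by the remaining time s - r. Below delta the whole kernel is given up,
    at the cost of the variance at time delta; above delta the loss is integrated by [far_tail].
    Both are of order delta^(1 - beta/2). *)
Lemma inc_var_space (s delta : R) (x y : 'rV[R]_k) : 0 <= s -> 0 < delta ->
 euclidean_norm (x - y) ^+ 2 <= delta ->
 inc_variance fm (s, x) (s, y) <= 2 * (Gam1 + 2 / beta * fine Mone) * delta `^ (1 - beta / 2).
move=> s0 d0 zd; set z := x - y in zd.
have e1 := @Gam_formula (s, x) (s, x) s0 (lexx s).
have e2 := @Gam_formula (delta, x) (delta, x) (ltW d0) (lexx _).
have e3 := @Gam_formula (s, x) (s, y) s0 (lexx s).
have e4 := @Gam_formula (s, y) (s, y) s0 (lexx s).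
have e5 := Gam_diag_scale x d0.
rewrite /= !subrr -/z in e1 e2 e3 e4.
have exy : Gam (s, y) (s, y) = Gam (s, x) (s, x) by exact: (EFin_inj (etrans e4 (esym e1))).
have finM := Mone_fin; have m0 := Mone_ge0.
suff : Gam (s, x) (s, x) <= Gam (s, x) (s, y) + (Gam (delta, x) (delta, x) + fine Mone * (delta `^ (1 - beta / 2) * (2 / beta))).
 rewrite /inc_variance exy e5; move: (Gam _ _) (Gam _ _) => a b.
 exact: inc_var_aux.
have e7 : ((fine Mone * (delta `^ (1 - beta / 2) * (2 / beta)))%:E = Mone * \int[leb]_sg (far_tail delta sg)%:E)%E.
 exact: Mone_far_tail.
clear e4 e5 exy.
move: (Gam (s, x) (s, x)) (Gam (delta, x) (delta, x)) (Gam (s, x) (s, y)) (fine Mone * _) e1 e2 e3 e7 => g1 g2 g3 g4 e1 e2 e3 e7.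
rewrite -lee_fin !EFinD e7 e1 e2 e3 {e1 e2 e3 e7}.
have mM (w : 'rV[R]_k) a b c : measurable_fun [set: mR] (fun r : mR => (((a <= r < b)%R%:R)%:E * Mfun (c - 2 * r) w)%E).
 apply: emfunM; first exact: mEFin.
 by apply: mfun_Mfun; apply: mfunB => //; exact: mfunM.
have M0 (w : 'rV[R]_k) a b c (r : mR) : (0 <= ((a <= r < b)%R%:R)%:E * Mfun (c - 2 * r) w)%E.
 by rewrite mule_ge0 ?Mfun_ge0 // lee_fin.
have N0 : (-1 : R) != 0 by rewrite oppr_eq0 oner_neq0.
have h1 := int_affine (delta - s) (oner_neq0 R) (mM 0 0 delta (delta + delta)) (M0 _ _ _ _).
have h2 := int_affine s N0 (mfun_far_tail delta) (fun sg => far_tail_ge0 sg d0).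
rewrite normr1 invr1 mul1e in h1; rewrite normrN1 invr1 mul1e in h2; rewrite -h1 -h2 {h1 h2}.
have mh1 : measurable_fun [set: mR] (fun r : mR => (((0 <= 1 * r + (delta - s) < delta)%R%:R)%:E *
  Mfun (delta + delta - 2 * (1 * r + (delta - s))) (0%R : 'rV[R]_k))%E).
 have ma : measurable_fun [set: mR] (fun r : mR => (1 * r + (delta - s) : mR)).
  by apply: mfunD => //; exact: mfunM.
 exact: (mcomp (mM 0 0 delta (delta + delta)) ma).
have mh2 : measurable_fun [set: mR] (fun r : mR => (far_tail delta (-1 * r + s))%:E).
 have ma : measurable_fun [set: mR] (fun r : mR => (-1 * r + s : mR)).
  by apply: mfunD => //; exact: mfunM.
 exact: (mcomp (mfun_far_tail delta) ma).
have mh3 := mfunZe Mone mh2.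
have p3 r : (0 <= Mone * (far_tail delta (-1 * r + s))%:E)%E by rewrite mule_ge0 ?Mone_ge0e // lee_fin far_tail_ge0.
rewrite -(ge0_integralZl leb measurableT mh2 (k := Mone) (fun r _ => far_tail_ge0 _ d0) Mone_ge0e).
have hD1 := @ge0_integralD _ _ R leb setT measurableT _ _
 (fun r _ => M0 0 0 delta (delta + delta) (1 * r + (delta - s))) mh1 (fun r _ => p3 r) mh3.
rewrite -[X in (_ <= _ + X)%E]hD1.
have p12 r := adde_ge0 (M0 0 0 delta (delta + delta) (1 * r + (delta - s))) (p3 r).
have m12 := emeasurable_funD mh1 mh3.
have hD2 := @ge0_integralD _ _ R leb setT measurableT _ _
 (fun r _ => M0 z 0 s (s + s) r) (mM z 0 s (s + s)) (fun r _ => p12 r) m12.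
rewrite -[X in (_ <= X)%E]hD2.
apply: ge0_le_integral; first exact: measurableT.
- by move=> r _; exact: M0.
- exact: mM.
- exact: (emeasurable_funD (mM z 0 s (s + s)) m12).
move=> r _.
have q1 := M0 0 0 delta (delta + delta) (1 * r + (delta - s)); have q2 := p12 r.
clear hD1 hD2 mh1 mh2 mh3 m12 mM p12.
apply: (indicator_le_aux q2) => /andP[r0 rs].
rewrite (_ : s + s - 2 * r = 2 * (s - r)); last by ring.
have eN : -1 * r + s = s - r by ring.
rewrite eN; have [sd|ds] := leP delta (s - r); last first.
 have -> : (0 <= 1 * r + (delta - s) < delta) = true by apply/andP; split; lra.
 rewrite mul1e (_ : delta + delta - 2 * (1 * r + (delta - s)) = 2 * (s - r)); last by ring.
 apply: (le_trans _ (leeDr _ (Mfun_ge0 _ _))); apply: leeDl.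
 by have := p3 r; rewrite eN.
apply: (le_trans (Mfun_near_far d0 zd sd)); apply: leeD2l; rewrite muleC.
by apply: leeDr; exact: q1.
Qed.

Lemma fm_mass_scale (rho : R) : 0 < rho ->
 mu [set s | (A s <= rho)%R] = ((rho `^ ((k%:R - beta) / 2))%:E * mu [set s | (A s <= 1)%R])%E.
move=> r0.
have mle (c : R) : measurable [set s | A s <= c].
 by rewrite -[X in measurable X]setTI; apply: (measurable_fun_ler (f := A) (g := cst c)).
pose f (a : R) : \bar R := ((a <= rho)%R%:R)%:E.
have mf : mfun f.
 apply: mEFin; have -> : (fun a : R => (a <= rho)%R%:R : R) = (fun a => if a <= rho then 1 else 0).
  by apply/funext => r; case: ifP.
 by apply: mfun_if => //; exact: measurable_fun_ler.
have f0 a : (0 <= f a)%E by rewrite lee_fin.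
have e (c : R) (g : mR -> R) : (forall s, (g s <= rho) = (A s <= c)) -> (\int[mu]_s f (g s) = mu [set s | (A s <= c)%R])%E.
 move=> hg; rewrite -[RHS]mul1e -integral_cst // [RHS]integral_mkcond.
 apply: eq_integral => s _; rewrite patchE /f hg; case: leP => h; first by rewrite mem_set.
 by rewrite memNset //=; apply/negP; rewrite -ltNge.
have h := fm_scale fm r0 mf f0.
rewrite (e 1 (fun s => rho * A s)) in h; last by move=> s; rewrite -[X in _ <= X](mulr1 rho) ler_pM2l.
rewrite (e rho A) // in h; rewrite h muleA -EFinM -powRD ?subrr ?powRr0 ?mul1e //.
by rewrite (gt_eqF r0) implybT.
Qed.

End covariance.

(** * Ramps: caloric elements of the Cameron-Martin space *)

Section ramps.
Context {R : realType} (k : nat) (beta : R).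
Variable fm : feature_model k beta.
Hypothesis kfin : kernels_finite k beta.
Notation mR := (measurableTypeR R).
Notation leb := (@lebesgue_measure R).
Notation V := (R * 'rV[R]_k)%type.
Notation A := (fm_A fm).
Notation kap := (fm_kap fm).
Notation mu := (fm_mu fm).
Notation ft := (feature (fm_A fm) (fm_kap fm)).
Notation FM := (feature_mu k (fm_mu fm)).
Variables (t0 rho a l : R) (x0 : 'rV[R]_k).
Hypotheses (rho0 : 0 < rho) (l0 : 0 < l) (a0 : 0 <= a) (at0 : t0 <= a).

(** The heat kernel issued from [x0] at time [t0 - 2 * rho], a solution of the heat equation of age
    at least 2 rho from time t0 on. *)
Definition caloric (p : V) : R := heat_kernel (p.1 - t0 + 2 * rho) (p.2 - x0).

Definition ramp_weight (s : mR) : R := (A s <= rho)%R%:R.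

(** The kernel is younger by [A] because a feature is older by [A]: the two cancel in the pairing.
    The cut-off [A <= rho] keeps its age at least rho. *)
Definition ramp_source (e : mR * (mR * k.-tuple mR)) : R :=
 (a <= e.1 < a + l)%R%:R * ramp_weight e.2.1 *
 heat_kernel (e.1 - t0 + 2 * rho - A e.2.1) (rowt e.2.2 - x0).

Let mA := fm_measurable fm.
Let A0 := fm_A0 fm.
Let kap0 : 0 < kap := fm_kap0 fm.

Let mI (b c : R) : mfun (fun r : mR => (((b <= r < c)%R%:R : R))).
have -> : (fun r : mR => ((b <= r < c)%R%:R : R)) = (fun r => if b <= r < c then 1 else 0).
 by apply/funext => r; case: ifP.
by apply: mfun_if => //; apply: measurable_and; [exact: measurable_fun_ler|exact: measurable_fun_ltr].
Qed.

Let mW : mfun ramp_weight.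
have -> : ramp_weight = (fun s => if A s <= rho then 1 else 0) by apply/funext => r; rewrite /ramp_weight; case: ifP.
by apply: mfun_if => //; exact: measurable_fun_ler.
Qed.

Lemma mfun_ramp_source : mfun ramp_source.
have mAe : mfun (fun e : mR * (mR * k.-tuple mR) => A e.2.1).
 exact: (mcomp mA (mcomp mfst msnd)).
apply: mfunM.
 apply: mfunM; first exact: (mcomp (mI a (a + l)) mfst).
 exact: (mcomp mW (mcomp mfst msnd)).
apply: mfun_hk.
 by apply: mfunB => //; apply: mfunD => //; exact: mfunB.
move=> i; under eq_fun do rewrite !mxE.
apply: mfunB => //.
exact: (mcomp (measurable_tnth i) (mcomp msnd msnd)).
Qed.

Lemma ramp_source_ge0 e : 0 <= ramp_source e.
by apply: mulr_ge0; [apply: mulr_ge0; exact: ler0n|exact: hker_ge0].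
Qed.

Definition ramp_mass : R := fine (mu [set s | (A s <= rho)%R]).

Lemma ramp_mass_ge0 : 0 <= ramp_mass. exact: fine_ge0. Qed.

Let W0 s : (0 <= (ramp_weight s)%:E)%E. by rewrite lee_fin. Qed.

Hypothesis mass_fin : (mu [set s | (A s <= rho)%R] < +oo)%E.

Lemma ramp_mass_integral : (\int[mu]_s (ramp_weight s)%:E = ramp_mass%:E)%E.
rewrite fineK ?ge0_fin_numE // -[RHS]mul1e -integral_cst //; last first.
 by rewrite -[X in measurable X]setTI; apply: (measurable_fun_ler (f := A) (g := cst rho)).
rewrite [RHS]integral_mkcond; apply: eq_integral => s _; rewrite patchE /ramp_weight.
case: leP => h; first by rewrite mem_set.
by rewrite memNset //=; apply/negP; rewrite -ltNge.
Qed.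

Lemma interval_length : (\int[leb]_r ((a <= r < a + l)%R%:R)%:E = l%:E)%E.
have := lebesgue_measure_itv `[a, (a + l)[ => /=; rewrite lte_fin ltrDl l0 -EFinB addrAC subrr add0r => h.
rewrite -h -[RHS]mul1e -integral_cst // [RHS]integral_mkcond.
apply: eq_integral => r _; rewrite patchE mem_setE in_itv /=.
by case: ifP.
Qed.

Let I0 r : (0 <= ((a <= r < a + l)%R%:R)%:E :> \bar R)%E. by rewrite lee_fin. Qed.

(** By the semigroup law every source time before p.1 contributes the same value [caloric p]. The
    pairing thus grows linearly while p.1 crosses the window, which explains the name and the
    exclusion of points inside. *)
Lemma ramp_pairing (p : V) : 0 <= p.1 -> (p.1 <= a \/ a + l <= p.1) ->
 (\int[FM]_e (ft p e * ramp_source e)%:E =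
  (kap * ramp_mass * l * ((a + l <= p.1)%R%:R * caloric p))%:E)%E.
move=> p0 hp.
have mF : mfun (fun e => (ft p e * ramp_source e)%:E).
 by apply: mEFin; exact: (mfunM (mfun_feature kap p mA) mfun_ramp_source).
have F0 e : (0 <= (ft p e * ramp_source e)%:E)%E.
 by rewrite lee_fin mulr_ge0 ?ramp_source_ge0 // feature_ge0 // ltW.
rewrite /feature_mu [LHS](int_sprod _ _ mF F0).
have K0 : 0 <= (a + l <= p.1)%R%:R * (kap * ramp_mass * caloric p).
 apply: mulr_ge0; first exact: ler0n.
 by apply: mulr_ge0; [apply: mulr_ge0; [exact: ltW|exact: ramp_mass_ge0]|exact: hker_ge0].
transitivity (\int[leb]_r (((a + l <= p.1)%R%:R * (kap * ramp_mass * caloric p))%:E * ((a <= r < a + l)%R%:R)%:E))%E; last first.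
 rewrite (ge0_integralZl leb measurableT (mEFin (mI a (a + l))) (fun r _ => I0 r) (k := ((a + l <= p.1)%R%:R * (kap * ramp_mass * caloric p))%:E) K0).
 by rewrite interval_length -EFinM; congr EFin; ring.
apply: eq_integral => r _.
have mFr : mfun (fun e => (ft p (r, e) * ramp_source (r, e))%:E).
 by apply: (mcomp mF); exact: mfun_pair.
rewrite (int_sprod _ _ mFr (fun e => F0 (r, e))).
have zero : ((a + l <= p.1) && (a <= r < a + l)) = false ->
  (\int[mu]_s \int[lebesgue_tuple R k]_w (ft p (r, (s, w)) * ramp_source (r, (s, w)))%:E = 0)%E.
 move=> hf; rewrite integral0_eq // => s _; rewrite integral0_eq // => w _.
 rewrite /feature /ramp_source /=; case: (boolP (a <= r < a + l)) => [/andP[ar rl]|_]; last by rewrite !mul0r mulr0.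
 case: hp => hp; last by move: hf; rewrite hp ar rl.
 by rewrite [r < p.1]ltNge (le_trans hp ar) andbF mul0r.
case: (boolP ((a + l <= p.1) && (a <= r < a + l))) => [/andP[hl /andP[ar rl]]|hn]; last first.
 rewrite zero; last exact: negbTE.
 by move: hn; rewrite negb_and => /orP[/negbTE->|/negbTE->]; rewrite ?mul0r ?mul0e ?mule0.
rewrite hl ar rl mul1r mule1.
have r0 : 0 <= r by exact: le_trans ar.
have rp : r < p.1 by exact: lt_le_trans hl.
transitivity (\int[mu]_s ((kap * caloric p)%:E * (ramp_weight s)%:E))%E; last first.
 have kc0 : 0 <= kap * caloric p by rewrite mulr_ge0 ?hker_ge0 // ltW.
 rewrite (ge0_integralZl mu measurableT (mEFin mW) (fun s _ => W0 s) (k := (kap * caloric p)%:E) kc0).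
 by rewrite ramp_mass_integral -EFinM; congr EFin; ring.
apply: eq_integral => s _.
have [As|nAs] := boolP (A s <= rho); last first.
 by rewrite /ramp_source /ramp_weight /= (negbTE nAs) mule0 integral0_eq // => w _; rewrite mulr0 mul0r mulr0.
rewrite /feature /ramp_source /ramp_weight /= r0 rp ar rl As /=.
have u0 : 0 < p.1 - r + A s by rewrite ltr_wpDr ?A0 // subr_gt0.
have w0 : 0 < r - t0 + 2 * rho - A s.
 have -> : r - t0 + 2 * rho - A s = (r - t0) + rho + (rho - A s) by ring.
 by apply: ltr_wpDr; rewrite ?subr_ge0 // ltr_wpDl // subr_ge0 (le_trans at0).
rewrite mule1; under eq_integral do rewrite !mul1r -mulrA EFinM.
rewrite ge0_integralZl //=.
- rewrite heat_semigroup // -EFinM /caloric; congr (_ * heat_kernel _ _)%:E; ring.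
- apply: mEFin; apply: mfunM; apply: mfun_hk => // i;
  under eq_fun do rewrite !mxE; apply: mfunB => //; exact: measurable_tnth.
- by move=> w _; rewrite lee_fin mulr_ge0 ?hker_ge0.
- by rewrite lee_fin ltW.
Qed.

(** The kernels in the source have age at least rho, so each has squared norm at most the kernel of
    age 2 rho at 0. *)
Lemma ramp_energy : (\int[FM]_e (ramp_source e ^+ 2)%:E <=
 (l * ramp_mass * heat_kernel (2 * rho) (0 : 'rV[R]_k))%:E)%E.
have mF : mfun (fun e => (ramp_source e ^+ 2)%:E).
 by apply: mEFin; apply: mfunX; exact: mfun_ramp_source.
have F0 e : (0 <= (ramp_source e ^+ 2)%:E)%E by rewrite lee_fin sqr_ge0.
rewrite /feature_mu [leLHS](int_sprod _ _ mF F0).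
set h := heat_kernel _ _; have h0 : 0 <= h by exact: hker_ge0.
have m0 : 0 <= ramp_mass by exact: fine_ge0.
have -> : (l * ramp_mass * h)%:E = (\int[leb]_r ((ramp_mass * h)%:E * ((a <= r < a + l)%R%:R)%:E))%E.
 have mh0 : 0 <= ramp_mass * h by rewrite mulr_ge0.
 rewrite (ge0_integralZl leb measurableT (mEFin (mI a (a + l))) (fun r _ => I0 r) (k := (ramp_mass * h)%:E) mh0).
 by rewrite interval_length -EFinM; congr EFin; ring.
apply: ge0_le_integral; first exact: measurableT.
- by move=> r _; apply: integral_ge0 => e _; exact: F0.
- exact: (mfun_sprod_F _ mF F0).
- by apply: emfunM => //; exact: mEFin.
move=> r _.
have mFr : mfun (fun e => (ramp_source (r, e) ^+ 2)%:E).
 by apply: (mcomp mF); exact: mfun_pair.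
rewrite (int_sprod _ _ mFr (fun e => F0 (r, e))).
have [/andP[ar rl]|hn] := boolP (a <= r < a + l); last first.
 rewrite mule0 integral0_eq // => s _; rewrite integral0_eq // => w _.
 by rewrite /ramp_source /= (negbTE hn) !mul0r expr0n.
rewrite mule1.
have -> : (ramp_mass * h)%:E = (\int[mu]_s (h%:E * (ramp_weight s)%:E))%E.
 rewrite (ge0_integralZl mu measurableT (mEFin mW) (fun s _ => W0 s) (k := h%:E) h0).
 by rewrite ramp_mass_integral -EFinM mulrC.
apply: ge0_le_integral; first exact: measurableT.
- by move=> s _; apply: integral_ge0 => w _; exact: (F0 (r, (s, w))).
- exact: (mfun_sprod_F _ mFr (fun e => F0 (r, e))).
- by apply: emfunM => //; exact: mEFin.
move=> s _; have [As|nAs] := boolP (A s <= rho); last first.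
 rewrite /ramp_source /ramp_weight /= (negbTE nAs) mule0 integral0_eq // => w _.
 by rewrite mulr0 mul0r expr0n.
have -> : ramp_weight s = 1 by rewrite /ramp_weight As.
rewrite mule1.
have w0 : rho <= r - t0 + 2 * rho - A s.
 have -> : r - t0 + 2 * rho - A s = rho + ((r - t0) + (rho - A s)) by ring.
 by rewrite lerDl addr_ge0 // subr_ge0 // (le_trans at0).
under eq_integral.
 move=> w _; rewrite /ramp_source /ramp_weight /= As ar rl /= !mul1r expr2.
 rewrite [X in (X * _)]heat_kernelC; over.
rewrite heat_semigroup ?(lt_le_trans rho0) // subrr lee_fin.
by apply: heat_kernel0_le; [rewrite mulr_gt0|lra].
Qed.

(** Cauchy-Schwarz in feature space between a combination of features and the source. It says that
    the ramp belongs to the reproducing kernel Hilbert space of [Gam], with squared norm at most the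
    factor in front of the double sum. *)
Lemma ramp_inequality (n : nat) (p : 'I_n -> V) (b : 'I_n -> R) : 0 < ramp_mass ->
 (forall i, 0 <= (p i).1) -> (forall i, (p i).1 <= a \/ a + l <= (p i).1) ->
 (\sum_i b i * ((a + l <= (p i).1)%R%:R * caloric (p i))) ^+ 2 <=
 heat_kernel (2 * rho) (0 : 'rV[R]_k) / (l * ramp_mass * kap ^+ 2) *
 \sum_i \sum_j b i * b j * Gam fm (p i) (p j).
move=> m0 p0 hp.
pose S := \sum_i b i * ((a + l <= (p i).1)%R%:R * caloric (p i)); rewrite -/S; set Q := (X in _ <= _ * X); set H := heat_kernel _ _.
have mft (q : V) := mfun_feature kap q mA.
have iff_ i j : intg FM (fun e => ft (p i) e * ft (p j) e) by apply: Gam_intg.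
have ipsi i : intg FM (fun e => ft (p i) e * ramp_source e).
 apply: intg_ge0P; first exact: (mfunM (mft (p i)) mfun_ramp_source).
  by move=> e; rewrite mulr_ge0 ?ramp_source_ge0 // feature_ge0 // ltW.
 by rewrite ramp_pairing // ltry.
have i2 : intg FM (fun e => ramp_source e ^+ 2).
 apply: intg_ge0P; first by apply: mfunX; exact: mfun_ramp_source.
  by move=> e; exact: sqr_ge0.
 by apply: (le_lt_trans ramp_energy); rewrite ltry.
have e2 : (\int[FM]_e (ramp_source e ^+ 2) <= l * ramp_mass * H)%R.
 by rewrite -lee_fin EFin_Rint //; exact: ramp_energy.
pose g e := \sum_i b i * ft (p i) e.
have gg e : g e ^+ 2 = \sum_i \sum_j b i * b j * (ft (p i) e * ft (p j) e).
 rewrite expr2 mulr_suml; apply: eq_bigr => i _; rewrite mulr_sumr; apply: eq_bigr => j _; ring.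
have gp e : g e * ramp_source e = \sum_i b i * (ft (p i) e * ramp_source e).
 by rewrite mulr_suml; apply: eq_bigr => i _; rewrite mulrA.
have igg : intg FM (fun e => g e ^+ 2).
 by under eq_fun do rewrite gg; apply: intg_sum => i; apply: intg_sum => j; exact: intgZ.
have igp : intg FM (fun e => g e * ramp_source e).
 by under eq_fun do rewrite gp; apply: intg_sum => i; exact: intgZ.
have QE : (\int[FM]_e (g e ^+ 2))%R = Q.
 under eq_Rintegral do rewrite gg.
 rewrite Rintegral_sum; last by move=> i; apply: intg_sum => j; exact: intgZ.
 apply: eq_bigr => i _; rewrite Rintegral_sum; last by move=> j; exact: intgZ.
 by apply: eq_bigr => j _; exact: (RintegralZl (b i * b j) measurableT (iff_ i j)).
have SE : (\int[FM]_e (g e * ramp_source e))%R = kap * ramp_mass * l * S.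
 under eq_Rintegral do rewrite gp.
 rewrite Rintegral_sum; last by move=> i; exact: intgZ.
 rewrite /S mulr_sumr; apply: eq_bigr => i _; rewrite (RintegralZl (b i) measurableT (ipsi i)).
 have -> : (\int[FM]_e (ft (p i) e * ramp_source e))%R = kap * ramp_mass * l * ((a + l <= (p i).1)%R%:R * caloric (p i)).
  by apply: EFin_inj; rewrite EFin_Rint // ramp_pairing.
 by rewrite mulrCA.
have E0 : 0 <= (\int[FM]_e (ramp_source e ^+ 2))%R by apply: Rintegral_ge0 => e _; exact: sqr_ge0.
have cs : (kap * ramp_mass * l * S) ^+ 2 <= Q * (\int[FM]_e (ramp_source e ^+ 2))%R.
 rewrite -SE -QE; apply: quadratic_discriminant => // t.
 have -> : ((\int[FM]_e (g e ^+ 2)) + 2 * t * (\int[FM]_e (g e * ramp_source e)) +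
   t ^+ 2 * (\int[FM]_e (ramp_source e ^+ 2)) = \int[FM]_e ((g e + t * ramp_source e) ^+ 2))%R.
  rewrite -RintegralZl // -RintegralZl // -RintegralD //; last exact: intgZ.
  rewrite -RintegralD //; [|by apply: intgD => //; exact: intgZ|exact: intgZ].
  apply: eq_Rintegral => e _; ring.
 by apply: Rintegral_ge0 => e _; exact: sqr_ge0.
have Q0 : 0 <= Q by rewrite -QE; apply: Rintegral_ge0 => e _; exact: sqr_ge0.
have c0 : 0 < kap * ramp_mass * l by rewrite !mulr_gt0.
have h3 := le_trans cs (ler_wpM2l Q0 e2).
rewrite exprMn in h3; rewrite -(ler_pM2l (exprn_gt0 2 c0)); apply: (le_trans h3).
rewrite le_eqVlt; apply/orP; left; apply/eqP; field.
by rewrite !gt_eqF.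
Qed.

End ramps.

(** * Probabilities with a density *)

Section density_probability.
Context d (T : measurableType d) {R : realType} (mu : {measure set T -> \bar R}) (g : T -> R).
Hypotheses (mg : mfun g) (g0 : nonneg g) (g1 : (\int[mu]_x (g x)%:E = 1)%E).

Lemma density_probability : exists Q : probability T R, forall f : T -> \bar R,
 mfun f -> (forall x, 0 <= f x)%E ->
 (\int[Q]_x f x = \int[mu]_x ((g x)%:E * f x))%E.
pose q (A : set T) := (\int[mu]_(x in A) (g x)%:E)%E.
have ig : mu.-integrable setT (EFin \o g) by apply: intg_ge0P => //; rewrite g1 ltry.
have q0 : q set0 = 0%E by rewrite /q integral_set0.
have qge0 A : (0 <= q A)%E by apply: integral_ge0 => x _; rewrite lee_fin.
have qs : semi_sigma_additive q.
 move=> A mA tA mUA; rewrite /q integral_bigcup //; last exact: (integrableS _ _ (subsetT _)).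
 apply: is_cvg_ereal_nneg_natsum_cond => n _ _.
 by apply: integral_ge0 => x _; rewrite lee_fin.
pose qm : {measure set T -> \bar R} := HB.pack q (isMeasure.Build _ _ _ q q0 qge0 qs).
have qm1 : qm setT = 1%E := g1.
pose Q : probability T R := HB.pack q (isMeasure.Build _ _ _ q q0 qge0 qs) (Measure_isProbability.Build _ _ _ qm qm1).
by exists Q => f mf f0; apply: int_density.
Qed.

End density_probability.

(** * Gaussian vectors with independent coordinates *)

Section gaussian_vectors.
Context {R : realType}.
Notation mR := (measurableTypeR R).
Notation leb := (@lebesgue_measure R).
Notation gam := (normal_prob (0 : R) 1).
Notation c := (gmoment (R := R) 1).

Definition npdf k (tau : R) (x : k.-tuple mR) : R := \prod_(i < k) normal_pdf 0 tau (tnth x i).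

Lemma mfun_npdf k tau : mfun (@npdf k tau).
apply: mfun_prodr => i.
exact: (mcomp (measurable_normal_pdf 0 tau) (measurable_tnth i)).
Qed.

Lemma npdf_ge0 k tau x : 0 <= @npdf k tau x.
by apply: prodr_ge0 => i _; exact: normal_pdf_ge0. Qed.

Lemma integral_npdf k tau : (\int[lebesgue_tuple R k]_x (npdf tau x)%:E = 1)%E.
rewrite (int_tuple_prod (g := fun=> normal_pdf 0 tau)).
- by rewrite big1 // => i _; exact: integral_normal_pdf.
- by move=> i; exact: measurable_normal_pdf.
- by move=> i x; exact: normal_pdf_ge0.
Qed.

Lemma normal_pdf_cos (tau b b0 : R) : tau != 0 ->
 (\int[leb]_x (normal_pdf 0 tau x * (1 + cos (b * x + b0)))%:E =
  (1 + cos b0 * expR (- (c * tau ^+ 2 * b ^+ 2 / 2)))%:E)%E.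
move=> t0.
have mf : measurable_fun [set: mR] (fun x : mR => (1 + cos (b * x + b0))%:E).
 apply: mEFin; apply: mfunD => //; apply: mfun_cosr.
 by apply: mfunD => //; exact: mfunM.
have f0 (x : mR) : (0 <= (1 + cos (b * x + b0))%:E)%E by rewrite lee_fin -lerBlDl sub0r cos_geN1.
transitivity (\int[normal_prob 0 tau]_x (1 + cos (b * x + b0))%:E)%E.
 rewrite (int_density (measurable_normal_pdf 0 tau) (normal_pdf_ge0 0 tau) (mu := leb) (m := normal_prob 0 tau)) //.
transitivity (\int[gam]_x (1 + cos (b * (tau * x) + b0))%:E)%E.
 have ms : measurable_fun [set: mR] (fun x : mR => (tau * x)%R : mR) by exact: mfunM.
 transitivity (\int[pushforward gam (fun x : mR => (tau * x)%R : mR)]_x (1 + cos (b * x + b0))%:E)%E.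
  by apply: eq_measure_integral => A mA _; exact: normal_prob_scale.
 by rewrite ge0_integral_pushforward.
have i1 := intg_gauss_cos (b * tau) b0.
have ic := intg_cst gam 1.
under eq_integral do rewrite mulrA.
rewrite -EFin_Rint; last exact: intgD.
rewrite RintD // Rint_cst gauss_cos_shift gauss_charE.
suff -> : c * (b * tau) ^+ 2 = c * tau ^+ 2 * b ^+ 2 by [].
by rewrite exprMn; ring.
Qed.

Lemma npdf_cos k (tau : R) (b : 'I_k -> R) (b0 : R) : tau != 0 ->
 (\int[lebesgue_tuple R k]_x (npdf tau x * (1 + cos (\sum_i b i * tnth x i + b0)))%:E =
  (1 + cos b0 * expR (- (c * tau ^+ 2 * (\sum_i b i ^+ 2) / 2)))%:E)%E.
move=> t0; elim: k b b0 => [|k IH] b b0.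
 rewrite int_tuple0; last first.
  apply: mEFin; apply: mfunM; first exact: mfun_npdf.
  apply: mfunD => //; apply: mfun_cosr; apply: mfunD => //.
  by apply: mfun_sumr => i; apply: mfunM => //; exact: measurable_tnth.
 by rewrite /npdf !big_ord0 mulr0 mul0r oppr0 expR0 mul1r mulr1 add0r.
have mF n (b' : 'I_n -> R) (b0' : R) : mfun (fun x : n.-tuple mR =>
  (npdf tau x * (1 + cos (\sum_i b' i * tnth x i + b0')))%:E).
 apply: mEFin; apply: mfunM; first exact: mfun_npdf.
 apply: mfunD => //; apply: mfun_cosr; apply: mfunD => //.
 by apply: mfun_sumr => i; apply: mfunM => //; exact: measurable_tnth.
have F0 n (b' : 'I_n -> R) (b0' : R) (x : n.-tuple mR) : (0 <= (npdf tau x * (1 + cos (\sum_i b' i * tnth x i + b0')))%:E)%E.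
 by rewrite lee_fin mulr_ge0 ?npdf_ge0 // -lerBlDl sub0r cos_geN1.
rewrite int_tupleS //.
set K := c * tau ^+ 2; pose b' i := b (lift ord0 i).
have inner (a : mR) : (\int[lebesgue_tuple R k]_x (npdf tau [tuple of a :: x] *
  (1 + cos (\sum_i b i * tnth [tuple of a :: x] i + b0)))%:E =
  (normal_pdf 0 tau a * (1 + cos (b ord0 * a + b0) * expR (- (K * (\sum_i b' i ^+ 2) / 2))))%:E)%E.
 have := IH b' (b ord0 * a + b0).
 have pa : (0 <= (normal_pdf 0 tau a)%:E)%E by rewrite lee_fin normal_pdf_ge0.
 rewrite EFinM => <-; rewrite -(ge0_integralZl _ measurableT (mF k b' (b ord0 * a + b0)) (fun x _ => F0 _ _ _ x) pa).
 apply: eq_integral => x _; rewrite -EFinM /npdf !big_ord_recl tnth0 -mulrA.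
 congr (_ * (_ * (1 + cos _)))%:E.
  by apply: eq_bigr => i _; rewrite tnthS.
 rewrite -addrA addrCA; congr (_ + _).
 by apply: eq_bigr => i _; rewrite tnthS.
under eq_integral do rewrite inner.
set E := expR _.
have E01 : 0 <= E <= 1.
 rewrite expR_ge0 /= -[leRHS]expR0 ler_expR oppr_le0; apply: divr_ge0 => //.
 apply: mulr_ge0; first by apply: mulr_ge0; [exact: gauss_moment_ge0|exact: sqr_ge0].
 by apply: sumr_ge0 => i _; exact: sqr_ge0.
have /andP[Ege0 Ele1] := E01.
(* A convex combination, since 0 <= E <= 1: both parts stay nonnegative and the second has the
   one-dimensional form. *)
have e (a : mR) : ((normal_pdf 0 tau a * (1 + cos (b ord0 * a + b0) * E))%:E =
  (1 - E)%:E * (normal_pdf 0 tau a)%:E + E%:E * (normal_pdf 0 tau a * (1 + cos (b ord0 * a + b0)))%:E)%E.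
 by rewrite -!EFinM -EFinD; congr EFin; ring.
under eq_integral do rewrite e.
have m1 : measurable_fun [set: mR] (fun a : mR => (normal_pdf 0 tau a)%:E).
 by apply: mEFin; exact: measurable_normal_pdf.
have m2 : measurable_fun [set: mR] (fun a : mR => (normal_pdf 0 tau a * (1 + cos (b ord0 * a + b0)))%:E).
 apply: mEFin; apply: mfunM; first exact: measurable_normal_pdf.
 apply: mfunD => //; apply: mfun_cosr; apply: mfunD => //.
have p1 (a : mR) : (0 <= (normal_pdf 0 tau a)%:E)%E by rewrite lee_fin normal_pdf_ge0.
have p2 (a : mR) : (0 <= (normal_pdf 0 tau a * (1 + cos (b ord0 * a + b0)))%:E)%E.
 by rewrite lee_fin mulr_ge0 ?normal_pdf_ge0 // -lerBlDl sub0r cos_geN1.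
have c1 : (0 <= (1 - E)%:E)%E by rewrite lee_fin subr_ge0.
have c2 : (0 <= E%:E)%E by rewrite lee_fin.
have hD := @ge0_integralD _ _ R leb setT measurableT _ _ (fun a _ => mule_ge0 c1 (p1 a))
 (mfunZe (1 - E)%:E m1) (fun a _ => mule_ge0 c2 (p2 a)) (mfunZe E%:E m2).
apply: (etrans hD).
rewrite (ge0_integralZl leb measurableT m1 (fun a _ => p1 a) c1).
rewrite (ge0_integralZl leb measurableT m2 (fun a _ => p2 a) c2).
rewrite integral_normal_pdf normal_pdf_cos // mule1 -EFinM -EFinD; congr EFin.
rewrite mulrDr mulr1 addrA subrK; congr (1 + _).
rewrite mulrCA -expRD; congr (_ * expR _).
by rewrite big_ord_recl /E /K /b'; ring.
Qed.

End gaussian_vectors.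

(** * Resampling a Gaussian family along a Cameron-Martin direction *)

Section resampling.
Context d (T : measurableType d) {R : realType} (P : probability T R) (D n : nat).
Notation mR := (measurableTypeR R).
Notation c := (gmoment (R := R) 1).
Notation J := ('I_D * 'I_n)%type.
Variable V : 'I_D -> 'I_n -> T -> R.
Variable Gm : 'M[R]_n.
Hypotheses (mV : forall j i, mfun (V j i)) (Gsym : Gm^T = Gm).

Definition qform (b : 'I_n -> R) : R := \sum_i \sum_l b i * b l * Gm i l.

Hypothesis Vchar : forall (b : J -> R) (b0 : R),
 (\int[P]_w cos (\sum_x b x * V x.1 x.2 w + b0) =
  cos b0 * expR (- ((\sum_j qform (fun i => b (j, i))) / 2)))%R.
Variables (e b1 : 'I_n -> R) (A : R).
Hypotheses (eA : forall b, (\sum_i b i * e i) ^+ 2 <= A * qform b) (A0 : 0 < A) (b1e : \sum_i b1 i * e i != 0).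

Lemma qformE (b : 'I_n -> R) : qform b = ((\row_i b i) *m Gm *m (\row_i b i)^T) 0 0.
rewrite /qform exchange_big mxE /=; apply: eq_bigr => l _; rewrite !mxE mulr_suml.
by apply: eq_bigr => i _; rewrite !mxE mulrAC.
Qed.

Lemma qform_ge0 b : 0 <= qform b.
by rewrite -(pmulr_rge0 _ A0); apply: le_trans (eA b); exact: sqr_ge0. Qed.

(** A vector b with Gm b = 0 has zero quadratic form, so [eA] forces b . e = 0. Hence e lies in the
    row space of Gm. *)
Lemma shift_in_range : exists a : 'rV[R]_n, a *m Gm = \row_i e i.
suff /submxP[a ->] : (\row_i e i <= Gm)%MS by exists a.
rewrite submxE; apply/eqP/matrixP => i j; rewrite mxE [RHS]mxE.
pose b l := cokermx Gm l j.
suff : (\sum_l b l * e l) ^+ 2 <= 0.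
 rewrite real_exprn_even_le0 ?num_real //= => /eqP h; rewrite -[RHS]h.
 by apply: eq_bigr => l _; rewrite [X in X * _]mxE mulrC.
apply: (le_trans (eA b)); rewrite qformE -mulmxA.
have -> : Gm *m (\row_i b i)^T = 0.
 have -> : (\row_i b i)^T = col j (cokermx Gm) by apply/matrixP => x y; rewrite [LHS]mxE [LHS]mxE [RHS]mxE.
 by rewrite colE mulmxA mulmx_coker mul0mx.
by rewrite mulmx0 mxE mulr0.
Qed.

(** With e = a Gm, the number S = a . e is the squared Cameron-Martin norm of e, and al = a / S is
    the functional of least variance s = 1 / S among those with al . e = 1. Testing minimality on b1
    bounds s from above, and [eA] on a bounds it from below. The last clause is the Pythagorean
    identity for V = (V - e eta) + e eta with eta = al . V. *)
Lemma resample_coefficients : exists (al : 'I_n -> R) (s : R),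
 [/\ 0 < s, A^-1 <= s, s <= qform b1 / (\sum_i b1 i * e i) ^+ 2,
   \sum_i al i * e i = 1 &
   forall b, qform (fun i => b i - (\sum_l b l * e l) * al i) + s * (\sum_l b l * e l) ^+ 2 = qform b].
have [a aE] := shift_in_range.
pose S := \sum_i a 0 i * e i.
have aG l : \sum_i a 0 i * Gm i l = e l.
 by move/matrixP: aE => /(_ 0 l); rewrite !mxE.
have aG' l : \sum_i a 0 i * Gm l i = e l.
 by rewrite -aG; apply: eq_bigr => i _; rewrite -[Gm in LHS]Gsym mxE.
have exp (b : 'I_n -> R) (t : R) : qform (fun i => b i + t * a 0 i) =
  qform b + 2 * t * (\sum_l b l * e l) + t ^+ 2 * S.
 have -> : qform (fun i => b i + t * a 0 i) = \sum_i \sum_l (b i * b l * Gm i l +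
   (t * (b l * (a 0 i * Gm i l)) + (t * (b i * (a 0 l * Gm i l)) + t ^+ 2 * (a 0 l * (a 0 i * Gm i l))))).
  by apply: eq_bigr => i _; apply: eq_bigr => l _; ring.
 under eq_bigr do rewrite !big_split /=.
 rewrite !big_split /= -/(qform b) -!addrA; congr (_ + _).
 have -> : \sum_i \sum_l t * (b l * (a 0 i * Gm i l)) = t * \sum_l b l * e l.
  rewrite exchange_big mulr_sumr; apply: eq_bigr => l _ /=.
  by rewrite -aG !mulr_sumr; apply: eq_bigr => i _.
 have -> : \sum_i \sum_l t * (b i * (a 0 l * Gm i l)) = t * \sum_l b l * e l.
  rewrite mulr_sumr; apply: eq_bigr => i _ /=.
  by rewrite -aG' !mulr_sumr; apply: eq_bigr => l _.
 have -> : \sum_i \sum_l t ^+ 2 * (a 0 l * (a 0 i * Gm i l)) = t ^+ 2 * S.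
  rewrite exchange_big mulr_sumr; apply: eq_bigr => l _ /=.
  by rewrite -aG !mulr_sumr; apply: eq_bigr => i _.
 by rewrite addrA -mulr2n -[2 * t * _]mulrA mulr_natl.
have Sa : qform (a 0) = S.
 have := exp (fun=> 0) 1; rewrite expr1n mul1r mulr1 big1 ?mulr0 ?addr0; last by move=> i _; rewrite mul0r.
 have -> : qform (fun=> 0) = 0 by rewrite /qform big1 // => i _; rewrite big1 // => l _; rewrite !mul0r.
 rewrite add0r => <-; rewrite /qform; apply: eq_bigr => i _; apply: eq_bigr => l _.
 by rewrite !add0r !mul1r.
have S0 : 0 <= S by rewrite -Sa qform_ge0.
have cs (b : 'I_n -> R) : (\sum_i b i * e i) ^+ 2 <= qform b * S.
 apply: quadratic_discriminant => // t; rewrite -exp; exact: qform_ge0.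
have b20 : 0 < (\sum_i b1 i * e i) ^+ 2 by rewrite exprn_even_gt0.
have Sp : 0 < S.
 rewrite lt0r S0 andbT; apply/eqP => Sz; have := cs b1.
 by rewrite Sz mulr0 leNgt b20.
exists (fun i => a 0 i / S), S^-1; split.
- by rewrite invr_gt0.
- rewrite lef_pV2 ?posrE //; have := eA (a 0); rewrite -/S Sa expr2.
 by rewrite ler_pM2r.
- by rewrite ler_pdivlMr // ler_pdivrMl // mulrC.
- by under eq_bigr do rewrite mulrAC; rewrite -mulr_suml -/S divff // gt_eqF.
move=> b; set t := \sum_l b l * e l.
have -> : qform (fun i => b i - t * (a 0 i / S)) = qform (fun i => b i + (- t / S) * a 0 i).
 by apply: eq_bigr => i _; apply: eq_bigr => l _; congr (_ * _ * _); field; rewrite gt_eqF.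
by rewrite exp -/t; field; rewrite gt_eqF.
Qed.

Definition unpack (x : #|{: J}|.-tuple mR) : 'I_D -> 'I_n -> R :=
 fun j i => tnth x (enum_rank (j, i)).

(* V = Z + e eta with eta independent of Z = V - e eta, eta having D
  independent centered Gaussian coordinates. *)
Lemma resampling : exists (al : 'I_n -> R) (tau : R),
 [/\ 0 < tau, A^-1 <= c * tau ^+ 2, c * tau ^+ 2 <= qform b1 / (\sum_i b1 i * e i) ^+ 2,
   \sum_i al i * e i = 1 &
   forall h : ('I_D -> 'I_n -> R) -> \bar R,
    mfun (fun x => h (unpack x)) -> (forall x, 0 <= h x)%E ->
    (\int[P]_w h (fun j i => V j i w) =
     \int[P]_w \int[lebesgue_tuple R D]_x ((npdf tau x)%:E *
      h (fun j i => V j i w + e i * (tnth x j - \sum_l al l * V j l w))%R))%E].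
have [al [s [s0 sA sb al1 hal]]] := resample_coefficients.
have c0 := @gmoment1_gt0 R.
(* Gives each coordinate of [npdf tau] the variance s. *)
pose tau := Num.sqrt (s / c).
have ctau : c * tau ^+ 2 = s by rewrite sqr_sqrtr ?divr_ge0 ?(ltW s0) ?(ltW c0) // mulrCA divff ?mulr1 // gt_eqF.
have tau0 : 0 < tau by rewrite sqrtr_gt0 divr_gt0.
exists al, tau; rewrite ctau; split => // h mh h0.
have [Q hQ] := density_probability (@mfun_npdf R D tau) (@npdf_ge0 R D tau) (@integral_npdf R D tau).
pose N := #|{: J}|.
pose ev (m : 'I_N) : J := enum_val m.
pose X1 (m : 'I_N) (w : T) : R := V (ev m).1 (ev m).2 w.
pose Y (x : J) (z : T * D.-tuple mR) : R :=
 V x.1 x.2 z.1 + e x.2 * (tnth z.2 x.1 - \sum_l al l * V x.1 l z.1).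
pose X2 (m : 'I_N) (z : T * D.-tuple mR) : R := Y (ev m) z.
have mY x : mfun (Y x).
 have mVf j i : mfun (fun z : T * D.-tuple mR => V j i z.1) by exact: (mcomp (mV j i) mfst).
 apply: mfunD => //; apply: mfunM => //; apply: mfunB.
  exact: (mcomp (measurable_tnth x.1) msnd).
 by apply: mfun_sumr => l; exact: mfunM.
have same (b : 'I_N -> R) (b0 : R) :
 (\int[P]_w cos (\sum_m b m * X1 m w + b0) =
  \int[(P \x Q)%E]_z cos (\sum_m b m * X2 m z + b0))%R.
 pose b' (x : J) := b (enum_rank x).
 have reidx (F : J -> R) : \sum_(m < N) b m * F (ev m) = \sum_x b' x * F x.
  rewrite (reindex (fun x : J => enum_rank x)) /=; last first.
   exists (fun m => enum_val m) => x _; [exact: enum_rankK|exact: enum_valK].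
  by apply: eq_bigr => x _; rewrite /b' /ev enum_rankK.
 under eq_Rintegral do rewrite (reidx (fun x => V x.1 x.2 _)).
 under [RHS]eq_Rintegral do rewrite (reidx (fun x => Y x _)).
 rewrite Vchar.
 have sumJ (F : J -> R) : \sum_x F x = \sum_j \sum_i F (j, i).
  by rewrite pair_bigA; apply: eq_bigr => -[].
 (* After substitution of the resampled field, [be] are the frequencies seen by the fresh Gaussian
    and [b2] those seen by V. *)
 pose be j := \sum_i b' (j, i) * e i.
 pose b2 (x : J) := b' x - be x.1 * al x.2.
 pose L (w : T) := \sum_x b2 x * V x.1 x.2 w + b0.
 have YE w x : \sum_y b' y * Y y (w, x) + b0 = \sum_j be j * tnth x j + L w.
  rewrite /L addrA; congr (_ + _).
  rewrite !sumJ -big_split /=; apply: eq_bigr => j _.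
  have -> : \sum_i b2 (j, i) * V j i w = \sum_i b' (j, i) * V j i w - be j * \sum_i al i * V j i w.
   rewrite mulr_sumr -sumrB; apply: eq_bigr => i _; rewrite /b2 /=; ring.
  set SS := \sum_i al i * V j i w.
  have -> : be j * tnth x j + (\sum_i b' (j, i) * V j i w - be j * SS) = \sum_i b' (j, i) * V j i w + be j * (tnth x j - SS) by ring.
  rewrite /be mulr_suml -big_split /=; apply: eq_bigr => i _; rewrite /Y /= -/SS; ring.
 pose K := expR (- (c * tau ^+ 2 * (\sum_j be j ^+ 2) / 2)).
 have mL : mfun L.
  by apply: mfunD => //; apply: mfun_sumr => x; exact: mfunM.
 have mS : mfun (fun z => \sum_y b' y * Y y z + b0).
  by apply: mfunD => //; apply: mfun_sumr => x; exact: mfunM.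
 have icos d' (U : measurableType d') (Pr : probability U R) (f : U -> R) : mfun f -> intg Pr (fun z => cos (f z)).
  move=> mf; apply: (@intg_bdd _ _ _ _ _ 1); first exact: mfun_cosr.
  by move=> z; rewrite ler_norml cos_geN1 cos_le1.
 have m1 : mfun (fun z => (1 + cos (\sum_y b' y * Y y z + b0))%:E).
  by apply: mEFin; apply: mfunD => //; exact: mfun_cosr.
 have p1 (r : R) : (0 <= (1 + cos r)%:E)%E by rewrite lee_fin -lerBlDl sub0r cos_geN1.
 have key : (\int[(P \x Q)%E]_z (1 + cos (\sum_y b' y * Y y z + b0))%:E = \int[P]_w (1 + K * cos (L w))%:E)%E.
  rewrite fubini_tonelli1 //; apply: eq_integral => w _; rewrite /fubini_F.
  rewrite hQ; last 2 first.
  - by apply: (mcomp m1); exact: mfun_pair.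
  - by move=> x; exact: p1.
  under eq_integral do rewrite -EFinM YE.
  by rewrite npdf_cos ?gt_eqF // mulrC.
 have iK : intg P (fun w => K * cos (L w)) by apply: intgZ; exact: icos.
 have i1 := intg_cst P 1; have i2 := intg_cst (P \x Q)%E 1.
 have iS := icos _ _ (P \x Q)%E _ mS.
 move: key; rewrite -!EFin_Rint; [|exact: intgD|exact: intgD].
 rewrite !RintD // !Rint_cst => -[/addrI ->].
 rewrite RintZ; last exact: icos.
 have -> : (\int[P]_w cos (L w))%R = cos b0 * expR (- ((\sum_j qform (fun i => b2 (j, i))) / 2)) by exact: Vchar.
 rewrite mulrCA -expRD; congr (_ * expR _).
 rewrite ctau -opprD -mulrDl mulr_sumr -big_split /=; congr (- (_ / _)).
 by apply: eq_bigr => j _; rewrite -(hal (fun i => b' (j, i))) addrC.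
have unpackE (f : J -> R) : unpack (mktuple (fun m => f (ev m))) = fun j i => f (j, i).
 by apply/funext => j; apply/funext => i; rewrite /unpack tnth_mktuple /ev enum_rankK.
have mX1 m : mfun (X1 m) by exact: mV.
have mX2 m : mfun (X2 m) by exact: mY.
have := int_same_law mX1 mX2 same mh (fun x => h0 _).
under eq_integral do rewrite (unpackE (fun x => V x.1 x.2 _)).
move=> ->; under eq_integral do rewrite (unpackE (fun x => Y x _)).
have mhY : mfun (fun z => h (fun j i => Y (j, i) z)).
 have := mcomp mh (mfun_mktuple mX2).
 by congr (measurable_fun _ _); apply/funext => z; rewrite /= (unpackE (fun x => Y x z)).
rewrite fubini_tonelli1 //; apply: eq_integral => w _; rewrite /fubini_F hQ //.
by apply: (mcomp mhY); exact: mfun_pair.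
Qed.

End resampling.

(** * Integrals of nonnegative real functions *)

Section nonnegative_integrals.
Context d (T : measurableType d) {R : realType} (mu : {measure set T -> \bar R}).
Implicit Types f g : T -> R.

Lemma nn_int_ge0 f : nonneg f -> (0 <= \int[mu]_x (f x)%:E)%E.
by move=> f0; apply: integral_ge0 => x _; rewrite lee_fin. Qed.

Lemma nn_intZ f k : mfun f -> nonneg f -> 0 <= k ->
 (\int[mu]_x (k * f x)%:E = k%:E * \int[mu]_x (f x)%:E)%E.
move=> mf f0 k0; rewrite -ge0_integralZl //; first exact: mEFin.
by move=> x _; rewrite lee_fin.
Qed.

Lemma nn_intD f g : mfun f -> mfun g ->
 nonneg f -> nonneg g ->
 (\int[mu]_x (f x + g x)%:E = \int[mu]_x (f x)%:E + \int[mu]_x (g x)%:E)%E.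
move=> mf mg f0 g0; rewrite -ge0_integralD //; try exact: mEFin.
 by move=> x _; rewrite lee_fin.
by move=> x _; rewrite lee_fin.
Qed.

Lemma nn_int_le f g : mfun f -> mfun g ->
 nonneg f -> (forall x, f x <= g x) ->
 (\int[mu]_x (f x)%:E <= \int[mu]_x (g x)%:E)%E.
move=> mf mg f0 fg; apply: ge0_le_integral => //; try exact: mEFin.
- by move=> x _; rewrite lee_fin.
- by move=> x _; rewrite lee_fin.
Qed.

Lemma nn_int_sum (I : Type) (s : seq I) (Q : pred I) (f : I -> T -> R) :
 (forall i, mfun (f i)) -> (forall i x, 0 <= f i x) ->
 (\int[mu]_x (\sum_(i <- s | Q i) f i x)%:E = \sum_(i <- s | Q i) \int[mu]_x (f i x)%:E)%E.
move=> mf f0; elim: s => [|i s IH].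
 by rewrite big_nil; under eq_integral do rewrite big_nil; rewrite integral0.
rewrite big_cons; under eq_integral do rewrite big_cons; case: (Q i) => //.
rewrite nn_intD ?IH // => [|x]; first exact: mfun_sumr.
exact: sumr_ge0.
Qed.

Lemma nn_int_cst (k : R) : (\int[mu]_x k%:E = k%:E * mu setT)%E.
exact: integral_cst. Qed.

(* Cauchy-Schwarz in the form N <= (s 1_{N > 0} + N^2 / s) / 2. *)
Lemma nn_int_support f g s : mfun f -> mfun g ->
 nonneg f -> nonneg g -> (forall x, f x != 0 -> 1 <= g x) -> 0 < s ->
 (2%:E * \int[mu]_x (f x)%:E <= s%:E * \int[mu]_x (g x)%:E + s^-1%:E * \int[mu]_x (f x ^+ 2)%:E)%E.
move=> mf mg f0 g0 fg s0; have s1 : 0 <= s^-1 by rewrite invr_ge0 ltW.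
have mf2 : mfun (fun x => f x ^+ 2) by exact: mfunX.
have f20 x : 0 <= f x ^+ 2 by exact: sqr_ge0.
rewrite -(nn_intZ mf f0) // -(nn_intZ mg g0 (ltW s0)) -(nn_intZ mf2 f20 s1).
rewrite -nn_intD; [|exact: mfunM|exact: mfunM|by move=> x; rewrite mulr_ge0 // ltW|by move=> x; rewrite mulr_ge0].
apply: nn_int_le => [||x|x]; [exact: mfunM| |by rewrite mulr_ge0|].
 by apply: mfunD; exact: mfunM.
have [->|fn] := eqVneq (f x) 0; first by rewrite mulr0 expr0n mulr0 addr0 mulr_ge0 // ltW.
apply: (@le_trans _ _ (s + s^-1 * f x ^+ 2)); last first.
 by rewrite lerD2r -[leLHS]mulr1 ler_wpM2l ?fg // ltW.
rewrite -subr_ge0.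
have -> : s + s^-1 * f x ^+ 2 - 2 * f x = s^-1 * (s - f x) ^+ 2 by field; rewrite gt_eqF.
exact: mulr_ge0 s1 (sqr_ge0 _).
Qed.

End nonnegative_integrals.

(** * Measurable indicators of finite conditions *)

Section indicators.
Context d (T : measurableType d) {R : realType}.

Lemma natr_forall (I : finType) (b : pred I) : ([forall i, b i]%:R : R) = \prod_i (b i)%:R.
case: forallP => [h|/forallP].
 by rewrite big1 // => i _; rewrite h.
by rewrite negb_forall => /existsP[i /negbTE bi]; rewrite (bigD1 i) //= bi mul0r.
Qed.

Lemma natr_exists (I : finType) (b : pred I) : ([exists i, b i]%:R : R) = 1 - \prod_i (1 - (b i)%:R).
case: existsP => [[i bi]|h'].
 by rewrite (bigD1 i) //= bi subrr mul0r subr0.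
have h i : ~~ b i by apply/negP => bi; apply: h'; exists i.
 rewrite big1 ?subrr // => i _.
by rewrite (negbTE (h i)) subr0.
Qed.

Lemma mfun_natr_lt (f g : T -> R) : mfun f -> mfun g ->
 mfun (fun x => ((f x < g x)%R%:R : R)).
move=> mf mg; have -> : (fun x => ((f x < g x)%R%:R : R)) = (fun x => if f x < g x then 1 else 0).
 by apply/funext => x; case: ifP.
by apply: mfun_if => //; exact: measurable_fun_ltr.
Qed.

Lemma mfun_natr_le (f g : T -> R) : mfun f -> mfun g ->
 mfun (fun x => ((f x <= g x)%R%:R : R)).
move=> mf mg; have -> : (fun x => ((f x <= g x)%R%:R : R)) = (fun x => if f x <= g x then 1 else 0).
 by apply/funext => x; case: ifP.
by apply: mfun_if => //; exact: measurable_fun_ler.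
Qed.

Lemma mfun_natr_forall (I : finType) (b : I -> T -> bool) :
 (forall i, mfun (fun x => ((b i x)%:R : R))) ->
 mfun (fun x => ([forall i, b i x]%:R : R)).
by move=> mb; under eq_fun do rewrite natr_forall; exact: mfun_prodr. Qed.

Lemma mfun_natr_exists (I : finType) (b : I -> T -> bool) :
 (forall i, mfun (fun x => ((b i x)%:R : R))) ->
 mfun (fun x => ([exists i, b i x]%:R : R)).
move=> mb; under eq_fun do rewrite natr_exists.
by apply: mfunB => //; apply: mfun_prodr => i; exact: mfunB.
Qed.

Lemma mfun_natr_and (a b : T -> bool) :
 mfun (fun x => ((a x)%:R : R)) -> mfun (fun x => ((b x)%:R : R)) ->
 mfun (fun x => ((a x && b x)%:R : R)).
move=> ma mb; have -> : (fun x => ((a x && b x)%:R : R)) = (fun x => (a x)%:R * (b x)%:R).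
 by apply/funext => x; rewrite -natrM mulnb.
exact: mfunM.
Qed.

End indicators.

(** * Hitting indicators and their average over shifts *)

Section hitting.
Context {R : realType} (D n : nat).
Notation mR := (measurableTypeR R).
Notation vec := (D.-tuple mR).
Notation lam := (lebesgue_tuple R D).
Notation conf := ('I_D -> 'I_n -> R).
Implicit Types (S w : pred 'I_n) (X : conf) (x y : 'I_D -> R) (K : R).

Variables (g : 'I_n -> R) (eps : R).

Definition shifted_hit S X y x : bool :=
 [exists i, S i && [forall j, `|X j i - y j + g i * x j| < eps]].

Definition inbox K x : bool := [forall j, `|x j| <= K].

(** The volume of the shifts in a box of size K that bring the image of S near y. As a function of y
    it is spread over the range of the shifts, so that images of different sub-cells overlap. *)
Definition shifted_fuzz S K X y : R :=
 fine (\int[lam]_x ((inbox K (tnth x))%:R * (shifted_hit S X y (tnth x))%:R)%:E)%E.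

Lemma inboxD K K' x x' : inbox K x -> inbox K' x' -> inbox (K + K') (fun j => x j + x' j).
move=> /forallP h /forallP h'; apply/forallP => j.
by apply: (le_trans (ler_normD _ _)); exact: lerD.
Qed.

Section measurability.
Context d (U : measurableType d).

Lemma mfun_hit S (X : 'I_D -> 'I_n -> U -> R) (y x : 'I_D -> U -> R) :
 (forall j i, mfun (X j i)) -> (forall j, mfun (y j)) ->
 (forall j, mfun (x j)) ->
 mfun (fun u => ((shifted_hit S (fun j i => X j i u) (y ^~ u) (x ^~ u))%:R : R)).
move=> mX my mx; apply: mfun_natr_exists => i; apply: mfun_natr_and => //.
apply: mfun_natr_forall => j; apply: mfun_natr_lt => //.
apply: mcomp => //; apply: mfunD; first exact: mfunB.
exact: mfunM.
Qed.

Lemma mfun_inbox K (x : 'I_D -> U -> R) : (forall j, mfun (x j)) ->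
 mfun (fun u => ((inbox K (x ^~ u))%:R : R)).
move=> mx; apply: mfun_natr_forall => j; apply: mfun_natr_le => //.
exact: mcomp.
Qed.

End measurability.

Lemma mfun_tnthR j : mfun (fun x : vec => tnth x j : R).
exact: measurable_tnth. Qed.

Lemma inbox_measure K : 0 <= K ->
 (\int[lam]_x ((inbox K (tnth x))%:R)%:E <= ((2 * (K + 1)) ^+ D)%:E)%E.
move=> K0; rewrite mulr_natl -(lebesgue_tuple_boxset (fun=> 0)) ?addr_ge0 //.
rewrite -[X in (_ <= lam X)%E]setIT -integral_indic //; last exact: mfun_boxset.
apply: ge0_le_integral => //.
- apply: mEFin; apply: mfun_inbox => j; exact: mfun_tnthR.
- by apply: mEFin; exact: measurable_indic (mfun_boxset _ _).
move=> x _; rewrite lee_fin indicE; case: (boolP (inbox K _)) => // /forallP h.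
rewrite mem_set // => j; rewrite subr0; apply: (le_lt_trans (h j)).
by rewrite ltrDl.
Qed.

Lemma inbox_measure_lty K : 0 <= K -> (\int[lam]_x ((inbox K (tnth x))%:R)%:E < +oo)%E.
by move=> /inbox_measure h; rewrite (le_lt_trans h) ?ltry. Qed.

Let mfuzz_in d (U : measurableType d) S K (X : 'I_D -> 'I_n -> U -> R) (y : 'I_D -> U -> R) :
 (forall j i, mfun (X j i)) -> (forall j, mfun (y j)) ->
 mfun (fun z : U * vec =>
  ((inbox K (tnth z.2))%:R * (shifted_hit S (fun j i => X j i z.1) (y ^~ z.1) (tnth z.2))%:R : R)%:E).
move=> mX my; apply: mEFin; apply: mfunM.
 apply: (@mfun_inbox _ _ K (fun j (z : U * vec) => tnth z.2 j)) => j.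
 exact: (mcomp (mfun_tnthR j) msnd).
apply: (@mfun_hit _ _ S (fun j i (z : U * vec) => X j i z.1) (fun j z => y j z.1) (fun j z => tnth z.2 j)).
- by move=> j i; exact: (mcomp (mX j i) mfst).
- by move=> j; exact: (mcomp (my j) mfst).
- by move=> j; exact: (mcomp (mfun_tnthR j) msnd).
Qed.

Lemma mfun_fuzz d (U : measurableType d) S K (X : 'I_D -> 'I_n -> U -> R) (y : 'I_D -> U -> R) :
 (forall j i, mfun (X j i)) -> (forall j, mfun (y j)) ->
 mfun (fun u => shifted_fuzz S K (fun j i => X j i u) (y ^~ u)).
move=> mX my; apply: mcomp; first exact: (fine_measurable measurableT).
apply: (@measurable_fun_fubini_tonelli_F _ _ _ _ _ lam _ (mfuzz_in S K mX my)).
by move=> z; rewrite lee_fin mulr_ge0.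
Qed.

Let mx_id j : mfun (fun x : vec => tnth x j : R) := mfun_tnthR j.

Lemma mfun_inhit S K X y : mfun (fun x : vec =>
 (inbox K (tnth x))%:R * (shifted_hit S X y (tnth x))%:R : R).
apply: mfunM; first exact: (@mfun_inbox _ _ K (fun j (x : vec) => tnth x j)).
have h := @mfun_hit _ _ S (fun j i (_ : vec) => X j i) (fun j _ => y j) (fun j (x : vec) => tnth x j).
by apply: h.
Qed.

Lemma fuzzE S K X y : 0 <= K ->
 ((shifted_fuzz S K X y)%:E = \int[lam]_x ((inbox K (tnth x))%:R * (shifted_hit S X y (tnth x))%:R)%:E)%E.
move=> K0; rewrite /shifted_fuzz fineK // ge0_fin_numE; last by apply: nn_int_ge0 => x; rewrite mulr_ge0.
apply: (le_lt_trans _ (inbox_measure_lty K0)); apply: nn_int_le => [||x|x].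
- exact: mfun_inhit.
- exact: (@mfun_inbox _ _ K (fun j (x : vec) => tnth x j)).
- by rewrite mulr_ge0.
- by case: (shifted_hit _ _ _ _); rewrite ?mulr1 ?mulr0.
Qed.

Lemma fuzz_ge0 S K X y : 0 <= shifted_fuzz S K X y.
by apply: fine_ge0; apply: nn_int_ge0 => x; rewrite mulr_ge0. Qed.

End hitting.

(** * Comparison of hits and fuzz under resampling *)

Section resampled_functionals.
Context {R : realType} (D n : nat).
Notation mR := (measurableTypeR R).
Notation vec := (D.-tuple mR).
Notation lam := (lebesgue_tuple R D).
Notation conf := ('I_D -> 'I_n -> R).

(** Measurability is required only after composition with measurable processes, which avoids
    choosing a sigma-algebra on configurations. *)
Definition measurable_conf (H : conf -> ('I_D -> R) -> R) :=
 forall d (U : measurableType d) (X : 'I_D -> 'I_n -> U -> R) (e : 'I_D -> U -> R),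
  (forall j i, mfun (X j i)) -> (forall j, mfun (e j)) ->
  mfun (fun u => H (fun j i => X j i u) (e ^~ u)).

Variable g : 'I_n -> R.

(** On the points of w, the Gaussian value e contained in X is replaced by the fresh value x. *)
Definition shift_conf (w : pred 'I_n) (X : conf) (x e : 'I_D -> R) : conf :=
 fun j i => X j i + (w i)%:R * g i * (x j - e j).

(* [eta] has density [phi] and is independent of the process X - w g eta. *)
Definition resamples d (T : measurableType d) (P : probability T R)
  (X : 'I_D -> 'I_n -> T -> R) (w : pred 'I_n) (eta : 'I_D -> T -> R) (phi : vec -> R) :=
 forall H : conf -> ('I_D -> R) -> R, measurable_conf H -> (forall X e, 0 <= H X e) ->
 (\int[P]_u (H (fun j i => X j i u) (eta ^~ u))%:E =
  \int[P]_u \int[lam]_x (phi x * H (shift_conf w (fun j i => X j i u) (tnth x) (eta ^~ u)) (tnth x))%:E)%E.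

Section resampling_bounds.
Context d (T : measurableType d) (P : probability T R).
Variables (X : 'I_D -> 'I_n -> T -> R) (w : pred 'I_n) (eta : 'I_D -> T -> R) (phi : vec -> R).
Hypotheses (mX : forall j i, mfun (X j i)) (meta : forall j, mfun (eta j)) (mphi : mfun phi)
 (phi0 : nonneg phi) (rs : resamples P X w eta phi).

Variables (eps : R) (S : pred 'I_n).
Hypothesis Sw : forall i, S i -> w i.
Notation hit := (shifted_hit g eps).
Notation fuzz := (shifted_fuzz g eps).
Notation Xc u := (fun j i => X j i u).

Lemma hit_shift (Y : conf) (y x x' e : 'I_D -> R) :
 hit S (shift_conf w Y x e) y x' = hit S (shift_conf w Y (fun=> 0) e) y (fun j => x j + x' j).
rewrite /shifted_hit; apply: eq_existsb => i; case: (boolP (S i)) => //= /Sw wi.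
apply: eq_forallb => j; rewrite /shift_conf wi; congr (`|_| < _); rewrite mul1r; ring.
Qed.

Let Zc u := shift_conf w (Xc u) (fun=> 0) (eta ^~ u).

Let mshift d' (U : measurableType d') (Y : 'I_D -> 'I_n -> U -> R) (x e : 'I_D -> U -> R) j i :
 (forall j i, mfun (Y j i)) ->
 (forall j, mfun (x j)) -> (forall j, mfun (e j)) ->
 mfun (fun u => shift_conf w (fun j i => Y j i u) (x ^~ u) (e ^~ u) j i).
move=> mY mx me; apply: mfunD => //; apply: mfunM => //.
exact: mfunB.
Qed.

Let mZ j i : mfun (fun u => Zc u j i).
by apply: (@mshift _ _ X (fun _ _ => 0) eta). Qed.

Let mtn j : mfun (fun x : vec => tnth x j : R) := mfun_tnthR j.

Let mresampled2 (H : conf -> ('I_D -> R) -> R) : measurable_conf H ->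
 mfun (fun z : T * vec =>
  phi z.2 * H (shift_conf w (Xc z.1) (tnth z.2) (eta ^~ z.1)) (tnth z.2)).
move=> mH; apply: mfunM; first exact: (mcomp mphi msnd).
apply: (mH _ _ (fun j i (z : T * vec) => shift_conf w (Xc z.1) (tnth z.2) (eta ^~ z.1) j i) (fun j z => tnth z.2 j)).
 move=> j i; apply: (@mshift _ _ (fun j i (z : T * vec) => X j i z.1) (fun j z => tnth z.2 j) (fun j z => eta j z.1)).
 - by move=> j' i'; exact: (mcomp (mX j' i') mfst).
 - by move=> j'; exact: (mcomp (mtn j') msnd).
 - by move=> j'; exact: (mcomp (meta j') mfst).
by move=> j'; exact: (mcomp (mtn j') msnd).
Qed.

Let mresampled (H : conf -> ('I_D -> R) -> R) : measurable_conf H -> (forall X e, 0 <= H X e) ->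
 mfun (fun u => \int[lam]_x (phi x * H (shift_conf w (Xc u) (tnth x) (eta ^~ u)) (tnth x))%:E)%E.
move=> mH H0; have m2 := mresampled2 mH.
apply: (@measurable_fun_fubini_tonelli_F _ _ _ _ _ lam (fun z : T * vec =>
  (phi z.2 * H (shift_conf w (Xc z.1) (tnth z.2) (eta ^~ z.1)) (tnth z.2))%:E)).
 exact: mEFin.
by move=> z; rewrite lee_fin mulr_ge0.
Qed.

Let mresampled1 (H : conf -> ('I_D -> R) -> R) u : measurable_conf H ->
 mfun (fun x : vec => phi x * H (shift_conf w (Xc u) (tnth x) (eta ^~ u)) (tnth x)).
move=> mH; have m : mfun (fun x : vec => (u, x)) by exact: mfun_pair.
exact: (mcomp (mresampled2 mH) m).
Qed.

Let resampled_ge0 (H : conf -> ('I_D -> R) -> R) u : (forall X e, 0 <= H X e) ->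
 (0 <= \int[lam]_x (phi x * H (shift_conf w (Xc u) (tnth x) (eta ^~ u)) (tnth x))%:E)%E.
by move=> H0; apply: nn_int_ge0 => x; rewrite mulr_ge0. Qed.

Lemma mf_hit (S' : pred 'I_n) (y : 'I_D -> R) : measurable_conf (fun Y _ => (hit S' Y y (fun=> 0))%:R).
by move=> d' U Y e mY me; apply: (@mfun_hit _ _ _ g eps _ _ S' Y (fun j _ => y j) (fun _ _ => 0)). Qed.

Lemma mf_inbox K : measurable_conf (fun _ e => (inbox K e)%:R).
by move=> d' U Y e mY me; exact: mfun_inbox. Qed.

Lemma mf_fuzz (S' : pred 'I_n) K (y : 'I_D -> R) : measurable_conf (fun Y _ => fuzz S' K Y y).
by move=> d' U Y e mY me; apply: (@mfun_fuzz _ _ _ g eps _ _ S' K Y (fun j _ => y j)). Qed.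

Lemma mf_mul H1 H2 : measurable_conf H1 -> measurable_conf H2 ->
 measurable_conf (fun Y e => H1 Y e * H2 Y e).
by move=> h1 h2 d' U Y e mY me; apply: mfunM; [exact: h1|exact: h2]. Qed.

Let minx K : mfun (fun x : vec => ((inbox K (tnth x))%:R : R)).
exact: (@mfun_inbox _ _ _ _ K (fun j (x : vec) => tnth x j)). Qed.

(** Given Z = X - w g eta, a hit with |eta| <= h is the integral of phi over the hitting shifts in
    that box, at most nmax times the fuzz of Z at size h. On the same event this fuzz is at most the
    fuzz of X at size 2h, and independence of eta and Z turns the event into a factor on the
    left. *)
Lemma hit_le_fuzz (h nmax : R) (y : 'I_D -> R) : 0 <= h -> 0 <= nmax ->
 (forall x, phi x <= nmax) ->
 ((\int[lam]_x (phi x * (inbox h (tnth x))%:R)%:E) *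
  (\int[P]_u ((hit S (Xc u) y (fun=> 0))%:R * (inbox h (eta ^~ u))%:R)%:E) <=
  nmax%:E * \int[P]_u (fuzz S (h + h) (Xc u) y)%:E)%E.
move=> h0 n0 hn.
set I := (\int[lam]_x _)%E.
have I0 : (0 <= I)%E by apply: nn_int_ge0 => x; rewrite mulr_ge0.
have h20 : 0 <= h + h by rewrite addr_ge0.
pose B u := fuzz S h (Zc u) y.
have mB : mfun B by apply: (@mfun_fuzz _ _ _ g eps _ _ S h (fun j i u => Zc u j i) (fun j _ => y j)).
have B0 u : 0 <= B u by exact: fuzz_ge0.
have mBe : mfun (fun u => (B u)%:E) by exact: mEFin.
have mH1 := mf_mul (mf_hit S y) (mf_inbox h).
have H10 (Y : conf) (e : 'I_D -> R) : 0 <= (hit S Y y (fun=> 0))%:R * (inbox h e)%:R :> R by rewrite mulr_ge0.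
have s1 : (\int[P]_u ((hit S (Xc u) y (fun=> 0))%:R * (inbox h (eta ^~ u))%:R)%:E <=
  nmax%:E * \int[P]_u (B u)%:E)%E.
 rewrite (rs mH1); last by move=> Y e; rewrite mulr_ge0.
 rewrite -nn_intZ //; apply: ge0_le_integral => //.
 - by move=> u _; exact: (resampled_ge0 u H10).
 - exact: (mresampled mH1 H10).
 - by apply: mEFin; exact: mfunM.
 move=> u _; have mI : mfun (fun x : vec => (inbox h (tnth x))%:R * (hit S (Zc u) y (tnth x))%:R : R).
  exact: mfun_inhit.
 have I00 (x : vec) : 0 <= (inbox h (tnth x))%:R * (hit S (Zc u) y (tnth x))%:R :> R by rewrite mulr_ge0.
 rewrite EFinM /B fuzzE // -(nn_intZ lam mI I00 n0).
 apply: nn_int_le => [||x|x].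
 - exact: (mresampled1 u mH1).
 - by apply: mfunM => //; exact: mfun_inhit.
 - by rewrite mulr_ge0 // mulr_ge0.
 rewrite hit_shift; under [X in hit S _ y X]eq_fun do rewrite addr0.
 by rewrite [_%:R * _]mulrC ler_wpM2r // mulr_ge0.
have s2 : (I * \int[P]_u (B u)%:E <= \int[P]_u (fuzz S (h + h) (Xc u) y)%:E)%E.
 rewrite (rs (mf_fuzz S (h + h) y)); last by move=> Y e; exact: fuzz_ge0.
 rewrite -ge0_integralZl //; last by move=> u _; rewrite lee_fin.
 apply: ge0_le_integral => //.
 - by move=> u _; rewrite mule_ge0 // lee_fin.
 - exact: mfunZe.
 - have hf0 (Y : conf) (e : 'I_D -> R) : 0 <= fuzz S (h + h) Y y by exact: fuzz_ge0.
  exact: (mresampled (mf_fuzz S (h + h) y) hf0).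
 move=> u _; rewrite muleC /I -nn_intZ //; last 2 first.
 - exact: mfunM.
 - by move=> x; rewrite mulr_ge0.
 apply: nn_int_le => [||x|x].
 - by apply: mfunM => //; exact: mfunM.
 - exact: (mresampled1 u (mf_fuzz S (h + h) y)).
 - by rewrite !mulr_ge0.
 rewrite mulrCA ler_wpM2l //; case: (boolP (inbox h (tnth x))) => hx; last by rewrite mulr0 fuzz_ge0.
 rewrite mulr1 -lee_fin /B !fuzzE //.
 pose f (x' : vec) : R := (inbox h (tnth x'))%:R * (hit S (Zc u) y (tnth x'))%:R.
 rewrite -(@int_tuple_translate _ _ x (fun x' => (f x')%:E)); last 2 first.
 - by apply: mEFin; exact: mfun_inhit.
 - by move=> x'; rewrite lee_fin mulr_ge0.
 have fE x' : tnth (addt x' x) = fun j => tnth x j + tnth x' j.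
  by apply/funext => j; rewrite tnth_mktuple addrC.
 apply: nn_int_le => [||x'|x'].
 - have mf : mfun f by exact: mfun_inhit.
  by apply: (mcomp mf); apply: mfun_addt.
 - exact: mfun_inhit.
 - by rewrite mulr_ge0.
 rewrite /f hit_shift -fE ler_wpM2r // fE ler_nat; case: (boolP (inbox h _)) => // hs.
 have -> // : inbox (h + h) (tnth x').
 have hN : inbox h (fun j => - tnth x j) by apply/forallP => j; rewrite normrN; exact: (forallP hx j).
 have := inboxD hs hN; congr (inbox _ _ = _); apply/funext => j; rewrite addrAC subrr add0r //.
apply: (@le_trans _ _ (I * (nmax%:E * \int[P]_u (B u)%:E))%E); first exact: lee_wpmul2l.
rewrite muleCA; apply: lee_wpmul2l => //.
Qed.

(** The converse comparison. On |eta| <= K' the fuzz of X at size K is at most that of Z at size K'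
    + K, where phi is at least nmin, so it is dominated by the conditional probability of a hit. The
    weight Psi passes through because the resampling does not change it. *)
Lemma fuzz_le_hit (K K' nmin : R) (y : 'I_D -> R) (Psi : conf -> R) : 0 <= K -> 0 <= K' -> 0 <= nmin ->
 (\int[lam]_x (phi x)%:E <= 1)%E ->
 (forall x, inbox (K' + K) (tnth x) -> nmin <= phi x) ->
 measurable_conf (fun Y _ => Psi Y) -> nonneg Psi ->
 (forall Y x e, Psi (shift_conf w Y x e) = Psi Y) ->
 (nmin%:E * (\int[P]_u (Psi (Xc u) * fuzz S K (Xc u) y * (inbox K' (eta ^~ u))%:R)%:E) <=
  \int[P]_u (Psi (Xc u) * (hit S (Xc u) y (fun=> 0))%:R)%:E)%E.
move=> K0 K'0 n0 phi1 hn mPsi Psi0 Psiw.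
have mH1 := mf_mul (mf_mul mPsi (mf_fuzz S K y)) (mf_inbox K').
have mH2 := mf_mul mPsi (mf_hit S y).
have KK : 0 <= K' + K by rewrite addr_ge0.
rewrite (rs mH1); last by move=> Y e; rewrite !mulr_ge0 // fuzz_ge0.
rewrite (rs mH2); last by move=> Y e; rewrite !mulr_ge0.
pose B u := fuzz S (K' + K) (Zc u) y.
have B0 u : 0 <= B u by exact: fuzz_ge0.
have H10 (Y : conf) (e : 'I_D -> R) : 0 <= Psi Y * fuzz S K Y y * (inbox K' e)%:R by rewrite !mulr_ge0 // fuzz_ge0.
have H20 (Y : conf) (e : 'I_D -> R) : 0 <= Psi Y * (hit S Y y (fun=> 0))%:R by rewrite !mulr_ge0.
rewrite -ge0_integralZl //; [|exact: mresampled mH1 H10|by move=> u _; exact: (resampled_ge0 u H10)].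
apply: ge0_le_integral => //.
- by move=> u _; rewrite mule_ge0 // (resampled_ge0 u H10).
- by apply: mfunZe; exact: mresampled mH1 H10.
- exact: mresampled mH2 H20.
move=> u _.
have PB : 0 <= Psi (Xc u) * B u by rewrite mulr_ge0.
apply: (@le_trans _ _ (nmin%:E * (Psi (Xc u) * B u)%:E)%E).
 apply: lee_wpmul2l; rewrite ?lee_fin //.
 apply: (@le_trans _ _ (\int[lam]_x ((Psi (Xc u) * B u) * phi x)%:E)%E); last first.
  by rewrite nn_intZ // -[leRHS]mule1; apply: lee_wpmul2l; rewrite ?lee_fin.
 apply: nn_int_le => [||x|x].
 - exact: (mresampled1 u mH1).
 - exact: mfunM.
 - by rewrite mulr_ge0.
 rewrite mulrC ler_wpM2r // Psiw -mulrA ler_wpM2l //.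
 case: (boolP (inbox K' (tnth x))) => hx; last by rewrite mulr0.
 rewrite mulr1 -lee_fin /B !fuzzE //.
 pose f (x' : vec) : R := (inbox (K' + K) (tnth x'))%:R * (hit S (Zc u) y (tnth x'))%:R.
 rewrite -[leRHS](@int_tuple_translate _ _ x (fun x' => (f x')%:E)); last 2 first.
 - by apply: mEFin; exact: mfun_inhit.
 - by move=> x'; rewrite lee_fin mulr_ge0.
 have fE x' : tnth (addt x' x) = fun j => tnth x j + tnth x' j.
  by apply/funext => j; rewrite tnth_mktuple addrC.
 apply: nn_int_le => [||x'|x'].
 - exact: mfun_inhit.
 - have mf : mfun f by exact: mfun_inhit.
  by apply: (mcomp mf); apply: mfun_addt.
 - by rewrite mulr_ge0.
 rewrite /f hit_shift -fE ler_wpM2r // fE ler_nat; case: (boolP (inbox K _)) => // hs.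
 by rewrite (inboxD hx hs).
have -> : (nmin%:E * (Psi (Xc u) * B u)%:E = (Psi (Xc u) * nmin)%:E * (B u)%:E)%E.
 by rewrite -!EFinM; congr EFin; ring.
have Pn : 0 <= Psi (Xc u) * nmin by rewrite mulr_ge0.
have mI : mfun (fun x : vec => (inbox (K' + K) (tnth x))%:R * (hit S (Zc u) y (tnth x))%:R : R).
 exact: mfun_inhit.
have I00 (x : vec) : 0 <= (inbox (K' + K) (tnth x))%:R * (hit S (Zc u) y (tnth x))%:R :> R by rewrite mulr_ge0.
rewrite /B fuzzE // -(nn_intZ lam mI I00 Pn).
apply: nn_int_le => [||x|x].
- by apply: mfunM => //; exact: mfun_inhit.
- exact: (mresampled1 u mH2).
- by apply: mulr_ge0 => //; rewrite mulr_ge0.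
rewrite hit_shift Psiw; under [X in _ <= _ * (_ * (hit S _ y X)%:R)]eq_fun do rewrite addr0.
rewrite [leRHS]mulrCA -!mulrA ler_wpM2l // mulrA ler_wpM2r //.
by case: (boolP (inbox _ _)) => hx; rewrite ?mulr0 ?mulr1 // hn.
Qed.

End resampling_bounds.
End resampled_functionals.

(** * The second-moment inequality for separated slots *)

Section core_inequality.
Context d (T : measurableType d) {R : realType} (P : probability T R) (D n n0 : nat).
Notation mR := (measurableTypeR R).
Notation vec := (D.-tuple mR).
Notation lam := (lebesgue_tuple R D).
Notation conf := ('I_D -> 'I_n -> R).
Variables (g : 'I_n -> R) (eps : R) (X : 'I_D -> 'I_n -> T -> R).
Hypothesis mX : forall j i, mfun (X j i).
Variable S : 'I_n0 -> pred 'I_n.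
Notation hit := (shifted_hit g eps).
Notation fuzz := (shifted_fuzz g eps).
Notation Xc u := (fun j i => X j i u).
Notation zero := (fun=> 0).
Notation M := (P \x lam)%E.

Variables (K h : R).
Hypotheses (h0 : 0 <= h) (KE : K = h + h).
Let K0 : 0 <= K. by rewrite KE addr_ge0. Qed.
Notation CK := ((2 * (K + 1)) ^+ D).
Let CK0 : 0 <= CK. by rewrite exprn_ge0 // mulr_ge0 // addr_ge0. Qed.

Variables (ctr : 'I_n0 -> 'I_D -> T -> R) (gc : R) (rad : 'I_n0 -> T -> R).
Hypotheses (gc0 : 0 < gc) (mrad : forall s, mfun (rad s)) (rad0 : forall s u, 0 <= rad s u).
Variable gcs : 'I_n0 -> R.
Hypothesis gcsE : forall s, gc <= gcs s.
Hypothesis hrad : forall s u (y x : 'I_D -> R), inbox K x -> hit (S s) (Xc u) y x ->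
 forall j, `|y j - (ctr s j u + gcs s * x j)| < rad s u.

Variable radz : 'I_n0 -> T -> R.
Hypotheses (mradz : forall s, mfun (radz s)) (radz0 : forall s u, 0 <= radz s u).
Hypothesis hradz : forall s u (y : 'I_D -> R), hit (S s) (Xc u) y zero ->
 forall j, `|y j - ctr s j u| < radz s u.

Let hitS s (z : T * vec) : R := (hit (S s) (Xc z.1) (tnth z.2) zero)%:R.
Let fz s (z : T * vec) : R := fuzz (S s) K (Xc z.1) (tnth z.2).

Let mhitS s : mfun (hitS s).
apply: (@mfun_hit _ _ _ g eps _ _ (S s) (fun j i (z : T * vec) => X j i z.1) (fun j z => tnth z.2 j) (fun _ _ => 0)) => //.
- by move=> j i; exact: (mcomp (mX j i) mfst).
- by move=> j; exact: (mcomp (mfun_tnthR j) msnd).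
Qed.

Let mfz s : mfun (fz s).
apply: (@mfun_fuzz _ _ _ g eps _ _ (S s) K (fun j i (z : T * vec) => X j i z.1) (fun j z => tnth z.2 j)).
- by move=> j i; exact: (mcomp (mX j i) mfst).
- by move=> j; exact: (mcomp (mfun_tnthR j) msnd).
Qed.

Let fz0 s z : 0 <= fz s z. exact: fuzz_ge0. Qed.

Lemma box_le (Q : vec -> bool) (c : 'I_D -> R) (r : R) : 0 <= r ->
 mfun (fun y => ((Q y)%:R : R)) ->
 (forall y, Q y -> forall j, `|tnth y j - c j| < r) ->
 (\int[lam]_y ((Q y)%:R)%:E <= ((2 * r) ^+ D)%:E)%E.
move=> r0 mQ hQ; rewrite mulr_natl -(lebesgue_tuple_boxset c r0).
rewrite -[X in (_ <= lam X)%E]setIT -integral_indic //; last exact: mfun_boxset.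
apply: ge0_le_integral => //.
- exact: mEFin.
- by apply: mEFin; exact: measurable_indic (mfun_boxset _ _).
move=> y _; rewrite lee_fin indicE; case: (boolP (Q y)) => // /hQ hy.
by rewrite mem_set.
Qed.

Lemma hit_measure_le s u (x : 'I_D -> R) : inbox K x ->
 (\int[lam]_y ((hit (S s) (Xc u) (tnth y) x)%:R)%:E <= ((2 * rad s u) ^+ D)%:E)%E.
move=> hx; apply: (@box_le _ (fun j => ctr s j u + gcs s * x j)) => //.
 by apply: (@mfun_hit _ _ _ g eps _ _ (S s) (fun j i (_ : vec) => X j i u) (fun j (y : vec) => tnth y j) (fun j _ => x j)) => // j; exact: mfun_tnthR.
by move=> y; exact: hrad.
Qed.

Lemma fuzz_le_inbox s (Y : conf) (y : 'I_D -> R) : fuzz (S s) K Y y <= CK.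
rewrite -lee_fin fuzzE //; apply: (le_trans _ (inbox_measure _ K0)).
apply: nn_int_le => [||x|x].
- exact: mfun_inhit.
- exact: (@mfun_inbox _ _ _ _ K (fun j (x : vec) => tnth x j) (@mfun_tnthR _ _)).
- by rewrite mulr_ge0.
- by case: (hit _ _ _ _); rewrite ?mulr1 ?mulr0.
Qed.

(** A shift moves the image with speed at least gc, so for fixed y the hitting shifts lie in a box
    of half-side rad / gc. This flatness makes the diagonal of the second moment small. *)
Lemma fuzz_le_rad s u (y : 'I_D -> R) : fuzz (S s) K (Xc u) y <= (2 * rad s u / gc) ^+ D.
have gs0 : 0 < gcs s := lt_le_trans gc0 (gcsE s).
rewrite -lee_fin fuzzE //.
apply: (@le_trans _ _ (\int[lam]_x ((inbox K (tnth x) && hit (S s) (Xc u) y (tnth x))%:R)%:E)%E).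
 by under eq_integral do rewrite -natrM mulnb.
apply: (le_trans (@box_le _ (fun j => (y j - ctr s j u) / gcs s) (rad s u / gcs s) _ _ _)).
- by rewrite divr_ge0 // ltW.
- have := mfun_inhit g eps (S s) K (Xc u) y.
 by apply: eq_measurable_fun => x _; rewrite -natrM mulnb.
- move=> x /andP[hx /(hrad hx) hh] j.
 have -> : tnth x j - (y j - ctr s j u) / gcs s = - ((y j - (ctr s j u + gcs s * tnth x j)) / gcs s).
  by field; rewrite gt_eqF.
 by rewrite normrN normrM normfV (gtr0_norm gs0) ltr_pM2r ?invr_gt0 //; exact: hh.
rewrite lee_fin lerXn2r ?nnegrE //.
- by rewrite mulr_ge0 // divr_ge0 // ltW.
- by rewrite divr_ge0 ?(ltW gc0) // mulr_ge0.
by rewrite mulrA ler_wpM2l ?lef_pV2 ?posrE ?mulr_ge0.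
Qed.

Let int2 (f : T * vec -> R) : mfun f -> nonneg f ->
 (\int[M]_z (f z)%:E = \int[lam]_y \int[P]_u (f (u, y))%:E)%E.
move=> mf f0; rewrite fubini_tonelli2 //; exact: mEFin.
Qed.

Let int1 (f : T * vec -> R) : mfun f -> nonneg f ->
 (\int[M]_z (f z)%:E = \int[P]_u \int[lam]_y (f (u, y))%:E)%E.
move=> mf f0; rewrite fubini_tonelli1 //; exact: mEFin.
Qed.

Let msec1 (f : T * vec -> R) u : mfun f -> mfun (fun y => f (u, y)).
move=> mf; have m : mfun (fun y : vec => (u, y)) by exact: mfun_pair.
exact: (mcomp mf m).
Qed.

Let mint1 (f : T * vec -> R) : mfun f -> nonneg f ->
 mfun (fun u => \int[lam]_y (f (u, y))%:E)%E.
move=> mf f0; apply: (@measurable_fun_fubini_tonelli_F _ _ _ _ _ lam (fun z => (f z)%:E)).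
 exact: mEFin.
by move=> z; rewrite lee_fin.
Qed.

Let mint2 (f : T * vec -> R) : mfun f -> nonneg f ->
 mfun (fun y => \int[P]_u (f (u, y))%:E)%E.
move=> mf f0; apply: (@measurable_fun_fubini_tonelli_G _ _ _ _ _ P (fun z => (f z)%:E)).
 exact: mEFin.
by move=> z; rewrite lee_fin.
Qed.

Lemma int1_le (f : T * vec -> R) (b : T -> R) : mfun f -> nonneg f ->
 mfun b -> (forall u, \int[lam]_y (f (u, y))%:E <= (b u)%:E)%E ->
 (\int[M]_z (f z)%:E <= \int[P]_u (b u)%:E)%E.
move=> mf f0 mb fb; rewrite int1 //; apply: ge0_le_integral => //.
- by move=> u _; apply: nn_int_ge0 => y.
- exact: mint1.
- exact: mEFin.
Qed.

(** After exchanging integrals, each shift of the box contributes the volume of one image of S, at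
    most (2 rad)^D. *)
Lemma fuzz_int_le s u : (\int[lam]_y (fz s (u, y))%:E <= (CK * (2 * rad s u) ^+ D)%:E)%E.
pose F (z : vec * vec) : R := (inbox K (tnth z.2))%:R * (hit (S s) (Xc u) (tnth z.1) (tnth z.2))%:R.
have mi2 : mfun (fun z : vec * vec => ((inbox K (tnth z.2))%:R : R)).
 apply: (@mfun_inbox _ _ _ _ K (fun j (z : vec * vec) => tnth z.2 j)) => j.
 exact: (mcomp (mfun_tnthR j) msnd).
have mF : mfun F.
 apply: mfunM => //.
 apply: (@mfun_hit _ _ _ g eps _ _ (S s) (fun j i (_ : vec * vec) => X j i u) (fun j z => tnth z.1 j) (fun j z => tnth z.2 j)) => // j.
 - exact: (mcomp (mfun_tnthR j) mfst).
 - exact: (mcomp (mfun_tnthR j) msnd).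
have F0 z : (0 <= (F z)%:E)%E by rewrite lee_fin mulr_ge0.
have mFe : mfun (fun z => (F z)%:E) by exact: mEFin.
have -> : (\int[lam]_y (fz s (u, y))%:E = \int[lam]_y \int[lam]_x (F (y, x))%:E)%E.
 by apply: eq_integral => y _; rewrite /fz fuzzE.
rewrite (fubini_tonelli _ mFe F0) /=.
have mi : mfun (fun x : vec => ((inbox K (tnth x))%:R : R)).
 exact: (@mfun_inbox _ _ _ _ K (fun j (x : vec) => tnth x j) (@mfun_tnthR _ _)).
have r0 : 0 <= (2 * rad s u) ^+ D by rewrite exprn_ge0 // mulr_ge0.
apply: (@le_trans _ _ (\int[lam]_x ((2 * rad s u) ^+ D * (inbox K (tnth x))%:R)%:E)%E).
 apply: ge0_le_integral => //.
 - by move=> x _; apply: integral_ge0.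
 - exact: (@measurable_fun_fubini_tonelli_G _ _ _ _ _ lam _ mFe F0).
 - by apply: mEFin; exact: mfunM.
 move=> x _; rewrite /F /=; case: (boolP (inbox K _)) => hx; last first.
  by under eq_integral do rewrite mul0r; rewrite integral0 mulr0.
 by under eq_integral do rewrite mul1r; rewrite mulr1; exact: hit_measure_le.
rewrite nn_intZ // [X in (_ <= X%:E)%E]mulrC EFinM; apply: lee_wpmul2l; first by rewrite lee_fin.
exact: inbox_measure.
Qed.

Lemma fuzz_sq_int s : (\int[M]_z (fz s z * fz s z)%:E <=
 (CK / gc ^+ D)%:E * \int[P]_u (((2 * rad s u) ^+ D) ^+ 2)%:E)%E.
have mr : mfun (fun u => ((2 * rad s u) ^+ D) ^+ 2).
 by do 2 apply: mfunX; exact: mfunM.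
have c0 : 0 <= CK / gc ^+ D by rewrite divr_ge0 // exprn_ge0 // ltW.
rewrite -nn_intZ //; last by move=> u; exact: sqr_ge0.
have mff : mfun (fun z => fz s z * fz s z) by exact: mfunM.
apply: int1_le => //; [by move=> z; rewrite mulr_ge0|exact: mfunM|move=> u].
have r0 : 0 <= (2 * rad s u / gc) ^+ D by rewrite exprn_ge0 // divr_ge0 ?(ltW gc0) // mulr_ge0.
apply: (@le_trans _ _ (\int[lam]_y (((2 * rad s u / gc) ^+ D) * fz s (u, y))%:E)%E).
 apply: nn_int_le => [||y|y].
 - exact: msec1 mff.
 - by apply: mfunM => //; exact: msec1.
 - by rewrite mulr_ge0.
 - by rewrite ler_wpM2r //; exact: fuzz_le_rad.
rewrite nn_intZ //; last exact: msec1.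
have -> : CK / gc ^+ D * ((2 * rad s u) ^+ D) ^+ 2 = (2 * rad s u / gc) ^+ D * (CK * (2 * rad s u) ^+ D).
 by rewrite expr_div_n; ring.
rewrite [leRHS]EFinM; apply: lee_wpmul2l; first by rewrite lee_fin.
exact: fuzz_int_le.
Qed.

Lemma fuzz_weight_int s (b : T -> R) : mfun b -> nonneg b ->
 (\int[M]_z (b z.1 * fz s z)%:E <= CK%:E * \int[P]_u ((2 * rad s u) ^+ D * b u)%:E)%E.
move=> mb b0; have mr : mfun (fun u => (2 * rad s u) ^+ D).
 by apply: mfunX; exact: mfunM.
have r0 u : 0 <= (2 * rad s u) ^+ D by rewrite exprn_ge0 // mulr_ge0.
rewrite -nn_intZ //; [|exact: mfunM|by move=> u; rewrite mulr_ge0].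
apply: int1_le.
- by apply: mfunM => //; exact: (mcomp mb mfst).
- by move=> z; rewrite mulr_ge0.
- by apply: mfunM => //; exact: mfunM.
move=> u; rewrite /= nn_intZ //; last exact: msec1.
by rewrite mulrA [X in (_ <= X%:E)%E]mulrC EFinM; apply: lee_wpmul2l; [rewrite lee_fin|exact: fuzz_int_le].
Qed.

Lemma hit_measurez_le s u :
 (\int[lam]_y ((hit (S s) (Xc u) (tnth y) zero)%:R)%:E <= ((2 * radz s u) ^+ D)%:E)%E.
apply: (@box_le _ (fun j => ctr s j u)) => //.
 by apply: (@mfun_hit _ _ _ g eps _ _ (S s) (fun j i (_ : vec) => X j i u) (fun j (y : vec) => tnth y j) (fun _ _ => 0)) => // j; exact: mfun_tnthR.
by move=> y; exact: hradz.
Qed.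

Lemma hit_weight_int s (b : T -> R) : mfun b -> nonneg b ->
 (\int[M]_z (b z.1 * hitS s z)%:E <= \int[P]_u ((2 * radz s u) ^+ D * b u)%:E)%E.
move=> mb b0; have mr : mfun (fun u => (2 * radz s u) ^+ D).
 by apply: mfunX; exact: mfunM.
apply: int1_le.
- by apply: mfunM => //; exact: (mcomp mb mfst).
- by move=> z; rewrite mulr_ge0.
- exact: mfunM.
move=> u; rewrite /= nn_intZ //; last exact: msec1.
by rewrite [X in (_ <= X%:E)%E]mulrC EFinM; apply: lee_wpmul2l; [rewrite lee_fin|exact: hit_measurez_le].
Qed.

Variables (w0 : pred 'I_n) (eta0 : 'I_D -> T -> R) (phi0 : vec -> R) (nmax : R).
Hypotheses (meta0 : forall j, mfun (eta0 j)) (mphi0 : mfun phi0) (phi00 : nonneg phi0)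
 (rs0 : resamples g P X w0 eta0 phi0) (Sw0 : forall s i, S s i -> w0 i) (nmax0 : 0 < nmax)
 (phi0_le : forall x, phi0 x <= nmax) (half : ((2^-1)%:E <= \int[lam]_x (phi0 x * (inbox h (tnth x))%:R)%:E)%E).

Variables (w_ : 'I_n0 -> pred 'I_n) (eta_ : 'I_n0 -> 'I_D -> T -> R) (phi_ : 'I_n0 -> vec -> R).
Variables (K' nmin K'' nmin' : R).
Hypotheses (meta : forall s j, mfun (eta_ s j)) (mphi : forall s, mfun (phi_ s))
 (phi_0 : forall s x, 0 <= phi_ s x) (phi_1 : forall s, (\int[lam]_x (phi_ s x)%:E <= 1)%E)
 (rs : forall s, resamples g P X (w_ s) (eta_ s) (phi_ s)) (Sw : forall s i, S s i -> w_ s i)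
 (disj : forall s s' i, s != s' -> S s' i -> ~~ w_ s i).
Hypothesis K'0 : 0 <= K'.
Hypotheses (nmin0 : 0 < nmin) (phi_ge : forall s x, inbox (K' + K) (tnth x) -> nmin <= phi_ s x).
Hypothesis K''0 : 0 <= K''.
Hypothesis nmin'0 : 0 < nmin'.
Hypothesis phi_ge' : forall s x, inbox (K'' + K) (tnth x) -> nmin' <= phi_ s x.

Variables (q mu theta E1 E1' C2 C0 : R).
Hypotheses (q0 : 0 < q) (mu0 : 0 < mu) (E10 : 0 <= E1) (E10' : 0 <= E1') (theta0 : 0 <= theta)
 (hitL : forall s, ((q * mu)%:E <= \int[M]_z (hitS s z)%:E)%E)
 (hit2 : forall s s', s != s' -> (\int[M]_z (hitS s z * hitS s' z)%:E <= theta%:E)%E).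
Hypothesis err0 : forall s,
 (\int[P]_u ((2 * radz s u) ^+ D * (~~ inbox h (eta0 ^~ u))%:R)%:E <= (q * mu / 2)%:E)%E.
Hypothesis err1 : forall s s',
 (\int[P]_u ((2 * rad s u) ^+ D * (~~ inbox K' (eta_ s' ^~ u))%:R)%:E <= E1%:E)%E.
Hypothesis err1' : forall s s',
 (\int[P]_u ((2 * rad s u) ^+ D * (~~ inbox K'' (eta_ s' ^~ u))%:R)%:E <= E1'%:E)%E.
Hypothesis radC2 : forall s, (\int[P]_u (((2 * rad s u) ^+ D) ^+ 2)%:E <= (C2 * mu ^+ 2)%:E)%E.
Variables (ctr0 : 'I_D -> T -> R) (rad00 : T -> R).
Hypotheses (mctr0 : forall j, mfun (ctr0 j)) (mrad00 : mfun rad00) (rad000 : nonneg rad00).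
Hypothesis hrad0 : forall s u (y x : 'I_D -> R), inbox K x -> hit (S s) (Xc u) y x ->
 forall j, `|y j - ctr0 j u| < rad00 u.
Hypotheses (C00 : 0 < C0) (radC0 : (\int[P]_u ((2 * rad00 u) ^+ D)%:E <= C0%:E)%E).

Let natrN (b : bool) : ((~~ b)%:R : R) = 1 - b%:R.
by case: b; rewrite ?subrr ?subr0. Qed.

Let mnin (H : R) (e : 'I_D -> T -> R) : (forall j, mfun (e j)) ->
 mfun (fun u => ((~~ inbox H (e ^~ u))%:R : R)).
by move=> me; under eq_fun do rewrite natrN; apply: mfunB => //; exact: mfun_inbox. Qed.

Let mfst (f : T -> R) : mfun f -> mfun (fun z : T * vec => f z.1).
by move=> mf; exact: (mcomp mf mfst). Qed.

Let min (H : R) (e : 'I_D -> T -> R) : (forall j, mfun (e j)) ->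
 mfun (fun u => ((inbox H (e ^~ u))%:R : R)).
exact: mfun_inbox. Qed.

(** Truncation to |eta0| <= h loses at most half of the hitting volume by [err0]; [hit_le_fuzz]
    loses the factor 1/2 of [half] and the factor nmax. Together they give 4 nmax. *)
Lemma fuzz_first_moment s : ((q * mu / (4 * nmax))%:E <= \int[M]_z (fz s z)%:E)%E.
pose b u : R := (inbox h (eta0 ^~ u))%:R; pose nb u : R := (~~ inbox h (eta0 ^~ u))%:R.
have mb : mfun b by exact: min.
have mnb : mfun nb by exact: mnin.
have mhb : mfun (fun z => hitS s z * b z.1) by apply: mfunM => //; exact: mfst.
have hb0 z : 0 <= hitS s z * b z.1 by rewrite mulr_ge0.
have split : (\int[M]_z (hitS s z)%:E = \int[M]_z (hitS s z * b z.1)%:E + \int[M]_z (nb z.1 * hitS s z)%:E)%E.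
 rewrite -nn_intD //.
 - by apply: eq_integral => z _; congr EFin; rewrite /nb /b natrN; ring.
 - by apply: mfunM => //; exact: mfst.
 - by move=> z; rewrite mulr_ge0.
have h1 : ((q * mu / 2)%:E <= \int[M]_z (hitS s z * b z.1)%:E)%E.
 have := hitL s; rewrite split => h1.
 have h2 : (\int[M]_z (nb z.1 * hitS s z)%:E <= (q * mu / 2)%:E)%E.
  by apply: (le_trans (hit_weight_int s mnb _)); [move=> u|exact: err0].
 have : ((q * mu)%:E <= \int[M]_z (hitS s z * b z.1)%:E + (q * mu / 2)%:E)%E.
  by apply: (le_trans h1); apply: leeD2l.
 rewrite -leeBlDr // -EFinB; apply: le_trans; rewrite lee_fin.
 by have -> : q * mu - q * mu / 2 = q * mu / 2 by field.
have h2 : ((2^-1)%:E * \int[M]_z (hitS s z * b z.1)%:E <= nmax%:E * \int[M]_z (fz s z)%:E)%E.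
 have nm0 : (0 <= nmax%:E)%E by rewrite lee_fin ltW.
 rewrite !int2 //.
 rewrite -ge0_integralZl //; [|exact: (mint2 mhb hb0)|by move=> y _; apply: nn_int_ge0].
 rewrite -ge0_integralZl //; [|exact: (mint2 (mfz s) (fz0 s))|by move=> y _; apply: nn_int_ge0].
 apply: ge0_le_integral => //.
 - by move=> y _; rewrite mule_ge0 //; exact: nn_int_ge0.
 - by apply: mfunZe; exact: (mint2 mhb hb0).
 - by apply: mfunZe; exact: (mint2 (mfz s) (fz0 s)).
 move=> y _; have := hit_le_fuzz mX meta0 mphi0 phi00 rs0 eps (@Sw0 s) (tnth y) h0 (ltW nmax0) phi0_le.
 rewrite /fz /= KE; apply: le_trans; apply: lee_wpmul2r => //.
 by apply: nn_int_ge0 => u; rewrite mulr_ge0.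
have : ((2^-1)%:E * (q * mu / 2)%:E <= nmax%:E * \int[M]_z (fz s z)%:E)%E.
 by apply: le_trans h2; apply: lee_wpmul2l; rewrite ?lee_fin.
rewrite -EFinM; have i0 : (0 <= (nmax^-1)%:E)%E by rewrite lee_fin invr_ge0 ltW.
move=> /(lee_wpmul2l i0); rewrite muleA -!EFinM mulVf ?gt_eqF // mul1e; apply: le_trans.
rewrite lee_fin; have -> // : q * mu / (4 * nmax) = nmax^-1 * (2^-1 * (q * mu / 2)).
by field; rewrite gt_eqF.
Qed.

Lemma hit_shift_other (s s' : 'I_n0) (Y : conf) (y x e x' : 'I_D -> R) : s != s' ->
 hit (S s') (shift_conf g (w_ s) Y x e) y x' = hit (S s') Y y x'.
move=> ss'; rewrite /shifted_hit; apply: eq_existsb => i; case: (boolP (S s' i)) => //= hi.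
apply: eq_forallb => j; rewrite /shift_conf (negbTE (disj ss' hi)) !mul0r addr0 //.
Qed.

(** Both fuzzes are replaced by hits, one resampling after the other. The resampling of s leaves the
    image of s' fixed because the windows are disjoint, and conversely; what remains is the overlap
    theta. The second truncation K'' is separate from K' because its error is divided by nmin, which
    depends on K'. *)
Lemma fuzz_pair s s' : s != s' ->
 (\int[M]_z (fz s z * fz s' z)%:E <=
  (nmin^-1 * (nmin'^-1 * theta + CK * E1') + CK * (CK * E1))%:E)%E.
move=> ss'; have s's : s' != s by rewrite eq_sym.
have ni0 : 0 <= nmin^-1 by rewrite invr_ge0 ltW.
have ni0' : 0 <= nmin'^-1 by rewrite invr_ge0 ltW.
have one t (Kt nt : R) (Psi : conf -> vec -> R) : 0 <= Kt -> 0 < nt ->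
  (forall s x, inbox (Kt + K) (tnth x) -> nt <= phi_ s x) -> (forall y, measurable_conf (fun Y _ => Psi Y y)) ->
  (forall Y y, 0 <= Psi Y y) -> (forall Y x e y, Psi (shift_conf g (w_ t) Y x e) y = Psi Y y) ->
  mfun (fun z : T * vec => Psi (Xc z.1) z.2) ->
  (\int[M]_z (Psi (Xc z.1) z.2 * fz t z * (inbox Kt (eta_ t ^~ z.1))%:R)%:E <=
   (nt^-1)%:E * \int[M]_z (Psi (Xc z.1) z.2 * hitS t z)%:E)%E.
 move=> Kt0 nt0 phi_t mPsi Psi0 Psiw mPz.
 have nti : 0 <= nt^-1 by rewrite invr_ge0 ltW.
 have mf1 : mfun (fun z => Psi (Xc z.1) z.2 * fz t z * (inbox Kt (eta_ t ^~ z.1))%:R).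
  apply: mfunM; first exact: mfunM.
  by apply: (mfst (f := fun u => ((inbox Kt (eta_ t ^~ u))%:R : R))); exact: min.
 have f10 z : 0 <= Psi (Xc z.1) z.2 * fz t z * (inbox Kt (eta_ t ^~ z.1))%:R by rewrite !mulr_ge0.
 have mf2 : mfun (fun z => Psi (Xc z.1) z.2 * hitS t z) by exact: mfunM.
 have f20 z : 0 <= Psi (Xc z.1) z.2 * hitS t z by rewrite mulr_ge0.
 have i0 : (0 <= (nt^-1)%:E)%E by rewrite lee_fin.
 rewrite !int2 // -(ge0_integralZl lam measurableT (mint2 mf2 f20) (fun y _ => nn_int_ge0 P (fun u => f20 (u, y))) i0).
 apply: ge0_le_integral => //.
 - by move=> y _; apply: nn_int_ge0 => u; exact: f10.
 - exact: (mint2 mf1 f10).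
 - by apply: mfunZe; exact: (mint2 mf2 f20).
 move=> y _; have := fuzz_le_hit mX (meta t) (mphi t) (phi_0 t) (rs t) eps (@Sw t) (tnth y) (Psi := Psi ^~ y)
  K0 Kt0 (ltW nt0) (phi_1 t) (@phi_t t) (mPsi y) (fun Y => Psi0 Y y) (fun Y x e => Psiw Y x e y).
 by move=> /(lee_wpmul2l i0); rewrite muleA -EFinM mulVf ?gt_eqF // mul1e.
have far t t' : (\int[M]_z ((~~ inbox K' (eta_ t ^~ z.1))%:R * fz t' z)%:E <= (CK * E1)%:E)%E.
 apply: (le_trans (fuzz_weight_int t' (mnin K' (meta t)) _)) => //.
 by rewrite EFinM; apply: lee_wpmul2l; rewrite ?lee_fin.
have far' t t' : (\int[M]_z ((~~ inbox K'' (eta_ t ^~ z.1))%:R * fz t' z)%:E <= (CK * E1')%:E)%E.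
 apply: (le_trans (fuzz_weight_int t' (mnin K'' (meta t)) _)) => //.
 by rewrite EFinM; apply: lee_wpmul2l; rewrite ?lee_fin.
have mnb Kt t : mfun (fun z : T * vec => ((~~ inbox Kt (eta_ t ^~ z.1))%:R : R)).
 by apply: (mfst (f := fun u => ((~~ inbox Kt (eta_ t ^~ u))%:R : R))); exact: mnin.
have mbb Kt t : mfun (fun z : T * vec => ((inbox Kt (eta_ t ^~ z.1))%:R : R)).
 by apply: (mfst (f := fun u => ((inbox Kt (eta_ t ^~ u))%:R : R))); exact: min.
have s2 : (\int[M]_z (hitS s z * fz s' z)%:E <= (nmin'^-1 * theta + CK * E1')%:E)%E.
 have -> : (\int[M]_z (hitS s z * fz s' z)%:E = \int[M]_z (hitS s z * fz s' z * (inbox K'' (eta_ s' ^~ z.1))%:R)%:E +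
   \int[M]_z (hitS s z * ((~~ inbox K'' (eta_ s' ^~ z.1))%:R * fz s' z))%:E)%E.
  rewrite -nn_intD.
  - by apply: eq_integral => z _; congr EFin; rewrite natrN; ring.
  - by apply: mfunM => //; exact: mfunM.
  - by apply: mfunM => //; exact: mfunM.
  - by move=> z; rewrite !mulr_ge0.
  - by move=> z; rewrite !mulr_ge0.
 rewrite EFinD; apply: leeD.
  have := one s' K'' nmin' (fun Y y => (hit (S s) Y (tnth y) zero)%:R) K''0 nmin'0 phi_ge' _ _ _ (mhitS s).
  move=> h1; apply: (le_trans (h1 _ _ _)).
  - by move=> y; exact: mf_hit.
  - by move=> Y y.
  - by move=> Y x e y; rewrite hit_shift_other.
  rewrite EFinM; apply: lee_wpmul2l; first by rewrite lee_fin.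
  exact: hit2.
 apply: le_trans (far' s' s'); apply: nn_int_le => [||z|z].
 - by apply: mfunM => //; exact: mfunM.
 - exact: mfunM.
 - by rewrite !mulr_ge0.
 - by rewrite ler_piMl ?mulr_ge0 // /hitS lern1 leq_b1.
have -> : (\int[M]_z (fz s z * fz s' z)%:E = \int[M]_z (fz s' z * fz s z * (inbox K' (eta_ s ^~ z.1))%:R)%:E +
  \int[M]_z (fz s z * ((~~ inbox K' (eta_ s ^~ z.1))%:R * fz s' z))%:E)%E.
 rewrite -nn_intD.
 - by apply: eq_integral => z _; congr EFin; rewrite natrN; ring.
 - by apply: mfunM => //; exact: mfunM.
 - by apply: mfunM => //; exact: mfunM.
 - by move=> z; rewrite !mulr_ge0.
 - by move=> z; rewrite !mulr_ge0.
rewrite EFinD; apply: leeD.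
 have := one s K' nmin (fun Y y => fuzz (S s') K Y (tnth y)) K'0 nmin0 phi_ge _ _ _ (mfz s').
 move=> h1; apply: (le_trans (h1 _ _ _)).
 - by move=> y; exact: mf_fuzz.
 - by move=> Y y; exact: fuzz_ge0.
 - by move=> Y x e y; rewrite /shifted_fuzz; under eq_integral do rewrite hit_shift_other //.
 rewrite EFinM; apply: lee_wpmul2l; first by rewrite lee_fin.
 apply: le_trans s2; under eq_integral do rewrite mulrC; exact: lexx.
apply: (@le_trans _ _ (\int[M]_z (CK * ((~~ inbox K' (eta_ s ^~ z.1))%:R * fz s' z))%:E)%E).
 apply: nn_int_le => [||z|z].
 - by apply: mfunM => //; exact: mfunM.
 - by apply: mfunM => //; exact: mfunM.
 - by rewrite !mulr_ge0.
 - by rewrite ler_wpM2r ?mulr_ge0 //; exact: fuzz_le_inbox.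
rewrite nn_intZ //; [|exact: mfunM|by move=> z; rewrite !mulr_ge0].
by rewrite EFinM; apply: lee_wpmul2l; [rewrite lee_fin|exact: far].
Qed.

(** The sum F of the fuzzes vanishes unless y lies in the box of radius rad00 around ctr0, whose
    mean volume is at most C0. Cauchy-Schwarz then compares the mean of F with its second moment,
    split into diagonal and off-diagonal terms. *)
Theorem core_inequality : (n0%:R * (q * mu / (4 * nmax))) ^+ 2 <=
 C0 * (n0%:R * (CK / gc ^+ D * (C2 * mu ^+ 2)) +
  n0%:R ^+ 2 * (nmin^-1 * (nmin'^-1 * theta + CK * E1') + CK * (CK * E1))).
set a := n0%:R * _; set b1 := CK / gc ^+ D * _; set b2 := nmin^-1 * _ + _.
have [n00|n0pos] := posnP n0; first by rewrite /a n00 !mul0r expr0n /= mul0r addr0 mulr0.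
have a0 : 0 < a by rewrite mulr_gt0 ?ltr0n // divr_gt0 ?mulr_gt0.
have cg : 0 <= CK / gc ^+ D by rewrite divr_ge0 // exprn_ge0 // ltW.
pose F z := \sum_s fz s z.
have mF : mfun F by exact: mfun_sumr.
have F0 z : 0 <= F z by exact: sumr_ge0.
have aF : (a%:E <= \int[M]_z (F z)%:E)%E.
 rewrite nn_int_sum //; have -> : (a%:E = \sum_(s < n0) (q * mu / (4 * nmax))%:E)%E.
  by rewrite sumEFin sumr_const card_ord /a mulr_natl.
 by apply: lee_sum => s _; exact: fuzz_first_moment.
have F2 : (\int[M]_z (F z ^+ 2)%:E <= (n0%:R * b1 + n0%:R ^+ 2 * b2)%:E)%E.
 have -> : (\int[M]_z (F z ^+ 2)%:E = \sum_s \sum_s' \int[M]_z (fz s z * fz s' z)%:E)%E.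
  under eq_integral do rewrite /F expr2 big_distrlr /=.
  rewrite nn_int_sum.
  - apply: eq_bigr => s _; rewrite nn_int_sum //.
   + by move=> s'; exact: mfunM.
   + by move=> s' z; rewrite mulr_ge0.
  - by move=> s; apply: mfun_sumr => s'; exact: mfunM.
  - by move=> s z; apply: sumr_ge0 => s' _; rewrite mulr_ge0.
 have diag s : (\int[M]_z (fz s z * fz s z)%:E <= b1%:E)%E.
  apply: (le_trans (fuzz_sq_int s)); rewrite /b1 [leRHS]EFinM; apply: lee_wpmul2l => //.
 have b10 : 0 <= b1 by rewrite -lee_fin; apply: le_trans (diag (Ordinal n0pos)); apply: nn_int_ge0 => z; rewrite mulr_ge0.
 have b20 : 0 <= b2.
  have ni0 : 0 <= nmin^-1 by rewrite invr_ge0 ltW.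
  have ni0' : 0 <= nmin'^-1 by rewrite invr_ge0 ltW.
  have CE : 0 <= CK * E1 by rewrite mulr_ge0.
  have CE' : 0 <= CK * E1' by rewrite mulr_ge0.
  by apply: addr_ge0; [apply: mulr_ge0 => //; apply: addr_ge0 => //; exact: mulr_ge0|exact: mulr_ge0].
 apply: (@le_trans _ _ (\sum_(s < n0) \sum_(s' < n0) (((s == s')%:R * b1 + b2)%R)%:E)%E).
  apply: lee_sum => s _; apply: lee_sum => s' _; have [<-|ss'] := eqVneq s s'.
   by apply: (le_trans (diag s)); rewrite lee_fin mul1r lerDl.
  by apply: (le_trans (fuzz_pair ss')); rewrite mul0r add0r.
 under eq_bigr do rewrite sumEFin; rewrite sumEFin lee_fin.
 under eq_bigr => s _.
  rewrite big_split /= sumr_const card_ord -mulr_suml (bigD1 s) //= eqxx big1 ?addr0 ?mul1r; last first.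
   by move=> s' /negbTE; rewrite eq_sym => ->.
  over.
 rewrite (_ : \sum_s _ = (b1 + b2 *+ n0) *+ n0); last by rewrite sumr_const card_ord.
 clearbody b1 b2; clear; rewrite -(mulr_natl b2) -mulr_natl mulrDr mulrA -expr2; exact: lexx.
pose ind (z : T * vec) : R := [forall j, `|tnth z.2 j - ctr0 j z.1| < rad00 z.1]%:R.
have mind : mfun ind.
 apply: mfun_natr_forall => j; apply: mfun_natr_lt; last exact: mfst.
 apply: mcomp => //; apply: mfunB; last exact: mfst.
 exact: (mcomp (mfun_tnthR j) msnd).
have indC : (\int[M]_z (ind z)%:E <= C0%:E)%E.
 apply: le_trans radC0; apply: int1_le => //.
  by apply: mfunX; exact: mfunM.
 move=> u; apply: (@box_le _ (ctr0 ^~ u)) => //; first exact: (msec1 u mind).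
 by move=> y /forallP.
have Find z : F z != 0 -> 1 <= ind z.
 move=> Fz; rewrite /ind; case: (boolP [forall j, _]) => // hn; exfalso.
 move/negP: Fz; apply; rewrite /F big1 // => s _.
 rewrite /fz /shifted_fuzz; under eq_integral => x _.
  have -> : (inbox K (tnth x))%:R * (hit (S s) (Xc z.1) (tnth z.2) (tnth x))%:R = 0 :> R.
   case: (boolP (inbox _ _)) => hx; last by rewrite mul0r.
   case: (boolP (hit _ _ _ _)) => hh; last by rewrite mulr0.
   by case/negP: hn; apply/forallP => j; exact: (hrad0 hx hh).
  over.
 by rewrite integral0.
have ac : 0 < a / C0 by rewrite divr_gt0.
(* The choice s = a / C0 makes the support term at most a, half of the left side. *)
have := nn_int_support M mF mind F0 (fun z => ler0n _ _) Find ac.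
move=> hs.
have : ((2 * a)%:E <= (a / C0 * C0 + (a / C0)^-1 * (n0%:R * b1 + n0%:R ^+ 2 * b2))%:E)%E.
 apply: (@le_trans _ _ (2%:E * \int[M]_z (F z)%:E)%E); first by rewrite EFinM; apply: lee_wpmul2l; rewrite ?lee_fin.
 apply: (le_trans hs); rewrite EFinD !EFinM; apply: leeD; apply: lee_wpmul2l; rewrite ?lee_fin ?invr_ge0 ?(ltW ac) //.
rewrite lee_fin divfK ?gt_eqF // invf_div mulrDl mul1r lerD2l => h1.
by move: h1; rewrite -mulrA mulrCA mulrC -ler_pdivrMr ?invr_gt0 // ?invrK.
Qed.

End core_inequality.

(** * Parabolic cells and dyadic grids *)

Section cells.
Context {R : realType} (k : nat).
Notation V := (R * 'rV[R]_k)%type.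

Definition cell (p0 : V) (r : R) (p : V) : Prop :=
 p0.1 <= p.1 <= p0.1 + r ^+ 2 /\ forall i, p0.2 0 i <= p.2 0 i <= p0.2 0 i + r.

Definition near_points (del : R) (p q : V) : Prop :=
 `|p.1 - q.1| <= del ^+ 2 /\ forall i, `|p.2 0 i - q.2 0 i| <= del.

(** One-sided closeness, produced by rounding down: two points below the same p are near each other
    at the same distance, without doubling. *)
Definition below (del : R) (p q : V) : Prop :=
 p.1 - del ^+ 2 <= q.1 <= p.1 /\ forall i, p.2 0 i - del <= q.2 0 i <= p.2 0 i.

Lemma below_near del p q q' : below del p q -> below del p q' -> near_points del q q'.
move=> [/andP[a1 a2] h] [/andP[b1 b2] h']; split; first by rewrite ler_norml; lra.
by move=> i; move: (h i) (h' i) => /andP[c1 c2] /andP[d1 d2]; rewrite ler_norml; lra.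
Qed.

Lemma belowW del del' p q : 0 <= del -> del <= del' -> below del p q -> below del' p q.
move=> d0 dd [/andP[a1 a2] h].
have d2 : del ^+ 2 <= del' ^+ 2 by rewrite lerXn2r ?nnegrE // (le_trans d0).
split; first by lra.
by move=> i; move: (h i) => /andP[c1 c2]; lra.
Qed.

(** Level 0 is the corner alone, so that every chain starts at p0. Level l has mesh r / 2^l in space
    and r^2 / 4^l in time. *)
Definition dyadic_grid (p0 : V) (r : R) (l : nat) : seq V :=
 if l is 0%N then [:: p0] else
 [seq (p0.1 + r ^+ 2 * (a%:R / 4 ^+ l), \row_i (p0.2 0 i + r * ((f i : nat)%:R / 2 ^+ l))) |
  a : nat <- iota 0 (4 ^ l).+1, f : {ffun 'I_k -> 'I_(2 ^ l).+1} <- enum {: {ffun 'I_k -> 'I_(2 ^ l).+1}}].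

Lemma size_dyadic_grid p0 r l :
 (size (dyadic_grid p0 r l) <= 2 ^ k.+1 * 2 ^ (l * k.+2))%N.
case: l => [|l]; first by rewrite /= mul0n expn0 muln1 expn_gt0.
rewrite size_allpairs size_iota -cardT card_ffun !card_ord; move: (l.+1) => L.
have e : (2 ^ k.+1 * 2 ^ (L * k.+2) = (2 * 4 ^ L) * (2 * 2 ^ L) ^ k)%N.
 rewrite -[4%N]/(2 ^ 2)%N -expnM -!expnS -expnM -!expnD; congr (2 ^ _)%N.
 rewrite !mulnS mulSn; ring.
rewrite e leq_mul //; first by rewrite mul2n -addnn -addn1 leq_add2l expn_gt0.
case: (k) => [|k']; first by rewrite !expn0.
by rewrite leq_exp2r // mul2n -addnn -addn1 leq_add2l expn_gt0.
Qed.

Lemma dyadic_grid_below p0 r l p : 0 < r -> cell p0 r p ->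
 exists2 q, q \in dyadic_grid p0 r l & below (r / 2 ^+ l) p q.
move=> r0 [/andP[t1 t2] hx]; case: l => [|l].
 exists p0; first by rewrite mem_seq1.
 rewrite expr0 divr1; split; first by lra.
 by move=> i; move: (hx i) => /andP[c1 c2]; lra.
set L := l.+1.
have r2 : 0 < r ^+ 2 by rewrite exprn_gt0.
have p4 : 0 < 4 ^+ L :> R by rewrite exprn_gt0.
have p2 : 0 < 2 ^+ L :> R by rewrite exprn_gt0.
have trunc (c y : R) (m : nat) : 0 < c -> (0 < m)%N -> 0 <= y <= c ->
  exists2 a : nat, (a <= m)%N & y - c / m%:R <= c * (a%:R / m%:R) <= y.
 move=> c0 m0 /andP[y0 yc]; have m0' : 0 < m%:R :> R by rewrite ltr0n.
 have z0 : 0 <= m%:R * (y / c) by rewrite mulr_ge0 // divr_ge0 // ltW.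
 have h1 := truncn_le (m%:R * (y / c)); rewrite z0 in h1.
 have h2 := truncnS_gt (m%:R * (y / c)).
 set a := Num.truncn _ in h1 h2; exists a.
  rewrite -(ler_nat R); apply: (le_trans h1).
  by rewrite -[leRHS]mulr1 ler_wpM2l ?ler0n // ler_pdivrMr // mul1r.
 have ya : c * (a%:R / m%:R) <= y.
  have -> : y = c * ((m%:R * (y / c)) / m%:R) by field; rewrite !gt_eqF.
  by rewrite ler_wpM2l ?(ltW c0) // ler_wpM2r // invr_ge0 ltW.
 rewrite ya andbT lerBlDr.
 have -> : c * (a%:R / m%:R) + c / m%:R = c * (a.+1%:R / m%:R) by rewrite -natr1; ring.
 have {1}-> : y = c * ((m%:R * (y / c)) / m%:R) by field; rewrite !gt_eqF.
 by rewrite ler_wpM2l ?(ltW c0) // ler_wpM2r ?invr_ge0 ?(ltW m0') // ltW.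
have [|||a aL ha] := trunc (r ^+ 2) (p.1 - p0.1) (4 ^ L)%N => //; first by rewrite expn_gt0.
 by lra.
have hb (i : 'I_k) : exists b : 'I_(2 ^ L).+1, (p.2 0 i - p0.2 0 i) - r / 2 ^+ L <= r * ((b : nat)%:R / 2 ^+ L) <= p.2 0 i - p0.2 0 i.
 have [|||b bL h] := trunc r (p.2 0 i - p0.2 0 i) (2 ^ L)%N => //; first by rewrite expn_gt0.
  by move: (hx i); lra.
 by rewrite natrX in h; exists (Ordinal (bL : (b < (2 ^ L).+1)%N)).
have [f hf] := choice hb.
exists (p0.1 + r ^+ 2 * (a%:R / 4 ^+ L), \row_i (p0.2 0 i + r * ((([ffun i => f i] : {ffun 'I_k -> 'I_(2 ^ L).+1}) i : nat)%:R / 2 ^+ L))).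
 by rewrite /dyadic_grid -/L; apply: allpairs_f; [rewrite mem_iota|rewrite mem_enum].
rewrite natrX in ha; have e : (r / 2 ^+ L) ^+ 2 = r ^+ 2 / 4 ^+ L.
 by rewrite expr_div_n -exprM mulnC exprM; congr (_ / _ ^+ _); ring.
split; rewrite /=; first by rewrite e; lra.
by move=> i; rewrite mxE ffunE; move: (hf i); lra.
Qed.

End cells.

(** * Sums along a chain *)

Section chaining_sums.
Context {R : realType}.

Lemma ler_mem_sum (I : eqType) (s : seq I) (Q : pred I) (f : I -> R) x : x \in s -> Q x ->
 nonneg f -> f x <= \sum_(y <- s | Q y) f y.
move=> xs Qx f0; rewrite (big_rem x) //= Qx lerDl; exact: sumr_ge0.
Qed.

Lemma lee_sum_size (I : Type) (s : seq I) (Q : pred I) (f : I -> \bar R) (c : R) : 0 <= c ->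
 (forall x, Q x -> f x <= c%:E)%E -> (\sum_(x <- s | Q x) f x <= ((size s)%:R * c)%:E)%E.
move=> c0 fc; elim: s => [|x s IH]; first by rewrite big_nil /= mul0r.
rewrite big_cons /= -natr1 mulrDl mul1r [X in (_ <= X%:E)%E]addrC EFinD.
case: (boolP (Q x)) => Qx; first by apply: leeD; [exact: fc|exact: IH].
by rewrite -[leLHS]add0e; apply: leeD; [rewrite lee_fin|exact: IH].
Qed.

Lemma geometric_sum_le (rho : R) L : 0 <= rho -> rho < 1 -> \sum_(l < L) rho ^+ l <= (1 - rho)^-1.
move=> r0 r1; rewrite -[leRHS]mul1r ler_pdivlMr ?subr_gt0 // mulrC -[leLHS]opprK -mulNr opprB -subrX1.
by rewrite opprB gerBl exprn_ge0.
Qed.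

(* Writing rho = 1 - 1/(2N), Bernoulli gives 2^-1 <= rho^N, so each term is at
  most rho^l Z^(1/N). *)
Lemma chain_power (N L : nat) (a : nat -> R) (Z : R) : (0 < N)%N -> 0 <= Z ->
 (forall l, (l <= L)%N -> 2 ^+ l * `|a l| ^+ N <= Z) ->
 `|\sum_(l < L.+1) a l| ^+ N <= (2 * N%:R) ^+ N * Z.
move=> N0 Z0 ha; pose y := Z `^ (N%:R^-1).
have NR : 0 < N%:R :> R by rewrite ltr0n.
have yN : y ^+ N = Z by rewrite -powR_mulrn ?powR_ge0 // -powRrM mulVf ?gt_eqF // powRr1.
have y0 : 0 <= y by exact: powR_ge0.
pose rho : R := 1 - (2 * N%:R)^-1.
have i1 : 0 < (2 * N%:R)^-1 :> R by rewrite invr_gt0 mulr_gt0.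
have i2 : (2 * N%:R)^-1 <= 2^-1 :> R.
 by rewrite lef_pV2 ?posrE ?mulr_gt0 // -[leLHS]mulr1 ler_wpM2l // ler1n.
have r0 : 0 <= rho by rewrite /rho; lra.
have r1 : rho < 1 by rewrite /rho; lra.
have bern n : 1 - n%:R * (2 * N%:R)^-1 <= rho ^+ n :> R.
 elim: n => [|n IH]; first by rewrite mul0r subr0 expr0.
 rewrite exprS; apply: (@le_trans _ _ (rho * (1 - n%:R * (2 * N%:R)^-1))); last by rewrite ler_wpM2l.
 rewrite /rho -natr1 -subr_ge0.
 have -> : (1 - (2 * N%:R)^-1) * (1 - n%:R * (2 * N%:R)^-1) - (1 - (n%:R + 1) * (2 * N%:R)^-1) =
  n%:R * (2 * N%:R)^-1 ^+ 2 :> R by ring.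
 by rewrite mulr_ge0 // sqr_ge0.
have rN : 2^-1 <= rho ^+ N.
 by apply: le_trans (bern N); have -> : N%:R * (2 * N%:R)^-1 = 2^-1 :> R; [field; rewrite gt_eqF|lra].
have term l : (l <= L)%N -> `|a l| <= rho ^+ l * y.
 move=> lL; rewrite -(ler_pXn2r N0) ?nnegrE ?mulr_ge0 ?exprn_ge0 // exprMn yN.
 have p2 : 0 < 2 ^+ l :> R by rewrite exprn_gt0.
 apply: (@le_trans _ _ ((2 ^+ l)^-1 * Z)); first by rewrite ler_pdivlMl // ha.
 rewrite ler_wpM2r // -exprM mulnC exprM -exprVn lerXn2r ?nnegrE ?exprn_ge0 //.
rewrite -yN -exprMn lerXn2r ?nnegrE ?mulr_ge0 ?ler0n //.
apply: (le_trans (ler_norm_sum _ _ _)).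
apply: (@le_trans _ _ (\sum_(l < L.+1) rho ^+ l * y)).
 by apply: ler_sum => l _; apply: term; rewrite -ltnS.
rewrite -mulr_suml ler_wpM2r //; apply: (le_trans (geometric_sum_le _ r0 r1)).
by rewrite /rho subKr invrK.
Qed.

End chaining_sums.

(** * Chaining over finite subsets of a cell *)

Section chaining.
Context d (T : measurableType d) {R : realType} (P : probability T R) (k N : nat).
Notation V := (R * 'rV[R]_k)%type.
Notation Q := k.+2.
Variables (u : V -> T -> R) (Cm : R).
Hypotheses (N0 : (0 < N)%N) (mu : forall p, mfun (u p)) (Cm0 : 0 <= Cm).
Hypothesis moment : forall del p q, 0 < del -> near_points del p q ->
 (\int[P]_w (`|u p w - u q w| ^+ N)%:E <= (Cm * del ^+ (4 * Q))%:E)%E.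

Definition chaining_constant : R :=
 (2 * N%:R) ^+ N * (Cm * ((2 ^+ k.+1) ^+ 2 * 2 ^+ Q * 2 + 2 ^+ k.+1)).

Lemma chaining_constant_ge0 : 0 <= chaining_constant.
by rewrite !mulr_ge0 // ?exprn_ge0 ?mulr_ge0 // addr_ge0 // !mulr_ge0. Qed.

(** Level l has of order 2^(2lQ) pairs, each with N-th moment of order 2^(-4lQ), so even with the
    weight 2^l required by [chain_power] the sum over levels is geometric. Summing over all near
    pairs makes Z independent of the chains, and its mean is bounded independently of F. *)
Lemma chaining (p0 : V) (r : R) (F : seq V) : 0 < r -> (forall p, p \in F -> cell p0 r p) ->
 exists Z : T -> R, [/\ mfun Z, forall w, 0 <= Z w,
  (\int[P]_w (Z w)%:E <= (chaining_constant * r ^+ (4 * Q))%:E)%E &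
  forall p w, p \in F -> `|u p w - u p0 w| ^+ N <= Z w].
(* The last link jumps from the grid of level [size F] to F itself. At that level 2^L exceeds the
   number of points of F, so an arbitrary finite set costs no more than a grid. *)
move=> r0 Fc; pose L := size F; pose Gd := dyadic_grid p0 r.
pose dl l : R := r / 2 ^+ l.
have dl0 l : 0 < dl l by rewrite divr_gt0 // exprn_gt0.
pose inc p q w : R := `|u p w - u q w| ^+ N.
have minc p q : mfun (inc p q).
 by apply: mfunX; apply: mcomp => //; exact: mfunB.
have inc0 p q w : 0 <= inc p q w by rewrite exprn_ge0.
pose pairs (s s' : seq V) del w : R := \sum_(q <- s) \sum_(q' <- s' | `[< near_points del q q' >]) inc q q' w.
have mpairs s s' del : mfun (pairs s s' del).
 by apply: mfun_sumr => q; exact: mfun_sumr.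
have pairs0 s s' del w : 0 <= pairs s s' del w by apply: sumr_ge0 => q _; exact: sumr_ge0.
have Epairs s s' del : 0 < del ->
  (\int[P]_w (pairs s s' del w)%:E <= ((size s)%:R * ((size s')%:R * (Cm * del ^+ (4 * Q))))%:E)%E.
 move=> d0; have c0 : 0 <= Cm * del ^+ (4 * Q) by rewrite mulr_ge0 // exprn_ge0 // ltW.
 rewrite nn_int_sum; [|by move=> q; exact: mfun_sumr|by move=> q w; exact: sumr_ge0].
 apply: lee_sum_size => [|q _]; first by rewrite mulr_ge0.
 rewrite nn_int_sum //; apply: lee_sum_size => // q' /asboolP nq; exact: moment.
pose Zt w := \sum_(l < L) 2 ^+ l * pairs (Gd l.+1) (Gd l) (dl l) w + 2 ^+ L * pairs F (Gd L) (dl L) w.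
have mlp l s s' del : mfun (fun w => 2 ^+ l * pairs s s' del w) by exact: mfunM.
have p20 l : 0 <= 2 ^+ l :> R by rewrite exprn_ge0.
have mZt : mfun Zt by apply: mfunD => //; exact: mfun_sumr.
have Zt0 w : 0 <= Zt w by rewrite addr_ge0 ?mulr_ge0 // sumr_ge0 // => l _; rewrite mulr_ge0.
have c20 : 0 <= (2 * N%:R) ^+ N :> R by rewrite exprn_ge0 // mulr_ge0.
exists (fun w => (2 * N%:R) ^+ N * Zt w); split.
- exact: mfunM.
- by move=> w; rewrite mulr_ge0.
- rewrite nn_intZ // /chaining_constant -mulrA EFinM; apply: lee_wpmul2l; first by rewrite lee_fin.
 set G := 2 ^+ k.+1 : R.
 have G0 : 0 <= G by exact: p20.
 have sG l : (size (Gd l))%:R <= G * 2 ^+ (l * Q) :> R.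
  by rewrite /G -!natrX -natrM ler_nat size_dyadic_grid.
 have rQ : 0 <= r ^+ (4 * Q) by rewrite exprn_ge0 // ltW.
 have dlE l : dl l ^+ (4 * Q) = r ^+ (4 * Q) / (2 ^+ (l * Q)) ^+ 4.
  by rewrite /dl expr_div_n -!exprM (mulnC 4%N) mulnA.
 have e2 l : 2 ^+ l <= 2 ^+ (l * Q) :> R by rewrite ler_eXn2l ?ltr1n // mulnS leq_addr.
 rewrite /Zt nn_intD //; last 3 first.
 - exact: mfun_sumr.
 - by move=> w; apply: sumr_ge0 => l _; rewrite mulr_ge0.
 - by move=> w; rewrite mulr_ge0.
 have -> : Cm * (G ^+ 2 * 2 ^+ Q * 2 + G) * r ^+ (4 * Q) =
  Cm * G ^+ 2 * 2 ^+ Q * r ^+ (4 * Q) * 2 + Cm * G * r ^+ (4 * Q) by ring.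
 rewrite EFinD; apply: leeD.
  rewrite nn_int_sum //; last by move=> l w; rewrite mulr_ge0.
  apply: (@le_trans _ _ (\sum_(l < L) (Cm * G ^+ 2 * 2 ^+ Q * r ^+ (4 * Q) * (2^-1) ^+ l)%:E)%E).
   apply: lee_sum => l _; rewrite nn_intZ //.
   apply: (le_trans (lee_wpmul2l _ (Epairs _ _ _ (dl0 l)))); first by rewrite lee_fin.
   rewrite -EFinM lee_fin dlE; have := sG l; have := sG l.+1; have := e2 l.
   have := exprn_gt0 Q (ltr0n R 2); have := exprn_gt0 (l * Q) (ltr0n R 2); have := exprn_gt0 l (ltr0n R 2).
   rewrite mulSn exprD exprVn; have := ler0n R (size (Gd l)); have := ler0n R (size (Gd l.+1)).
   move: (size _)%:R (size _)%:R (2 ^+ l) (2 ^+ (l * Q)) (2 ^+ Q) (r ^+ (4 * Q)) rQ.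
   move=> s1 s2 a b c rr rr0 s10 s20 a0 b0 c0 ab hs1 hs2.
   apply: (@le_trans _ _ (a * ((G * (c * b)) * ((G * b) * (Cm * (rr / b ^+ 4)))))).
    have x0 : 0 <= Cm * (rr / b ^+ 4) by rewrite mulr_ge0 // divr_ge0 // exprn_ge0 // ltW.
    rewrite ler_wpM2l ?(ltW a0) //; apply: ler_pM => //; first by rewrite mulr_ge0.
    by rewrite ler_wpM2r.
   have -> : a * ((G * (c * b)) * ((G * b) * (Cm * (rr / b ^+ 4)))) = Cm * G ^+ 2 * c * rr * (a / b ^+ 2).
    by field; rewrite gt_eqF.
   rewrite ler_wpM2l ?mulr_ge0 ?sqr_ge0 ?(ltW c0) // ler_pdivrMr ?exprn_gt0 // mulrC ler_pdivlMr // expr2.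
   by rewrite ler_pM // ltW.
  rewrite sumEFin lee_fin -mulr_sumr ler_wpM2l //.
   by do 3! (apply: mulr_ge0 => //); exact: exprn_ge0.
  apply: (le_trans (geometric_sum_le _ _ _)); [lra|lra|].
  have -> : 1 - 2^-1 = 2^-1 :> R by field.
  by rewrite invrK.
 rewrite nn_intZ //.
 apply: (le_trans (lee_wpmul2l _ (Epairs _ _ _ (dl0 L)))); first by rewrite lee_fin.
 rewrite -EFinM lee_fin dlE.
 have sL : (size F)%:R <= 2 ^+ L :> R by rewrite -natrX ler_nat ltnW // ltn_expl.
 have b1 : 1 <= 2 ^+ (L * Q) :> R by rewrite exprn_ege1 // ler1n.
 have := sG L; have := e2 L; have := exprn_gt0 L (ltr0n R 2).
 have := ler0n R (size (Gd L)); have := ler0n R (size F).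
 move: (size F)%:R (size (Gd L))%:R (2 ^+ L) (2 ^+ (L * Q)) (r ^+ (4 * Q)) sL b1 rQ.
 move=> s1 s2 a b rr s1a b1 rr0 s10 s20 a0 ab hs2.
 have b0 : 0 < b by apply: lt_le_trans b1.
 apply: (@le_trans _ _ (b * (b * ((G * b) * (Cm * (rr / b ^+ 4)))))).
  have x0 : 0 <= Cm * (rr / b ^+ 4) by rewrite mulr_ge0 // divr_ge0 // exprn_ge0 // ltW.
  apply: ler_pM => //; [exact: ltW|by rewrite mulr_ge0 // mulr_ge0|].
  apply: ler_pM => //; [by rewrite mulr_ge0|exact: le_trans ab|].
  by rewrite ler_wpM2r.
 have -> : b * (b * ((G * b) * (Cm * (rr / b ^+ 4)))) = Cm * G * rr / b.
  by field; rewrite gt_eqF.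
 rewrite ler_piMr ?invf_le1 //; by do 2! (apply: mulr_ge0 => //).
move=> p w pF.
have hb l : exists2 q, q \in Gd l & below (dl l) p q := dyadic_grid_below l r0 (Fc p pF).
have [pi hpi] := choice (fun l => (let: ex_intro2 q a b := hb l in ex_intro (fun q => q \in Gd l /\ below (dl l) p q) q (conj a b))).
have pi0 : pi 0%N = p0 by have [+ _] := hpi 0%N; rewrite mem_seq1 => /eqP.
pose a l := if (l < L)%N then u (pi l.+1) w - u (pi l) w else u p w - u (pi l) w.
have -> : u p w - u p0 w = \sum_(l < L.+1) a l.
 rewrite big_ord_recr /= /a ltnn -pi0.
 under eq_bigr => l _ do rewrite ltn_ord.
 by rewrite -(big_mkord xpredT (fun l => u (pi l.+1) w - u (pi l) w)) telescope_sumr // addrC addrA subrK.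
apply: chain_power => // l lL; rewrite /a; case: ifP => lL'.
 have [q1 b1] := hpi l.+1; have [q2 b2] := hpi l.
 have nr : near_points (dl l) (pi l.+1) (pi l).
  apply: (below_near _ b2); apply: (belowW (ltW (dl0 _)) _ b1).
  by rewrite /dl ler_wpM2l ?(ltW r0) // lef_pV2 ?posrE ?exprn_gt0 // ler_eXn2l ?ltr1n.
 apply: (@le_trans _ _ (2 ^+ l * pairs (Gd l.+1) (Gd l) (dl l) w)).
  rewrite ler_wpM2l //; apply: (le_trans _ (ler_mem_sum q1 isT _)); last by move=> q; exact: sumr_ge0.
  by apply: (ler_mem_sum q2) => //; apply/asboolP.
 rewrite /Zt ler_wpDr ?mulr_ge0 //.
 rewrite (bigD1 (Ordinal lL')) //= lerDl; apply: sumr_ge0 => i _; rewrite mulr_ge0 //.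
have -> : l = L by apply/eqP; rewrite eqn_leq lL leqNgt lL'.
have [q2 b2] := hpi L.
rewrite /Zt ler_wpDl //; first by apply: sumr_ge0 => i _; rewrite mulr_ge0.
rewrite ler_wpM2l //; apply: (le_trans _ (ler_mem_sum pF isT _)); last by move=> q; exact: sumr_ge0.
apply: (ler_mem_sum q2) => //; apply/asboolP; apply: (below_near _ b2).
split; first by rewrite lexx andbT lerBlDr lerDl exprn_ge0 // ltW.
by move=> i; rewrite lexx andbT lerBlDr lerDl ltW.
Qed.

End chaining.

(** * Gaussian densities with variance in a given range *)

Section density_bounds.
Context {R : realType} (D : nat).
Notation mR := (measurableTypeR R).
Notation vec := (D.-tuple mR).
Notation lam := (lebesgue_tuple R D).
Notation leb := (@lebesgue_measure R).
Notation c := (gmoment (R := R) 1).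
Let c0 : 0 < c := @gmoment1_gt0 R.

(** The peak of the density of least variance a per coordinate. [npdf_inf] combines the lowest peak,
    of variance B, with the fastest decay, of variance a. *)
Definition npdf_sup (a : R) : R := (Num.sqrt (a / c * pi *+ 2))^-1 ^+ D.
Definition npdf_inf (a B K : R) : R :=
 ((Num.sqrt (B / c * pi *+ 2))^-1 * expR (- (K ^+ 2 / (a / c *+ 2)))) ^+ D.

Lemma npdf_sup_gt0 a : 0 < a -> 0 < npdf_sup a.
by move=> a0; rewrite exprn_gt0 // invr_gt0 sqrtr_gt0 pmulrn_lgt0 // mulr_gt0 ?pi_gt0 // divr_gt0.
Qed.

Lemma npdf_inf_gt0 a B K : 0 < B -> 0 < npdf_inf a B K.
move=> B0; rewrite exprn_gt0 // mulr_gt0 ?expR_gt0 // invr_gt0 sqrtr_gt0 pmulrn_lgt0 //.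
by rewrite mulr_gt0 ?pi_gt0 // divr_gt0.
Qed.

Variables (a B tau : R).
Hypotheses (a0 : 0 < a) (tau0 : 0 < tau) (alo : a <= c * tau ^+ 2) (bhi : c * tau ^+ 2 <= B).

Let ta : a / c <= tau ^+ 2. by rewrite ler_pdivrMr // mulrC. Qed.
Let tB : tau ^+ 2 <= B / c. by rewrite ler_pdivlMr // mulrC. Qed.
Let ac : 0 < a / c. exact: divr_gt0. Qed.
Let t2 : 0 < tau ^+ 2. exact: exprn_gt0. Qed.
Let B0 : 0 < B. by apply: lt_le_trans bhi; rewrite mulr_gt0. Qed.

Lemma npdf_le (x : vec) : npdf tau x <= npdf_sup a.
rewrite /npdf /npdf_sup -[D in _ ^+ D]card_ord -prodr_const; apply: ler_prod => i _.
rewrite normal_pdf_ge0 /=; apply: (le_trans (normal_pdf_ub _ _ (lt0r_neq0 tau0))).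
rewrite /normal_peak lef_pV2 ?posrE ?sqrtr_gt0 ?pmulrn_lgt0 ?(mulr_gt0 ac) ?(mulr_gt0 t2) ?pi_gt0 //.
by rewrite ler_wsqrtr // lerMn2r /= ler_wpM2r // ltW // pi_gt0.
Qed.

Lemma npdf_ge K (x : vec) : inbox K (tnth x) -> npdf_inf a B K <= npdf tau x.
move=> /forallP hx; rewrite /npdf /npdf_inf -[D in _ ^+ D]card_ord -prodr_const.
apply: ler_prod => i _; apply/andP; split.
 by rewrite mulr_ge0 ?expR_ge0 // invr_ge0 sqrtr_ge0.
rewrite /normal_pdf gt_eqF // /normal_peak /normal_fun subr0.
apply: ler_pM; rewrite ?expR_ge0 ?invr_ge0 ?sqrtr_ge0 //.
 have Bc : 0 < B / c by exact: divr_gt0.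
 rewrite lef_pV2 ?posrE ?sqrtr_gt0 ?pmulrn_lgt0 ?(mulr_gt0 Bc) ?(mulr_gt0 t2) ?pi_gt0 //.
 by rewrite ler_wsqrtr // lerMn2r /= ler_wpM2r // ltW // pi_gt0.
rewrite ler_expR mulNr lerN2.
apply: ler_pM; rewrite ?sqr_ge0 ?invr_ge0 ?mulrn_wge0 ?sqr_ge0 //.
 by rewrite -(real_normK (num_real (tnth x i))) lerXn2r ?nnegrE // (le_trans _ (hx i)).
by rewrite lef_pV2 ?posrE ?pmulrn_lgt0 // lerMn2r.
Qed.

Lemma normal_tail (K : R) : 0 < K ->
 (\int[leb]_x (normal_pdf 0 tau x * ((K < `|x|)%R%:R))%:E <= (c * tau ^+ 2 / K ^+ 2)%:E)%E.
move=> K0; have mS : measurable [set x : mR | K < `|x|].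
 rewrite -[X in measurable X]setTI; apply: (measurable_fun_ltr (f := cst K) (g := fun x : mR => `|x|)) => //.
 exact: mcomp.
have -> : (\int[leb]_x (normal_pdf 0 tau x * ((K < `|x|)%R%:R))%:E = normal_prob 0 tau [set x | (K < `|x|)%R])%E.
 rewrite /normal_prob [RHS]integral_mkcond; apply: eq_integral => x _.
 rewrite patchE; case: ifPn => [|/negP]; rewrite inE /= => h; first by rewrite h mulr1.
 by move/negbTE: (introN idP h) => ->; rewrite mulr0.
rewrite normal_prob_scale ?gt_eqF //.
have Kt : 0 < K / tau by rewrite divr_gt0.
have -> : (c * tau ^+ 2 / K ^+ 2 = c / (K / tau) ^+ 2) by field; rewrite !gt_eqF.
apply: le_trans (gauss_tail Kt); apply: le_measure; rewrite ?inE.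
- rewrite -[X in measurable X]setTI; apply: (measurable_fun_ltr (f := cst K) (g := fun x : mR => `|tau * x|)) => //.
 by apply: mcomp => //; exact: mfunM.
- rewrite -[X in measurable X]setTI; apply: (measurable_fun_ler (f := cst (K / tau)) (g := fun x : mR => `|x|)) => //.
 exact: mcomp.
by move=> x /=; rewrite normrM (gtr0_norm tau0) ler_pdivrMr // mulrC => /ltW.
Qed.

Lemma npdf_tail (K : R) : 0 < K ->
 (\int[lam]_x (npdf tau x * (~~ inbox K (tnth x))%:R)%:E <= (D%:R * (B / K ^+ 2))%:E)%E.
move=> K0.
have mt i : mfun (fun x : vec => ((K < `|tnth x i|)%R%:R : R)).
 by apply: mfun_natr_lt => //; apply: mcomp => //; exact: mfun_tnthR.
have e (x : vec) : (~~ inbox K (tnth x))%:R <= \sum_i (K < `|tnth x i|)%R%:R :> R.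
 case: (boolP (inbox _ _)) => [_|]; first exact: sumr_ge0.
 rewrite negb_forall => /existsP[i]; rewrite -ltNge => hi.
 by rewrite (bigD1 i) //= hi lerDl sumr_ge0.
have mn : mfun (fun x : vec => ((~~ inbox K (tnth x))%:R : R)).
 have e' b : ((~~ b)%:R : R) = 1 - b%:R by case: b; rewrite ?subrr ?subr0.
 under eq_fun do rewrite e'; apply: mfunB => //.
 exact: (@mfun_inbox _ _ _ _ K (fun j (x : vec) => tnth x j) (@mfun_tnthR _ _)).
have mN := @mfun_npdf R D tau.
apply: (@le_trans _ _ (\int[lam]_x (\sum_i npdf tau x * (K < `|tnth x i|)%R%:R)%:E)%E).
 apply: nn_int_le => [||x|x].
 - exact: mfunM.
 - by apply: mfun_sumr => i; exact: mfunM.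
 - by rewrite mulr_ge0 // npdf_ge0.
 - by rewrite -mulr_sumr ler_wpM2l // npdf_ge0.
rewrite nn_int_sum; [|by move=> i; exact: mfunM|by move=> i x; rewrite mulr_ge0 // npdf_ge0].
have h i : (\int[lam]_x (npdf tau x * (K < `|tnth x i|)%R%:R)%:E <= (B / K ^+ 2)%:E)%E.
 pose gg (j : 'I_D) (x : mR) : R := normal_pdf 0 tau x * (if j == i then (K < `|x|)%R%:R else 1).
 have mgg j : mfun (gg j).
  apply: mfunM; first exact: measurable_normal_pdf.
  case: (j == i) => //; apply: (mfun_natr_lt (f := cst K) (g := fun x : mR => `|x|)) => //.
  exact: mcomp.
 have gg0 j x : 0 <= gg j x by rewrite mulr_ge0 ?normal_pdf_ge0 //; case: ifP.
 have -> : (\int[lam]_x (npdf tau x * (K < `|tnth x i|)%R%:R)%:E = \int[lam]_x (\prod_j gg j (tnth x j))%:E)%E.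
  apply: eq_integral => x _; rewrite /gg big_split /=; congr (_ * _)%:E.
  by rewrite (bigD1 i) //= eqxx big1 ?mulr1 // => j /negbTE ->.
 rewrite int_tuple_prod // (bigD1 i) //= big1 ?mule1; last first.
  move=> j /negbTE ji; rewrite /gg ji; under eq_integral do rewrite mulr1.
  exact: integral_normal_pdf.
 rewrite /gg eqxx; apply: (le_trans (normal_tail K0)).
 by rewrite lee_fin ler_wpM2r // invr_ge0 sqr_ge0.
apply: (@le_trans _ _ (\sum_(i < D) (B / K ^+ 2)%:E)%E); first by apply: lee_sum => i _; exact: h.
by rewrite sumEFin sumr_const card_ord mulr_natl.
Qed.

Lemma npdf_half (K : R) : 0 < K -> D%:R * (B / K ^+ 2) <= 2^-1 ->
 ((2^-1)%:E <= \int[lam]_x (npdf tau x * (inbox K (tnth x))%:R)%:E)%E.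
move=> K0 hK; have ht := npdf_tail K0.
have mN := @mfun_npdf R D tau.
have mi := @mfun_inbox _ _ _ _ K (fun j (x : vec) => tnth x j : R) (@mfun_tnthR _ _).
have e' b : ((~~ b)%:R : R) = 1 - b%:R by case: b; rewrite ?subrr ?subr0.
have mn : mfun (fun x : vec => ((~~ inbox K (tnth x))%:R : R)).
 by under eq_fun do rewrite e'; exact: mfunB.
have : (\int[lam]_x (npdf tau x)%:E = \int[lam]_x (npdf tau x * (inbox K (tnth x))%:R)%:E +
  \int[lam]_x (npdf tau x * (~~ inbox K (tnth x))%:R)%:E)%E.
 rewrite -nn_intD; try by [exact: mfunM|move=> x; rewrite mulr_ge0 // npdf_ge0].
 by apply: eq_integral => x _; congr EFin; rewrite e'; ring.
rewrite integral_npdf => h1.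
have : (1 <= \int[lam]_x (npdf tau x * (inbox K (tnth x))%:R)%:E + (2^-1)%:E)%E.
 by rewrite {1}h1; apply: leeD2l; apply: (le_trans ht); rewrite lee_fin.
by rewrite -leeBlDr // -EFinB; apply: le_trans; rewrite lee_fin; lra.
Qed.

End density_bounds.

(** * Resampling of the normalized field *)

Section resampled_field.
Context d (T : measurableType d) {R : realType} (P : probability T R) (D n : nat).
Notation mR := (measurableTypeR R).
Notation c := (gmoment (R := R) 1).
Notation J := ('I_D * 'I_n)%type.
Variable V : 'I_D -> 'I_n -> T -> R.
Variable Gm : 'M[R]_n.
Hypotheses (mV : forall j i, mfun (V j i)) (Gsym : Gm^T = Gm).
Hypothesis Vchar : forall (b : J -> R) (b0 : R),
 (\int[P]_w cos (\sum_x b x * V x.1 x.2 w + b0) =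
  cos b0 * expR (- ((\sum_j qform Gm (fun i => b (j, i))) / 2)))%R.
Variables (g hs b1 : 'I_n -> R) (w : pred 'I_n) (z : 'I_D -> R) (A : R).
Let e i := (w i)%:R * g i * hs i.
Hypotheses (hs0 : forall i, hs i != 0) (eA : forall b, (\sum_i b i * e i) ^+ 2 <= A * qform Gm b) (A0 : 0 < A)
 (b1e : \sum_i b1 i * e i != 0).
Let X j i u := (V j i u - z j) / hs i.

(** V is resampled along w g h, which division by h turns into w g. *)
Lemma resampled_field : exists (eta : 'I_D -> T -> R) (tau : R),
 [/\ forall j, mfun (eta j), 0 < tau, A^-1 <= c * tau ^+ 2,
   c * tau ^+ 2 <= qform Gm b1 / (\sum_i b1 i * e i) ^+ 2 &
   resamples g P X w eta (npdf tau)].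
have [al [tau [tau0 lo hi al1 rs]]] := resampling mV Gsym Vchar eA A0 b1e.
exists (fun j u => \sum_l al l * V j l u), tau; split => //.
 by move=> j; apply: mfun_sumr => l; exact: mfunM.
move=> H mH H0.
pose h (Y : 'I_D -> 'I_n -> R) : \bar R := (H (fun j i => (Y j i - z j) / hs i) (fun j => \sum_l al l * Y j l))%:E.
have mh : mfun (fun x => h (unpack x)).
 have mu j i : mfun (fun x : #|{: J}|.-tuple mR => unpack x j i : R) by exact: mfun_tnthR.
 apply: mEFin; apply: (mH _ _ (fun j i (x : #|{: J}|.-tuple mR) => (unpack x j i - z j) / hs i) (fun j x => \sum_l al l * unpack x j l)).
  by move=> j i; apply: mfunM => //; exact: mfunB.
 by move=> j; apply: mfun_sumr => l; exact: mfunM.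
have h0 Y : (0 <= h Y)%E by rewrite lee_fin.
rewrite -[LHS]/(\int[P]_u h (fun j i => V j i u))%E (rs h mh h0).
apply: eq_integral => u _; apply: eq_integral => x _; rewrite /h -EFinM; congr (_ * H _ _)%:E.
 apply/funext => j; apply/funext => i; rewrite /shift_conf /X /e; field; exact: hs0.
(* Since al . e = 1, the functional al recovers the fresh value from the resampled field. *)
apply/funext => j; under eq_bigr do rewrite mulrDr mulrA.
by rewrite big_split /= -mulr_suml al1 mul1r addrC subrK.
Qed.

End resampled_field.

(** * Even moments of a Gaussian *)

Section gaussian_even_moment.
Context d (T : measurableType d) {R : realType} (P : probability T R).

(** The cosine transform is that of a multiple of a standard Gaussian, so [int_same_law] in
    dimension 1 transfers the moment. *)
Lemma gaussian_even_moment (D : T -> R) (var : R) (m : nat) : mfun D -> 0 <= var ->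
 (forall a b0 : R, (\int[P]_w cos (a * D w + b0) = cos b0 * expR (- (var * a ^+ 2 / 2)))%R) ->
 (\int[P]_w (D w ^+ m.*2)%:E = (gmoment m * (var / gmoment 1) ^+ m)%:E)%E.
move=> mD v0 hchar.
pose s := Num.sqrt (var / gmoment 1).
have c0 := @gmoment1_gt0 R.
have s2 : s ^+ 2 = var / gmoment 1 by rewrite sqr_sqrtr // divr_ge0 // ltW.
have ms : mfun (fun x : measurableTypeR R => s * x) by exact: mfunM.
pose h (x : 1.-tuple (measurableTypeR R)) : \bar R := ((tnth x ord0) ^+ m.*2)%:E.
have mh : mfun h.
 by apply: mEFin; apply: mfunX; exact: measurable_tnth.
have h0 x : (0 <= h x)%E by rewrite lee_fin -mul2n exprM exprn_ge0 // sqr_ge0.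
have := @int_same_law R 1 _ _ P (fun=> D) _ _ (normal_prob (0 : R) 1) (fun _ (x : measurableTypeR R) => s * x)
 (fun=> mD) (fun=> ms) _ h mh h0.
rewrite /h; under eq_integral do rewrite tnth_mktuple.
under [X in (_ -> _ = X) -> _]eq_integral do rewrite tnth_mktuple exprMn EFinM.
move=> ->; last first.
 move=> b b0; under eq_Rintegral do rewrite big_ord_recl big_ord0 addr0.
 under [RHS]eq_Rintegral do rewrite big_ord_recl big_ord0 addr0 mulrA.
 apply: (etrans (hchar (b ord0) b0)); apply: esym.
 apply: (etrans (gauss_cos_shift (b ord0 * s) b0)).
 rewrite (gauss_charE (b ord0 * s)).
 suff -> : gmoment 1 * (b ord0 * s) ^+ 2 = var * b ord0 ^+ 2 by [].
 by rewrite exprMn s2; field; rewrite gt_eqF.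
rewrite integralZl //; last exact: (intg_gauss_pow m.*2).
rewrite -(EFin_Rint (intg_gauss_pow m.*2)) -EFinM -/(gmoment m) mulrC.
by rewrite -mul2n exprM s2.
Qed.

End gaussian_even_moment.

(** Positivity at the coefficients (1, 1, -2): the square of p + q - 2r is nonnegative. *)
Lemma form_triangle (R : realFieldType) (V : eqType) (G : V -> V -> R) (p q r : V) :
 (forall x y, G x y = G y x) ->
 (forall b : 'I_3 -> R, 0 <= \sum_i \sum_j b i * b j * G (nth p [:: p; q; r] (i : 'I_3)) (nth p [:: p; q; r] (j : 'I_3))) ->
 G p p - 2 * G p q + G q q <= 2 * (G p p - 2 * G p r + G r r) + 2 * (G r r - 2 * G r q + G q q).
move=> Gs /(_ (fun i : 'I_3 => nth 0 [:: 1; 1; -2] i)).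
rewrite !big_ord_recl !big_ord0 /= (Gs q p) (Gs r p) (Gs q r).
move: (G p p) (G q q) (G r r) (G p q) (G p r) (G r q) => x1 x2 x3 x4 x5 x6 h.
rewrite -subr_ge0; apply: (le_trans h); rewrite le_eqVlt; apply/orP; left; apply/eqP; ring.
Qed.

Lemma sqr_diff_le (R : realFieldType) (s1 s2 C Q : R) : s1 ^+ 2 <= C * Q -> s2 ^+ 2 <= C * Q ->
 (s1 - s2) ^+ 2 <= 4 * C * Q.
move=> hs1 hs2; apply: (@le_trans _ _ (2 * s1 ^+ 2 + 2 * s2 ^+ 2)).
 rewrite -subr_ge0; have -> : 2 * s1 ^+ 2 + 2 * s2 ^+ 2 - (s1 - s2) ^+ 2 = (s1 + s2) ^+ 2 by ring.
 exact: sqr_ge0.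
have -> : 4 * C * Q = 2 * (C * Q) + 2 * (C * Q) by ring.
by apply: lerD; rewrite ler_wpM2l.
Qed.

(** * Parabolic increments and window shifts *)

Section increment_bounds.
Context {R : realType} (k : nat) (beta : R).
Variable fm : feature_model k beta.
Hypotheses (beta0 : 0 < beta) (beta2 : beta < 2) (kfin : kernels_finite k beta).
Notation V := (R * 'rV[R]_k)%type.
Notation A := (fm_A fm).
Notation kap := (fm_kap fm).
Notation mu := (fm_mu fm).
Notation ft := (feature (fm_A fm) (fm_kap fm)).
Notation FM := (feature_mu k (fm_mu fm)).
Notation Gam := (Gam fm).
Notation inc_var := (inc_variance fm).
Notation a := (1 - beta / 2).

Lemma Gam_psd n (p : 'I_n -> V) (b : 'I_n -> R) : (forall i, 0 <= (p i).1) ->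
 0 <= \sum_i \sum_j b i * b j * Gam (p i) (p j).
move=> p0.
have iff_ i j : intg FM (fun e => ft (p i) e * ft (p j) e) by apply: Gam_intg.
have -> : \sum_i \sum_j b i * b j * Gam (p i) (p j) = (\int[FM]_e ((\sum_i b i * ft (p i) e) ^+ 2))%R.
 transitivity (\int[FM]_e (\sum_i \sum_j b i * b j * (ft (p i) e * ft (p j) e)))%R; last first.
  apply: eq_Rintegral => e _; rewrite expr2 mulr_suml; apply: eq_bigr => i _.
  rewrite mulr_sumr; apply: eq_bigr => j _; ring.
 rewrite Rintegral_sum; last by move=> i; apply: intg_sum => j; exact: intgZ.
 apply: eq_bigr => i _; rewrite Rintegral_sum; last by move=> j; exact: intgZ.
 by apply: eq_bigr => j _; rewrite (RintegralZl (b i * b j) measurableT (iff_ i j)).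
by apply: Rintegral_ge0 => e _; exact: sqr_ge0.
Qed.

Lemma inc_var_sym p q : inc_var p q = inc_var q p.
by rewrite /inc_variance (Gam_sym fm q p); move: (Gam p p) (Gam p q) (Gam q q) => x y z; ring.
Qed.

Lemma inc_varpp p : inc_var p p = 0.
by rewrite /inc_variance; move: (Gam p p) => x; ring. Qed.

Lemma inc_var_triangle (p q r : V) : 0 <= p.1 -> 0 <= q.1 -> 0 <= r.1 ->
 inc_var p q <= 2 * inc_var p r + 2 * inc_var r q.
move=> p0 q0 r0.
apply: form_triangle => [x y|b]; first exact: Gam_sym.
by apply: (Gam_psd (p := fun i : 'I_3 => nth p [:: p; q; r] i)) => -[[|[|[|]]] ?].
Qed.

Lemma inc_var_ge0 (p q : V) : 0 <= p.1 -> 0 <= q.1 -> 0 <= inc_var p q.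
move=> p0 q0; have := inc_var_triangle p0 p0 q0; rewrite inc_varpp (inc_var_sym q p).
by move: (inc_var p q) => x; lra.
Qed.

Definition inc_constant : R :=
 4 * Gam1 fm + 4 * (Gam1 fm + 2 / beta * fine (Mone fm)) * k%:R `^ a.

Lemma inc_constant_ge0 : 0 <= inc_constant.
have g0 := Gam1_ge0 fm; have m0 := Mone_ge0 fm.
by rewrite addr_ge0 ?mulr_ge0 ?powR_ge0 // ?addr_ge0 ?mulr_ge0 // ?invr_ge0 ?(ltW beta0).
Qed.

Let a_ge0 : 0 <= a. by rewrite subr_ge0 ler_pdivrMr // mul1r ltW. Qed.

Lemma inc_var_near (del : R) (p q : V) : (0 < k)%N -> 0 < del -> 0 <= p.1 -> 0 <= q.1 ->
 near_points del p q -> inc_var p q <= inc_constant * (del ^+ 2) `^ a.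
move=> k0 d0; case: p q => [t x] [s y] /= t0 s0 [/= ht hx].
have d2 : 0 < del ^+ 2 by rewrite exprn_gt0.
have time : inc_var (t, x) (s, x) <= 2 * Gam1 fm * (del ^+ 2) `^ a.
 have G0 : 0 <= 2 * Gam1 fm by rewrite mulr_ge0 // Gam1_ge0.
 have pw (u : R) : 0 <= u -> u <= del ^+ 2 -> 2 * Gam1 fm * u `^ a <= 2 * Gam1 fm * (del ^+ 2) `^ a.
  by move=> u0 ud; rewrite ler_wpM2l // ge0_ler_powR // nnegrE // ltW.
 have := ht; rewrite ler_norml => /andP[h1 h2].
 have [ts|st|->] := ltgtP t s.
 - rewrite inc_var_sym; apply: (le_trans (inc_var_time fm beta2 kfin x t0 ts)).
  by apply: pw; lra.
 - by apply: (le_trans (inc_var_time fm beta2 kfin x s0 st)); apply: pw; lra.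
 - by rewrite inc_varpp mulr_ge0 // powR_ge0.
have space : inc_var (s, x) (s, y) <= 2 * (Gam1 fm + 2 / beta * fine (Mone fm)) * (k%:R * del ^+ 2) `^ a.
 apply: inc_var_space => //; first by rewrite mulr_gt0 // ltr0n.
 rewrite sqr_norm; apply: (@le_trans _ _ (\sum_(i < k) del ^+ 2)).
  apply: ler_sum => i _; rewrite -(real_normK (num_real _)) lerXn2r ?nnegrE //; first exact: ltW.
  by rewrite !mxE; exact: hx.
 by rewrite sumr_const card_ord mulr_natl.
apply: (le_trans (inc_var_triangle (r := (s, x)) _ _ _)) => //.
move: space; rewrite powRM //; last exact: ltW.
rewrite /inc_constant; move: time; move: (inc_var (t, x) (s, x)) (inc_var (s, x) (s, y)) (Gam1 fm) (fine (Mone fm)) ((del ^+ 2) `^ a) (k%:R `^ a).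
move=> i1 i2 G M dd kk h1 h2.
have -> : (4 * G + 4 * (G + 2 / beta * M) * kk) * dd = 2 * (2 * G * dd) + 2 * (2 * (G + 2 / beta * M) * (kk * dd)) by ring.
by apply: lerD; rewrite ler_wpM2l.
Qed.

(** Difference of two ramps with the same caloric function, switched on after a1 and after a2: it
    vanishes up to a1 and from a2 + l on, and is caloric from a1 + l to a2. Points inside the two
    switching intervals are excluded by hypothesis. *)
Lemma window_inequality (n : nat) (p : 'I_n -> V) (t0 r a1 a2 l : R) (x0 : 'rV[R]_k) (b : 'I_n -> R) :
 0 < r -> 0 < l -> 0 <= t0 -> t0 <= a1 -> a1 <= a2 ->
 (forall i, 0 <= (p i).1) ->
 (forall i, (p i).1 <= a1 \/ a1 + l <= (p i).1) ->
 (forall i, (p i).1 <= a2 \/ a2 + l <= (p i).1) ->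
 (\sum_i b i * ((a1 + l <= (p i).1 <= a2)%R%:R * caloric t0 (r ^+ 2) x0 (p i))) ^+ 2 <=
 4 * (heat_kernel (2 * r ^+ 2) (0 : 'rV[R]_k) / (l * ramp_mass fm (r ^+ 2) * kap ^+ 2)) *
 \sum_i \sum_j b i * b j * Gam (p i) (p j).
move=> r0 l0 tt0 ta1 a12 p0 h1 h2.
have r2 : 0 < r ^+ 2 by rewrite exprn_gt0.
have /andP[m0 mfin] := fm_mass fm.
have pr : 0 < (r ^+ 2) `^ ((k%:R - beta) / 2) by rewrite powR_gt0.
have fin1 : (mu [set s | (A s <= 1)%R] = (fine (mu [set s | (A s <= 1)%R]))%:E)%E.
 by rewrite fineK // ge0_fin_numE // ltW.
have mf1 : (mu [set s | (A s <= r ^+ 2)%R] < +oo)%E.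
 by rewrite fm_mass_scale // fin1 -EFinM ltry.
have rm0 : 0 < ramp_mass fm (r ^+ 2).
 by rewrite /ramp_mass fm_mass_scale // fin1 -EFinM /= mulr_gt0 // fine_gt0 // m0.
have R1 := @ramp_inequality R k beta fm kfin t0 (r ^+ 2) a1 l x0 r2 l0 (le_trans tt0 ta1) ta1 mf1 n p b rm0 p0 h1.
have R2 := @ramp_inequality R k beta fm kfin t0 (r ^+ 2) a2 l x0 r2 l0 (le_trans tt0 (le_trans ta1 a12)) (le_trans ta1 a12) mf1 n p b rm0 p0 h2.
have -> : \sum_i b i * ((a1 + l <= (p i).1 <= a2)%R%:R * caloric t0 (r ^+ 2) x0 (p i)) =
 \sum_i b i * ((a1 + l <= (p i).1)%R%:R * caloric t0 (r ^+ 2) x0 (p i)) -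
 \sum_i b i * ((a2 + l <= (p i).1)%R%:R * caloric t0 (r ^+ 2) x0 (p i)).
 rewrite -sumrB; apply: eq_bigr => i _; rewrite -mulrBr -mulrBl; congr (_ * (_ * _)).
 case: (h2 i) => h.
  by rewrite h andbT [a2 + l <= _]leNgt (le_lt_trans h) ?subr0 // ltrDl.
 have h3 : a1 + l <= (p i).1 by apply: le_trans h; rewrite lerD2r.
 by rewrite h3 h [_ <= a2]leNgt (lt_le_trans _ h) ?ltrDl // subrr.
exact: sqr_diff_le R1 R2.
Qed.

Definition window_constant : R :=
 4 * heat_kernel 2 (0 : 'rV[R]_k) / (fine (mu [set s | (A s <= 1)%R]) * kap ^+ 2).

Lemma window_constant_gt0 : 0 < window_constant.
have /andP[m0 mfin] := fm_mass fm.
apply: divr_gt0; first by apply: mulr_gt0 => //; exact: heat_kernel_gt0.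
by apply: mulr_gt0; [rewrite fine_gt0 // m0|rewrite exprn_gt0 // fm_kap0].
Qed.

(** Units adapted to a cell of side r: r^k times the caloric function is of order 1 there, and the
    square root is the size of the increments of v. In these units the squared norm is of order 1/l,
    whatever r. *)
Lemma window_inequality_scaled (n : nat) (p : 'I_n -> V) (t0 r a1 a2 l : R) (x0 : 'rV[R]_k) (b : 'I_n -> R) :
 0 < r -> 0 < l -> 0 <= t0 -> t0 <= a1 -> a1 <= a2 ->
 (forall i, 0 <= (p i).1) ->
 (forall i, (p i).1 <= a1 \/ a1 + l * r ^+ 2 <= (p i).1) ->
 (forall i, (p i).1 <= a2 \/ a2 + l * r ^+ 2 <= (p i).1) ->
 (\sum_i b i * ((a1 + l * r ^+ 2 <= (p i).1 <= a2)%R%:R *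
   (r ^+ k * caloric t0 (r ^+ 2) x0 (p i) * Num.sqrt ((r ^+ 2) `^ a)))) ^+ 2 <=
 window_constant / l * \sum_i \sum_j b i * b j * Gam (p i) (p j).
move=> r0 l0 tt0 ta1 a12 p0 h1 h2.
have r2 : 0 < r ^+ 2 by rewrite exprn_gt0.
have W := window_inequality x0 b r0 (mulr_gt0 l0 r2) tt0 ta1 a12 p0 h1 h2.
set s := Num.sqrt _; have s2 : s ^+ 2 = (r ^+ 2) `^ a by rewrite sqr_sqrtr // powR_ge0.
have -> : \sum_i b i * ((a1 + l * r ^+ 2 <= (p i).1 <= a2)%R%:R *
   (r ^+ k * caloric t0 (r ^+ 2) x0 (p i) * s)) =
  (r ^+ k * s) * \sum_i b i * ((a1 + l * r ^+ 2 <= (p i).1 <= a2)%R%:R * caloric t0 (r ^+ 2) x0 (p i)).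
 by rewrite mulr_sumr; apply: eq_bigr => i _; ring.
suff id : (r ^+ k * s) ^+ 2 * (4 * (heat_kernel (2 * r ^+ 2) (0 : 'rV[R]_k) / (l * r ^+ 2 * ramp_mass fm (r ^+ 2) * kap ^+ 2))) =
  window_constant / l.
 rewrite exprMn; apply: (le_trans (ler_wpM2l (sqr_ge0 _) W)); rewrite [leLHS]mulrA id; exact: lexx.
have /andP[m0 mfin] := fm_mass fm.
have fin1 : (mu [set s | (A s <= 1)%R] = (fine (mu [set s | (A s <= 1)%R]))%:E)%E.
 by rewrite fineK // ge0_fin_numE // ltW.
have m1 : 0 < fine (mu [set s | (A s <= 1)%R]) by rewrite fine_gt0 // m0.
have hH : heat_kernel (2 * r ^+ 2) (0 : 'rV[R]_k) = (r ^+ 2) `^ (- (k%:R / 2)) * heat_kernel 2 (0 : 'rV[R]_k).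
 rewrite !heat_kernel0 -powRM ?(ltW r2) //; last by rewrite !mulr_ge0 // pi_ge0.
 by congr (_ `^ _); ring.
have hm : ramp_mass fm (r ^+ 2) = (r ^+ 2) `^ ((k%:R - beta) / 2) * fine (mu [set s | (A s <= 1)%R]).
 by rewrite /ramp_mass (fm_mass_scale fm r2) fin1.
have rp (e : R) : 0 < (r ^+ 2) `^ e by rewrite powR_gt0.
(* Exponents of r^2: k + (1 - beta/2) - k/2 = 1 + (k - beta)/2. *)
have key : (r ^+ 2) ^+ k * (r ^+ 2) `^ a * (r ^+ 2) `^ (- (k%:R / 2)) = r ^+ 2 * (r ^+ 2) `^ ((k%:R - beta) / 2).
 rewrite -powR_mulrn ?(ltW r2) //.
 have -> : r ^+ 2 * (r ^+ 2) `^ ((k%:R - beta) / 2) = (r ^+ 2) `^ 1 * (r ^+ 2) `^ ((k%:R - beta) / 2) by rewrite (powRr1 (ltW r2)).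
 rewrite -!powRD ?(gt_eqF r2) ?implybT //.
 by congr (_ `^ _); field.
have rk : (r ^+ k) ^+ 2 = (r ^+ 2) ^+ k by rewrite -!exprM mulnC.
rewrite exprMn s2 hH hm /window_constant rk.
move: key; have := fm_kap0 fm; move: m1 (rp a) (rp (- (k%:R / 2))) (rp ((k%:R - beta) / 2)).
move: (fine _) (_ `^ a) (_ `^ (- (k%:R / 2))) (_ `^ ((k%:R - beta) / 2)) (heat_kernel _ _) (kap) ((r ^+ 2) ^+ k).
move: (r ^+ 2) r2 => rr rr0 m A1 A2 A4 H kp rk' mp A10 A20 A40 kp0 key.
have -> : rk' * A1 * (4 * (A2 * H / (l * rr * (A4 * m) * kp ^+ 2))) = (rk' * A1 * A2) * (4 * (H / (l * rr * (A4 * m) * kp ^+ 2))) by ring.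
by rewrite key; field; rewrite !gt_eqF.
Qed.

End increment_bounds.

(** * Bounds for the logarithm of the heat kernel *)

Section log_heat_kernel.
Context {R : realType} (k : nat).

Lemma expR_lip (a b B : R) : a <= B -> b <= B -> `|expR a - expR b| <= expR B * `|a - b|.
have one (x y : R) : x <= y -> y <= B -> expR y - expR x <= expR B * (y - x).
 move=> xy yB; have h := expR_ge1Dx (x - y).
 have -> : expR y - expR x = expR y * (1 - expR (x - y)) by rewrite mulrBr mulr1 -expRD [y + _]addrC subrK.
 apply: (@le_trans _ _ (expR y * (y - x))); first by rewrite ler_wpM2l ?expR_ge0 //; lra.
 by rewrite ler_wpM2r ?subr_ge0 // ler_expR.
move=> aB bB; have [ab|ba] := leP a b.
 rewrite distrC [`|a - b|]distrC ger0_norm ?subr_ge0 ?ler_expR // ger0_norm ?subr_ge0 //; exact: one.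
by rewrite ger0_norm ?subr_ge0 ?ler_expR ?(ltW ba) // ger0_norm ?subr_ge0 ?(ltW ba) //; exact: one (ltW ba) _.
Qed.

(** Minus the logarithm of the heat kernel. Quotients of kernels become exponentials of differences,
    for which range and Lipschitz bounds simply add. *)
Definition logheat (t : R) (x : 'rV[R]_k) : R := k%:R / 2 * ln (4 * pi * t) + euclidean_norm x ^+ 2 / (4 * t).

Lemma logheatE (t : R) (x : 'rV[R]_k) : 0 < t -> heat_kernel t x = expR (- logheat t x).
move=> t0; have p0 : 0 < 4 * pi * t :> R by rewrite !mulr_gt0 // pi_gt0.
by rewrite /heat_kernel /powR gt_eqF // -expRD /logheat opprD mulNr.
Qed.

Definition logheat_lip (Xm : R) : R := k%:R * (1 + Xm + Xm ^+ 2).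
Definition logheat_bound (Tm Xm : R) : R := k%:R / 2 * ln (4 * pi * Tm) + k%:R * Xm ^+ 2 / 8.

Lemma logheat_lipschitz (Xm del t t' : R) (x x' : 'rV[R]_k) : 0 <= Xm -> 2 <= t -> 2 <= t' ->
 (forall i, `|x 0 i| <= Xm) -> (forall i, `|x' 0 i| <= Xm) ->
 `|t - t'| <= del -> (forall i, `|x 0 i - x' 0 i| <= del) ->
 `|logheat t x - logheat t' x'| <= logheat_lip Xm * del.
move=> X0 t2 t2' hx hx' ht hd.
have t0 : 0 < t by lra.
have t0' : 0 < t' by lra.
have d0 : 0 <= del := le_trans (normr_ge0 _) ht.
have lnl (s s' : R) : 2 <= s -> 2 <= s' -> `|s - s'| <= del -> ln (4 * pi * s) - ln (4 * pi * s') <= del / 2.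
 move=> s2 s2' hs; have s0 : 0 < s by lra.
 have s0' : 0 < s' by lra.
 have pp : 0 < 4 * pi :> R by rewrite mulr_gt0 // pi_gt0.
 have e (u : R) : 0 < u -> ln (4 * pi * u) = ln (4 * pi) + ln u by move=> u0; rewrite lnM ?posrE.
 rewrite !e // opprD addrACA subrr add0r -ln_div ?posrE //.
 have -> : s / s' = 1 + (s - s') / s' by field; rewrite gt_eqF.
 have gt1 : -1 < (s - s') / s' by rewrite ltr_pdivlMr //; lra.
 apply: (le_trans (le_ln1Dx gt1)); rewrite ler_pdivrMr //.
 have := ler_norm (s - s'); nra.
have lnb : `|ln (4 * pi * t) - ln (4 * pi * t')| <= del / 2.
 rewrite ler_norml lnl // andbT lerNl opprB lnl // distrC //.
have x2 (y : 'rV[R]_k) : (forall i, `|y 0 i| <= Xm) -> euclidean_norm y ^+ 2 <= k%:R * Xm ^+ 2.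
 move=> hy; rewrite sqr_norm; apply: (@le_trans _ _ (\sum_(i < k) Xm ^+ 2)).
  by apply: ler_sum => i _; rewrite -(real_normK (num_real _)) lerXn2r ?nnegrE.
 by rewrite sumr_const card_ord mulr_natl.
have xd : `|euclidean_norm x ^+ 2 - euclidean_norm x' ^+ 2| <= k%:R * (2 * Xm * del).
 rewrite !sqr_norm -sumrB; apply: (le_trans (ler_norm_sum _ _ _)).
 apply: (@le_trans _ _ (\sum_(i < k) (2 * Xm * del))); last by rewrite sumr_const card_ord -[leLHS]mulr_natl lexx.
 apply: ler_sum => i _; rewrite subr_sqr normrM mulrC ler_pM //.
 by apply: (le_trans (ler_normD _ _)); have := hx i; have := hx' i; lra.
have n0 : 0 <= euclidean_norm x' ^+ 2 by exact: sqr_ge0.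
have xb := x2 _ hx'.
rewrite /logheat /logheat_lip.
have -> : k%:R / 2 * ln (4 * pi * t) + euclidean_norm x ^+ 2 / (4 * t) - (k%:R / 2 * ln (4 * pi * t') + euclidean_norm x' ^+ 2 / (4 * t')) =
 k%:R / 2 * (ln (4 * pi * t) - ln (4 * pi * t')) + (euclidean_norm x ^+ 2 - euclidean_norm x' ^+ 2) / (4 * t)
  + euclidean_norm x' ^+ 2 * (t' - t) / (4 * t * t').
 by field; rewrite !gt_eqF.
have k0 := ler0n R k.
move: lnb xd n0 xb; move: (ln _ - ln _) (euclidean_norm x ^+ 2 - euclidean_norm x' ^+ 2) (euclidean_norm x' ^+ 2) => L E N lnb xd n0 xb.
have -> : k%:R * (1 + Xm + Xm ^+ 2) * del = k%:R * del + k%:R * Xm * del + k%:R * Xm ^+ 2 * del by ring.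
apply: (le_trans (ler_normD _ _)); apply: lerD; first (apply: (le_trans (ler_normD _ _)); apply: lerD).
- rewrite normrM ger0_norm ?divr_ge0 //.
 apply: (@le_trans _ _ (k%:R / 2 * (del / 2))); first by rewrite ler_wpM2l ?divr_ge0.
 have -> : k%:R / 2 * (del / 2) = (k%:R * del) / 4 by field.
 by have : 0 <= k%:R * del by [rewrite mulr_ge0]; move: (k%:R * del) => y; lra.
- have t4 : 0 < 4 * t by rewrite mulr_gt0.
 rewrite normrM normfV (gtr0_norm t4) ler_pdivrMr //; apply: (le_trans xd).
 have Y0 : 0 <= k%:R * Xm * del by rewrite !mulr_ge0.
 have -> : k%:R * (2 * Xm * del) = k%:R * Xm * del * 2 by ring.
 by rewrite ler_wpM2l //; lra.
- have t4 : 0 < 4 * t * t' by rewrite !mulr_gt0.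
 rewrite normrM normfV (gtr0_norm t4) ler_pdivrMr // normrM (ger0_norm n0) distrC.
 have Y0 : 0 <= k%:R * Xm ^+ 2 * del by rewrite !mulr_ge0 // sqr_ge0.
 apply: (@le_trans _ _ (k%:R * Xm ^+ 2 * del)); first by rewrite ler_pM.
 by rewrite ler_peMr //; nra.
Qed.

Lemma logheat_le (Tm Xm t : R) (x : 'rV[R]_k) : 0 <= Xm -> 2 <= t -> t <= Tm ->
 (forall i, `|x 0 i| <= Xm) -> 0 <= logheat t x <= logheat_bound Tm Xm.
move=> X0 t2 tT hx; have t0 : 0 < t by lra.
have pp : 2 <= pi :> R by exact: pi_ge2.
have k0 := ler0n R k.
have p1 : 1 <= 4 * pi * t by nra.
have x2 : euclidean_norm x ^+ 2 <= k%:R * Xm ^+ 2.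
 rewrite sqr_norm; apply: (@le_trans _ _ (\sum_(i < k) Xm ^+ 2)).
  by apply: ler_sum => i _; rewrite -(real_normK (num_real _)) lerXn2r ?nnegrE.
 by rewrite sumr_const card_ord mulr_natl.
apply/andP; split.
 rewrite addr_ge0 // ?divr_ge0 ?sqr_ge0 ?mulr_ge0 ?ln_ge0 ?divr_ge0 // ltW //.
apply: lerD.
 rewrite ler_wpM2l ?divr_ge0 // ler_ln ?posrE; [nra|lra|nra].
apply: ler_pM => //; first exact: sqr_ge0.
 by rewrite invr_ge0 mulr_ge0 // ltW.
by rewrite lef_pV2 ?posrE ?mulr_gt0 //; lra.
Qed.

Lemma heat_kernel_scale (r u : R) (x : 'rV[R]_k) : 0 < r -> 0 < u ->
 r ^+ k * heat_kernel (r ^+ 2 * u) x = heat_kernel u (r^-1 *: x).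
move=> r0 u0; have r2 : 0 < r ^+ 2 by rewrite exprn_gt0.
have pp : 0 <= 4 * pi * u :> R by rewrite !mulr_ge0 ?pi_ge0 // ltW.
rewrite /heat_kernel mulrA; congr (_ * expR (- _)).
 have -> : 4 * pi * (r ^+ 2 * u) = r ^+ 2 * (4 * pi * u) by ring.
 rewrite powRM ?(ltW r2) // mulrA -[RHS]mul1r; congr (_ * _).
 rewrite -(powR_mulrn 2 (ltW r0)) -powRrM -(powR_mulrn k (ltW r0)) -powRD ?(gt_eqF r0) ?implybT //.
 have -> : k%:R + 2%:R * - (k%:R / 2) = 0 :> R by field.
 by rewrite powRr0.
rewrite !sqr_norm.
have -> : \sum_i (r^-1 *: x) 0 i ^+ 2 = (r ^+ 2)^-1 * \sum_i x 0 i ^+ 2.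
 by rewrite mulr_sumr; apply: eq_bigr => i _; rewrite mxE exprMn exprVn.
by field; rewrite !gt_eqF.
Qed.

End log_heat_kernel.

(** * The mild solution on parabolic cells *)

Section mild_field.
Context d (T : measurableType d) {R : realType} (P : probability T R) (k D : nat) (beta : R).
Variables (W : 'I_D -> test_function R k -> T -> R) (v : R -> 'rV[R]_k -> T -> 'rV[R]_D).
Hypotheses (hW : is_noise P beta W) (hv : is_mild_solution P beta W v).
Variable fm : feature_model k beta.
Hypotheses (beta0 : 0 < beta) (beta2 : beta < 2) (kfin : kernels_finite k beta) (k0 : (0 < k)%N)
 (critical : (1 - beta / 2) * D%:R = k.+2%:R).
Notation V := (R * 'rV[R]_k)%type.
Notation a := (1 - beta / 2).
Notation c := (gmoment (R := R) 1).
Notation Gam := (Gam fm).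

(** Times are truncated at 0 so that chaining can range over the whole space. Truncation does not
    increase time distances. *)
Definition clamped (j : 'I_D) (p : V) (w : T) : R := v (Num.max 0 p.1) p.2 w 0 j.

Let max0 (t : R) : 0 <= Num.max 0 t. by rewrite le_max lexx. Qed.

Lemma clampedE j p w : 0 <= p.1 -> clamped j p w = v p.1 p.2 w 0 j.
by move=> p0; rewrite /clamped max_r. Qed.

Lemma mfun_clamped j p : mfun (clamped j p).
exact: (mild_measurable hv j (p := (Num.max 0 p.1, p.2)) (max0 p.1)). Qed.

(** Criticality enters here: D-dimensional volume at the scale of the increments equals the
    parabolic volume of a cell, here in squared form. *)
Lemma critical_power (x : R) : 0 < x -> ((x ^+ 2) `^ a) ^+ D = x ^+ (2 * k.+2).
move=> x0; have x2 : 0 < x ^+ 2 by rewrite exprn_gt0.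
by rewrite -powR_mulrn ?powR_ge0 // -powRrM critical powR_mulrn ?(ltW x2) // exprM.
Qed.

Definition field_moment : R := gmoment D.*2 / c ^+ D.*2 * inc_constant fm ^+ D.*2.

Lemma field_moment_ge0 : 0 <= field_moment.
by rewrite mulr_ge0 ?exprn_ge0 ?divr_ge0 ?exprn_ge0 ?gauss_moment_ge0 ?inc_constant_ge0 ?(ltW gmoment1_gt0).
Qed.

(** At order 4D the moment scales as del^(4(k + 2)), twice the power lost to the number of pairs in
    the chaining. *)
Lemma clamped_moment j del p q : 0 < del -> near_points del p q ->
 (\int[P]_w (`|clamped j p w - clamped j q w| ^+ (4 * D))%:E <= (field_moment * del ^+ (4 * k.+2))%:E)%E.
move=> d0 [nt nx]; pose p' : V := (Num.max 0 p.1, p.2); pose q' : V := (Num.max 0 q.1, q.2).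
have n' : near_points del p' q'.
 split => //=; apply: le_trans nt; rewrite ler_norml.
 have h1 := ler_norm (p.1 - q.1); have h2 := ler_norm (- (p.1 - q.1)); rewrite normrN in h2.
 have := normr_ge0 (p.1 - q.1).
 by rewrite !maxEle; case: (leP 0 p.1); case: (leP 0 q.1) => ? ? ?; apply/andP; split; lra.
have p0 : 0 <= p'.1 by exact: max0.
have q0 : 0 <= q'.1 by exact: max0.
have v0 := inc_var_ge0 fm kfin p0 q0.
have hv' := inc_var_near fm beta0 beta2 kfin k0 d0 p0 q0 n'.
have e (x : R) : `|x| ^+ (4 * D) = x ^+ (D.*2).*2.
 by rewrite -!mul2n (_ : (4 * D = 2 * (2 * D))%N) ?mulnA // -mulnA !(exprM _ 2) real_normK ?num_real.
under eq_integral do rewrite e.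
have -> : (\int[P]_w ((clamped j p w - clamped j q w) ^+ (D.*2).*2)%:E = (gmoment D.*2 * (inc_variance fm p' q' / c) ^+ D.*2)%:E)%E.
 apply: (gaussian_even_moment D.*2 (D := fun w => v p'.1 p'.2 w 0 j - v q'.1 q'.2 w 0 j)) => //.
  by apply: mfunB; [exact: (mild_measurable hv j p0)|exact: (mild_measurable hv j q0)].
 by move=> b b0; exact: (increment_char hW hv fm j p0 q0).
have c0 := @gmoment1_gt0 R.
rewrite lee_fin /field_moment.
have -> : gmoment D.*2 / c ^+ D.*2 * inc_constant fm ^+ D.*2 * del ^+ (4 * k.+2) =
  gmoment D.*2 * (inc_constant fm * (del ^+ 2) `^ a / c) ^+ D.*2.
 rewrite expr_div_n exprMn -[in (_ `^ a) ^+ _]muln2 [(_ `^ a) ^+ _]exprM critical_power // -exprM.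
 by rewrite (_ : (2 * k.+2 * 2 = 4 * k.+2)%N); [ring|rewrite mulnAC].
rewrite ler_wpM2l ?gauss_moment_ge0 // lerXn2r ?nnegrE ?divr_ge0 ?mulr_ge0 ?powR_ge0 ?inc_constant_ge0 ?(ltW c0) //.
by rewrite ler_wpM2r // invr_ge0 ltW.
Qed.

Lemma clamped_moment1 j p : exists C : R, (\int[P]_w (`|clamped j p w| ^+ (4 * D))%:E <= C%:E)%E.
pose p' : V := (Num.max 0 p.1, p.2); have p0 : 0 <= p'.1 by exact: max0.
exists (gmoment D.*2 * (Gam p' p' / c) ^+ D.*2).
have e (x : R) : `|x| ^+ (4 * D) = x ^+ (D.*2).*2.
 by rewrite -!mul2n (_ : (4 * D = 2 * (2 * D))%N) ?mulnA // -mulnA !(exprM _ 2) real_normK ?num_real.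
under eq_integral do rewrite e.
have G0 : 0 <= Gam p' p' by apply: Rintegral_ge0 => x _; rewrite -expr2 sqr_ge0.
rewrite (gaussian_even_moment (var := Gam p' p') D.*2 (D := fun w => v p'.1 p'.2 w 0 j)) //.
 exact: (mild_measurable hv j p0).
move=> b b0; have := @mild_char _ _ _ _ _ _ _ _ _ hW hv fm 1 (fun=> j) (fun=> p') (fun=> p0) (fun=> b) b0.
rewrite !big_ord_recl !big_ord0 !addr0 eqxx => h.
transitivity (\int[P]_w cos (\sum_(m < 1) b * v p'.1 p'.2 w 0 j + b0))%R.
 by apply: eq_Rintegral => w _; rewrite big_ord_recl big_ord0 addr0.
suff -> : Gam p' p' * b ^+ 2 = b * b * Gam p' p' by exact: h.
by move: (Gam p' p') => y; ring.
Qed.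

Section finite_family.
Variables (n : nat) (p : 'I_n -> V).
Hypothesis p0 : forall i, 0 <= (p i).1.
Let Gm : 'M[R]_n := \matrix_(i, l) Gam (p i) (p l).

Lemma qform_Gam b : qform Gm b = \sum_i \sum_l b i * b l * Gam (p i) (p l).
by apply: eq_bigr => i _; apply: eq_bigr => l _; rewrite mxE. Qed.

Lemma Gam_mx_sym : Gm^T = Gm.
by apply/matrixP => i l; rewrite !mxE Gam_sym. Qed.

Lemma family_char (b : 'I_D * 'I_n -> R) (b0 : R) :
 (\int[P]_w cos (\sum_x b x * clamped x.1 (p x.2) w + b0) =
  cos b0 * expR (- ((\sum_j qform Gm (fun i => b (j, i))) / 2)))%R.
pose ev (m : 'I_#|{: 'I_D * 'I_n}|) := enum_val m.
have bev : bijective ev by exact: enum_val_bij.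
have re (F : 'I_D * 'I_n -> R) : \sum_x F x = \sum_m F (ev m) by rewrite (reindex ev) //; exact: onW_bij.
have := @mild_char _ _ _ _ _ _ _ _ _ hW hv fm _ (fun m => (ev m).1) (fun m => p (ev m).2) (fun m => p0 _) (fun m => b (ev m)) b0.
move=> h; transitivity (\int[P]_w cos (\sum_m b (ev m) * v (p (ev m).2).1 (p (ev m).2).2 w 0 (ev m).1 + b0))%R.
 apply: eq_Rintegral => w _; rewrite re; congr (cos (_ + _)).
 by apply: eq_bigr => m _; rewrite clampedE.
rewrite h; suff -> : \sum_m \sum_l b (ev m) * b (ev l) * (if (ev m).1 == (ev l).1 then Gam (p (ev m).2) (p (ev l).2) else 0) =
  \sum_j qform Gm (fun i => b (j, i)) by [].
transitivity (\sum_x \sum_y b x * b y * (if x.1 == y.1 then Gam (p x.2) (p y.2) else 0)).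
 by rewrite re; apply: eq_bigr => m _; rewrite re.
transitivity (\sum_j \sum_i \sum_y b (j, i) * b y * (if j == y.1 then Gam (p i) (p y.2) else 0)).
 by rewrite [RHS]pair_bigA; apply: eq_bigr => -[j i] _.
apply: eq_bigr => j _; rewrite qform_Gam; apply: eq_bigr => i _.
transitivity (\sum_j' \sum_i' b (j, i) * b (j', i') * (if j == j' then Gam (p i) (p i') else 0)).
 by rewrite [RHS]pair_bigA; apply: eq_bigr => -[j' i'] _.
rewrite (bigD1 j) //= eqxx [X in _ + X]big1 ?addr0 // => j' j'j.
by rewrite big1 // => i' _; rewrite eq_sym (negbTE j'j) mulr0.
Qed.

End finite_family.

(** The caloric weight h, equal to [caloric 0 1 0]: the heat kernel issued from the origin at time
    -2. *)
Definition hst (p : V) : R := heat_kernel (p.1 + 2) p.2.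
Definition caloric_at (p0 : V) (r : R) (p : V) : R := r ^+ k * caloric p0.1 (r ^+ 2) p0.2 p.
Definition field_scale (r : R) : R := Num.sqrt ((r ^+ 2) `^ a).

Lemma field_scale_gt0 r : 0 < r -> 0 < field_scale r.
by move=> r0; rewrite sqrtr_gt0 powR_gt0 // exprn_gt0. Qed.

Lemma hst_gt0 p : 0 <= p.1 -> 0 < hst p.
by move=> p0; apply: heat_kernel_gt0; lra. Qed.

(** The corner p0, whose time precedes the window, is added as the point of index [ord0]. The
    increment from p0 to p i0 then serves as test functional b1, and its variance, of the order of
    the squared field scale, bounds the variance of eta from above uniformly in r. *)
Lemma local_resampling (n : nat) (p0 : V) (r a1 a2 l gmin : R) (p : 'I_n -> V) (z : 'I_D -> R) (i0 : 'I_n) :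
 0 < r -> 0 < l -> 0 <= p0.1 -> p0.1 <= a1 -> a1 <= a2 -> 0 < gmin ->
 (forall i, cell p0 r (p i)) ->
 (forall i, (p i).1 <= a1 \/ a1 + l * r ^+ 2 <= (p i).1) ->
 (forall i, (p i).1 <= a2 \/ a2 + l * r ^+ 2 <= (p i).1) ->
 (forall i, gmin <= caloric_at p0 r (p i)) ->
 a1 + l * r ^+ 2 <= (p i0).1 <= a2 ->
 exists (eta : 'I_D -> T -> R) (tau : R),
 [/\ forall j, mfun (eta j), 0 < tau, l / window_constant fm <= c * tau ^+ 2,
   c * tau ^+ 2 <= inc_constant fm / gmin ^+ 2 &
   resamples (fun i => field_scale r * (caloric_at p0 r (p i) / hst (p i))) P
    (fun j i w => (clamped j (p i) w - z j) / hst (p i))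
    (fun i => a1 + l * r ^+ 2 <= (p i).1 <= a2) eta (npdf tau)].
move=> r0 l0 t0 ta1 a12 g0 pc h1 h2 hg wi0.
have s0 := field_scale_gt0 r0; have r2 : 0 < r ^+ 2 by rewrite exprn_gt0.
pose pp (m : 'I_n.+1) : V := if unlift ord0 m is Some i then p i else p0.
have ppl i : pp (lift ord0 i) = p i by rewrite /pp liftK.
have pp0 : pp ord0 = p0 by rewrite /pp unlift_none.
have pt0 i : 0 <= (p i).1 by have [/andP[h _] _] := pc i; apply: le_trans h.
have ppt m : 0 <= (pp m).1 by case: (unliftP ord0 m) => [i ->|->]; rewrite ?ppl ?pp0.
pose w m := a1 + l * r ^+ 2 <= (pp m).1 <= a2.
have lr : 0 < l * r ^+ 2 by rewrite mulr_gt0.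
have w0 : w ord0 = false by apply/negbTE; rewrite /w pp0 negb_and -ltNge; apply/orP; left; lra.
pose g m := field_scale r * (caloric_at p0 r (pp m) / hst (pp m)).
pose hs m := hst (pp m).
have hs0 m : hs m != 0 by rewrite gt_eqF // hst_gt0.
pose b1 (m : 'I_n.+1) : R := if m == ord0 then -1 else (m == lift ord0 i0)%:R.
have wc := window_constant_gt0 fm.
have A0 : 0 < window_constant fm / l by rewrite divr_gt0.
have eE m : (w m)%:R * g m * hs m = (w m)%:R * (r ^+ k * caloric p0.1 (r ^+ 2) p0.2 (pp m) * field_scale r).
 by rewrite /g /hs /caloric_at; field; rewrite gt_eqF // hst_gt0.
have eA b : (\sum_m b m * ((w m)%:R * g m * hs m)) ^+ 2 <= window_constant fm / l * qform (\matrix_(i, l) Gam (pp i) (pp l)) b.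
 rewrite qform_Gam; under eq_bigr do rewrite eE.
 apply: (window_inequality_scaled fm kfin p0.2 b r0 l0 t0 ta1 a12 ppt) => m.
  by case: (unliftP ord0 m) => [i ->|->]; rewrite ?ppl ?pp0; [exact: h1|left].
 by case: (unliftP ord0 m) => [i ->|->]; rewrite ?ppl ?pp0; [exact: h2|left; lra].
have b1E (F : 'I_n.+1 -> R) : \sum_m b1 m * F m = F (lift ord0 i0) - F ord0.
 rewrite big_ord_recl /b1 /= mulN1r addrC; congr (_ - _).
 rewrite (bigD1 i0) //= eqxx mul1r big1 ?addr0 // => i /negbTE ii0.
 by rewrite (inj_eq lift_inj) ii0 mul0r.
have wl : w (lift ord0 i0) by rewrite /w ppl.
have eb : \sum_m b1 m * ((w m)%:R * g m * hs m) = caloric_at p0 r (p i0) * field_scale r.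
 by rewrite b1E w0 wl !mul0r subr0 mul1r /g /hs ppl; field; rewrite gt_eqF // hst_gt0.
have lc0 : 0 < caloric_at p0 r (p i0) := lt_le_trans g0 (hg i0).
have b1e : \sum_m b1 m * ((w m)%:R * g m * hs m) != 0 by rewrite eb gt_eqF // mulr_gt0.
have [eta [tau [meta tau0 lo hi rs]]] := resampled_field (fun j m => mfun_clamped j (pp m)) (Gam_mx_sym pp)
 (family_char ppt) z hs0 eA A0 b1e.
exists eta, tau; split => //; first by move: lo; rewrite invf_div.
 apply: (le_trans hi); rewrite eb qform_Gam.
 have -> : \sum_i \sum_l0 b1 i * b1 l0 * Gam (pp i) (pp l0) = inc_variance fm (p i0) p0.
  under eq_bigr => m _ do (under eq_bigr => l' _ do rewrite -mulrA; rewrite -mulr_sumr b1E).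
  rewrite b1E !ppl !pp0 /inc_variance (Gam_sym fm p0 (p i0)).
  by move: (Gam _ _) (Gam _ _) (Gam _ _) => x1 x2 x3; ring.
 have nr : near_points r (p i0) p0.
  by have [/andP[x1 x2] hx] := pc i0; split => [|i]; [|move: (hx i) => /andP[y1 y2]]; rewrite ger0_norm; lra.
 have hv' := inc_var_near fm beta0 beta2 kfin k0 r0 (pt0 i0) t0 nr.
 have s2 : field_scale r ^+ 2 = (r ^+ 2) `^ a by rewrite sqr_sqrtr // powR_ge0.
 rewrite exprMn s2; have pr : 0 < (r ^+ 2) `^ a by rewrite powR_gt0.
 have ic := inc_constant_ge0 fm beta0.
 move: hv' (hg i0) lc0; move: (inc_variance _ _ _) (caloric_at _ _ _) (inc_constant _) ic (_ `^ a) pr => x y C C0 s' s'0 hx hy y0.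
 have y2 : 0 < y ^+ 2 * s' by rewrite mulr_gt0 // exprn_gt0.
 have g2 : 0 < gmin ^+ 2 by rewrite exprn_gt0.
 rewrite (ler_pdivrMr _ _ y2); apply: (le_trans hx).
 have -> : C / gmin ^+ 2 * (y ^+ 2 * s') = (C * s') * (y ^+ 2 / gmin ^+ 2) by ring.
 rewrite ler_peMr ?mulr_ge0 ?(ltW s'0) // ler_pdivlMr // mul1r lerXn2r // nnegrE ltW //.
move=> H mH H0.
pose H' (Y : 'I_D -> 'I_n.+1 -> R) e := H (fun j i => Y j (lift ord0 i)) e.
have := rs H' (fun _ U Y e mY me => mH _ U (fun j i => Y j (lift ord0 i)) e (fun j i => mY j _) me) (fun Y e => H0 _ _).
rewrite /H' => h; have fE (F : V -> R) : (fun i => F (pp (lift ord0 i))) = (fun i => F (p i)).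
 by apply/funext => i; rewrite ppl.
move: h; under eq_integral => u _.
 under [X in H X]eq_fun do under eq_fun do rewrite /hs ppl.
 over.
move=> ->; apply: eq_integral => u _; apply: eq_integral => x _; congr (_ * H _ _)%:E.
by apply/funext => j; apply/funext => i; rewrite /shift_conf /hs /g /w ppl.
Qed.

(** The ramp with t0 = a = 0, x0 = 0, rho = 1 and l = t1 coincides with h from time t1 on. With g =
    -1 the normalized field is Z - eta, so a hit of 0 by the field is a hit of eta by Z. *)
Lemma global_resampling (t1 : R) : 0 < t1 -> exists2 A : R, 0 < A &
 forall (n : nat) (p : 'I_n -> V) (z : 'I_D -> R) (i0 : 'I_n), (forall i, t1 <= (p i).1) ->
 exists (eta : 'I_D -> T -> R) (tau : R),
 [/\ forall j, mfun (eta j), 0 < tau, A^-1 <= c * tau ^+ 2 &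
   resamples (fun=> -1) P (fun j i w => (clamped j (p i) w - z j) / hst (p i)) xpredT eta (npdf tau)].
move=> t10; have /andP[m0 mfin] := fm_mass fm.
have rm0 : 0 < ramp_mass fm 1 by rewrite /ramp_mass fine_gt0 // m0.
pose A := heat_kernel (2 * 1) (0 : 'rV[R]_k) / (t1 * ramp_mass fm 1 * fm_kap fm ^+ 2).
have A0 : 0 < A.
 apply: divr_gt0; first by apply: heat_kernel_gt0; rewrite mulr1.
 by apply: mulr_gt0; [exact: mulr_gt0|rewrite exprn_gt0 // fm_kap0].
exists A => // n p z i0 hp.
have pt0 i : 0 <= (p i).1 by apply: le_trans (hp i); exact: ltW.
have hs0 i : hst (p i) != 0 by rewrite gt_eqF // hst_gt0.
have eE i : (xpredT i)%:R * -1 * hst (p i) = - ((0 + t1 <= (p i).1)%R%:R * caloric 0 1 0 (p i)).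
 by rewrite add0r hp /caloric !mulr1 !subr0 !mul1r /hst mulN1r.
have eA b : (\sum_i b i * ((xpredT i)%:R * -1 * hst (p i))) ^+ 2 <= A * qform (\matrix_(i, l) Gam (p i) (p l)) b.
 rewrite qform_Gam; under eq_bigr do rewrite eE mulrN; rewrite sumrN sqrrN.
 apply: (@ramp_inequality R k beta fm kfin 0 1 0 t1 0) => // i.
 by right; rewrite add0r.
pose b1 (i : 'I_n) : R := (i == i0)%:R.
have b1e : \sum_i b1 i * ((xpredT i)%:R * -1 * hst (p i)) != 0.
 rewrite (bigD1 i0) //= /b1 eqxx !mul1r mulN1r big1 ?addr0 ?oppr_eq0 // => i /negbTE ->; by rewrite mul0r.
have [eta [tau [meta tau0 lo hi rs]]] := resampled_field (fun j m => mfun_clamped j (p m)) (Gam_mx_sym p)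
 (family_char pt0) z hs0 eA A0 b1e.
by exists eta, tau; split.
Qed.

End mild_field.

(** * Uniform bounds for the weight and for local caloric functions *)

Section caloric_bounds.
Context {R : realType} (k : nat).
Notation V := (R * 'rV[R]_k)%type.
Variables (P0 : V) (r0 : R).
Hypotheses (t00 : 0 <= P0.1) (r00 : 0 < r0).

Definition subcell (p0 : V) (r : R) : Prop :=
 [/\ 0 < r, r <= r0, P0.1 <= p0.1, p0.1 + r ^+ 2 <= P0.1 + r0 ^+ 2 &
   forall i, P0.2 0 i <= p0.2 0 i /\ p0.2 0 i + r <= P0.2 0 i + r0].

Lemma subcell_cell p0 r p : subcell p0 r -> cell p0 r p -> cell P0 r0 p.
move=> [a1 a2 a3 a4 a5] [/andP[h1 h2] h3]; split; first by apply/andP; split; lra.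
by move=> i; have [b1 b2] := a5 i; have /andP[b3 b4] := h3 i; apply/andP; split; lra.
Qed.

Definition space_bound : R := \sum_i `|P0.2 0 i| + r0.
Definition weight_bound : R := logheat_bound k (P0.1 + r0 ^+ 2 + 2) space_bound.
Definition weight_lip : R := logheat_lip k space_bound * (1 + r0).

Let Xm0 : 0 <= space_bound. by rewrite addr_ge0 ?sumr_ge0 // ltW. Qed.

Let cell_space p : cell P0 r0 p -> forall i, `|p.2 0 i| <= space_bound.
move=> [_ h] i; have /andP[h1 h2] := h i.
apply: (@le_trans _ _ (`|P0.2 0 i| + r0)); last first.
 by rewrite lerD2r (bigD1 i) //= lerDl sumr_ge0.
have := ler_norm (P0.2 0 i); have := ler_norm (- P0.2 0 i); rewrite normrN ler_norml => ? ?.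
by have := r00; lra.
Qed.

Let cell_time p : cell P0 r0 p -> 2 <= p.1 + 2 /\ p.1 + 2 <= P0.1 + r0 ^+ 2 + 2.
by move=> [/andP[h1 h2] _]; have := t00; split; lra. Qed.

Lemma hstE p : cell P0 r0 p -> hst p = expR (- logheat (p.1 + 2) p.2).
by move=> /cell_time[h _]; apply: logheatE; lra. Qed.

Lemma weight_range p : cell P0 r0 p -> 0 <= logheat (p.1 + 2) p.2 <= weight_bound.
by move=> h; have [h1 h2] := cell_time h; apply: logheat_le => //; exact: cell_space. Qed.

Lemma weight_lipschitz del p p' : cell P0 r0 p -> cell P0 r0 p' -> 0 <= del -> del <= r0 -> near_points del p p' ->
 `|logheat (p.1 + 2) p.2 - logheat (p'.1 + 2) p'.2| <= weight_lip * del.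
move=> h h' d0 dr [nt nx]; have [h1 h2] := cell_time h; have [h1' h2'] := cell_time h'.
rewrite /weight_lip -mulrA; apply: logheat_lipschitz => //; try exact: cell_space.
 have -> : p.1 + 2 - (p'.1 + 2) = p.1 - p'.1 by ring.
 by apply: (le_trans nt); rewrite expr2 ler_wpM2r //; lra.
by move=> i; apply: (le_trans (nx i)); rewrite ler_peMl //; have := r00; lra.
Qed.

Lemma hst_range p : cell P0 r0 p -> expR (- weight_bound) <= hst p <= 1.
move=> h; rewrite hstE // ler_expR lerN2; have /andP[h1 h2] := weight_range h.
by rewrite h2 /= -[leRHS]expR0 ler_expR oppr_le0.
Qed.

Lemma hst_inv_lip del p p' : cell P0 r0 p -> cell P0 r0 p' -> 0 <= del -> del <= r0 -> near_points del p p' ->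
 `|(hst p)^-1 - (hst p')^-1| <= expR weight_bound * weight_lip * del.
move=> h h' d0 dr n; rewrite !hstE // !expRN !invrK -mulrA.
have /andP[_ b1] := weight_range h; have /andP[_ b2] := weight_range h'.
by apply: (le_trans (expR_lip b1 b2)); rewrite ler_wpM2l ?expR_ge0 //; exact: weight_lipschitz.
Qed.

(** Parabolic coordinates of p relative to the cell, shifted so that the local caloric function has
    age between 2 and 3. *)
Definition local_time (p0 : V) (r : R) (p : V) : R := (p.1 - p0.1) / r ^+ 2 + 2.
Definition local_space (p0 : V) (r : R) (p : V) : 'rV[R]_k := r^-1 *: (p.2 - p0.2).

Lemma local_caloricE p0 r p : 0 < r -> cell p0 r p ->
 caloric_at p0 r p = expR (- logheat (local_time p0 r p) (local_space p0 r p)).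
move=> rp [/andP[h1 h2] _]; have r2 : 0 < r ^+ 2 by rewrite exprn_gt0.
have t0 : 0 < local_time p0 r p.
 have : 0 <= (p.1 - p0.1) / r ^+ 2 by rewrite divr_ge0 ?(ltW r2) //; lra.
 by rewrite /local_time; lra.
rewrite -logheatE // -heat_kernel_scale // /caloric_at /caloric; congr (_ * heat_kernel _ _).
by rewrite /local_time; field; rewrite gt_eqF.
Qed.

Let local_dom p0 r p : 0 < r -> cell p0 r p ->
 [/\ 2 <= local_time p0 r p, local_time p0 r p <= 3 & forall i, `|local_space p0 r p 0 i| <= 1].
move=> rp [/andP[h1 h2] hx]; have r2 : 0 < r ^+ 2 by rewrite exprn_gt0.
have q0 : 0 <= (p.1 - p0.1) / r ^+ 2 by rewrite divr_ge0 ?(ltW r2) //; lra.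
have q1 : (p.1 - p0.1) / r ^+ 2 <= 1 by rewrite ler_pdivrMr // mul1r; lra.
split; rewrite /local_time; [lra|lra|move=> i].
have /andP[h3 h4] := hx i; rewrite /local_space !mxE mulrC normrM normfV (gtr0_norm rp) ler_pdivrMr // mul1r.
by rewrite ger0_norm; lra.
Qed.

Definition ratio_lip : R := expR weight_bound * (weight_lip * r0 + logheat_lip k 1).
Definition ratio_min : R := expR (- logheat_bound k 3 1).

Lemma local_caloric_ge (p0 : V) r p : 0 < r -> cell p0 r p -> ratio_min <= caloric_at p0 r p.
move=> rp h; rewrite local_caloricE // ler_expR lerN2; have [a1 a2 a3] := local_dom rp h.
by have /andP[] := logheat_le ler01 a1 a2 a3.
Qed.

Let ratioE p0 r p : 0 < r -> cell p0 r p -> cell P0 r0 p ->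
 caloric_at p0 r p / hst p = expR (logheat (p.1 + 2) p.2 - logheat (local_time p0 r p) (local_space p0 r p)).
by move=> rp h h'; rewrite local_caloricE // hstE // -expRN opprK -expRD addrC. Qed.

Lemma ratio_range p0 r p : 0 < r -> cell p0 r p -> cell P0 r0 p ->
 ratio_min <= caloric_at p0 r p / hst p <= expR weight_bound.
move=> rp h h'; have [a1 a2 a3] := local_dom rp h; have /andP[b1 b2] := logheat_le ler01 a1 a2 a3.
have /andP[c1 c2] := weight_range h'.
by rewrite ratioE // !ler_expR; apply/andP; split; lra.
Qed.

(** In local coordinates the cell has size 1, so a displacement of r / m changes both logarithms by
    order 1/m. A shift therefore moves the points of one sub-cell rigidly, up to an error of the
    scale of that sub-cell. *)
Lemma ratio_lipschitz p0 r (m : R) p p' : subcell p0 r -> 1 <= m -> cell p0 r p -> cell p0 r p' ->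
 near_points (r / m) p p' ->
 `|caloric_at p0 r p / hst p - caloric_at p0 r p' / hst p'| <= ratio_lip / m.
move=> sc m1 h h' nn; have [rp rr _ _ _] := sc.
have H := subcell_cell sc h; have H' := subcell_cell sc h'.
have m0 : 0 < m by apply: lt_le_trans m1.
have [a1 a2 a3] := local_dom rp h; have [a1' a2' a3'] := local_dom rp h'.
have /andP[b1 b2] := logheat_le ler01 a1 a2 a3; have /andP[b1' b2'] := logheat_le ler01 a1' a2' a3'.
have /andP[c1 c2] := weight_range H; have /andP[c1' c2'] := weight_range H'.
have rm : r / m <= r0 by rewrite ler_pdivrMr //; apply: (le_trans rr); rewrite ler_peMr // ltW.
have rm0 : 0 <= r / m by rewrite divr_ge0 // ltW.
have w1 := weight_lipschitz H H' rm0 rm nn.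
have r2 : 0 < r ^+ 2 by rewrite exprn_gt0.
have [nt nx] := nn.
have w2 : `|logheat (local_time p0 r p) (local_space p0 r p) - logheat (local_time p0 r p') (local_space p0 r p')| <= logheat_lip k 1 * m^-1.
 apply: logheat_lipschitz => //.
  have -> : local_time p0 r p - local_time p0 r p' = (p.1 - p'.1) / r ^+ 2 by rewrite /local_time; field; rewrite gt_eqF.
  rewrite normrM normfV (gtr0_norm r2) ler_pdivrMr //; apply: (le_trans nt).
  rewrite expr_div_n mulrC ler_wpM2r ?(ltW r2) // lef_pV2 ?posrE ?exprn_gt0 //.
  by rewrite expr2 ler_peMr // ltW.
 move=> i; rewrite /local_space !mxE -mulrBr opprB addrA subrK normrM normfV (gtr0_norm rp) mulrC ler_pdivrMr //.
 by apply: (le_trans (nx i)); rewrite mulrC.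
rewrite !ratioE //.
apply: (le_trans (expR_lip (B := weight_bound) _ _)); [lra|lra|].
rewrite /ratio_lip -mulrA ler_wpM2l ?expR_ge0 //.
have -> : (weight_lip * r0 + logheat_lip k 1) / m = weight_lip * (r0 / m) + logheat_lip k 1 * m^-1 by field; rewrite gt_eqF.
move: w1 w2; move: (logheat (p.1 + 2) p.2) (logheat (p'.1 + 2) p'.2) (logheat (local_time p0 r p) _) (logheat (local_time p0 r p') _) => x1 x2 y1 y2 w1 w2.
have -> : x1 - y1 - (x2 - y2) = (x1 - x2) - (y1 - y2) by ring.
apply: (le_trans (ler_normB _ _)); apply: lerD => //; apply: (le_trans w1).
have wl0 : 0 <= weight_lip.
 apply: mulr_ge0; last by have := r00; lra.
 by apply: mulr_ge0 => //; apply: addr_ge0; [apply: addr_ge0|exact: sqr_ge0].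
by rewrite ler_wpM2l // ler_wpM2r // invr_ge0 ltW.
Qed.

End caloric_bounds.

(** * Powers of sums *)

Section power_sums.
Context {R : realType}.

Lemma add_pow_le (a b : R) N : 0 <= a -> 0 <= b -> (a + b) ^+ N <= 2 ^+ N * (a ^+ N + b ^+ N).
move=> a0 b0; wlog ab : a b a0 b0 / a <= b.
 move=> h; have [ab|/ltW ba] := leP a b; first exact: h.
 by rewrite addrC [X in _ * X]addrC; exact: h.
apply: (@le_trans _ _ ((2 * b) ^+ N)); first by rewrite lerXn2r ?nnegrE ?addr_ge0 ?mulr_ge0 //; lra.
by rewrite exprMn ler_wpM2l ?exprn_ge0 // lerDr exprn_ge0.
Qed.

Lemma sum_pow_le (D : nat) (y : 'I_D -> R) N : (0 < N)%N -> nonneg y ->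
 (\sum_j y j) ^+ N <= D%:R ^+ N * \sum_j y j ^+ N.
move=> N0 y0; case: D y y0 => [|D] y y0.
 by rewrite !big_ord0 mulr0 expr0n gtn_eqF.
pose M := [arg max_(j > ord0) y j]%O.
have hM j : y j <= y M by rewrite /M; case: Order.TotalTheory.arg_maxP => // i _ h; exact: h.
apply: (@le_trans _ _ ((D.+1%:R * y M) ^+ N)).
 rewrite lerXn2r ?nnegrE ?mulr_ge0 ?sumr_ge0 //.
 apply: (@le_trans _ _ (\sum_(j < D.+1) y M)); first by apply: ler_sum => j _.
 by rewrite sumr_const card_ord mulr_natl.
rewrite exprMn ler_wpM2l ?exprn_ge0 // (bigD1 M) //= lerDl.
by apply: sumr_ge0 => j _; rewrite exprn_ge0.
Qed.

End power_sums.

Lemma prob_int_cst d (T : measurableType d) (R : realType) (P : probability T R) (c : R) :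
 (\int[P]_w c%:E = c%:E)%E.
by rewrite nn_int_cst; apply: (etrans (congr1 (mule c%:E) (probability_setT P))); rewrite mule1. Qed.

(** * Oscillation of the normalized field *)

Section oscillation.
Context d (T : measurableType d) {R : realType} (P : probability T R) (k D : nat).
Notation V := (R * 'rV[R]_k)%type.
Notation N := (4 * D)%N.
Notation Q := k.+2.
Variables (u : 'I_D -> V -> T -> R) (Cm : R).
Hypotheses (D0 : (0 < D)%N) (mu : forall j p, mfun (u j p)) (Cm0 : 0 <= Cm).
Hypothesis moment : forall j del p q, 0 < del -> near_points del p q ->
 (\int[P]_w (`|u j p w - u j q w| ^+ N)%:E <= (Cm * del ^+ (4 * Q))%:E)%E.
Hypothesis moment1 : forall j p, exists C : R, (\int[P]_w (`|u j p w| ^+ N)%:E <= C%:E)%E.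
Variables (P0 : V) (r0 : R) (z : 'I_D -> R) (sc : R -> R).
Hypotheses (t00 : 0 <= P0.1) (r00 : 0 < r0) (sc0 : forall r, 0 < r -> 0 < sc r)
 (scD : forall r, 0 < r -> sc r ^+ D = r ^+ Q) (DQ : (Q <= D)%N).
Notation subcell := (subcell P0 r0).

Let N0 : (0 < N)%N. by rewrite muln_gt0. Qed.

Lemma le_scale (x r : R) : 0 < r -> 0 <= x -> x ^+ D <= r ^+ Q -> x <= sc r.
by move=> rp x0; rewrite -scD // ler_pXn2r // nnegrE // ltW // sc0. Qed.

(** Uses Q <= D. The variation of 1/h over a cell, of the order of its side s, is thereby absorbed
    into the field scale. *)
Lemma scale_ge s : 0 < s -> s <= r0 -> s <= (1 + r0) * sc s.
move=> s0 sr; have r1 : 1 <= 1 + r0 by have := r00; lra.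
have r10 : 0 < 1 + r0 by lra.
rewrite -ler_pdivrMl // mulrC; apply: le_scale => //; first by rewrite divr_ge0 // ltW.
rewrite expr_div_n ler_pdivrMr ?exprn_gt0 // -(subnKC DQ) !exprD mulrC -[leLHS]mulrC.
rewrite ler_wpM2l ?exprn_ge0 ?(ltW s0) //.
apply: (@le_trans _ _ ((1 + r0) ^+ (D - Q))); first by rewrite lerXn2r ?nnegrE ?(ltW s0) ?(ltW r10) //; lra.
by rewrite ler_peMl ?exprn_ge0 ?(ltW r10) // exprn_ege1.
Qed.

Lemma scale_mono s r : 0 < s -> s <= r -> sc s <= sc r.
move=> s0 sr; have rp : 0 < r by apply: lt_le_trans sr.
by apply: le_scale => //; [rewrite ltW // sc0|rewrite scD // lerXn2r // nnegrE ltW].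
Qed.

(** The field scale shrinks no faster than the side of the cell because Q <= D. *)
Lemma scale_div (m r : R) : 0 < r -> 1 <= m -> sc r / m <= sc (r / m).
move=> rp m1; have mp : 0 < m by apply: lt_le_trans m1.
apply: le_scale; rewrite ?divr_gt0 ?divr_ge0 ?(ltW mp) ?(ltW (sc0 rp)) //.
rewrite !expr_div_n scD // ler_wpM2l ?exprn_ge0 ?(ltW rp) // lef_pV2 ?posrE ?exprn_gt0 //.
exact: ler_weXn2l.
Qed.

Definition ratio_field j p w : R := (u j p w - z j) / hst p.

Lemma mfun_ratio_field j p : mfun (ratio_field j p).
by apply: mfunM => //; exact: mfunB. Qed.

Let mabs j (p : V) : mfun (fun w => `|u j p w - z j| ^+ N).
by apply: mfunX; apply: mcomp => //; exact: mfunB. Qed.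

Lemma base_moment : exists2 C : R, 0 <= C & forall j p, cell P0 r0 p ->
 (\int[P]_w (`|u j p w - z j| ^+ N)%:E <= C%:E)%E.
have [Cj hC] := choice (fun j => moment1 j P0).
pose c1 := Cm * r0 ^+ (4 * Q); pose c2 j := 2 ^+ N * (`|Cj j| + `|z j| ^+ N).
have c10 : 0 <= c1 by rewrite mulr_ge0 // exprn_ge0 // ltW.
have c20 j : 0 <= c2 j by rewrite mulr_ge0 ?exprn_ge0 // addr_ge0 // exprn_ge0.
exists (2 ^+ N * (c1 + \sum_j c2 j)); first by rewrite mulr_ge0 ?exprn_ge0 // addr_ge0 // sumr_ge0.
move=> j p [/andP[h1 h2] hx].
have np : near_points r0 p P0.
 by split => [|i]; [|have /andP[h3 h4] := hx i]; rewrite ger0_norm; lra.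
have ma q : mfun (fun w => `|u j q w| ^+ N) by apply: mfunX; exact: mcomp.
have md : mfun (fun w => `|u j p w - u j P0 w| ^+ N).
 by apply: mfunX; apply: mcomp => //; exact: mfunB.
have two0 : 0 <= 2 ^+ N :> R by rewrite exprn_ge0.
have step (a b c : R) : `|a - b| ^+ N <= 2 ^+ N * (`|a - c| ^+ N + `|c - b| ^+ N).
 apply: le_trans (add_pow_le _ _ _) => //; rewrite lerXn2r ?nnegrE ?addr_ge0 //.
 exact: ler_distD.
have step2 w : `|u j P0 w - z j| ^+ N <= 2 ^+ N * (`|u j P0 w| ^+ N + `|z j| ^+ N).
 by have := step (u j P0 w) (z j) 0; rewrite subr0 sub0r normrN.
have mc : (\int[P]_w (`|u j P0 w - z j| ^+ N)%:E <= (c2 j)%:E)%E.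
 apply: (@le_trans _ _ (\int[P]_w (2 ^+ N * (`|u j P0 w| ^+ N + `|z j| ^+ N))%:E)%E).
  apply: nn_int_le => [||w|w]; [exact: mabs| |by rewrite exprn_ge0|exact: step2].
  by apply: mfunM => //; exact: mfunD.
 rewrite nn_intZ; [|exact: mfunD|by move=> w; rewrite addr_ge0 // exprn_ge0|by []].
 rewrite /c2 EFinM; apply: lee_wpmul2l; first by rewrite lee_fin.
 rewrite nn_intD; [|by []|by []|by move=> w; rewrite exprn_ge0|by move=> w; rewrite exprn_ge0].
 rewrite EFinD; apply: leeD.
  by apply: (le_trans (hC j)); rewrite lee_fin ler_norm.
 by rewrite prob_int_cst.
apply: (@le_trans _ _ (\int[P]_w (2 ^+ N * (`|u j p w - u j P0 w| ^+ N + `|u j P0 w - z j| ^+ N))%:E)%E).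
 apply: nn_int_le => [||w|w]; [exact: mabs| |by rewrite exprn_ge0|exact: step].
 by apply: mfunM => //; apply: mfunD => //; exact: mabs.
have mab := mabs j P0.
rewrite nn_intZ; [|exact: mfunD|by move=> w; rewrite addr_ge0 // exprn_ge0|by []].
rewrite EFinM; apply: lee_wpmul2l; first by rewrite lee_fin.
rewrite nn_intD; [|by []|by []|by move=> w; rewrite exprn_ge0|by move=> w; rewrite exprn_ge0].
rewrite EFinD; apply: leeD; first exact: moment.
by apply: (le_trans mc); rewrite lee_fin (bigD1 j) //= lerDl sumr_ge0.
Qed.

(** The increment of (v - z)/h splits into the increment of v, controlled by chaining in each
    component, and the variation of 1/h multiplied by v - z at the corner, whose moments are bounded
    over the large cell by [base_moment]. *)
Lemma oscillation : exists2 C : R, 0 <= C & forall pc s, subcell pc s ->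
 forall (n : nat) (p : 'I_n -> V) (S : pred 'I_n), (forall i, S i -> cell pc s (p i)) ->
 exists Rv : T -> R, [/\ mfun Rv, forall w, 0 <= Rv w,
  (\int[P]_w (Rv w ^+ N)%:E <= C%:E)%E &
  forall i j w, S i -> `|ratio_field j (p i) w - ratio_field j pc w| <= sc s * Rv w].
have [Cb Cb0 hCb] := base_moment.
pose E := expR (weight_bound P0 r0); pose Lh := expR (weight_bound P0 r0) * weight_lip P0 r0.
have E0 : 0 < E by exact: expR_gt0.
pose cc := chaining_constant k N Cm.
have cc0 : 0 <= cc by exact: chaining_constant_ge0.
pose aL := (1 + r0) * `|Lh|.
have aL0 : 0 <= aL by rewrite mulr_ge0 //; have := r00; lra.
exists (2 ^+ N * (E ^+ N * (D%:R ^+ N * (D%:R * cc)) + aL ^+ N * (D%:R ^+ N * (D%:R * Cb)))).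
 have EE := ltW E0; apply: mulr_ge0; first exact: exprn_ge0.
 by apply: addr_ge0; apply: mulr_ge0; rewrite ?exprn_ge0 //; apply: mulr_ge0; rewrite ?exprn_ge0 ?ler0n //; exact: mulr_ge0.
move=> pc s sub n p S hS; have [s0 sr _ _ _] := sub.
have pcc : cell pc s pc.
 by split => [|i]; rewrite lexx /= lerDl ?sqr_ge0 // ltW.
have PC := subcell_cell sub pcc.
pose F := [seq p i | i <- enum 'I_n & S i].
have Fc q : q \in F -> cell pc s q.
 by move=> /mapP[i]; rewrite mem_filter => /andP[Si _] ->; exact: hS.
have [Z hZ] := choice (fun j => chaining N0 (mu j) Cm0 (@moment j) s0 Fc).
have mZ j : mfun (Z j) by have [] := hZ j.
have Z0 j w : 0 <= Z j w by have [_ h _ _] := hZ j.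
have EZ j : (\int[P]_w (Z j w)%:E <= (cc * s ^+ (4 * Q))%:E)%E by have [_ _ h _] := hZ j.
have HZ j q w : q \in F -> `|u j q w - u j pc w| ^+ N <= Z j w by have [_ _ _ h] := hZ j; exact: h.
have NR : 0 < N%:R :> R by rewrite ltr0n.
(* The N-th root of the chaining variable bounds the increments themselves. *)
pose rho j w := Z j w `^ (N%:R^-1).
have rhoN j w : rho j w ^+ N = Z j w by rewrite -powR_mulrn ?powR_ge0 // -powRrM mulVf ?gt_eqF // powRr1.
have rho0 j w : 0 <= rho j w by exact: powR_ge0.
have mrho j : mfun (rho j) by exact: mfun_powRr.
have scs := sc0 s0.
pose A w := E / sc s * \sum_j rho j w; pose B w := aL * \sum_j `|u j pc w - z j|.
have mub j : mfun (fun w => `|u j pc w - z j|) by apply: mcomp => //; exact: mfunB.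
have mA : mfun A by apply: mfunM => //; exact: mfun_sumr.
have mB : mfun B by apply: mfunM => //; exact: mfun_sumr.
have A0 w : 0 <= A w by rewrite mulr_ge0 ?divr_ge0 ?(ltW E0) ?(ltW scs) // sumr_ge0.
have B0 w : 0 <= B w by rewrite mulr_ge0 // sumr_ge0.
exists (fun w => A w + B w); split.
- exact: mfunD.
- by move=> w; rewrite addr_ge0.
- have two0 : 0 <= 2 ^+ N :> R by rewrite exprn_ge0.
 pose SZ w := \sum_j Z j w; pose SB w := \sum_j `|u j pc w - z j| ^+ N.
 have mSZ : mfun SZ by exact: mfun_sumr.
 have mSB : mfun SB by apply: mfun_sumr => j; exact: mabs.
 have SZ0 w : 0 <= SZ w by exact: sumr_ge0.
 have SB0 w : 0 <= SB w by apply: sumr_ge0 => j _; rewrite exprn_ge0.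
 pose ca := (E / sc s) ^+ N * D%:R ^+ N; pose cb := aL ^+ N * D%:R ^+ N.
 have ca0 : 0 <= ca by rewrite mulr_ge0 // exprn_ge0 // divr_ge0 // ltW.
 have cb0 : 0 <= cb by rewrite mulr_ge0 // exprn_ge0.
 apply: (@le_trans _ _ (\int[P]_w (2 ^+ N * (ca * SZ w + cb * SB w))%:E)%E).
  apply: nn_int_le => [||w|w].
  - by apply: mfunX; exact: mfunD.
  - by apply: mfunM => //; apply: mfunD; exact: mfunM.
  - by rewrite exprn_ge0 // addr_ge0.
  apply: (le_trans (add_pow_le N (A0 w) (B0 w))); rewrite ler_wpM2l //; apply: lerD.
   rewrite /A exprMn /ca -mulrA ler_wpM2l ?exprn_ge0 ?divr_ge0 ?(ltW E0) ?(ltW scs) //.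
   by apply: (le_trans (sum_pow_le N0 (rho0 ^~ w))); under eq_bigr do rewrite rhoN.
  rewrite /B exprMn /cb -mulrA ler_wpM2l ?exprn_ge0 //.
  by apply: sum_pow_le => // j.
 rewrite nn_intZ //; last 2 first.
 - by apply: mfunD; exact: mfunM.
 - by move=> w; rewrite addr_ge0 // mulr_ge0.
 rewrite EFinM; apply: lee_wpmul2l; first by rewrite lee_fin.
 rewrite nn_intD; [|exact: mfunM|exact: mfunM|by move=> w; rewrite mulr_ge0|by move=> w; rewrite mulr_ge0].
 rewrite EFinD; apply: leeD.
  rewrite nn_intZ // nn_int_sum //.
  apply: (@le_trans _ _ (ca%:E * \sum_(j < D) (cc * s ^+ (4 * Q))%:E)%E).
   by apply: lee_wpmul2l; [rewrite lee_fin|apply: lee_sum => j _].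
  rewrite sumEFin sumr_const card_ord -EFinM lee_fin /ca -[cc * _ *+ D]mulr_natl expr_div_n.
  have -> : sc s ^+ N = s ^+ (4 * Q) by rewrite mulnC exprM scD // -exprM mulnC.
  have sp : 0 < s ^+ (4 * Q) by rewrite exprn_gt0.
  move: (s ^+ (4 * Q)) sp (E ^+ N) (D%:R ^+ N) => x x0 e1 e2.
  rewrite le_eqVlt; apply/orP; left; apply/eqP; field; exact: lt0r_neq0.
 rewrite nn_intZ // nn_int_sum //.
 apply: (@le_trans _ _ (cb%:E * \sum_(j < D) Cb%:E)%E).
  by apply: lee_wpmul2l; [rewrite lee_fin|apply: lee_sum => j _; exact: hCb].
 by rewrite sumEFin sumr_const card_ord -EFinM lee_fin /cb -[Cb *+ D]mulr_natl !mulrA lexx.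
move=> i j w Si; have ci := hS i Si; have Ci := subcell_cell sub ci.
have np : near_points s (p i) pc.
 by have [/andP[h1 h2] hx] := ci; split => [|i']; [|have /andP[h3 h4] := hx i']; rewrite ger0_norm; lra.
have iF : p i \in F by apply/mapP; exists i => //; rewrite mem_filter Si mem_enum.
have hl := hst_inv_lip t00 r00 Ci PC (ltW s0) sr np.
have /andP[h1 h2] := hst_range t00 r00 Ci.
have hp0 : 0 < hst (p i) by apply: lt_le_trans h1; exact: expR_gt0.
have iE : (hst (p i))^-1 <= E by rewrite /E -[E in _ <= E]invrK -expRN lef_pV2 ?posrE ?expR_gt0.
have ur : `|u j (p i) w - u j pc w| <= rho j w.
 by rewrite -(ler_pXn2r N0) ?nnegrE // rhoN HZ.
have -> : ratio_field j (p i) w - ratio_field j pc w =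
  (u j (p i) w - u j pc w) * (hst (p i))^-1 + (u j pc w - z j) * ((hst (p i))^-1 - (hst pc)^-1).
 by rewrite /ratio_field; ring.
apply: (le_trans (ler_normD _ _)); rewrite [leRHS]mulrDr; apply: lerD.
 rewrite normrM /A mulrA [sc s * _]mulrC divfK ?gt_eqF // mulrC ger0_norm ?invr_ge0 ?(ltW hp0) //.
 apply: ler_pM => //; first by rewrite invr_ge0 ltW.
 by apply: (le_trans ur); rewrite (bigD1 j) //= lerDl sumr_ge0.
rewrite normrM /B mulrA mulrC; apply: ler_pM => //.
 apply: (le_trans hl); rewrite -/Lh /aL; apply: (@le_trans _ _ (`|Lh| * s)).
  by rewrite ler_wpM2r ?(ltW s0) // ler_norm.
 by rewrite [leRHS]mulrC -mulrA mulrC -mulrA ler_wpM2l // mulrC scale_ge.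
by rewrite (bigD1 j) //= lerDl sumr_ge0.
Qed.

End oscillation.

(** * Subdivision of a cell into sub-cells *)

Section children.
Context {R : realType} (k : nat).
Notation V := (R * 'rV[R]_k)%type.
Variables (P0 : V) (r0 : R).

Definition child (p0 : V) (r : R) (m : nat) (c : 'I_(m ^ 2) * {ffun 'I_k -> 'I_m}) : V :=
 (p0.1 + r ^+ 2 * ((c.1 : nat)%:R / m%:R ^+ 2), \row_i (p0.2 0 i + r * ((c.2 i : nat)%:R / m%:R))).

(** The truncation is capped at the last index so that the right end point y = c falls into the last
    interval. *)
Lemma unit_cell_index (c y : R) (m : nat) : 0 < c -> (0 < m)%N -> 0 <= y <= c ->
 exists a : 'I_m, c * ((a : nat)%:R / m%:R) <= y <= c * ((a : nat)%:R / m%:R) + c / m%:R.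
move=> c0 m0 /andP[y0 yc]; have mR : 0 < m%:R :> R by rewrite ltr0n.
case: m m0 mR => // m _ mR.
pose x := m.+1%:R * (y / c); have x0 : 0 <= x by rewrite mulr_ge0 // divr_ge0 // ltW.
have xm : x <= m.+1%:R by rewrite /x ler_piMr // ler_pdivrMr // mul1r.
have yE0 (b : R) : 0 < b -> y = c * (b * (y / c) / b) by move=> b0; field; rewrite !gt_eqF.
have yE : y = c * (x / m.+1%:R) := yE0 _ mR.
have h1 : (Num.truncn x)%:R <= x by rewrite truncn_le.
have h2 := truncnS_gt x.
have cm : 0 < c / m.+1%:R by rewrite divr_gt0.
have E (b : R) : c * (b / m.+1%:R) = c / m.+1%:R * b by ring.
have hm : (minn (Num.truncn x) m < m.+1)%N by rewrite ltnS geq_minr.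
exists (Ordinal hm) => /=; rewrite yE !E -{5}[c / _]mulr1 -mulrDr !ler_pM2l //.
apply/andP; split; first by apply: le_trans h1; rewrite ler_nat geq_minl.
rewrite /minn; case: ltnP => _; first by rewrite natr1 ltW.
by rewrite natr1.
Qed.

Lemma cell_child (p0 p : V) (r : R) (m : nat) : 0 < r -> (0 < m)%N -> cell p0 r p ->
 exists c : 'I_(m ^ 2) * {ffun 'I_k -> 'I_m}, cell (child p0 r c) (r / m%:R) p.
move=> rp m0 [/andP[h1 h2] hx]; have r2 : 0 < r ^+ 2 by rewrite exprn_gt0.
have m2 : (0 < m ^ 2)%N by rewrite expn_gt0 m0.
have [|a ha] := @unit_cell_index (r ^+ 2) (p.1 - p0.1) _ r2 m2; first by apply/andP; split; lra.
have hb (i : 'I_k) : exists b : 'I_m, r * ((b : nat)%:R / m%:R) <= p.2 0 i - p0.2 0 i <= r * ((b : nat)%:R / m%:R) + r / m%:R.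
 by apply: unit_cell_index => //; have /andP[h3 h4] := hx i; apply/andP; split; lra.
have [b hb'] := choice hb.
exists (a, [ffun i => b i]); rewrite natrX in ha; split => /=.
 by move: ha; rewrite expr_div_n; lra.
by move=> i; rewrite mxE ffunE; move: (hb' i); lra.
Qed.

Lemma child_subcell (p0 : V) (r : R) (m : nat) (c : 'I_(m ^ 2) * {ffun 'I_k -> 'I_m}) : (0 < m)%N -> subcell P0 r0 p0 r ->
 subcell P0 r0 (child p0 r c) (r / m%:R).
move=> m0 [rp rr h1 h2 h3]; have mR : 0 < m%:R :> R by rewrite ltr0n.
have m1 : 1 <= m%:R :> R by rewrite ler1n.
have r2 : 0 < r ^+ 2 by rewrite exprn_gt0.
have rm : r / m%:R <= r by rewrite ler_pdivrMr // ler_peMr // ltW.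
split => //; [by rewrite divr_gt0|exact: le_trans rr|..] => /=.
- by apply: (le_trans h1); rewrite lerDl mulr_ge0 ?(ltW r2) // divr_ge0 // exprn_ge0.
- apply: le_trans h2; rewrite -addrA lerD2l expr_div_n -mulrDr ler_piMr ?(ltW r2) //.
 have m2 : 0 < m%:R ^+ 2 :> R by rewrite exprn_gt0.
 rewrite -{2}[_^-1]mul1r -mulrDl ler_pdivrMr // mul1r natr1 -natrX ler_nat; exact: ltn_ord.
move=> i; have [b1 b2] := h3 i; rewrite mxE; split.
 by apply: (le_trans b1); rewrite lerDl mulr_ge0 ?(ltW rp) // divr_ge0.
apply: le_trans b2; rewrite -addrA lerD2l -mulrDr ler_piMr ?(ltW rp) //.
rewrite -{2}[_^-1]mul1r -mulrDl ler_pdivrMr // mul1r natr1 ler_nat; exact: ltn_ord.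
Qed.

End children.

(** * Mean volumes of neighbourhoods of images *)

Section volumes.
Context d (T : measurableType d) {R : realType} (P : probability T R) (k D : nat).
Notation V := (R * 'rV[R]_k)%type.
Notation mR := (measurableTypeR R).
Notation vec := (D.-tuple mR).
Notation lam := (lebesgue_tuple R D).
Notation M := (P \x lam)%E.
Variable X : 'I_D -> V -> T -> R.
Hypothesis mX : forall j p, mfun (X j p).

Definition hits n (p : 'I_n -> V) (S : pred 'I_n) (eps : R) (y : T * vec) : bool :=
 shifted_hit (fun=> 0) eps S (fun j i => X j (p i) y.1) (tnth y.2) (fun=> 0).

Definition mean_volume n (p : 'I_n -> V) (S : pred 'I_n) (eps : R) : \bar R :=
 (\int[M]_y ((hits p S eps y)%:R)%:E)%E.

Lemma hit0E n g eps S Y (y : 'I_D -> R) : @shifted_hit R D n g eps S Y y (fun=> 0) = shifted_hit (fun=> 0) eps S Y y (fun=> 0).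
by apply: eq_existsb => i; congr (_ && _); apply: eq_forallb => j; rewrite !mulr0. Qed.

Lemma mfun_hits n (p : 'I_n -> V) S eps : mfun (fun y => ((hits p S eps y)%:R : R)).
apply: (@mfun_hit _ _ _ (fun=> 0) eps _ _ S (fun j i (z : T * vec) => X j (p i) z.1) (fun j z => tnth z.2 j) (fun _ _ => 0)) => //.
- by move=> j i; exact: (mcomp (mX j (p i)) mfst).
- by move=> j; exact: (mcomp (mfun_tnthR j) msnd).
Qed.

Lemma volume_mono n (p : 'I_n -> V) (S : pred 'I_n) eps eps' : eps <= eps' ->
 (mean_volume p S eps <= mean_volume p S eps')%E.
move=> ee; apply: nn_int_le => [||y|y] //; try exact: mfun_hits.
rewrite ler_nat; case: (boolP (hits p S eps y)) => // /existsP[i /andP[Si /forallP h]].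
have -> // : hits p S eps' y; apply/existsP; exists i; rewrite Si.
by apply/forallP => j; exact: lt_le_trans (h j) ee.
Qed.

Section split_volume.
Variables (n : nat) (p : 'I_n -> V) (S : pred 'I_n) (eps : R) (I : finType) (ch : 'I_n -> I).
Let Sc c : pred 'I_n := fun i => S i && (ch i == c).

Let hits_split y : hits p S eps y -> exists c, hits p (Sc c) eps y.
move=> /existsP[i /andP[Si h]]; exists (ch i); apply/existsP; exists i.
by rewrite /Sc Si eqxx.
Qed.

Lemma volume_split : (mean_volume p S eps <= \sum_c mean_volume p (Sc c) eps)%E.
have mh c := @mfun_hits n p (Sc c) eps.
rewrite -nn_int_sum //; apply: nn_int_le => [||y|y] //.
- exact: mfun_hits.
- exact: mfun_sumr.
case: (boolP (hits p S eps y)) => [/hits_split[c hc]|_]; last exact: sumr_ge0.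
by rewrite (bigD1 c) //= hc lerDl sumr_ge0.
Qed.

(** Points in the overlap of c and c' are counted at least twice on the right and once in the union.
    Near-equality in [volume_split] therefore forces small overlaps. *)
Lemma volume_pair c c' : c != c' ->
 (mean_volume p S eps + \int[M]_y ((hits p (Sc c) eps y)%:R * (hits p (Sc c') eps y)%:R)%:E <=
  \sum_c mean_volume p (Sc c) eps)%E.
move=> cc; have mh c0 := @mfun_hits n p (Sc c0) eps.
rewrite -nn_int_sum // -nn_intD; [|exact: mfun_hits|exact: mfunM|by move=> y|by move=> y; rewrite mulr_ge0].
apply: nn_int_le => [||y|y].
- by apply: mfunD; [exact: mfun_hits|exact: mfunM].
- exact: mfun_sumr.
- by rewrite addr_ge0 // mulr_ge0.
have [[c0 hc0]|hn] : (exists c, hits p (Sc c) eps y) \/ hits p S eps y = false.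
- by case: (boolP (hits p S eps y)) => [/hits_split|_]; [left|right].
- case: (boolP (hits p (Sc c) eps y)) => h1; case: (boolP (hits p (Sc c') eps y)) => h2;
  rewrite ?mulr1 ?mulr0 ?mul0r ?addr0; try by rewrite (bigD1 c0) //= hc0 ler_wpDr ?sumr_ge0 // lern1 leq_b1.
 rewrite (bigD1 c) //= h1 (bigD1 c') 1?eq_sym //= h2 addrA ler_wpDr ?sumr_ge0 //.
 by rewrite lerD2r lern1 leq_b1.
rewrite hn add0r; case: (boolP (hits p (Sc c) eps y)) => h1; last by rewrite mul0r sumr_ge0.
by rewrite mul1r (bigD1 c') //= lerDl sumr_ge0.
Qed.

End split_volume.
End volumes.

(** * Moments of random radii *)

Section moment_consequences.
Context d (T : measurableType d) {R : realType} (P : probability T R) (D : nat).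
Notation N := (4 * D)%N.

Definition moment_bound (c C : R) : R := 1 + 2 ^+ N * (2 ^+ N * (c ^+ N + C)).

Lemma moment_bound_ge1 c C : 0 <= c -> 0 <= C -> 1 <= moment_bound c C.
by move=> c0 C0; rewrite lerDl !mulr_ge0 ?exprn_ge0 // addr_ge0 // exprn_ge0. Qed.

Variables (Rv : T -> R) (c C : R).
Hypotheses (mR : mfun Rv) (R0 : nonneg Rv) (RC : (\int[P]_w (Rv w ^+ N)%:E <= C%:E)%E) (c0 : 0 <= c).

Let y w := 2 * (c + Rv w).
Let y0 w : 0 <= y w. by rewrite mulr_ge0 // addr_ge0. Qed.
Let my : mfun y. by apply: mfunM => //; exact: mfunD. Qed.

Lemma pow_le_moment n w : (n <= N)%N -> y w ^+ n <= 1 + 2 ^+ N * (2 ^+ N * (c ^+ N + Rv w ^+ N)).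
move=> nN; apply: (@le_trans _ _ (1 + y w ^+ N)).
 have [y1|/ltW y1] := leP (y w) 1.
  by rewrite ler_wpDr ?exprn_ge0 // exprn_ile1.
 by rewrite ler_wpDl // ler_weXn2l.
rewrite lerD2l /y exprMn ler_wpM2l ?exprn_ge0 //; exact: add_pow_le.
Qed.

Lemma moment_le n : (n <= N)%N -> (\int[P]_w (y w ^+ n)%:E <= (moment_bound c C)%:E)%E.
move=> nN; have two0 : 0 <= 2 ^+ N :> R by rewrite exprn_ge0.
have mRN : mfun (fun w => Rv w ^+ N) by exact: mfunX.
have RN0 w : 0 <= Rv w ^+ N by rewrite exprn_ge0.
have cN0 : 0 <= c ^+ N by rewrite exprn_ge0.
have m1 : mfun (fun w => c ^+ N + Rv w ^+ N) by exact: mfunD.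
have m2 : mfun (fun w => 2 ^+ N * (c ^+ N + Rv w ^+ N)) by exact: mfunM.
apply: (@le_trans _ _ (\int[P]_w (1 + 2 ^+ N * (2 ^+ N * (c ^+ N + Rv w ^+ N)))%:E)%E).
 apply: nn_int_le => [||w|w].
 - exact: mfunX.
 - by apply: mfunD => //; exact: mfunM.
 - by rewrite exprn_ge0.
 - exact: pow_le_moment.
rewrite nn_intD; [|by []|exact: mfunM|by []|by move=> w; rewrite !mulr_ge0 // addr_ge0].
rewrite prob_int_cst /moment_bound EFinD; apply: leeD2l.
rewrite nn_intZ; [|by []|by move=> w; rewrite mulr_ge0 // addr_ge0|by []].
rewrite EFinM; apply: lee_wpmul2l; first by rewrite lee_fin.
rewrite nn_intZ; [|by []|by move=> w; rewrite addr_ge0|by []].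
rewrite EFinM; apply: lee_wpmul2l; first by rewrite lee_fin.
rewrite nn_intD; [|by []|by []|by []|by []].
by rewrite prob_int_cst EFinD; exact: leeD2l.
Qed.

(** On the event b, AM-GM gives x <= del x^2 + 1/del for the D-th power x. Taking del small first
    and the probability t small afterwards makes the truncation error negligible. *)
Lemma weighted_moment_le (b : T -> bool) (t del : R) : 0 < del ->
 mfun (fun w => ((b w)%:R : R)) -> (\int[P]_w ((b w)%:R)%:E <= t%:E)%E ->
 (\int[P]_w (y w ^+ D * (b w)%:R)%:E <= (del * moment_bound c C + t / del)%:E)%E.
move=> d0 mb tb; have di : 0 <= del^-1 by rewrite invr_ge0 ltW.
have m2D : mfun (fun w => y w ^+ (D * 2)) by exact: mfunX.
apply: (@le_trans _ _ (\int[P]_w (del * y w ^+ (D * 2) + del^-1 * (b w)%:R)%:E)%E).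
 apply: nn_int_le => [||w|w].
 - by apply: mfunM => //; exact: mfunX.
 - by apply: mfunD; exact: mfunM.
 - by rewrite mulr_ge0 // exprn_ge0.
 have yD : 0 <= y w ^+ (D * 2) by rewrite exprn_ge0.
 case: (b w); rewrite ?mulr1 ?mulr0 ?addr0; last by rewrite mulr_ge0 // ltW.
 rewrite exprM; set x := y w ^+ D; have x0 : 0 <= x by rewrite exprn_ge0.
 rewrite -subr_ge0; have -> : del * x ^+ 2 + del^-1 - x = del^-1 * ((del * x - 2^-1) ^+ 2 + 3 / 4).
  by field; rewrite gt_eqF.
 by rewrite mulr_ge0 // addr_ge0 // sqr_ge0.
rewrite nn_intD; [|exact: mfunM|exact: mfunM|by move=> w; rewrite mulr_ge0 ?(ltW d0) // exprn_ge0|by move=> w; rewrite mulr_ge0].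
rewrite EFinD; apply: leeD.
 rewrite nn_intZ; [|by []|by move=> w; rewrite exprn_ge0|exact: ltW].
 rewrite EFinM; apply: lee_wpmul2l; first by rewrite lee_fin ltW.
 by apply: moment_le; rewrite mulnC leq_mul2r orbT.
rewrite nn_intZ // mulrC EFinM; apply: lee_wpmul2l => //.
Qed.

End moment_consequences.

(** * Good constants and the inequality inside one cell *)

Section good_cells.
Context d (T : measurableType d) {R : realType} (P : probability T R) (k D : nat).
Notation V := (R * 'rV[R]_k)%type.
Notation mR := (measurableTypeR R).
Notation vec := (D.-tuple mR).
Notation lam := (lebesgue_tuple R D).
Notation M := (P \x lam)%E.
Notation N := (4 * D)%N.
Notation Q := k.+2.
Notation c := (gmoment (R := R) 1).
Variables (u : 'I_D -> V -> T -> R) (P0 : V) (r0 : R) (z : 'I_D -> R) (sc : R -> R).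
Hypotheses (mu : forall j p, mfun (u j p)) (t00 : 0 <= P0.1) (r00 : 0 < r0) (sc0 : forall r, 0 < r -> 0 < sc r)
 (scD : forall r, 0 < r -> sc r ^+ D = r ^+ Q) (D0 : (0 < D)%N) (DQ : (Q <= D)%N).
Notation subcell := (subcell P0 r0).
Notation X := (ratio_field u z).
Notation volume := (mean_volume P X).
Notation hits := (hits X).

Definition oscillates (C : R) := forall pc s, subcell pc s ->
 forall (n : nat) (p : 'I_n -> V) (S : pred 'I_n), (forall i, S i -> cell pc s (p i)) ->
 exists Rv : T -> R, [/\ mfun Rv, forall w, 0 <= Rv w,
  (\int[P]_w (Rv w ^+ N)%:E <= C%:E)%E &
  forall i j w, S i -> `|X j (p i) w - X j pc w| <= sc s * Rv w].

Variable C : R.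
Hypotheses (C0 : 0 <= C) (osc : oscillates C).

(** For a given theta, eps depends on the cell but on neither the number nor the position of the
    points; this uniformity lets finite sets stand for the whole cell. *)
Definition good (theta : R) := forall p0 r, subcell p0 r -> exists2 eps : R, 0 < eps &
 forall n (p : 'I_n -> V) (S : pred 'I_n), (forall i, S i -> cell p0 r (p i)) ->
 (volume p S eps <= (theta * r ^+ Q)%:E)%E.

Let mX j p : mfun (X j p). exact: mfun_ratio_field. Qed.

Lemma good_le theta theta' : theta <= theta' -> good theta -> good theta'.
move=> tt h p0 r sub; have [e e0 he] := h p0 r sub; exists e => // n p S hS.
apply: (le_trans (he n p S hS)); rewrite lee_fin ler_wpM2r //.
by have [rp _ _ _ _] := sub; rewrite exprn_ge0 // ltW.
Qed.

(** With eps = sc r the neighbourhood lies in a box whose side is a random multiple of sc r, and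
    [scD] makes its D-th power a multiple of r^Q. *)
Lemma good_initial : good (moment_bound D 1 C).
move=> p0 r sub; have [rp _ _ _ _] := sub; have s0 := sc0 rp.
exists (sc r) => // n p S hS; have [Rv [mRv R0 RC hR]] := osc sub hS.
apply: (@le_trans _ _ (\int[P]_w (r ^+ Q * (2 * (1 + Rv w)) ^+ D)%:E)%E).
 apply: int1_le.
 - exact: mfun_hits.
 - by [].
 - by apply: mfunM => //; apply: mfunX; apply: mfunM => //; exact: mfunD.
 move=> w; have -> : r ^+ Q * (2 * (1 + Rv w)) ^+ D = (2 * (sc r * (1 + Rv w))) ^+ D.
  by rewrite -scD // -exprMn; congr (_ ^+ _); ring.
 apply: (@box_le _ _ _ (fun j => X j p0 w)).
 - by rewrite mulr_ge0 ?(ltW s0) // addr_ge0.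
 - have m : mfun (fun y : vec => (w, y)) by exact: mfun_pair.
  exact: (mcomp (mfun_hits mX p S (sc r)) m).
 move=> y /existsP[i /andP[Si /forallP h]] j; have hj := h j; rewrite /= mul0r addr0 in hj.
 have -> : tnth y j - X j p0 w = (X j (p i) w - X j p0 w) - (X j (p i) w - tnth y j) by ring.
 apply: (le_lt_trans (ler_normB _ _)); rewrite mulrDr mulr1 addrC.
 by apply: ltr_leD => //; exact: hR.
rewrite nn_intZ; [|by apply: mfunX; apply: mfunM => //; exact: mfunD|by move=> w; rewrite exprn_ge0 // mulr_ge0 // addr_ge0|by rewrite exprn_ge0 // ltW].
rewrite [X in (_ <= X%:E)%E]mulrC [leRHS]EFinM; apply: lee_wpmul2l; first by rewrite lee_fin exprn_ge0 // ltW.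
by apply: moment_le => //; rewrite leq_pmull.
Qed.

Variables (wc B0 : R).
Hypotheses (wc0 : 0 < wc) (B00 : 0 < B0).
(** The outcome of [local_resampling], with both variance bounds reduced to constants wc and B0
    common to all cells. *)
Definition resampling_property := forall (n : nat) (p0 : V) (r a1 a2 l : R) (p : 'I_n -> V) (i0 : 'I_n),
 0 < r -> 0 < l -> 0 <= p0.1 -> p0.1 <= a1 -> a1 <= a2 ->
 (forall i, cell p0 r (p i)) ->
 (forall i, (p i).1 <= a1 \/ a1 + l * r ^+ 2 <= (p i).1) ->
 (forall i, (p i).1 <= a2 \/ a2 + l * r ^+ 2 <= (p i).1) ->
 a1 + l * r ^+ 2 <= (p i0).1 <= a2 ->
 exists (eta : 'I_D -> T -> R) (tau : R),
 [/\ forall j, mfun (eta j), 0 < tau, l / wc <= c * tau ^+ 2,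
   c * tau ^+ 2 <= B0 &
   resamples (fun i => sc r * (caloric_at p0 r (p i) / hst (p i))) P
    (fun j i w => X j (p i) w)
    (fun i => a1 + l * r ^+ 2 <= (p i).1 <= a2) eta (npdf tau)].
Hypothesis local_rs : resampling_property.

Lemma resampled_tail n (p : 'I_n -> V) g w eta tau (K : R) : 0 < K -> 0 < tau -> c * tau ^+ 2 <= B0 ->
 resamples g P (fun j i w => X j (p i) w) w eta (npdf tau) ->
 (\int[P]_u' ((~~ inbox K (eta ^~ u'))%:R)%:E <= (D%:R * (B0 / K ^+ 2))%:E)%E.
move=> K0 tau0 hB rs.
have mH : measurable_conf (fun (_ : 'I_D -> 'I_n -> R) e => ((~~ inbox K e)%:R : R)).
 move=> d' U Y e mY me; have e' b : ((~~ b)%:R : R) = 1 - b%:R by case: b; rewrite ?subrr ?subr0.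
 by under eq_fun do rewrite e'; apply: mfunB => //; exact: mfun_inbox.
rewrite (rs _ mH); last by [].
have e : (\int[lam]_x (npdf tau x * (~~ inbox K (tnth x))%:R)%:E <= (D%:R * (B0 / K ^+ 2))%:E)%E.
 exact: npdf_tail.
set I := (\int[lam]_x _)%E in e *.
have -> : (\int[P]__ I = I)%E.
 have I0 : (0 <= I)%E by apply: nn_int_ge0 => x; rewrite mulr_ge0 // npdf_ge0.
 by rewrite integral_cst // -[RHS]mule1; congr (_ * _)%E; exact: probability_setT.
exact: e.
Qed.

Lemma hits_ext n (p p' : 'I_n -> V) (S : pred 'I_n) eps y : (forall i, S i -> p i = p' i) ->
 hits p S eps y = hits p' S eps y.
by move=> h; apply: eq_existsb => i; case: (boolP (S i)) => //= Si; apply: eq_forallb => j; rewrite h.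
Qed.

Lemma volume_ext n (p p' : 'I_n -> V) (S : pred 'I_n) eps : (forall i, S i -> p i = p' i) ->
 volume p S eps = volume p' S eps.
by move=> h; apply: eq_integral => y _; rewrite (hits_ext eps y h). Qed.

Section cell_inequality.
Variables (n n0 m : nat) (p0 : V) (r : R) (p : 'I_n -> V) (SS : 'I_n0 -> pred 'I_n) (a : 'I_n0 -> nat).
Variables (pc : 'I_n0 -> V) (eps : R).
Hypotheses (sub : subcell p0 r) (m0 : (0 < m)%N) (subc : forall s, subcell (pc s) (r / m%:R)).
Notation x := (r ^+ 2 / m%:R ^+ 2).
Definition time_slot (s : 'I_n0) (q : V) := p0.1 + x * (a s)%:R <= q.1 <= p0.1 + x * (a s)%:R + x.
Hypotheses (pcell : forall i, cell p0 r (p i)) (pslot : forall i, exists s, time_slot s (p i))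
 (SSslot : forall s i, SS s i -> time_slot s (p i))
 (SScell : forall s i, SS s i -> cell (pc s) (r / m%:R) (p i)) (SSn0 : forall s, exists i, SS s i)
 (aspace : forall s s', s != s' -> ((a s + 2 <= a s') || (a s' + 2 <= a s))%N)
 (ahalf : forall s, (m ^ 2 <= 2 * a s)%N) (pcc : forall s, cell p0 r (pc s)) (eps0 : 0 < eps)
 (eps1 : eps <= sc (r / m%:R)).

Variables (K h K1 K2 del0 del1 del2 q e0 e1 e2 th : R).
Notation Lg := `|ratio_lip P0 r0|.
Notation g2 := (expR (weight_bound P0 r0)).
Notation g1 := (ratio_min (R := R) k).
Notation mom1 := (moment_bound D (1 + K * Lg) C).
Notation mom0 := (moment_bound D (1 + g2 * K) C).
Hypotheses (h0 : 0 < h) (KE : K = h + h) (K10 : 0 < K1) (K20 : 0 < K2) (del00 : 0 < del0) (del10 : 0 < del1)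
 (del20 : 0 < del2) (q0 : 0 < q) (e10 : 0 <= e1) (e20 : 0 <= e2) (th0 : 0 <= th)
 (tail_half : D%:R * (B0 / h ^+ 2) <= 2^-1)
 (tail0 : del0 * moment_bound D 1 C + D%:R * (B0 / h ^+ 2) / del0 <= q / 2)
 (tail1 : del1 * mom1 + D%:R * (B0 / K1 ^+ 2) / del1 <= e1)
 (tail2 : del2 * mom1 + D%:R * (B0 / K2 ^+ 2) / del2 <= e2).
Notation muc := ((r / m%:R) ^+ Q).
Hypothesis vol_ge : forall s, ((q * muc)%:E <= volume p (SS s) eps)%E.
Hypothesis pair_le : forall s s', s != s' ->
 (\int[M]_y ((hits p (SS s) eps y)%:R * (hits p (SS s') eps y)%:R)%:E <= th%:E)%E.
Notation CK := ((2 * (K + 1)) ^+ D).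
Notation nmax := (npdf_sup D (2^-1 / wc)).
Notation al := ((m%:R ^+ 2)^-1 / wc).
Notation nmin1 := (npdf_inf D al B0 (K1 + K)).
Notation nmin2 := (npdf_inf D al B0 (K2 + K)).

(** An instance of [core_inequality]. The resampling common to all slots is switched on during the
    first half of the cell (l = 1/2), whence slot indices of at least m^2 / 2. Each slot has its own
    window of length r^2 / m^2 between two switching intervals of that length, whence slots at least
    two indices apart. *)
Lemma cell_inequality : (0 < n0)%N ->
 (n0%:R * (q * muc / (4 * nmax))) ^+ 2 <=
 (mom0 * r ^+ Q) * (n0%:R * (CK / (sc r * g1) ^+ D * (mom1 * muc ^+ 2)) +
  n0%:R ^+ 2 * (nmin1^-1 * (nmin2^-1 * th + CK * (e2 * muc)) + CK * (CK * (e1 * muc)))).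
move=> n00; have [rp rr hp1 hp2 hp3] := sub.
have mR : 0 < m%:R :> R by rewrite ltr0n.
have m1 : 1 <= m%:R :> R by rewrite ler1n.
have m2 : 0 < m%:R ^+ 2 :> R by rewrite exprn_gt0.
have r2 : 0 < r ^+ 2 by rewrite exprn_gt0.
have x0 : 0 < x by rewrite divr_gt0.
have p00 : 0 <= p0.1 by apply: le_trans hp1.
have rm0 : 0 < r / m%:R by rewrite divr_gt0.
have scm := sc0 rm0; have scr := sc0 rp.
have K0 : 0 < K by rewrite KE addr_gt0.
have rE : r ^+ 2 = x * (m ^ 2)%:R by rewrite natrX divfK ?gt_eqF.
have xle (b b' : nat) : (b <= b')%N -> x * b%:R <= x * b'%:R by move=> bb; rewrite ler_pM2l // ler_nat.
have space s s' q' : s != s' -> time_slot s' q' ->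
  q'.1 <= p0.1 + x * (a s)%:R - x \/ p0.1 + x * (a s)%:R + x + x <= q'.1.
 move=> ss /andP[t1 t2]; case/orP: (aspace ss) => /xle; rewrite natrD mulrDr => hx; [right|left]; lra.
have g1p : 0 < g1 by exact: expR_gt0.
have s_ : 'I_n0 := Ordinal n00.
pose g i := sc r * (caloric_at p0 r (p i) / hst (p i)).
have hbig i : p0.1 + 2^-1 * r ^+ 2 <= (p i).1.
 have [s /andP[t1 t2]] := pslot i; apply: le_trans t1; rewrite lerD2l.
 have := xle _ _ (ahalf s); rewrite -rE natrM mulrCA.
 by move: (x * (a s)%:R) (r ^+ 2) => xa ra; lra.
have hbig2 i : (p i).1 <= p0.1 + r ^+ 2 by have [/andP[]] := pcell i.
have [i_ _] := SSn0 s_.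
have [eta0 [tau0 [meta0 tau00 lo0 hi0 rs0]]] := @local_rs n p0 r p0.1 (p0.1 + r ^+ 2) 2^-1 p i_ rp
 (ltac:(lra)) p00 (lexx _) (ltac:(lra)) pcell (fun i => or_intror (hbig i)) (fun i => or_introl (hbig2 i))
 (introT andP (conj (hbig i_) (hbig2 i_))).
have small s : exists et : ('I_D -> T -> R) * R,
 [/\ forall j, mfun (et.1 j), 0 < et.2, al <= c * et.2 ^+ 2, c * et.2 ^+ 2 <= B0 &
   resamples g P (fun j i w => X j (p i) w) (fun i => time_slot s (p i)) et.1 (npdf et.2)].
 have [i1 Si1] := SSn0 s.
 have lE : (m%:R ^+ 2)^-1 * r ^+ 2 = x by rewrite mulrC.
 pose a1 := p0.1 + x * (a s)%:R - x; pose a2 := p0.1 + x * (a s)%:R + x.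
 have a1E : a1 + (m%:R ^+ 2)^-1 * r ^+ 2 = p0.1 + x * (a s)%:R by rewrite lE /a1 subrK.
 have ge1 : p0.1 <= a1.
  have : x * 1%:R <= x * (a s)%:R.
   apply: xle; have := ahalf s; have : (0 < m ^ 2)%N by rewrite expn_gt0 m0.
   by case: (a s) => //; rewrite muln0 leqn0 => /lt0n_neq0 /negbTE ->.
  by rewrite /a1; lra.
 have l12 : a1 <= a2 by rewrite /a1 /a2; lra.
 have gap i : (p i).1 <= a1 \/ a1 + (m%:R ^+ 2)^-1 * r ^+ 2 <= (p i).1.
  have [s' hs'] := pslot i; rewrite a1E; have [ss|ss] := eqVneq s s'.
   by right; rewrite ss; case/andP: hs'.
  by case: (space _ _ _ ss hs') => hh; [left|right; lra].
 have gap2 i : (p i).1 <= a2 \/ a2 + (m%:R ^+ 2)^-1 * r ^+ 2 <= (p i).1.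
  have [s' hs'] := pslot i; rewrite lE; have [ss|ss] := eqVneq s s'.
   by left; rewrite /a2 ss; case/andP: hs'.
  by case: (space _ _ _ ss hs') => hh; [left; rewrite /a2; lra|right].
 have wi : a1 + (m%:R ^+ 2)^-1 * r ^+ 2 <= (p i1).1 <= a2 by rewrite a1E; exact: SSslot.
 have l0 : 0 < (m%:R ^+ 2)^-1 :> R by rewrite invr_gt0.
 have [eta [tau [h1 h2 h3 h4 h5]]] := local_rs rp l0 p00 ge1 l12 pcell gap gap2 wi.
 have wE : (fun i => time_slot s (p i)) = (fun i => a1 + (m%:R ^+ 2)^-1 * r ^+ 2 <= (p i).1 <= a2).
  by apply/funext => i; rewrite a1E.
 by exists (eta, tau); rewrite wE; exact: And5 h1 h2 h3 h4 h5.
have [et het] := choice small.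
have disj s s' i : s != s' -> SS s' i -> ~~ time_slot s (p i).
 move=> ss /SSslot hs'; apply/negP => /andP[t1 t2].
 by case: (space _ _ _ ss hs'); lra.
have [Rs hRs] := choice (fun s => osc (subc s) (@SScell s)).
have mRs s : mfun (Rs s) by have [] := hRs s.
have Rs0 s w : 0 <= Rs s w by have [] := hRs s.
have RsC s : (\int[P]_w (Rs s w ^+ N)%:E <= C%:E)%E by have [] := hRs s.
have [R_ [mR_ R_0 R_C hR_]] := osc sub (S := fun _ => true) (fun i _ => pcell i).
have KL0 : 0 <= 1 + K * Lg by rewrite addr_ge0 // mulr_ge0 // ltW.
have gK0 : 0 <= 1 + g2 * K by rewrite addr_ge0 // mulr_ge0 ?expR_ge0 // ltW.
(* In rad, the term 1 accounts for eps, [K * Lg] for the non-rigidity of the shift on a sub-cell and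
   Rs for the oscillation. In radz there is no shift, and in rad00, for the whole cell, the shift
   itself has size at most g2 K. *)
pose rad s w := sc (r / m%:R) * (1 + K * Lg + Rs s w).
pose radz s w := sc (r / m%:R) * (1 + Rs s w).
pose rad00 w := sc r * (1 + g2 * K + R_ w).
have powE (y b : R) : 0 < y -> (2 * (sc y * b)) ^+ D = y ^+ Q * (2 * b) ^+ D.
 by move=> y0; rewrite -scD // -exprMn; congr (_ ^+ _); ring.
pose G s := caloric_at p0 r (pc s) / hst (pc s).
have Grange i : g1 <= caloric_at p0 r (p i) / hst (p i) <= g2.
 exact: (ratio_range t00 r00 rp (pcell i) (subcell_cell sub (pcell i))).
have GcR s : g1 <= G s <= g2.
 exact: (ratio_range t00 r00 rp (pcc s) (subcell_cell sub (pcc s))).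
have eps2 : eps <= sc r.
 apply: (le_trans eps1); apply: (scale_mono D0 sc0 scD) => //.
 by rewrite ler_pdivrMr // ler_peMr // ltW.
have mradd (cc y : R) (f : T -> R) : mfun f -> mfun (fun w => y * (cc + f w)).
 by move=> mf; apply: mfunM => //; exact: mfunD.
have muc0 : 0 < muc by rewrite exprn_gt0.
have rQ0 : 0 < r ^+ Q by rewrite exprn_gt0.
have wtail s (cc : R) (eta : 'I_D -> T -> R) (KK del ee : R) : 0 <= cc -> 0 < del -> (forall j, mfun (eta j)) ->
  (\int[P]_w ((~~ inbox KK (eta ^~ w))%:R)%:E <= (D%:R * (B0 / KK ^+ 2))%:E)%E ->
  del * moment_bound D cc C + D%:R * (B0 / KK ^+ 2) / del <= ee ->
  (\int[P]_w ((2 * (sc (r / m%:R) * (cc + Rs s w))) ^+ D * (~~ inbox KK (eta ^~ w))%:R)%:E <= (ee * muc)%:E)%E.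
 move=> cc0 del0' meta ht hee.
 have mb : mfun (fun w => ((~~ inbox KK (eta ^~ w))%:R : R)).
  have e' b : ((~~ b)%:R : R) = 1 - b%:R by case: b; rewrite ?subrr ?subr0.
  by under eq_fun do rewrite e'; apply: mfunB => //; exact: mfun_inbox.
 have wm := weighted_moment_le (mRs s) (Rs0 s) (RsC s) cc0 del0' mb ht.
 under eq_integral do rewrite powE // -mulrA.
 rewrite nn_intZ; [|by apply: mfunM => //; apply: mfunX; exact: mradd|by move=> w; rewrite mulr_ge0 // exprn_ge0 // mulr_ge0 // addr_ge0|exact: ltW].
 rewrite [X in (_ <= X%:E)%E]mulrC [leRHS]EFinM; apply: lee_wpmul2l; first by rewrite lee_fin ltW.
 by apply: (le_trans wm); rewrite lee_fin.
apply: (@core_inequality _ _ _ P D n n0 g eps (fun j i w => X j (p i) w) (fun j i => mX j (p i)) SS K h (ltW h0) KE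
 (fun s j w => X j (pc s) w) (sc r * g1) rad _ _ _ (fun s => sc r * G s) _ _ radz _ _ _
 (fun i => p0.1 + 2^-1 * r ^+ 2 <= (p i).1 <= p0.1 + r ^+ 2) eta0 (npdf tau0) nmax meta0 (@mfun_npdf R D tau0)
 (@npdf_ge0 R D tau0) rs0 _ _ _ _ (fun s i => time_slot s (p i)) (fun s => (et s).1) (fun s => npdf (et s).2)
 K1 nmin1 K2 nmin2 _ _ _ _ _ _ _ (ltW K10) _ _ (ltW K20) _ _ q muc th (e1 * muc) (e2 * muc) mom1 (mom0 * r ^+ Q)
 q0 muc0 _ _ th0 _ _ _ _ _ _ (fun j w => X j p0 w) rad00).
- exact: mulr_gt0.
- by move=> s; exact: mradd.
- by move=> s w; rewrite mulr_ge0 ?(ltW scm) // addr_ge0.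
- by move=> s; rewrite ler_pM2l //; have /andP[] := GcR s.
- move=> s w y v hv /existsP[i /andP[Si /forallP hh]] j.
 have [/andP[b1 b2] bx] := SScell Si.
 have nr : near_points (r / m%:R) (p i) (pc s).
  by split => [|i']; [|have /andP[b3 b4] := bx i']; rewrite ger0_norm; lra.
 have lip := ratio_lipschitz t00 r00 sub m1 (pcell i) (pcc s) nr.
 have [_ _ _ hRs'] := hRs s; have o := hRs' i j w Si.
 have vK : `|v j| <= K by move/forallP: hv; apply.
 have -> : y j - (X j (pc s) w + sc r * G s * v j) =
  (X j (p i) w - X j (pc s) w) + (g i - sc r * G s) * v j - (X j (p i) w - y j + g i * v j) by ring.
 apply: (le_lt_trans (ler_normB _ _)); rewrite /rad.
 have -> : sc (r / m%:R) * (1 + K * Lg + Rs s w) = sc (r / m%:R) * Rs s w + sc (r / m%:R) * (Lg * K) + sc (r / m%:R) by ring.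
 apply: ler_ltD; last exact: (lt_le_trans (hh j) eps1).
 apply: (le_trans (ler_normD _ _)); apply: lerD => //.
 rewrite /g -mulrBr [leLHS]normrM [X in X * _ <= _]normrM (gtr0_norm scr) -mulrA.
 apply: (@le_trans _ _ (sc r * (Lg / m%:R * K))).
  rewrite ler_wpM2l ?(ltW scr) // ler_pM //; apply: (le_trans lip).
  by rewrite ler_wpM2r ?invr_ge0 ?(ltW mR) // ler_norm.
 have -> : sc r * (Lg / m%:R * K) = sc r / m%:R * (Lg * K) by ring.
 by rewrite ler_wpM2r ?mulr_ge0 ?(ltW K0) //; exact: (scale_div D0 sc0 scD DQ).
- by move=> s; exact: mradd.
- by move=> s w; rewrite mulr_ge0 ?(ltW scm) // addr_ge0.
- move=> s w y /existsP[i /andP[Si /forallP hh]] j.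
 have [_ _ _ hRs'] := hRs s; have o := hRs' i j w Si.
 have -> : y j - X j (pc s) w = (X j (p i) w - X j (pc s) w) - (X j (p i) w - y j + g i * 0) by ring.
 apply: (le_lt_trans (ler_normB _ _)); rewrite /radz mulrDr mulr1 addrC.
 by apply: ltr_leD => //; exact: (lt_le_trans (hh j) eps1).
- by move=> s i _; rewrite hbig hbig2.
- by apply: npdf_sup_gt0; rewrite divr_gt0.
- by move=> y; apply: npdf_le => //; rewrite divr_gt0.
- by apply: (npdf_half tau00 hi0).
- by move=> s; have [] := het s.
- by move=> s; exact: mfun_npdf.
- by move=> s y; exact: npdf_ge0.
- by move=> s; rewrite integral_npdf.
- by move=> s; have [] := het s.
- exact: SSslot.
- exact: disj.
- exact: npdf_inf_gt0.
- by move=> s y; have [_ h1 h2 h3 _] := het s; apply: npdf_ge => //; rewrite divr_gt0 // invr_gt0.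
- exact: npdf_inf_gt0.
- by move=> s y; have [_ h1 h2 h3 _] := het s; apply: npdf_ge => //; rewrite divr_gt0 // invr_gt0.
- by rewrite mulr_ge0 // ltW.
- by rewrite mulr_ge0 // ltW.
- by move=> s; apply: (le_trans (vol_ge s)); under [leRHS]eq_integral do rewrite hit0E; exact: lexx.
- move=> s s' ss; under eq_integral do rewrite !(hit0E g); exact: pair_le ss.
- move=> s; have -> : q * muc / 2 = q / 2 * muc by ring.
 apply: (wtail s 1 eta0 h del0 (q / 2)) => //.
 exact: (resampled_tail h0 tau00 hi0 rs0).
- move=> s s'; have [h1 h2 h3 h4 h5] := het s'.
 by apply: (wtail s (1 + K * Lg) (et s').1 K1 del1 e1) => //; exact: (resampled_tail K10 h2 h4 h5).
- move=> s s'; have [h1 h2 h3 h4 h5] := het s'.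
 by apply: (wtail s (1 + K * Lg) (et s').1 K2 del2 e2) => //; exact: (resampled_tail K20 h2 h4 h5).
- move=> s; under eq_integral do rewrite powE // exprMn -[((2 * _) ^+ D) ^+ 2]exprM.
 have mm2 : 0 <= muc ^+ 2 by exact: sqr_ge0.
 rewrite nn_intZ; [|by apply: mfunX; apply: mfunM => //; exact: mfunD|by move=> w; rewrite exprn_ge0 // mulr_ge0 // addr_ge0|exact: mm2].
 rewrite [X in (_ <= X%:E)%E]mulrC [leRHS]EFinM; apply: lee_wpmul2l; first by rewrite lee_fin.
 by apply: moment_le => //; rewrite mulnC leq_mul2r orbT.
- by move=> j; exact: mX.
- exact: mradd.
- by move=> w; rewrite mulr_ge0 ?(ltW scr) // addr_ge0.
- move=> s w y v hv /existsP[i /andP[Si /forallP hh]] j.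
 have o := hR_ i j w isT; have vK : `|v j| <= K by move/forallP: hv; apply.
 have -> : y j - X j p0 w = (X j (p i) w - X j p0 w) + g i * v j - (X j (p i) w - y j + g i * v j) by ring.
 apply: (le_lt_trans (ler_normB _ _)); rewrite /rad00.
 have -> : sc r * (1 + g2 * K + R_ w) = sc r * R_ w + sc r * (g2 * K) + sc r by ring.
 apply: ler_ltD; last exact: (lt_le_trans (hh j) eps2).
 apply: (le_trans (ler_normD _ _)); apply: lerD => //.
 rewrite /g [leLHS]normrM [X in X * _ <= _]normrM (gtr0_norm scr) -mulrA ler_wpM2l ?(ltW scr) //.
 have /andP[G1 G2] := Grange i; rewrite ger0_norm; last exact: le_trans (ltW g1p) G1.
 exact: ler_pM (le_trans (ltW g1p) G1) (normr_ge0 _) G2 vK.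
- by rewrite mulr_gt0 // (lt_le_trans ltr01) // moment_bound_ge1.
- under eq_integral do rewrite powE //.
 rewrite nn_intZ; [|by apply: mfunX; apply: mfunM => //; exact: mfunD|by move=> w; rewrite exprn_ge0 // mulr_ge0 // addr_ge0|exact: ltW].
 rewrite [X in (_ <= X%:E)%E]mulrC [leRHS]EFinM; apply: lee_wpmul2l; first by rewrite lee_fin ltW.
 by apply: moment_le => //; rewrite leq_pmull.
Qed.

End cell_inequality.

End good_cells.

(** Slot s receives the time index 2 n0^2 + 2s + 1 among 4 n0^2. This and the next two lemmas say
    that the slots fit, are two apart and lie in the second half. *)
Lemma slot_lt (n0 s : nat) : (s < n0)%N -> (2 * (n0 * n0) + 2 * s + 1 < 4 * (n0 * n0))%N.
by move=> sn; have : (n0 <= n0 * n0)%N by [rewrite leq_pmull //; case: n0 sn]; lia. Qed.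

Lemma slot_gap (b s s' : nat) : s <> s' -> ((b + 2 * s + 1 + 2 <= b + 2 * s' + 1) || (b + 2 * s' + 1 + 2 <= b + 2 * s + 1))%N.
lia. Qed.

Lemma slot_half (b s : nat) : (4 * b <= 2 * (2 * b + 2 * s + 1))%N.
lia. Qed.

(** * Choice of constants *)

Section arithmetic.
Context {R : realType}.

(** The reciprocal of the sum of all reciprocals lies below every term. *)
Lemma exists_lower (I : finType) (f : I -> R) (b : R) : 0 < b -> (forall i, 0 < f i) ->
 exists e : R, [/\ 0 < e, e <= b & forall i, e <= f i].
move=> b0 f0; pose S := b^-1 + \sum_i (f i)^-1.
have bi : 0 < b^-1 by rewrite invr_gt0.
have fi i : 0 <= (f i)^-1 by rewrite invr_ge0 ltW.
have S0 : 0 < S by rewrite ltr_wpDr // sumr_ge0.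
exists S^-1; split; first by rewrite invr_gt0.
 by rewrite -[b]invrK lef_pV2 ?posrE // lerDl sumr_ge0.
move=> i; rewrite -[f i]invrK lef_pV2 ?posrE ?invr_gt0 // /S (bigD1 i) //= addrCA lerDl.
by rewrite addr_ge0 ?(ltW bi) // sumr_ge0.
Qed.

(** del reduces the moment term to e/2, and K then reduces the tail to [e * del / 2], which division
    by del turns into e/2. *)
Lemma tail_choice (D : nat) (A B e : R) : 0 <= A -> 0 < B -> 0 < e ->
 exists del K : R, [/\ 0 < del, 0 < K, D%:R * (B / K ^+ 2) <= 2^-1 &
  del * A + D%:R * (B / K ^+ 2) / del <= e].
move=> A0 B0 e0; pose del := e / (2 * (A + 1)).
have A1 : 0 < A + 1 by lra.
have d0 : 0 < del by rewrite divr_gt0 // mulr_gt0.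
pose tau := Num.min (e * del / 2) 2^-1.
have t0 : 0 < tau by rewrite lt_min invr_gt0 ltr0n andbT divr_gt0 // mulr_gt0.
pose K := 1 + D%:R * B / tau.
have x0 : 0 <= D%:R * B / tau by rewrite !mulr_ge0 ?invr_ge0 // ltW.
have K1 : 1 <= K by rewrite lerDl.
have K0 : 0 < K by apply: lt_le_trans K1.
have hK : D%:R * (B / K ^+ 2) <= tau.
 rewrite mulrA ler_pdivrMr ?exprn_gt0 // [leRHS]mulrC -ler_pdivrMr //.
 apply: (@le_trans _ _ K); first by rewrite lerDr.
 by rewrite expr2 ler_peMr // ltW.
exists del, K; split => //; first by apply: (le_trans hK); rewrite ge_min lexx orbT.
have h1 : del * A <= e / 2.
 rewrite /del -mulrA ler_pdivlMr // mulrAC -mulrA ler_piMr ?(ltW e0) //.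
 have -> : 2 * ((2 * (A + 1))^-1 * A) = A / (A + 1) by field; rewrite gt_eqF.
 by rewrite ler_pdivrMr // mul1r lerDl.
have h2 : D%:R * (B / K ^+ 2) / del <= e / 2.
 rewrite ler_pdivrMr //; apply: (le_trans hK); rewrite /tau ge_min.
 by apply/orP; left; rewrite mulrAC.
by lra.
Qed.

(** The off-diagonal part uses at most half of the left side, and the diagonal part is linear in n0
    while the left side is quadratic. The factor muc^2 cancels, so the contradiction is independent
    of r. *)
Lemma final_arith (n0 qn mom0 CK g1D mom1 muc mQ E2 : R) : 0 < n0 -> 0 < muc -> 0 < mQ -> 0 < mom0 -> 0 < g1D ->
 (n0 * (qn * muc)) ^+ 2 <= mom0 * (mQ * muc) * (n0 * (CK / (mQ * muc * g1D) * (mom1 * muc ^+ 2)) + n0 ^+ 2 * E2) ->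
 E2 <= qn ^+ 2 / (2 * mom0 * mQ) * muc -> 2 * (mom0 * CK * mom1 / g1D) < n0 * qn ^+ 2 -> False.
move=> n00 mu0 mQ0 m00 g0 H HE Hn.
have m2 : 0 < muc ^+ 2 by rewrite exprn_gt0.
have h1 : mom0 * (mQ * muc) * (n0 ^+ 2 * E2) <= n0 ^+ 2 * (qn ^+ 2 / 2) * muc ^+ 2.
 apply: (@le_trans _ _ (mom0 * (mQ * muc) * (n0 ^+ 2 * (qn ^+ 2 / (2 * mom0 * mQ) * muc)))).
  by rewrite ler_wpM2l ?mulr_ge0 ?(ltW m00) ?(ltW mQ0) ?(ltW mu0) // ler_wpM2l // sqr_ge0.
 by rewrite le_eqVlt; apply/orP; left; apply/eqP; field; rewrite !gt_eqF.
have h2 : mom0 * (mQ * muc) * (n0 * (CK / (mQ * muc * g1D) * (mom1 * muc ^+ 2))) = n0 * (mom0 * CK * mom1 / g1D) * muc ^+ 2.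
 by field; rewrite !gt_eqF.
move: H; rewrite mulrDr h2 => H.
have : n0 ^+ 2 * qn ^+ 2 * muc ^+ 2 <= (n0 * (mom0 * CK * mom1 / g1D) + n0 ^+ 2 * (qn ^+ 2 / 2)) * muc ^+ 2.
 rewrite mulrDl; apply: le_trans (lerD (lexx _) h1); apply: le_trans H.
 by rewrite !exprMn mulrA.
rewrite ler_pM2r //; move: Hn; move: (mom0 * CK * mom1 / g1D) => kk Hn.
have -> : n0 ^+ 2 * qn ^+ 2 = n0 * (n0 * qn ^+ 2) by ring.
have -> : n0 * kk + n0 ^+ 2 * (qn ^+ 2 / 2) = n0 * (kk + n0 * qn ^+ 2 / 2) by ring.
rewrite ler_pM2l //; move: Hn; move: (n0 * qn ^+ 2) => y; lra.
Qed.

End arithmetic.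

(** * Self-improvement of good constants *)

Section improvement.
Context d (T : measurableType d) {R : realType} (P : probability T R) (k D : nat).
Notation V := (R * 'rV[R]_k)%type.
Notation Q := k.+2.
Variables (u : 'I_D -> V -> T -> R) (P0 : V) (r0 : R) (z : 'I_D -> R) (sc : R -> R).
Hypotheses (mu : forall j p, mfun (u j p)) (t00 : 0 <= P0.1) (r00 : 0 < r0) (sc0 : forall r, 0 < r -> 0 < sc r)
 (scD : forall r, 0 < r -> sc r ^+ D = r ^+ Q) (D0 : (0 < D)%N) (DQ : (Q <= D)%N).
Notation X := (ratio_field u z).
Notation volume := (mean_volume P X).
Notation hits := (hits X).
Notation M := (P \x lebesgue_tuple R D)%E.
Notation good := (good P u P0 r0 z).
Variable C : R.
Hypotheses (C0 : 0 <= C) (osc : oscillates P u P0 r0 z sc C).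
Variables (wc B0 : R).
Hypotheses (wc0 : 0 < wc) (B00 : 0 < B0) (local_rs : resampling_property P u z sc wc B0).

Let mX j p : mfun (X j p). exact: mfun_ratio_field. Qed.

(** If q + e is good while some cell violates q - e, each of its m^Q sub-cells has volume at most (q
    + e) muc and their union more than (q - e) m^Q muc. Hence each has at least (q/2) muc and any
    two overlap by at most 2 e r^Q, against [cell_inequality] on n0 of them. The order of choices is
    essential: h, then n0 and m, then K1 and nmin1, then K2 and nmin2, and e last, since it must be
    small against all of them. *)
Lemma improvement (q : R) : 0 < q -> exists2 e : R, 0 < e & (good (q + e) -> good (q - e)).
move=> q0; pose g1 : R := ratio_min (R := R) k; pose g2 := expR (weight_bound P0 r0); pose Lg := `|ratio_lip P0 r0|.
have g10 : 0 < g1 by exact: expR_gt0.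
have Lg0 : 0 <= Lg by exact: normr_ge0.
have g20 : 0 <= g2 by exact: expR_ge0.
have mb1 := moment_bound_ge1 D ler01 C0.
have q2 : 0 < q / 2 by rewrite divr_gt0.
have q4 : 0 < q / 2 / 2 by rewrite divr_gt0.
have [del0 [h [del00 h0 half tail0]]] := tail_choice D (le_trans ler01 mb1) B00 q4.
pose K := h + h; have K0 : 0 < K by rewrite addr_gt0.
have KL0 : 0 <= 1 + K * Lg by rewrite addr_ge0 // mulr_ge0 // ltW.
have gK0 : 0 <= 1 + g2 * K by rewrite addr_ge0 // mulr_ge0 // ltW.
pose mom1 := moment_bound D (1 + K * Lg) C; pose mom0 := moment_bound D (1 + g2 * K) C.
have mom11 : 1 <= mom1 by exact: moment_bound_ge1.
have mom01 : 1 <= mom0 by exact: moment_bound_ge1.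
have mom00 : 0 < mom0 by apply: lt_le_trans mom01.
pose CK : R := (2 * (K + 1)) ^+ D.
have CK0 : 0 < CK by rewrite exprn_gt0 // mulr_gt0 // addr_gt0.
pose nmax : R := npdf_sup D (2^-1 / wc).
have nmax0 : 0 < nmax by apply: npdf_sup_gt0; rewrite divr_gt0.
pose qn := q / 2 / (4 * nmax); have qn0 : 0 < qn by rewrite divr_gt0 // mulr_gt0.
have qn2 : 0 < qn ^+ 2 by rewrite exprn_gt0.
have g1D : 0 < g1 ^+ D by rewrite exprn_gt0.
pose n0 := (Num.truncn (2 * (mom0 * CK * mom1 / g1 ^+ D) / qn ^+ 2)).+1.
have n00 : (0 < n0)%N by [].
have hn0 : 2 * (mom0 * CK * mom1 / g1 ^+ D) < n0%:R * qn ^+ 2 by rewrite -ltr_pdivrMr //; exact: truncnS_gt.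
(* The m^2 = 4 n0^2 time layers leave room in the second half for n0 slots two apart. *)
clearbody n0; pose m := (2 * n0)%N; have m0 : (0 < m)%N by rewrite muln_gt0.
have m2E : (m ^ 2 = 4 * (n0 * n0))%N by rewrite /m expnMn -mulnn.
have mR : 0 < m%:R :> R by rewrite ltr0n.
pose mQ : R := m%:R ^+ Q; have mQ0 : 0 < mQ by rewrite exprn_gt0.
pose tau := qn ^+ 2 / (2 * mom0 * mQ).
have tau0 : 0 < tau by apply: divr_gt0 => //; do 2! (apply: mulr_gt0 => //).
pose al : R := (m%:R ^+ 2)^-1 / wc.
pose e1 := tau / (3 * CK ^+ 2).
have e10 : 0 < e1 by rewrite divr_gt0 // mulr_gt0 // exprn_gt0.
have [del1 [K1 [del10 K10 _ tail1]]] := tail_choice D (le_trans ler01 mom11) B00 e10.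
pose nmin1 : R := npdf_inf D al B0 (K1 + K); have nmin10 : 0 < nmin1 by exact: npdf_inf_gt0.
pose e2 := tau * nmin1 / (3 * CK).
have e20 : 0 < e2 by apply: divr_gt0; exact: mulr_gt0.
have [del2 [K2 [del20 K20 _ tail2]]] := tail_choice D (le_trans ler01 mom11) B00 e20.
pose nmin2 : R := npdf_inf D al B0 (K2 + K); have nmin20 : 0 < nmin2 by exact: npdf_inf_gt0.
(* The first bound makes an overlap 2 e r^Q, divided by both density minima, at most a third of the
   budget tau; the second guarantees every sub-cell the volume (q/2) muc. *)
pose e := Num.min (tau * nmin1 * nmin2 / (6 * mQ)) (q / (4 * mQ)).
have e0 : 0 < e.
 rewrite lt_min; apply/andP; split; apply: divr_gt0 => //; try exact: mulr_gt0.
 by do 2! (apply: mulr_gt0 => //).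
have ea : e <= tau * nmin1 * nmin2 / (6 * mQ) by rewrite ge_min lexx.
have eb : e <= q / (4 * mQ) by rewrite ge_min lexx orbT.
exists e => // hG p0 r sub; apply: contrapT => hN.
have [rp rr hp1 hp2 hp3] := sub.
pose I := ('I_(m ^ 2) * {ffun 'I_k -> 'I_m})%type.
have csub (c : I) : subcell P0 r0 (child p0 r c) (r / m%:R) by exact: child_subcell.
have csub' (c : I) : subcell p0 r (child p0 r c) (r / m%:R) by apply: child_subcell.
have rm0 : 0 < r / m%:R by rewrite divr_gt0.
have hep (c : I) : exists ep : R, 0 < ep /\ forall n (p : 'I_n -> V) (S : pred 'I_n),
  (forall i, S i -> cell (child p0 r c) (r / m%:R) (p i)) ->
  (volume p S ep <= ((q + e) * (r / m%:R) ^+ Q)%:E)%E.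
 by have [ep ep0 h'] := hG _ _ (csub c); exists ep.
have [ep hep'] := choice hep.
have [eps [eps0 eps1 epsle]] := exists_lower (sc0 rm0) (fun c => (hep' c).1).
have [n [p [S [hS hV]]]] : exists (n : nat) (p : 'I_n -> V) (S : pred 'I_n),
  (forall i, S i -> cell p0 r (p i)) /\ (((q - e) * r ^+ Q)%:E < volume p S eps)%E.
 apply: contrapT => hno; apply: hN; exists eps => // n p S hS; rewrite leNgt; apply/negP => hlt.
 by apply: hno; exists n, p, S.
set muc := (r / m%:R) ^+ Q; have muc0 : 0 < muc by rewrite exprn_gt0.
have rQE : r ^+ Q = mQ * muc by rewrite /mQ /muc expr_div_n mulrC divfK // gt_eqF.
have p0c : cell p0 r p0 by split => [|i]; rewrite lexx /= lerDl ?sqr_ge0 // ltW.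
have hch i : exists c : I, S i -> cell (child p0 r c) (r / m%:R) (p i).
 case: (boolP (S i)) => [/hS Si|_].
  by have [c hc] := cell_child rp m0 Si; exists c.
 by have [c _] := cell_child rp m0 p0c; exists c.
have [ch hch'] := choice hch.
pose Sc (c : I) : pred 'I_n := fun i => S i && (ch i == c).
have Sccell c i : Sc c i -> cell (child p0 r c) (r / m%:R) (p i).
 by move=> /andP[Si /eqP <-]; exact: hch'.
have volc c : (volume p (Sc c) eps <= ((q + e) * muc)%:E)%E.
 apply: (le_trans (volume_mono P mX p (Sc c) (epsle c))); exact: (hep' c).2 _ _ _ (@Sccell c).
have cI : #|{: I}|%:R = mQ :> R.
 by rewrite card_prod card_ffun !card_ord -expnD /mQ natrX.
have sumI (A : pred I) : (\sum_(c | A c) volume p (Sc c) eps <= (#|A|%:R * ((q + e) * muc))%:E)%E.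
 apply: (@le_trans _ _ (\sum_(c | A c) ((q + e) * muc)%:E)%E); first by apply: lee_sum => c _; exact: volc.
 by rewrite sumEFin sumr_const mulr_natl.
have vlow c : ((q / 2 * muc)%:E <= volume p (Sc c) eps)%E.
 have h1 := volume_split P mX p S eps ch.
 rewrite (bigD1 c) //= in h1.
 have h2 : (\sum_(c' | c' != c) volume p (Sc c') eps <= ((mQ - 1) * ((q + e) * muc))%:E)%E.
  apply: (le_trans (sumI _)); rewrite lee_fin.
  have h3 : #|[pred c' | c' != c]| = #|{: I}|.-1 by exact: cardC1.
  have cpos : (0 < #|{: I}|)%N by apply/card_gt0P; exists c.
  have -> : mQ - 1 = #|[pred c' | c' != c]|%:R by rewrite h3 -cI -{1}(prednK cpos) -natr1 addrK.
  exact: lexx.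
 have : (((q - e) * r ^+ Q)%:E <= volume p (Sc c) eps + ((mQ - 1) * ((q + e) * muc))%:E)%E.
  by apply: (le_trans (ltW hV)); apply: (le_trans h1); exact: leeD2l.
 rewrite -leeBlDr // -EFinB; apply: le_trans; rewrite lee_fin rQE.
 have -> : (q - e) * (mQ * muc) - (mQ - 1) * ((q + e) * muc) = (q + e - 2 * e * mQ) * muc by ring.
 rewrite ler_wpM2r ?(ltW muc0) //.
 have : e * mQ <= q / 4.
  by apply: (le_trans (ler_wpM2r (ltW mQ0) eb)); rewrite le_eqVlt; apply/orP; left; apply/eqP; field; rewrite gt_eqF.
 by have := e0; move: (e * mQ) (mulrA 2 e mQ) => y <-; lra.
have vpair c c' : c != c' ->
  (\int[M]_y ((hits p (Sc c) eps y)%:R * (hits p (Sc c') eps y)%:R)%:E <= (2 * e * r ^+ Q)%:E)%E.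
 move=> cc; have h1 := volume_pair P mX p S eps ch cc.
 have h2 := le_trans h1 (sumI xpredT); rewrite cI in h2.
 have : (\int[M]_y ((hits p (Sc c) eps y)%:R * (hits p (Sc c') eps y)%:R)%:E + ((q - e) * r ^+ Q)%:E <= (mQ * ((q + e) * muc))%:E)%E.
  by apply: le_trans h2; rewrite addeC; apply: leeD2r; exact: ltW.
 rewrite -leeBrDr // -EFinB => h3; apply: (le_trans h3); rewrite lee_fin rQE.
 by rewrite le_eqVlt; apply/orP; left; apply/eqP; ring.
have selP (s : 'I_n0) : (2 * (n0 * n0) + 2 * s + 1 < m ^ 2)%N by rewrite m2E; exact: slot_lt.
pose a (s : 'I_n0) := (2 * (n0 * n0) + 2 * s + 1)%N.
(* The selected sub-cells share the same spatial corner and differ only in time. *)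
pose sel (s : 'I_n0) : I := (Ordinal (selP s), [ffun=> Ordinal m0]).
have sel_inj s s' : s != s' -> sel s != sel s'.
 apply: contra_neq => -[] /eqP; rewrite eqn_add2r eqn_add2l eqn_mul2l /= => /eqP; exact: val_inj.
pose SS s := Sc (sel s).
have SSn0 s : exists i, SS s i.
 apply: contrapT => hno; have := vlow (sel s).
 have -> : volume p (Sc (sel s)) eps = 0%E.
  rewrite /mean_volume; under eq_integral => y _.
   have -> : hits p (Sc (sel s)) eps y = false.
    by apply/negbTE/negP => /existsP[i /andP[Si _]]; apply: hno; exists i.
   over.
  by rewrite integral0.
 by rewrite lee_fin leNgt mulr_gt0.
have [i0 Si0] := SSn0 (Ordinal n00).
(* Points outside the selected sub-cells are replaced by a selected one: every point must lie in a
   slot, and the volumes of the slots do not see the replaced points. *)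
pose p' i := if [exists s, SS s i] then p i else p i0.
have p'E s i : SS s i -> p i = p' i by move=> Si; rewrite /p'; have -> : [exists s, SS s i] by apply/existsP; exists s.
have SSp' s i : SS s i -> cell (child p0 r (sel s)) (r / m%:R) (p' i) by move=> Si; rewrite -(p'E s i Si); exact: Sccell.
have p'sel i : exists s, cell (child p0 r (sel s)) (r / m%:R) (p' i).
 rewrite /p'; case: (boolP [exists s, SS s i]) => [/existsP[s Si]|_].
  by exists s; exact: Sccell.
 by exists (Ordinal n00); exact: Sccell.
have slot s q' : cell (child p0 r (sel s)) (r / m%:R) q' -> time_slot m p0 r a s q'.
 move=> [/andP[h1 h2] _]; rewrite /time_slot; move: h1 h2; rewrite /child /= expr_div_n.
 have -> : r ^+ 2 * ((a s)%:R / m%:R ^+ 2) = r ^+ 2 / m%:R ^+ 2 * (a s)%:R by ring.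
 by move=> h1 h2; apply/andP.
have H := @cell_inequality _ _ _ P k D u P0 r0 z sc mu t00 r00 sc0 scD D0 DQ C C0 osc wc B0 wc0 B00 local_rs
 n n0 m p0 r p' SS a (fun s => child p0 r (sel s)) eps sub m0 (fun s => csub (sel s)).
have {}H := H _ _ _ _ _ _ _ _ eps1 K h K1 K2 del0 del1 del2 (q / 2) e1 e2 (2 * e * r ^+ Q) h0 erefl K10 K20 del00 del10 del20 q2
 (ltW e10) (ltW e20) _ half tail0 tail1 tail2 _ _ n00.
have {}H : (n0%:R * (q / 2 * muc / (4 * nmax))) ^+ 2 <=
 (mom0 * r ^+ Q) * (n0%:R * (CK / (sc r * g1) ^+ D * (mom1 * muc ^+ 2)) +
  n0%:R ^+ 2 * (nmin1^-1 * (nmin2^-1 * (2 * e * r ^+ Q) + CK * (e2 * muc)) + CK * (CK * (e1 * muc)))).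
 apply: H.
 - by move=> i; have [s hs] := p'sel i; exact: subcell_cell (csub' (sel s)) hs.
 - by move=> i; have [s hs] := p'sel i; exists s; exact: slot.
 - by move=> s i /SSp'; exact: slot.
 - exact: SSp'.
 - exact: SSn0.
 - move=> s s' ss; have : (s : nat) <> s' by move=> /val_inj /eqP; apply/negP.
  by exact: slot_gap.
 - by move=> s; rewrite m2E; exact: slot_half.
 - move=> s; have cc : cell (child p0 r (sel s)) (r / m%:R) (child p0 r (sel s)).
   by split => [|i]; rewrite lexx /= lerDl ?sqr_ge0 // ltW.
  exact: subcell_cell (csub' (sel s)) cc.
 - by apply: mulr_ge0; [rewrite mulr_ge0 // ltW|rewrite exprn_ge0 // ltW].
 - by move=> s; rewrite -(volume_ext P u z eps (p'E s)); exact: vlow.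
 - move=> s s' ss; under eq_integral => y _ do rewrite -(hits_ext u z eps y (p'E s)) -(hits_ext u z eps y (p'E s')).
  exact: vpair (sel_inj _ _ ss).
have nR : 0 < n0%:R :> R by rewrite ltr0n.
apply: (@final_arith R n0%:R qn mom0 CK (g1 ^+ D) mom1 muc mQ _ nR muc0 mQ0 mom00 g1D _ _ hn0).
- move: H; rewrite [(sc r * g1) ^+ D]exprMn (scD rp) rQE.
 have -> : q / 2 * muc / (4 * nmax) = qn * muc by rewrite /qn; ring.
 exact.
rewrite -/tau.
have t1 : CK * (CK * (e1 * muc)) = tau / 3 * muc by rewrite /e1; field; rewrite gt_eqF.
have t2 : nmin1^-1 * (CK * (e2 * muc)) = tau / 3 * muc by rewrite /e2; field; rewrite !gt_eqF.
have t3 : nmin1^-1 * (nmin2^-1 * (2 * e * (mQ * muc))) <= tau / 3 * muc.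
 have -> : nmin1^-1 * (nmin2^-1 * (2 * e * (mQ * muc))) = (2 * mQ / (nmin1 * nmin2) * e) * muc.
  by field; rewrite !gt_eqF.
 rewrite ler_wpM2r ?(ltW muc0) //.
 apply: (@le_trans _ _ (2 * mQ / (nmin1 * nmin2) * (tau * nmin1 * nmin2 / (6 * mQ)))).
  by rewrite ler_wpM2l // divr_ge0 // ltW // mulr_gt0.
 by rewrite le_eqVlt; apply/orP; left; apply/eqP; field; rewrite !gt_eqF.
rewrite mulrDr t1 t2; apply: (le_trans (lerD (lerD t3 (lexx _)) (lexx _))).
by rewrite le_eqVlt; apply/orP; left; apply/eqP; field.
Qed.

(** A positive infimum would be lowered by [improvement] applied at the infimum itself. The maximum
    with half of it only keeps the new constant positive. *)
Lemma all_good (theta : R) : 0 < theta -> good theta.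
move=> th0; pose G : set R := [set t | 0 < t /\ good t].
have mb : moment_bound D 1 C \in G.
 rewrite inE; split; last exact: (good_initial mu sc0 scD osc).
 exact: lt_le_trans (moment_bound_ge1 D ler01 C0).
have hasG : has_inf G.
 by split; [exists (moment_bound D 1 C); rewrite inE in mb|exists 0 => t [t0 _]; exact: ltW].
have iG0 : 0 <= inf G by apply: lb_le_inf; [case: hasG|move=> t [t0 _]; exact: ltW].
suff iG : inf G <= 0.
 have [t [t0 gt] tt] : exists2 t, G t & t < inf G + theta by apply: inf_adherent.
 by apply: good_le gt => //; lra.
rewrite leNgt; apply/negP => iG; have [e e0 he] := improvement iG.
have [t [t0 gt] tt] : exists2 t, G t & t < inf G + e by apply: inf_adherent.
have g1 := he (good_le (ltW tt) gt).
have hpos : 0 < Num.max (inf G - e) (inf G / 2) by rewrite lt_max; apply/orP; right; rewrite divr_gt0.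
have g2 : good (Num.max (inf G - e) (inf G / 2)) by apply: good_le g1; rewrite le_max lexx.
have : inf G <= Num.max (inf G - e) (inf G / 2) by apply: ge_inf => //; case: hasG.
by rewrite leNgt gt_max; apply/negP/negPn/andP; split; lra.
Qed.

End improvement.

(** * From mean volume to hitting probability *)

Section hitting_probability.
Context d (T : measurableType d) {R : realType} (P : probability T R) (k D : nat).
Notation V := (R * 'rV[R]_k)%type.
Notation mR := (measurableTypeR R).
Notation vec := (D.-tuple mR).
Notation lam := (lebesgue_tuple R D).
Notation c := (gmoment (R := R) 1).
Variable X : 'I_D -> V -> T -> R.
Hypothesis mX : forall j p, mfun (X j p).

(** The field resampled along the constant -1 hits 0 when the field plus its old eta hits the fresh
    value. Bounding the density of the fresh value by its maximum leaves Lebesgue measure, whose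
    translation invariance removes eta and gives the mean volume. *)
Lemma hit_probability_le (n : nat) (p : 'I_n -> V) (eta : 'I_D -> T -> R) (amin tau eps : R) :
 (forall j, mfun (eta j)) -> 0 < amin -> 0 < tau -> amin <= c * tau ^+ 2 ->
 resamples (fun=> -1) P (fun j i w => X j (p i) w) xpredT eta (npdf tau) ->
 (\int[P]_w ((shifted_hit (fun=> 0) eps xpredT (fun j i => X j (p i) w) (fun=> 0) (fun=> 0))%:R : R)%:E <=
  (npdf_sup D amin)%:E * mean_volume P X p xpredT eps)%E.
move=> meta a0 tau0 alo rs.
pose H (Y : 'I_D -> 'I_n -> R) (e : 'I_D -> R) : R := (@shifted_hit R D n (fun=> -1) eps xpredT Y (fun=> 0) (fun=> 0))%:R.
have mH : measurable_conf H by exact: mf_hit.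
have H0 Y e : 0 <= H Y e by rewrite /H.
under eq_integral do rewrite -(hit0E (fun=> -1)).
rewrite (rs H mH H0).
have mZ j : mfun (fun z : T * vec => tnth z.2 j).
 exact: (mcomp (mfun_tnthR j) msnd).
have meta' j : mfun (fun z : T * vec => eta j z.1).
 exact: (mcomp (meta j) mfst).
have mS : mfun (fun z : T * vec =>
  H (shift_conf (fun=> -1) xpredT (fun j i => X j (p i) z.1) (tnth z.2) (eta ^~ z.1)) (tnth z.2)).
 pose Y j i (z : T * vec) : R := X j (p i) z.1 + (xpredT i)%:R * -1 * (tnth z.2 j - eta j z.1).
 have mY j i : mfun (Y j i).
  apply: mfunD; first exact: (mcomp (mX j (p i)) mfst).
  apply: (@mfunM _ _ R setT (fun=> (xpredT i)%:R * -1)); first exact: measurable_cst.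
  exact: (mfunB (mZ j) (meta' j)).
 exact: (mH _ _ Y (fun j z => tnth z.2 j) mY mZ).
have mN : mfun (fun z : T * vec => npdf tau z.2 : R).
 exact: (mcomp (mfun_npdf tau) msnd).
have mh := @mfun_hits _ T R k D X mX n p xpredT eps.
have ns0 : 0 <= npdf_sup D amin by apply/ltW/npdf_sup_gt0.
have slice (f : T * vec -> R) w : mfun f -> mfun (fun y => f (w, y)).
 by move=> mf; apply: (mcomp mf); exact: mfun_pair.
have int_meas (f : T * vec -> R) : mfun f -> nonneg f ->
  mfun (fun w => \int[lam]_y (f (w, y))%:E)%E.
 move=> mf f0; apply: (@measurable_fun_fubini_tonelli_F _ _ _ _ _ lam (fun z => (f z)%:E)).
  exact: mEFin.
 by move=> z; rewrite lee_fin.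
rewrite /mean_volume fubini_tonelli1; last 2 first.
- exact: mEFin.
- by move=> z; rewrite lee_fin.
rewrite -ge0_integralZl //; last 2 first.
- exact: (int_meas (fun z => (hits X p xpredT eps z)%:R) mh).
- by move=> w _; apply: nn_int_ge0.
apply: ge0_le_integral => //.
- by move=> w _; apply: nn_int_ge0 => y; rewrite mulr_ge0 ?npdf_ge0.
- apply: (int_meas (fun z => npdf tau z.2 * H (shift_conf (fun=> -1) xpredT (fun j i => X j (p i) z.1) (tnth z.2) (eta ^~ z.1)) (tnth z.2))).
  exact: mfunM.
 by move=> z; rewrite mulr_ge0 ?npdf_ge0.
- by apply: mfunZe; exact: (int_meas (fun z => (hits X p xpredT eps z)%:R) mh).
move=> w _; rewrite /fubini_F.
pose b : vec := [tuple - eta j w | j < D].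
have hb (y : vec) : H (shift_conf (fun=> -1) xpredT (fun j i => X j (p i) w) (tnth y) (eta ^~ w)) (tnth y) = (hits X p xpredT eps (w, addt y b))%:R.
 congr (_ %:R); congr nat_of_bool; apply: eq_existsb => i; congr (_ && _); apply: eq_forallb => j.
 by rewrite /shift_conf /= !tnth_mktuple; congr (`|_| < _); ring.
apply: (@le_trans _ _ (\int[lam]_y (npdf tau y * (hits X p xpredT eps (w, addt y b))%:R)%:E)%E).
 by rewrite le_eqVlt; apply/orP; left; apply/eqP; apply: eq_integral => y _; congr (_ * _)%:E; exact: hb.
rewrite -(@int_tuple_translate _ _ b (fun y => ((hits X p xpredT eps (w, y))%:R : R)%:E)); last 2 first.
- by apply: mEFin; apply: (slice (fun y => (hits X p xpredT eps y)%:R) w).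
- by move=> y; rewrite lee_fin.
have mhb : mfun (fun y : vec => (hits X p xpredT eps (w, addt y b))%:R : R).
 have mf := slice (fun y => (hits X p xpredT eps y)%:R) w mh.
 by apply: (mcomp mf); exact: mfun_addt.
rewrite -nn_intZ //; apply: nn_int_le => //.
- by apply: mfunM => //; exact: mfun_npdf.
- exact: mfunM.
- by move=> y; rewrite mulr_ge0 ?npdf_ge0.
- by move=> y; rewrite ler_wpM2r // npdf_le.
Qed.

End hitting_probability.

(** * Grids and compactness of cells *)

Section grid_in_cell.
Context {R : realType} (k : nat).
Notation V := (R * 'rV[R]_k)%type.

Lemma dyadic_grid_cell (p0 : V) (r : R) l q : 0 < r -> q \in dyadic_grid p0 r l -> cell p0 r q.
move=> r0; have r2 : 0 < r ^+ 2 by rewrite exprn_gt0.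
case: l => [|l].
 rewrite mem_seq1 => /eqP ->; split; first by lra.
 by move=> i; rewrite lexx lerDl ltW.
case/allpairsP => -[a f] [ha _ ->]; have {}ha : a \in iota 0 (4 ^ l.+1).+1 := ha.
rewrite mem_iota add0n ltnS in ha; split => /=.
 apply/andP; split; first by rewrite lerDl; apply: mulr_ge0; [exact: ltW|rewrite divr_ge0].
 rewrite lerD2l ler_piMr ?(ltW r2) //.
 by rewrite ler_pdivrMr ?exprn_gt0 // mul1r -natrX ler_nat; case/andP: ha.
move=> i; rewrite mxE; apply/andP; split; first by rewrite lerDl; apply: mulr_ge0; [exact: ltW|rewrite divr_ge0].
rewrite lerD2l ler_piMr ?(ltW r0) //.
by rewrite ler_pdivrMr ?exprn_gt0 // mul1r -natrX ler_nat -ltnS.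
Qed.

Lemma compact_cell (p0 : V) (r : R) : compact (cell p0 r).
have -> : cell p0 r = `[p0.1, p0.1 + r ^+ 2]%classic `*`
  [set x : 'rV[R]_k | forall i, (fun i => `[p0.2 0 i, p0.2 0 i + r]%classic) i (x ord0 i)].
 apply/seteqP; split => [[t x] [h1 h2]|[t x] [h1 h2]]; split.
 - by rewrite /= in_itv.
 - by move=> i; have := h2 i; rewrite /= in_itv.
 - by move: h1; rewrite /= in_itv.
 - by move=> i; have := h2 i; rewrite /= in_itv.
apply: compact_setX; first exact: segment_compact.
by apply: (rV_compact (A := fun i => `[p0.2 0 i, p0.2 0 i + r]%classic)) => i; exact: segment_compact.
Qed.

Lemma belowE (del : R) (p q : V) : 0 < del -> del <= 1 -> below (del / 2) p q -> ball p del q.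
move=> d0 d1 [/andP[h1 h2] h3]; have d2 : (del / 2) ^+ 2 < del.
 rewrite expr2; apply: (@le_lt_trans _ _ (del / 2)); last lra.
 by rewrite ler_piMr //; lra.
split; first by rewrite /ball /= ger0_norm; lra.
split => // i j; rewrite (ord1 i) /ball /=; have /andP[h4 h5] := h3 j.
by rewrite ger0_norm; lra.
Qed.

End grid_in_cell.

Lemma prob_natr d (T : measurableType d) (R : realType) (P : probability T R) (b : T -> bool) :
 mfun (fun w => (b w)%:R : R) ->
 measurable [set w | b w] /\ P [set w | b w] = (\int[P]_w ((b w)%:R)%:E)%E.
move=> mb; have mB : measurable [set w | b w].
 have -> : [set w | b w] = setT `&` (fun w => (b w)%:R : R) @^-1` [set 1%R].
  apply/seteqP; split => w /=; first by move=> ->.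
  by move=> [_] /eqP; case: (b w) => //; rewrite eq_sym oner_eq0.
 exact: mb.
split => //; rewrite -[X in P X]setIT -integral_indic //; apply: eq_integral => w _.
by rewrite indicE; congr ((nat_of_bool _)%:R)%:E; apply/idP/idP; rewrite inE.
Qed.

(** * The solution misses z on a compact cell *)

Section polar_cell.
Context d (T : measurableType d) {R : realType} (P : probability T R) (k D : nat) (beta : R).
Variables (W : 'I_D -> test_function R k -> T -> R) (v : R -> 'rV[R]_k -> T -> 'rV[R]_D).
Hypotheses (hW : is_noise P beta W) (hv : is_mild_solution P beta W v) (hc : continuous_paths v).
Variable fm : feature_model k beta.
Hypotheses (beta0 : 0 < beta) (beta2 : beta < 2) (k0 : (0 < k)%N) (D0 : (0 < D)%N)
 (critical : (1 - beta / 2) * D%:R = k.+2%:R).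
Notation V := (R * 'rV[R]_k)%type.
Variables (P0 : V) (r0 : R) (z0 : 'rV[R]_D).
Hypotheses (t00 : 0 < P0.1) (r00 : 0 < r0).
Let z (j : 'I_D) : R := z0 0 j.
Notation u := (clamped v).
Notation X := (ratio_field u z).
Notation sc := (field_scale beta).
Notation grid := (dyadic_grid P0 r0).
Let kfin : kernels_finite k beta := mild_kernels_finite hv (Ordinal D0).
Let mu j p : mfun (u j p) := mfun_clamped hv j p.

Let scD (r : R) : 0 < r -> sc r ^+ D = r ^+ k.+2.
move=> rp; have s0 := field_scale_gt0 beta rp.
apply/eqP; rewrite -(@eqrXn2 _ 2) ?exprn_ge0 ?(ltW rp) ?(ltW s0) // -!exprM mulnC exprM.
rewrite /field_scale sqr_sqrtr ?powR_ge0 // (critical_power critical rp) mulnC //.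
Qed.

Let DQ : (k.+2 <= D)%N.
rewrite -(ler_nat R) -critical ler_piMl // lerBlDr lerDl.
by rewrite divr_ge0 // ltW.
Qed.

Lemma ratio_field_good (theta : R) : 0 < theta -> good P u P0 r0 z theta.
have t0 := ltW t00.
have [C C0 osc] := oscillation D0 mu (field_moment_ge0 D fm beta0)
 (clamped_moment hW hv fm beta0 beta2 kfin k0 critical)
 (clamped_moment1 hW hv fm)
 z t0 r00 (field_scale_gt0 beta) scD DQ.
have g0 : 0 < ratio_min k :> R by exact: expR_gt0.
have B00 : 0 < inc_constant fm / ratio_min k ^+ 2 + 1.
 by rewrite ltr_wpDl // divr_ge0 ?inc_constant_ge0 // exprn_ge0 // ltW.
apply: (all_good mu t0 r00 (field_scale_gt0 beta) scD D0 DQ C0 osc (window_constant_gt0 fm) B00).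
move=> n p0 r a1 a2 l p i0 rp lp p0t h1 h2 h3 h4 h5 h6.
have [|eta [tau [e1 e2 e3 e4 e5]]] := local_resampling hW hv fm beta0 beta2 kfin k0 z rp lp p0t h1 h2 g0 h3 h4 h5 _ h6.
 by move=> i; apply: local_caloric_ge.
by exists eta, tau; split => //; apply: (le_trans e4); rewrite lerDl.
Qed.

Definition close (l : nat) (e : R) (w : T) : bool :=
 [exists i : 'I_(size (grid l)), [forall j, `|u j (tnth (in_tuple (grid l)) i) w - z j| < e]].

Lemma mfun_close l e : mfun (fun w => (close l e w)%:R : R).
apply: mfun_natr_exists => i; apply: mfun_natr_forall => j.
apply: mfun_natr_lt => //; apply: mcomp => //.
by apply: mfunB => //; exact: mu.
Qed.

(** h is at least [expR (- weight_bound P0 r0)] on the cell, so v within e = eps times this bound of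
    z puts (v - z)/h within eps of 0. The estimate is uniform in the grid level because eps is. *)
Lemma close_probability : exists2 nm : R, 0 <= nm & forall theta : R, 0 < theta ->
 exists2 e : R, 0 < e & forall l, (P [set w | close l e w] <= (nm * theta)%:E)%E.
have [A A0 hA] := global_resampling hW hv fm kfin t00.
have Ai : 0 < A^-1 by rewrite invr_gt0.
have ns0 : 0 <= npdf_sup D A^-1 by apply/ltW/npdf_sup_gt0.
exists (npdf_sup D A^-1 * r0 ^+ k.+2) => [|theta th0].
 by rewrite mulr_ge0 // exprn_ge0 // ltW.
have sub : subcell P0 r0 P0 r0 by split => // i; rewrite !lexx.
have [eps eps0 he] := ratio_field_good th0 sub.
have cw : 0 < eps * expR (- weight_bound P0 r0) by rewrite mulr_gt0 // expR_gt0.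
exists (eps * expR (- weight_bound P0 r0)) => // l; set e := eps * _.
have [_ ->] := prob_natr P (mfun_close l e).
pose p i := tnth (in_tuple (grid l)) i.
have pc i : cell P0 r0 (p i) by apply: (dyadic_grid_cell (l := l)) => //; exact: (mem_tnth i (in_tuple (grid l))).
have cP : cell P0 r0 P0.
 split; first by rewrite lexx lerDl exprn_ge0 // ltW.
 by move=> i; rewrite lexx lerDl ltW.
have [q qg _] := dyadic_grid_below l r00 cP.
have i0 : 'I_(size (grid l)) by rewrite -index_mem in qg; exact: Ordinal qg.
have [|eta [tau [meta tau0 alo rs]]] := hA _ p z i0.
 by move=> i; have [/andP[h _] _] := pc i.
have mX j q' : mfun (X j q') by exact: mfun_ratio_field.
have h1 := hit_probability_le mX eps meta Ai tau0 alo rs.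
have h2 := he _ p xpredT (fun i _ => pc i).
apply: (@le_trans _ _ ((npdf_sup D A^-1)%:E * (theta * r0 ^+ k.+2)%:E)%E); last first.
 by rewrite -EFinM lee_fin -mulrA [theta * _]mulrC.
apply: le_trans (lee_wpmul2l _ h2); last by rewrite lee_fin.
apply: le_trans h1; apply: nn_int_le => // [||w].
- exact: mfun_close.
- by apply: (@mfun_hit _ _ _ (fun=> 0) eps _ _ xpredT (fun j i w => X j (p i) w) (fun j _ => 0) (fun j _ => 0)).
rewrite ler_nat; case: (boolP (close l e w)) => // /existsP[i /forallP hi].
suff -> : shifted_hit (fun=> 0) eps xpredT (fun j i => X j (p i) w) (fun=> 0) (fun=> 0) by [].
apply/existsP; exists i => /=; apply/forallP => j; rewrite mul0r addr0 subr0.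
have /andP[h3 _] := hst_range (ltW t00) r00 (pc i).
have hp : 0 < hst (p i) by apply: lt_le_trans h3; exact: expR_gt0.
rewrite /ratio_field normrM normfV (gtr0_norm hp) ltr_pdivrMr //.
apply: (lt_le_trans (hi j)); rewrite /e ler_wpM2l //; exact: ltW.
Qed.

Definition touches : set T := [set w | exists p, cell P0 r0 p /\ v p.1 p.2 w = z0].

Let in_domain p : cell P0 r0 p -> 0 <= p.1.
by move=> [/andP[h _] _]; apply: le_trans h; exact: ltW. Qed.

Lemma touches_close w e : 0 < e -> touches w -> exists L, forall l, (L <= l)%N -> close l e w.
move=> e0 [p [cp vp]].
have cv : (fun q : V => v q.1 q.2 w) x @[x --> within [set q | 0 <= q.1] (nbhs p)] --> z0.
 by rewrite -vp; have /subspace_continuousP/(_ p (in_domain cp)) := @hc w.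
have /cvg_ballP/(_ e e0)/nbhs_ballP[del /= del0 hdel] := cv.
pose dl := Num.min del 1.
have dl0 : 0 < dl by rewrite lt_min del0 ltr01.
have dl1 : dl <= 1 by rewrite ge_min lexx orbT.
have [L hL] : exists L : nat, 2 * r0 / dl < L%:R.
 by have [L] := archi_boundP (divr_ge0 (mulr_ge0 (ler0n R 2) (ltW r00)) (ltW dl0)); exists (Num.bound (2 * r0 / dl)).
exists L => l Ll; have [q qg bq] := dyadic_grid_below l r00 cp.
have b2 : below (dl / 2) p q.
 apply: belowW bq; first by rewrite divr_ge0 ?exprn_ge0 // ltW.
 rewrite ler_pdivrMr ?exprn_gt0 // mulrAC ler_pdivlMr // -ler_pdivrMl // mulrC.
 rewrite [r0 * 2]mulrC; apply/ltW/(lt_le_trans hL).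
 by rewrite -natrX ler_nat (leq_trans Ll) // ltnW // ltn_expl.
have bl : ball p del q.
 by apply: (le_ball (e1 := dl)); [rewrite ge_min lexx|exact: belowE].
have cq := dyadic_grid_cell r00 qg.
have hb := hdel q bl (in_domain cq).
apply/existsP; rewrite -index_mem in qg; exists (Ordinal qg); apply/forallP => j.
rewrite (tnth_nth q) /= nth_index -?index_mem // (clampedE _ _ _ (in_domain cq)) distrC.
by have [_ h] := hb; exact: h.
Qed.

(** The image of the compact cell is closed, so approximate hits at every precision give an exact
    one. With [touches_close] this also makes the hitting event measurable. *)
Lemma close_touches w : (forall m, exists l, close l (m.+1%:R^-1) w) -> touches w.
move=> h; pose f (p : V) := v p.1 p.2 w.
have cf : {within cell P0 r0, continuous f}.
 by apply: continuous_subspaceW (@hc w) => p; exact: in_domain.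
have cl : closed (f @` cell P0 r0).
 apply: compact_closed; first exact: norm_hausdorff.
 by apply: continuous_compact; [exact: cf|exact: compact_cell].
suff [p cp fp] : (f @` cell P0 r0) z0 by exists p.
apply: cl => B /nbhs_ballP[e /= e0 he].
have [m hm] : exists m : nat, e^-1 < m%:R.
 by have := archi_boundP (ltW (etrans (invr_gt0 e) e0)); exists (Num.bound e^-1).
have [l /existsP[i /forallP hi]] := h m.
pose p := tnth (in_tuple (grid l)) i.
have cp : cell P0 r0 p by apply: (dyadic_grid_cell (l := l)) => //; exact: (mem_tnth i (in_tuple (grid l))).
exists (f p); split; first by exists p.
apply: he; split => // a j; rewrite (ord1 a) /ball /= distrC.
have := hi j; rewrite (clampedE _ _ _ (in_domain cp)) => /lt_le_trans; apply.
rewrite -[e]invrK lef_pV2 ?posrE ?invr_gt0 //; apply/ltW/(lt_trans hm).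
by rewrite ltr_nat.
Qed.

Lemma touches_null : measurable touches /\ P touches = 0%E.
pose G e l := [set w | close l e w].
have mG e l : measurable (G e l) by have [] := prob_natr P (mfun_close l e).
have mB : measurable touches.
 have -> : touches = \bigcap_(m in setT) \bigcup_(l in setT) G (m.+1%:R^-1) l.
  apply/seteqP; split => w hw.
   move=> m _; have [|L hL] := touches_close (e := m.+1%:R^-1) _ hw; first by rewrite invr_gt0.
   by exists L => //; exact: hL.
  apply: close_touches => m; have [l _ hl] := hw m I; by exists l.
 by apply: bigcapT_measurable => m; apply: bigcupT_measurable => l.
split => //; have [nm nm0 hnm] := close_probability.
suff h e : 0 < e -> (P touches <= e%:E)%E.
 apply/eqP; rewrite eq_le measure_ge0 andbT; apply/lee_addgt0Pr => e e0; rewrite add0e; exact: h.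
move=> e0; have th0 : 0 < e / (nm + 1) by rewrite divr_gt0 // ltr_wpDl.
have [eta eta0 heta] := hnm _ th0.
(* The event of being close at all levels from L on. These events increase to one containing
   [touches], so continuity from below transfers the bound of a single level. *)
pose F L := \bigcap_(l in [set l | (L <= l)%N]) G eta l.
have mF L : measurable (F L) by apply: bigcap_measurable => //; exists L => /=.
have mUF : measurable (\bigcup_L F L) by exact: bigcupT_measurable.
have ndF : {homo F : n m / (n <= m)%N >-> (n <= m)%O}.
 move=> n m nm'; apply/subsetPset => w hw l /= ml; apply: hw => /=; exact: leq_trans ml.
apply: (@le_trans _ _ (P (\bigcup_L F L))).
 apply: le_measure; rewrite ?inE // => w hw; have [L hL] := touches_close eta0 hw.
 by exists L => // l /= Ll; exact: hL.
have cv := nondecreasing_cvg_mu mF mUF ndF (mu := P).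
rewrite -(cvg_lim _ cv) //; apply: lime_le; first by apply/cvg_ex; eexists; exact: cv.
apply: nearW => L /=; apply: (@le_trans _ _ (P (G eta L))).
 by apply: le_measure; rewrite ?inE // => w; apply; rewrite /= leqnn.
apply: (le_trans (heta L)); rewrite lee_fin mulrA ler_pdivrMr ?ltr_wpDl //.
by rewrite mulrC ler_wpM2l ?(ltW e0) // lerDl.
Qed.

End polar_cell.

(** The n-th cell starts at the positive time 1/(n + 1), since the global resampling needs a
    positive time to be switched on. *)
Lemma cells_cover (R : realType) (k : nat) (t : R) (x : 'rV[R]_k) : 0 < t ->
 exists n : nat, cell (n.+1%:R^-1, const_mx (- n%:R)) (2 * n.+1%:R) (t, x).
move=> t0; pose S := t^-1 + t + \sum_i `|x 0 i|.
have ti0 : 0 < t^-1 by rewrite invr_gt0.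
have X0 : 0 <= \sum_i `|x 0 i| by exact: sumr_ge0.
have S0 : 0 <= S by rewrite !addr_ge0 // ltW.
have hn := archi_boundP S0; set n := Num.bound S in hn; exists n.
have n1 : n.+1%:R = n%:R + 1 :> R by rewrite -natr1.
have n0 : 0 <= n%:R :> R by [].
split => /=.
 have tn : t^-1 <= n.+1%:R by rewrite n1; rewrite /S in hn; lra.
 apply/andP; split; first by rewrite -[leRHS]invrK lef_pV2 ?posrE.
 have i0 : 0 <= n.+1%:R^-1 :> R by rewrite invr_ge0.
 have : t <= n%:R by rewrite /S in hn; lra.
 by move: i0; rewrite n1; move: (_^-1) n0 => y m0 y0 tm; nra.
move=> i; rewrite mxE n1; have xi : `|x 0 i| <= \sum_i `|x 0 i|.
 by rewrite (bigD1 i) //= lerDl sumr_ge0.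
have : `|x 0 i| <= n%:R by rewrite /S in hn; lra.
by rewrite ler_norml => /andP[h1 h2]; lra.
Qed.

(** The relation between D, k and beta is rewritten as (1 - beta/2) D = k + 2, and countably many
    compact cells exhaust the positive times. *)
Lemma critical_points_polar d (T : measurableType d) (R : realType) (P : probability T R)
  (k D : nat) (beta : R) (W : 'I_D -> test_function R k -> T -> R)
  (v : R -> 'rV[R]_k -> T -> 'rV[R]_D) :
 is_noise P beta W -> is_mild_solution P beta W v -> continuous_paths v ->
 feature_model k beta -> 0 < beta -> beta < 2 -> (0 < k)%N ->
 (4 + 2 * k%:R) / (2 - beta) = D%:R -> points_polar P v.
move=> hW hv hc fm beta0 beta2 k0 hD z.
have b2 : 0 < 2 - beta by lra.
have D0 : (0 < D)%N.
 by rewrite -(ltr_nat R) -hD divr_gt0 // ltr_wpDr // mulr_ge0.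
have critical : (1 - beta / 2) * D%:R = k.+2%:R.
 rewrite -hD -!natr1; field; exact: lt0r_neq0.
pose A n := touches v (n.+1%:R^-1, const_mx (- n%:R)) (2 * n.+1%:R) z.
have hA n : measurable (A n) /\ P (A n) = 0%E.
 by apply: (touches_null hW hv hc fm beta0 beta2 k0 D0 critical) => /=; [rewrite invr_gt0|rewrite mulr_gt0].
have -> : [set w | exists t x, 0 < t /\ v t x w = z] = \bigcup_n A n.
 apply/seteqP; split => w.
  move=> [t [x [t0 vz]]]; have [n hn] := cells_cover x t0.
  by exists n => //; exists (t, x).
 move=> [n _ [p [[/andP[h _] _] vz]]]; exists p.1, p.2; split => //.
 by apply: lt_le_trans h; rewrite invr_gt0.
apply: measure_negligible; first by apply: bigcupT_measurable => n; have [] := hA n.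
by apply: negligible_bigcup => n; apply/negligibleP; have [] := hA n.
Qed.

Theorem theorem6p1 (R : realType) (dT : measure_display) (T : measurableType dT)
  (P : probability T R) :
 (forall (k d : nat) (beta : R)
   (W : 'I_d -> test_function R k -> T -> R)
   (v : R -> 'rV[R]_k -> T -> 'rV[R]_d),
  (1 <= k)%N ->
  (0 < beta < Num.min k%:R 2) \/ (k = 1%N /\ beta = 1) ->
  is_noise P beta W ->
  is_mild_solution P beta W v ->
  continuous_paths v ->
  (4 + 2 * k%:R) / (2 - beta) = d%:R ->
  points_polar P v) /\
 (forall (W : 'I_6 -> test_function R 1 -> T -> R)
   (v : R -> 'rV[R]_1 -> T -> 'rV[R]_6),
  is_noise P 1 W ->
  is_mild_solution P 1 W v ->
  continuous_paths v ->
  points_polar P v).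
Proof.
have white D (W : 'I_D -> test_function R 1 -> T -> R) (v : R -> 'rV[R]_1 -> T -> 'rV[R]_D) :
  is_noise P 1 W -> is_mild_solution P 1 W v -> continuous_paths v ->
  (4 + 2 * 1%:R) / (2 - 1) = D%:R :> R -> points_polar P v.
 move=> hW hv hc hD; have [fm] := @white_model R.
 by apply: (critical_points_polar hW hv hc fm) => //; rewrite ltr1n.
split=> [k d beta W v k0 hb hW hv hc hd|W v hW hv hc].
 case: hb => [/andP[beta0]|[k1 b1]]; last by subst k beta; exact: (white _ _ _ hW hv hc hd).
 rewrite lt_min => /andP[bk b2].
 (* The strict inequality beta < k excludes the white-noise branch of [noise_inner]. *)
 have nw : (k == 1%N) && (beta == 1) = false.
  by apply/negbTE/negP => /andP[/eqP k1 /eqP b1]; move: bk; rewrite k1 b1 ltxx.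
 have [fm] := riesz_model k0 beta0 bk nw.
 exact: (critical_points_polar hW hv hc fm beta0 b2 k0 hd).
apply: (white _ _ _ hW hv hc); have -> : 2 - 1 = 1 :> R by ring.
by rewrite divr1; ring.
Qed.
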